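(* Let $m\ge0$, $n\ge m+4$ be integers and let $\mathcal L$ be the boundary forcing operator with parameters $m,n$ defined in the context. Let $h\in C^\infty_{0,c}(\mathbb R^+)$. Then: (a) (Regularity and time traces) $\mathcal Lh\in C(\mathbb R^2)$, and for every $\alpha\in\mathbb R$, $$\sup_{x\in\mathbb R}\|\mathcal Lh(x,\cdot)\|_{H^\alpha(\mathbb R_t)}\le C\|h\|_{H^\alpha(\mathbb R)},$$ with $x\mapsto\mathcal Lh(x,\cdot)$ continuous into $H^\alpha(\mathbb R_t)$. Moreover $\mathcal Lh(0,t)=h(t)$ for all $t\in\mathbb R$. (b) (Causality) $\mathcal Lh(x,t)=0$ for $t\le0$; in particular $\mathcal Lh(x,0)=0$. (c) (Equation on $x>0$) $F:=(\partial_t+\partial_x^3)\mathcal Lh$ is a continuous function on $\mathbb R^2$ with $F(x,t)=0$ for $x>0$. Hence $\mathcal Lh$ solves $\partial_tu+\partial_x^3u=0$ in $(0,+\infty)\times\mathbb R$. (d) (Explicit form on $x>0$) For $x>0$, $$\mathcal Lh(x,t)=\frac1{2\pi}\int_{\mathbb R}e^{it\tau}\,\widehat h(\tau)\,e^{ix\omega\rho(\tau)}\,d\tau,\qquad |e^{ix\omega\rho(\tau)}|=e^{-\frac{\sqrt3}2|\tau|^{1/3}x}.$$ (e) (Bourgain–Besov norm) Let $s\ge-1$ and assume in addition $$m>-s-\tfrac12,\qquad n>m+s+2,\qquad \operatorname{supp}h\subset[0,2].$$ Then $$\|\mathcal Lh\|_{X^{s,\frac12,1}}\le C\|h\|_{H^{\frac{s+1}3}(\mathbb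 R)},\qquad\text{hence}\qquad\|\mathcal Lh\|_{C(\mathbb R_t;H^s(\mathbb R_x))}\le C\|h\|_{H^{\frac{s+1}3}(\mathbb R)}.$$ For $s=-\frac34$ one may take $m=1$, $n=5$, and then (for $\operatorname{supp}h\subset[0,2]$) $\|\mathcal Lh\|_X\le2\|\mathcal Lh\|_{X^{-\frac34,\frac12,1}}\le C\|h\|_{H^{1/12}(\mathbb R)}$. Here the constants $C$ do not depend on $h$.
   Context: Fourier transforms: $\widehat f(\xi)=\int_{\mathbb R}e^{-ix\xi}f(x)\,dx$, $\widehat u(\xi,\tau)=\iint_{\mathbb R^2}e^{-i(x\xi+t\tau)}u(x,t)\,dx\,dt$, $\mathcal F^{-1}$ the inverse transform; $\langle\cdot\rangle=(1+|\cdot|^2)^{1/2}$. $C^\infty_{0,c}(\mathbb R^+)$ is the space of smooth compactly supported functions on $\mathbb R$ with support in $[0,+\infty)$. The derivatives in $(\partial_t+\partial_x^3)\mathcal Lh$ are taken in the sense of distributions. Let $\omega=e^{2\pi i/3}$, and for $\tau\in\mathbb R\setminus\{0\}$ let $\rho(\tau)=(\tau-i0)^{1/3}$, i.e. $\rho(\tau)=|\tau|^{1/3}$ for $\tau>0$ and $\rho(\tau)=|\tau|^{1/3}e^{-i\pi/3}$ for $\tau<0$. Fix integers $m\ge0$, $n\ge m+4$ and define $$a(\zeta)=c\,\frac{\zeta^m}{(\zeta+i)^n},\qquad c=-i\,\omega^{-m}(\omega+i)^n\quad(\text{so that }a(\omega)=-i),$$ $$K(\xi,\tau)=\frac1{\rho(\tau)}\,\frac{a(\zeta)}{\zeta-\omega},\qquad\zeta=\frac{\xi}{\rho(\tau)},\qquad\xi\in\mathbb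 R,\ \tau\in\mathbb R\setminus\{0\}.$$ For $h\in C^\infty_{0,c}(\mathbb R^+)$ the boundary forcing operator is $$\mathcal Lh(x,t)=\mathcal F^{-1}[\widehat h(\tau)K(\xi,\tau)](x,t)=\frac1{(2\pi)^2}\iint_{\mathbb R^2}e^{i(x\xi+t\tau)}\,\widehat h(\tau)K(\xi,\tau)\,d\xi\,d\tau.$$ For integers $j,k\ge0$ let $A_j=\{(\tau,\xi):2^j\le\langle\xi\rangle<2^{j+1}\}$, $B_k=\{(\tau,\xi):2^k\le\langle\tau-\xi^3\rangle<2^{k+1}\}$, and $$\|u\|_{X^{s,b}}=\|\langle\xi\rangle^s\langle\tau-\xi^3\rangle^b\widehat u\|_{L^2_{\tau,\xi}},\qquad\|u\|_{X^{s,b,1}}=\Big(\sum_{j\ge0}\Big(\sum_{k\ge0}\|\langle\xi\rangle^s\langle\tau-\xi^3\rangle^b\widehat u\|_{L^2_{\tau,\xi}(A_j\cap B_k)}\Big)^2\Big)^{1/2}.$$ With $D=\{(\tau,\xi)\in\mathbb R^2:|\xi|\le1,\ |\tau|\ge|\xi|^{-3}\}$, $$\|u\|_X=\|\mathcal F^{-1}[\mathbf 1_{\mathbb R^2\setminus D}\widehat u]\|_{X^{-3/4,1/2,1}}+\|\mathcal F^{-1}[\mathbf 1_D\widehat u]\|_{X^{-3/4,1/2}}.$$ The norm of $C(\mathbb R_t;H^s(\mathbb R_x))$ is the supremum in $t$ of the $H^s(\mathbb R_x)$ norm. *)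

(* Defs.v *)
From HB Require Import structures.
From mathcomp Require Import all_boot all_order all_algebra.
From mathcomp Require Import all_classical all_reals all_analysis.
From mathcomp Require Export complex.
Import Order.TTheory GRing.Theory Num.Theory.
Import numFieldNormedType.Exports.

Set Implicit Arguments.
Unset Strict Implicit.
Unset Printing Implicit Defensive.

Local Open Scope classical_set_scope.
Local Open Scope ring_scope.
Local Open Scope complex_scope.

Section ComplexValued.
Context {R : realType}.

Definition cmod (z : R[i]) : R := ComplexField.Normc.normc z.

Definition cexp (z : R[i]) : R[i] :=
  (expR (complex.Re z))%:C * (cos (complex.Im z) +i* sin (complex.Im z)).

(* R[i] carries no topology, measurable structure or normed R-module structure
   in the libraries, so continuity, derivatives and integrals of complex-valued
   functions are taken on the real and imaginary parts. *)
Definition ccontinuous {T : topologicalType} (f : T -> R[i]) : Prop :=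
  continuous (fun p => complex.Re (f p)) /\ continuous (fun p => complex.Im (f p)).

Definition cmeasurable {d} {T : measurableType d} (f : T -> R[i]) : Prop :=
  measurable_fun setT (fun p => complex.Re (f p)) /\
  measurable_fun setT (fun p => complex.Im (f p)).

Definition cintegrable {d} {T : measurableType d}
    (mu : {measure set T -> \bar R}) (f : T -> R[i]) : Prop :=
  mu.-integrable setT (fun p => (complex.Re (f p))%:E) /\
  mu.-integrable setT (fun p => (complex.Im (f p))%:E).

Definition cintegral {d} {T : measurableType d}
    (mu : {measure set T -> \bar R}) (f : T -> R[i]) : R[i] :=
  (\int[mu]_p complex.Re (f p)) +i* (\int[mu]_p complex.Im (f p)).

Definition csupp {T : topologicalType} (f : T -> R[i]) : set T :=
  closure [set p | f p != 0].

Section Smooth.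
Context {V : normedModType R}.

Definition cderivable (f : V -> R[i]) (p v : V) : Prop :=
  derivable (fun q => complex.Re (f q)) p v /\ derivable (fun q => complex.Im (f q)) p v.

Definition cderiv (v : V) (f : V -> R[i]) : V -> R[i] :=
  fun p => 'D_v (fun q => complex.Re (f q)) p +i* 'D_v (fun q => complex.Im (f q)) p.

Definition cderivs (vs : seq V) (f : V -> R[i]) : V -> R[i] :=
  foldr cderiv f vs.

(* C^oo: all iterated directional derivatives exist and are continuous
   (used for V = R and V = R^2 only) *)
Definition csmooth (f : V -> R[i]) : Prop :=
  forall vs : seq V, ccontinuous (cderivs vs f) /\
    forall p v : V, cderivable (cderivs vs f) p v.

Definition schwartz (f : V -> R[i]) : Prop :=
  csmooth f /\
  forall (vs : seq V) (k : nat), exists M : R,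
    forall p : V, `|p| ^+ k * cmod (cderivs vs f p) <= M.

End Smooth.
End ComplexValued.

Section Fourier.
Context {R : realType}.
Local Notation mu := (@lebesgue_measure R).

Definition leb2 := (mu \x mu)%E.

Definition fourier1 (f : R -> R[i]) (xi : R) : R[i] :=
  cintegral mu (fun x => cexp (- 'i%C * (x * xi)%:C) * f x).

(* points of physical space are (x, t), points of frequency space (xi, tau) *)
Definition fourier2 (f : R * R -> R[i]) (k : R * R) : R[i] :=
  cintegral leb2
    (fun p => cexp (- 'i%C * (p.1 * k.1 + p.2 * k.2)%:C) * f p).

(* The Sobolev and Bourgain norms are applied to functions that need not be
   integrable (the boundary forcing term in general is not in L^1(R^2)), so the
   Fourier transform in the norms is that of tempered distributions:
   <u^, phi> = <u, phi^>. *)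
Definition tempered1 (u : R -> R[i]) : Prop :=
  cmeasurable u /\
  forall phi : R -> R[i], schwartz phi -> cintegrable mu (fun x => u x * phi x).

Definition tempered2 (u : R * R -> R[i]) : Prop :=
  cmeasurable u /\
  forall phi : R * R -> R[i], schwartz phi ->
    cintegrable leb2 (fun p => u p * phi p).

Definition is_fourier1 (u U : R -> R[i]) : Prop :=
  [/\ tempered1 u, tempered1 U &
   forall phi : R -> R[i], schwartz phi ->
     cintegral mu (fun xi => U xi * phi xi) =
     cintegral mu (fun x => u x * fourier1 phi x)].

Definition is_fourier2 (u U : R * R -> R[i]) : Prop :=
  [/\ tempered2 u, tempered2 U &
   forall phi : R * R -> R[i], schwartz phi ->
     cintegral leb2 (fun k => U k * phi k) =
     cintegral leb2 (fun p => u p * fourier2 phi p)].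

End Fourier.

Section Norms.
Context {R : realType}.
Local Notation mu := (@lebesgue_measure R).

Definition jap (x : R) : R := Num.sqrt (1 + x ^+ 2).

(* In all the norms below the infimum runs over the functions representing u^,
   which agree almost everywhere: it is the common value of the weighted norm,
   and +oo when u^ is not a function. *)
Definition Hnorm (s : R) (u : R -> R[i]) : \bar R :=
  ereal_inf [set Lnorm mu 2%:E (fun xi => (jap xi `^ s * cmod (U xi))%:E)
            | U in [set U | is_fourier1 u U]].

Definition CHs_norm (s : R) (u : R * R -> R[i]) : \bar R :=
  ereal_sup [set Hnorm s (fun x => u (x, t)) | t in setT].

Definition in_CHs (s : R) (u : R * R -> R[i]) : Prop :=
  (forall t : R, Hnorm s (fun x => u (x, t)) < +oo)%E /\
  forall t0 : R,
    Hnorm s (fun x => u (x, t) - u (x, t0)) @[t --> t0] --> 0%E.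

Definition Ablock (j : nat) : set (R * R) :=
  [set k | 2 ^+ j <= jap k.1 < 2 ^+ j.+1].

Definition Bblock (l : nat) : set (R * R) :=
  [set k | 2 ^+ l <= jap (k.2 - k.1 ^+ 3) < 2 ^+ l.+1].

Definition Dset : set (R * R) :=
  [set k | [/\ k.1 != 0, `|k.1| <= 1 & `|k.1| ^- 3 <= `|k.2|]].

Definition bweight (s b : R) (U : R * R -> R[i]) : R * R -> \bar R :=
  fun k => (jap k.1 `^ s * jap (k.2 - k.1 ^+ 3) `^ b * cmod (U k))%:E.

(* the X^{s,b} and X^{s,b,1} norms of F^{-1}[U], in terms of U *)
Definition Xsb_hat (s b : R) (U : R * R -> R[i]) : \bar R :=
  'N[leb2]_2%:E[bweight s b U]%E.

Definition Xsb1_hat (s b : R) (U : R * R -> R[i]) : \bar R :=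
  ((\sum_(0 <= j <oo)
     (\sum_(0 <= l <oo)
        'N[leb2]_2%:E[bweight s b U \_ (Ablock j `&` Bblock l)]) `^ 2)
   `^ 2^-1)%E.

Definition Xsb1_norm (s b : R) (u : R * R -> R[i]) : \bar R :=
  ereal_inf [set Xsb1_hat s b U | U in [set U | is_fourier2 u U]].

Definition crestr (A : set (R * R)) (U : R * R -> R[i]) : R * R -> R[i] :=
  fun k => if k \in A then U k else 0.

Definition X_norm (u : R * R -> R[i]) : \bar R :=
  ereal_inf [set (Xsb1_hat (- (3 / 4)) 2^-1 (crestr (~` Dset) U) +
                  Xsb_hat (- (3 / 4)) 2^-1 (crestr Dset U))%E
            | U in [set U | is_fourier2 u U]].

End Norms.

Section BoundaryForcing.
Context {R : realType}.
Local Notation mu := (@lebesgue_measure R).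

Definition omega : R[i] := cexp ('i%C * (2 * pi / 3)%:C).

(* (tau - i0)^{1/3}; the value at tau = 0 is 0 and is never used *)
Definition rho (tau : R) : R[i] :=
  if 0 < tau then (`|tau| `^ 3^-1)%:C
  else (`|tau| `^ 3^-1)%:C * cexp (- 'i%C * (pi / 3)%:C).

Definition symb_c (m n : nat) : R[i] :=
  - 'i%C * omega ^- m * (omega + 'i%C) ^+ n.

Definition symb_a (m n : nat) (zeta : R[i]) : R[i] :=
  symb_c m n * (zeta ^+ m / (zeta + 'i%C) ^+ n).

Definition symb_K (m n : nat) (xi tau : R) : R[i] :=
  let zeta := xi%:C / rho tau in
  (rho tau)^-1 * (symb_a m n zeta / (zeta - omega)).

Definition bforce (m n : nat) (h : R -> R[i]) (p : R * R) : R[i] :=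
  ((2 * pi) ^- 2)%:C *
  cintegral leb2 (fun k => cexp ('i%C * (p.1 * k.1 + p.2 * k.2)%:C) *
                           (fourier1 h k.2 * symb_K m n k.1 k.2)).

Definition C0c_infty (h : R -> R[i]) : Prop :=
  [/\ csmooth h, compact (csupp h) & csupp h `<=` [set x | 0 <= x]].

Definition dx : (R * R -> R[i]) -> R * R -> R[i] :=
  cderiv ((1, 0) : R * R).

Definition dt : (R * R -> R[i]) -> R * R -> R[i] :=
  cderiv ((0, 1) : R * R).

(* (d_t + d_x^3) u = F in the sense of distributions on the open set O *)
Definition airy_dist (O : set (R * R)) (u F : R * R -> R[i]) : Prop :=
  forall phi : R * R -> R[i],
    csmooth phi -> compact (csupp phi) -> csupp phi `<=` O ->
    cintegral leb2 (fun p => u p *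
      (- dt phi p - dx (dx (dx phi)) p)) =
    cintegral leb2 (fun p => F p * phi p).

End BoundaryForcing.

(* Main.v *)
(** For fixed tau <> 0 the symbol K is a rational function of xi with a simple
    pole omega rho(tau) in the upper half plane, of residue normalised by
    a(omega) = -i, and a pole of order n at -i rho(tau) in the lower one.
    Partial fractions give its inverse transform: exp(i x omega rho) for x >= 0,
    a polynomial in x rho times exp(x rho) for x < 0.  This yields the trace at
    x = 0 and (d); multiplication by tau - xi^3 removes the upper pole, hence (c).

    (b) Write h^(tau) = (1 + i tau)^-3 g^(tau) with g = (1 + d_t)^3 h, again
    supported in t >= 0.  By Fubini, (b) reduces to the vanishing, for c <= 0, of
    the integral of exp(i c tau) (1 + i tau)^-3 G(rho(tau)), where G is one of the
    functions of w = rho(tau) above; they are holomorphic and bounded for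
    -pi/3 <= arg w <= 0.  As w^3 = tau runs through the lower half plane, the
    half-line tau > 0 can be rotated onto tau < 0.

    (e) Put W(r) = r^e + r^-e for a small e > 0.  Cauchy-Schwarz with weight
    W(2^l / 2^(3j)) in the sum over modulations, and with weight
    <tau - xi^3> W(<tau - xi^3> / <xi>^3) in the integral over tau, bounds both
    norms by the integral of |h^|^2 J, where J(tau) is the integral over xi of
    <xi>^2s <tau - xi^3> W(<tau - xi^3> / <xi>^3) |K|^2.  By scaling, J(tau) is at
    most a constant times |tau|^(2(s+1)/3) for |tau| >= 1 and |tau|^(-1/3) for
    |tau| <= 1; on the latter range h^ is bounded by the L^2 norm of h because
    supp h lies in [0,2]. *)

Require Import Defs.
From HB Require Import structures.
From mathcomp Require Import all_boot all_order all_algebra.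
From mathcomp Require Import all_classical all_reals all_analysis.
From mathcomp Require Import measurable_realfun.
From mathcomp Require Import ring lra zify.
Import Order.TTheory GRing.Theory Num.Theory.
Import numFieldNormedType.Exports.
Set Implicit Arguments.
Unset Strict Implicit.
Unset Printing Implicit Defensive.
Local Open Scope classical_set_scope.
Local Open Scope ring_scope.
Local Open Scope complex_scope.

(** The norms on the left are infima over representatives of a distributional transform, so one
    representative bounds them. The norm of [h] stands on the right and must be computed, hence the
    almost everywhere uniqueness of the transform. The forcing term need not be integrable on the
    plane: its transforms are read off from an integrable symbol by moving the Fourier kernel onto
    test functions.

    The condition n >= m + 4 is one of decay: K is of order |xi|^(m-n-1) at infinity, so xi^3 K is
    still integrable, with the majorant T^-1 (1 + (xi/T)^2)^-1, T = |tau|^(1/3), of integral pi for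
    every tau.

    The exponent -3 in (b) pays for the derivative of z f(z): differentiating exp(i c z) costs one
    power of |z|, and |z|^-2 is left for integrability. The rotation itself is Fubini for a single
    function of polar coordinates.

    The C(H^s) bound comes directly from the quadratic form and not through the Bourgain norm.
    Continuity in time costs a factor tau, which becomes a derivative of h. *)

Arguments cmod : simpl never.

(** * Complex-valued functions *)

Section Complex.
Context {R : realType}.
Implicit Types (z w : R[i]) (a b t : R).
Local Notation Re := (@complex.Re R).
Local Notation Im := (@complex.Im R).

Lemma complexP z w : Re z = Re w -> Im z = Im w -> z = w.
Proof. by case: z => a b; case: w => c d /= -> ->. Qed.

Lemma ReD z w : Re (z + w) = Re z + Re w. Proof. by case: z; case: w. Qed.
Lemma ImD z w : Im (z + w) = Im z + Im w. Proof. by case: z; case: w. Qed.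
Lemma ReN z : Re (- z) = - Re z. Proof. by case: z. Qed.
Lemma ImN z : Im (- z) = - Im z. Proof. by case: z. Qed.
Lemma ReB z w : Re (z - w) = Re z - Re w. Proof. by rewrite ReD ReN. Qed.
Lemma ImB z w : Im (z - w) = Im z - Im w. Proof. by rewrite ImD ImN. Qed.
Lemma ReM z w : Re (z * w) = Re z * Re w - Im z * Im w.
Proof. by case: z; case: w. Qed.
Lemma ImM z w : Im (z * w) = Re z * Im w + Im z * Re w.
Proof. by case: z => a b; case: w => c d. Qed.
Definition cpartE := (ReD, ImD, ReN, ImN, ReM, ImM).

Lemma cmodE z : cmod z = Num.sqrt (Re z ^+ 2 + Im z ^+ 2).
Proof. by rewrite /cmod; case: z. Qed.
Lemma cmod_ge0 z : 0 <= cmod z. Proof. by rewrite cmodE sqrtr_ge0. Qed.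
Lemma cmod_sqr z : cmod z ^+ 2 = Re z ^+ 2 + Im z ^+ 2.
Proof. by rewrite cmodE sqr_sqrtr// addr_ge0// sqr_ge0. Qed.
Lemma cmodM z w : cmod (z * w) = cmod z * cmod w.
Proof. exact: ComplexField.Normc.normcM. Qed.
Lemma cmod0 : cmod 0 = 0 :> R. Proof. exact: ComplexField.Normc.normc0. Qed.
Lemma cmod1 : cmod 1 = 1 :> R. Proof. exact: ComplexField.Normc.normc1. Qed.
Lemma cmodV z : cmod z^-1 = (cmod z)^-1.
Proof. exact: ComplexField.Normc.normcV. Qed.
Lemma cmodN z : cmod (- z) = cmod z. Proof. exact: normcN. Qed.
Lemma cmodX z n : cmod (z ^+ n) = cmod z ^+ n.
Proof. by elim: n => [|n ih]; rewrite ?expr0 ?cmod1// !exprS cmodM ih. Qed.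
Lemma cmodD_le z w : cmod (z + w) <= cmod z + cmod w.
Proof. exact: le_normcD. Qed.
Lemma cmodB_le z w : cmod (z - w) <= cmod z + cmod w.
Proof. by rewrite -(cmodN w) cmodD_le. Qed.
Lemma cmodBC z w : cmod (z - w) = cmod (w - z).
Proof. by rewrite -cmodN opprB. Qed.
Lemma cmod_eq0 z : (cmod z == 0) = (z == 0).
Proof.
apply/eqP/eqP => [|->]; last exact: cmod0.
exact: ComplexField.Normc.eq0_normc.
Qed.
Lemma cmodR a : cmod a%:C = `|a|.
Proof. by rewrite cmodE /= expr0n addr0 sqrtr_sqr. Qed.
Lemma cmodi : cmod 'i%C = 1 :> R.
Proof. by rewrite cmodE /= expr0n add0r expr1n sqrtr1. Qed.
Lemma norm_Re_le z : `|Re z| <= cmod z.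
Proof. by rewrite cmodE -sqrtr_sqr ler_wsqrtr// lerDl sqr_ge0. Qed.
Lemma norm_Im_le z : `|Im z| <= cmod z.
Proof. by rewrite cmodE -sqrtr_sqr ler_wsqrtr// lerDr sqr_ge0. Qed.
Lemma cmod_le_ReIm z : cmod z <= `|Re z| + `|Im z|.
Proof.
rewrite -ler_sqr ?nnegrE ?cmod_ge0 ?addr_ge0// cmod_sqr sqrrD.
by rewrite !real_normK ?num_real// -addrAC lerDl mulrn_wge0// mulr_ge0.
Qed.
Lemma le_cmod_ReIm z a b : `|Re z| <= a -> `|Im z| <= b -> cmod z <= a + b.
Proof. by move=> za zb; rewrite (le_trans (cmod_le_ReIm z))// lerD. Qed.

Lemma conjc_ReE z : Re (conjc z) = Re z. Proof. by case: z. Qed.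
Lemma conjc_ImE z : Im (conjc z) = - Im z. Proof. by case: z. Qed.
Lemma cmod_conj z : cmod (conjc z) = cmod z.
Proof. by rewrite !cmodE conjc_ReE conjc_ImE sqrrN. Qed.
Lemma mulc_conj z : z * conjc z = (cmod z ^+ 2)%:C.
Proof.
rewrite cmod_sqr; case: z => a b; apply: complexP => /=; last by ring.
by ring.
Qed.

Definition cis (t : R) : R[i] := cos t +i* sin t.

Lemma cisD a b : cis (a + b) = cis a * cis b.
Proof.
by apply: complexP; rewrite cpartE /= ?cosD ?sinD; ring.
Qed.
Lemma cis0 : cis 0 = 1. Proof. by rewrite /cis cos0 sin0. Qed.
Lemma cmod_cis a : cmod (cis a) = 1.
Proof. by rewrite cmodE /= cos2Dsin2 sqrtr1. Qed.
Lemma cis_conj a : conjc (cis a) = cis (- a).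
Proof. by apply: complexP; rewrite /= ?cosN ?sinN. Qed.
Lemma cis_neq0 a : cis a != 0.
Proof. by rewrite -cmod_eq0 cmod_cis oner_eq0. Qed.
Lemma cisN a : cis (- a) = (cis a)^-1.
Proof.
apply: (mulfI (cis_neq0 a)); rewrite -cisD subrr cis0 mulfV//.
exact: cis_neq0.
Qed.

Lemma cexpD z w : cexp (z + w) = cexp z * cexp w.
Proof.
case: z => a b; case: w => c d; rewrite /cexp /= expRD cosD sinD.
by apply: complexP; rewrite !cpartE /=; ring.
Qed.
Lemma cmod_cexp z : cmod (cexp z) = expR (Re z).
Proof. by rewrite /cexp cmodM cmodR cmod_cis mulr1 ger0_norm// expR_ge0. Qed.
Lemma cexp0 : cexp 0 = 1 :> R[i].
Proof. by rewrite /cexp /= expR0 cos0 sin0; apply: complexP; rewrite /= ?mulr0 ?mulr1; ring. Qed.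
Lemma cexp_i a : cexp ('i%C * a%:C) = cis a.
Proof.
rewrite /cexp !cpartE /=.
have -> : 0 * a - 1 * 0 = 0 :> R by ring.
have -> : 0 * 0 + 1 * a = a :> R by ring.
by rewrite expR0; apply: complexP; rewrite !cpartE /=; ring.
Qed.
Lemma cexp_Ni a : cexp (- 'i%C * a%:C) = cis (- a).
Proof.
rewrite -cexp_i; congr cexp; apply: complexP; rewrite !cpartE /=; ring.
Qed.

Lemma sin_le a : `|sin a| <= `|a|.
Proof.
wlog a0 : a / 0 <= a => [h|].
  by case: (lerP 0 a) => [/h //|/ltW]; rewrite -oppr_ge0 => /h; rewrite sinN !normrN.
move: a0; rewrite le_eqVlt => /predU1P[<-|a0]; first by rewrite sin0.
have [c _ /=] := @MVT R sin cos 0 a a0 (fun x _ => is_derive_sin x)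
  (continuous_subspaceT (@continuous_sin R)).
rewrite sin0 !subr0 => ->; rewrite normrM ler_piMl// ler_norml.
by rewrite cos_le1 cos_geN1.
Qed.

Lemma cos_lip a : `|cos a - 1| <= `|a|.
Proof.
wlog a0 : a / 0 <= a => [h|].
  by case: (lerP 0 a) => [/h //|/ltW]; rewrite -oppr_ge0 => /h; rewrite cosN !normrN.
move: a0; rewrite le_eqVlt => /predU1P[<-|a0]; first by rewrite cos0 subrr normr0.
have [c _ /=] := @MVT R cos (fun x => - sin x) 0 a a0 (fun x _ => is_derive_cos x)
  (continuous_subspaceT (@continuous_cos R)).
rewrite cos0 !subr0 => ->; rewrite normrM normrN ler_piMl// ler_norml.
by rewrite sin_le1 sin_geN1.
Qed.

(** Factoring out [cis b] leaves [cis (a - b) - 1], each part of which is at most [|a - b|]; the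
    factor 2 comes from adding the two parts. *)
Lemma cis_lip a b : cmod (cis a - cis b) <= 2 * `|a - b|.
Proof.
have -> : cis a - cis b = cis b * (cis (a - b) - 1).
  by rewrite mulrBr -cisD mulr1; congr (cis _ - _); ring.
rewrite cmodM cmod_cis mul1r mulr_natl mulr2n; apply: le_cmod_ReIm.
  by rewrite !cpartE /=; exact: cos_lip.
by rewrite !cpartE /= subr0; exact: sin_le.
Qed.

End Complex.

(** * Measurability of complex-valued functions *)

Section CMeasurable.
Context {R : realType} d (T : measurableType d).
Implicit Types f g : T -> R[i].

(** Inversion is continuous off 0 only; the conventional value [0^-1 = 0] is split off as a separate
    case. *)
Lemma measurable_invr : measurable_fun setT (fun x : R => x^-1).
Proof.
have -> : (fun x : R => x^-1) = (fun x => if x == 0 then 0 else x^-1).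
  by apply/funext => x; case: ifPn => // /eqP ->; rewrite invr0.
apply: measurable_fun_if => //.
  exact: measurable_fun_eqr.
rewrite setTI; apply: open_continuous_measurable_fun.
  rewrite (_ : _ @^-1` _ = ~` [set 0]); first by apply: closed_openC; exact: closed_eq.
  by apply/seteqP; split => x /=; [move/eqP|move/eqP/negbTE].
move=> x; rewrite inE /= => /negbT x0; exact: inv_continuous.
Qed.

Lemma measurable_fun_inv (f : T -> R) :
  measurable_fun setT f -> measurable_fun setT (fun x => (f x)^-1).
Proof. by move=> mf; apply: (measurableT_comp measurable_invr). Qed.

Lemma cmeasurable_cst (z : R[i]) : cmeasurable (fun _ : T => z).
Proof. by split; exact: measurable_cst. Qed.

Lemma cmeasurable_real (f : T -> R) :
  measurable_fun setT f -> cmeasurable (fun x => (f x)%:C).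
Proof. by split => //=; exact: measurable_cst. Qed.

Lemma cmeasurableD f g : cmeasurable f -> cmeasurable g ->
  cmeasurable (fun x => f x + g x).
Proof.
move=> [f1 f2] [g1 g2]; split.
  by under eq_fun do rewrite ReD; exact: measurable_funD.
by under eq_fun do rewrite ImD; exact: measurable_funD.
Qed.

Lemma cmeasurableN f : cmeasurable f -> cmeasurable (fun x => - f x).
Proof.
move=> [f1 f2]; split.
  by under eq_fun do rewrite ReN; exact: measurable_funN.
by under eq_fun do rewrite ImN; exact: measurable_funN.
Qed.

Lemma cmeasurableB f g : cmeasurable f -> cmeasurable g ->
  cmeasurable (fun x => f x - g x).
Proof. by move=> mf mg; apply: cmeasurableD => //; exact: cmeasurableN. Qed.

Lemma cmeasurableM f g : cmeasurable f -> cmeasurable g ->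
  cmeasurable (fun x => f x * g x).
Proof.
move=> [f1 f2] [g1 g2]; split.
  under eq_fun do rewrite ReM.
  by apply: measurable_funB; exact: measurable_funM.
under eq_fun do rewrite ImM.
by apply: measurable_funD; exact: measurable_funM.
Qed.

Lemma cmeasurableX f n : cmeasurable f -> cmeasurable (fun x => f x ^+ n).
Proof.
move=> mf; elim: n => [|n ih].
  by under eq_fun do rewrite expr0; exact: cmeasurable_cst.
by under eq_fun do rewrite exprS; exact: cmeasurableM.
Qed.

Lemma measurable_cmod f : cmeasurable f -> measurable_fun setT (fun x => cmod (f x)).
Proof.
move=> [f1 f2]; under eq_fun do rewrite cmodE.
apply: (measurableT_comp (continuous_measurable_fun (@sqrt_continuous R))).
by apply: measurable_funD; exact: measurable_funX.
Qed.

(** The inverse is the conjugate over the squared modulus, also at 0, where both vanish by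
    convention. *)
Lemma cmeasurableV f : cmeasurable f -> cmeasurable (fun x => (f x)^-1).
Proof.
move=> [f1 f2].
have m2 : measurable_fun setT (fun x => (complex.Re (f x) ^+ 2 + complex.Im (f x) ^+ 2)^-1).
  by apply: measurable_fun_inv; apply: measurable_funD; exact: measurable_funX.
split.
  rewrite (_ : (fun _ => _) = (fun x => complex.Re (f x) *
    (complex.Re (f x) ^+ 2 + complex.Im (f x) ^+ 2)^-1)); first exact: measurable_funM.
  by apply/funext => x; case: (f x).
rewrite (_ : (fun _ => _) = (fun x => - complex.Im (f x) *
  (complex.Re (f x) ^+ 2 + complex.Im (f x) ^+ 2)^-1)).
  by apply: measurable_funM => //; exact: measurable_funN.
by apply/funext => x; case: (f x) => a b /=; rewrite mulNr.
Qed.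

Lemma cmeasurable_conj f : cmeasurable f -> cmeasurable (fun x => conjc (f x)).
Proof.
move=> [f1 f2]; split.
  by under eq_fun do rewrite conjc_ReE.
by under eq_fun do rewrite conjc_ImE; exact: measurable_funN.
Qed.

Lemma cmeasurable_cis (f : T -> R) :
  measurable_fun setT f -> cmeasurable (fun x => cis (f x)).
Proof.
by move=> mf; split => /=; apply: measurableT_comp => //;
  apply: continuous_measurable_fun; [exact: continuous_cos|exact: continuous_sin].
Qed.

Lemma cmeasurable_cexp f : cmeasurable f -> cmeasurable (fun x => cexp (f x)).
Proof.
move=> [f1 f2]; rewrite /cexp; apply: cmeasurableM; last exact: cmeasurable_cis.
apply: cmeasurable_real; apply: measurableT_comp => //.
Qed.

Lemma cmeasurable_comp d' (S : measurableType d') (f : S -> R[i]) (h : T -> S) :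
  cmeasurable f -> measurable_fun setT h -> cmeasurable (fun x => f (h x)).
Proof. by move=> [f1 f2] mh; split; [exact: (measurableT_comp f1)|exact: (measurableT_comp f2)]. Qed.

Lemma cmeasurable_if (b : T -> bool) f g : measurable_fun setT b ->
  cmeasurable f -> cmeasurable g -> cmeasurable (fun x => if b x then f x else g x).
Proof.
move=> mb [f1 f2] [g1 g2]; split.
  rewrite (_ : (fun _ => _) = (fun x => if b x then complex.Re (f x) else complex.Re (g x))).
    by apply: measurable_fun_if => //; rewrite setTI; apply: measurable_funTS.
  by apply/funext => x; case: ifP.
rewrite (_ : (fun _ => _) = (fun x => if b x then complex.Im (f x) else complex.Im (g x))).
  by apply: measurable_fun_if => //; rewrite setTI; apply: measurable_funTS.
by apply/funext => x; case: ifP.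
Qed.

End CMeasurable.

(** * Integrals of complex functions by real and imaginary parts *)

Section CIntegral.
Context {R : realType} d (T : measurableType d).
Variable mu : {measure set T -> \bar R}.
Implicit Types f g : T -> R[i].

Lemma cintegrable_measurable f : cintegrable mu f -> cmeasurable f.
Proof.
by move=> [/measurable_int/measurable_EFinP f1 /measurable_int/measurable_EFinP f2].
Qed.

Lemma le_cintegrable f (g : T -> R) : cmeasurable f ->
  mu.-integrable setT (fun x => (g x)%:E) ->
  (forall x, cmod (f x) <= g x) -> cintegrable mu f.
Proof.
move=> [f1 f2] ig fg; split; apply: (le_integrable measurableT _ _ ig).
- exact/measurable_EFinP.
- move=> x _ /=; rewrite lee_fin (le_trans (norm_Re_le _))//.
  exact: le_trans (fg x) (ler_norm _).
- exact/measurable_EFinP.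
- move=> x _ /=; rewrite lee_fin (le_trans (norm_Im_le _))//.
  exact: le_trans (fg x) (ler_norm _).
Qed.

Lemma cintegrable_cmod f : cintegrable mu f ->
  mu.-integrable setT (fun x => (cmod (f x))%:E).
Proof.
move=> fi; have mf := cintegrable_measurable fi; case: fi => f1 f2.
apply: (le_integrable measurableT _ _
  (integrableD measurableT (integrable_abse f1) (integrable_abse f2))).
  exact/measurable_EFinP/measurable_cmod.
move=> x _ /=; rewrite lee_fin ger0_norm ?cmod_ge0//.
by rewrite (le_trans (cmod_le_ReIm _))// ler_norm.
Qed.

Lemma cintegrableP f : cintegrable mu f <->
  cmeasurable f /\ (\int[mu]_x (cmod (f x))%:E < +oo)%E.
Proof.
split=> [fi|[mf foo]].
  split; first exact: cintegrable_measurable.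
  have /integrableP[_] := cintegrable_cmod fi.
  by under eq_integral do rewrite gee0_abs ?lee_fin ?cmod_ge0//.
apply: (@le_cintegrable _ (fun x => cmod (f x))) => //.
apply/integrableP; split; first exact/measurable_EFinP/measurable_cmod.
by under eq_integral do rewrite gee0_abs ?lee_fin ?cmod_ge0//.
Qed.

Lemma cintegrable_le f g : cmeasurable f -> cintegrable mu g ->
  (forall x, cmod (f x) <= cmod (g x)) -> cintegrable mu f.
Proof. by move=> mf /cintegrable_cmod ig; exact: le_cintegrable. Qed.

Lemma cintegrable0 : cintegrable mu (fun=> 0).
Proof. by split; exact: integrable0. Qed.

Lemma cintegrableD f g : cintegrable mu f -> cintegrable mu g ->
  cintegrable mu (fun x => f x + g x).
Proof.
move=> [f1 f2] [g1 g2]; split.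
  by under eq_fun do rewrite ReD EFinD; exact: integrableD.
by under eq_fun do rewrite ImD EFinD; exact: integrableD.
Qed.

Lemma cintegrableMl f g (M : R) : cmeasurable g -> (forall x, cmod (g x) <= M) ->
  cintegrable mu f -> cintegrable mu (fun x => g x * f x).
Proof.
move=> mg gM fi; have mf := cintegrable_measurable fi.
apply: (@le_cintegrable _ (fun x => M * cmod (f x))).
- exact: cmeasurableM.
- by under eq_fun do rewrite EFinM; apply: integrableZl => //; exact: cintegrable_cmod.
- by move=> x; rewrite cmodM ler_wpM2r// cmod_ge0.
Qed.

Lemma cintegrableMr f g (M : R) : cmeasurable g -> (forall x, cmod (g x) <= M) ->
  cintegrable mu f -> cintegrable mu (fun x => f x * g x).
Proof.
by move=> mg gM fi; under eq_fun do rewrite mulrC; exact: cintegrableMl gM fi.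
Qed.

Lemma cintegrableZ f (z : R[i]) : cintegrable mu f ->
  cintegrable mu (fun x => z * f x).
Proof. by apply: (@cintegrableMl _ _ (cmod z)) => //; exact: cmeasurable_cst. Qed.

Lemma cintegrableN f : cintegrable mu f -> cintegrable mu (fun x => - f x).
Proof.
by move=> /(cintegrableZ (-1)); under eq_fun do rewrite mulN1r.
Qed.

Lemma cintegrableB f g : cintegrable mu f -> cintegrable mu g ->
  cintegrable mu (fun x => f x - g x).
Proof. by move=> fi gi; apply: cintegrableD => //; exact: cintegrableN. Qed.

Lemma cintegrable_conj f : cintegrable mu f -> cintegrable mu (fun x => conjc (f x)).
Proof.
move=> fi; apply: (cintegrable_le _ fi).
  by apply: cmeasurable_conj; exact: cintegrable_measurable fi.
by move=> x; rewrite cmod_conj.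
Qed.

Lemma cintegralD f g : cintegrable mu f -> cintegrable mu g ->
  cintegral mu (fun x => f x + g x) = cintegral mu f + cintegral mu g.
Proof.
move=> [f1 f2] [g1 g2]; apply: complexP => /=.
  by under eq_Rintegral do rewrite ReD; exact: RintegralD.
by under eq_Rintegral do rewrite ImD; exact: RintegralD.
Qed.

Lemma cintegralZ f (z : R[i]) : cintegrable mu f ->
  cintegral mu (fun x => z * f x) = z * cintegral mu f.
Proof.
move=> [f1 f2]; case: z => a b.
have i1 c : mu.-integrable setT (EFin \o (fun x => c * complex.Re (f x))).
  by rewrite /comp; under eq_fun do rewrite EFinM; exact: integrableZl.
have i2 c : mu.-integrable setT (EFin \o (fun x => c * complex.Im (f x))).
  by rewrite /comp; under eq_fun do rewrite EFinM; exact: integrableZl.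
apply: complexP; rewrite !cpartE /=.
  by under eq_Rintegral do rewrite ReM /=; rewrite RintegralB// !RintegralZl.
by under eq_Rintegral do rewrite ImM /=; rewrite RintegralD// !RintegralZl.
Qed.

Lemma cintegralZr f (z : R[i]) : cintegrable mu f ->
  cintegral mu (fun x => f x * z) = cintegral mu f * z.
Proof.
move=> fi; rewrite mulrC -cintegralZ//.
by congr cintegral; apply/funext => x; rewrite mulrC.
Qed.

Lemma cintegralN f : cintegrable mu f ->
  cintegral mu (fun x => - f x) = - cintegral mu f.
Proof.
move=> fi; rewrite -mulN1r -cintegralZ//.
by congr cintegral; apply/funext => x; rewrite mulN1r.
Qed.

Lemma cintegralB f g : cintegrable mu f -> cintegrable mu g ->
  cintegral mu (fun x => f x - g x) = cintegral mu f - cintegral mu g.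
Proof.
move=> fi gi; rewrite -cintegralN// -cintegralD//; exact: cintegrableN.
Qed.

Lemma cintegral_conj f : cintegrable mu f ->
  cintegral mu (fun x => conjc (f x)) = conjc (cintegral mu f).
Proof.
move=> [f1 f2]; apply: complexP; rewrite /= ?conjc_ReE ?conjc_ImE /=.
  by under eq_Rintegral do rewrite conjc_ReE.
under eq_Rintegral do rewrite conjc_ImE -mulN1r.
by rewrite RintegralZl// mulN1r.
Qed.

Lemma eq_cintegral f g : f =1 g -> cintegral mu f = cintegral mu g.
Proof. by move=> fg; congr cintegral; apply/funext. Qed.

Lemma cintegral0 : cintegral mu (fun=> 0) = 0.
Proof.
by apply: complexP => /=; rewrite /Rintegral integral0_eq.
Qed.

(** Each of the two parts of the integral is at most the integral of the modulus, whence the factor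
    2; it is harmless where only the existence of a constant matters. If the modulus has infinite
    integral, the right-hand side is [+oo]. *)
Lemma cmod_cintegral_le f : cmeasurable f ->
  ((cmod (cintegral mu f))%:E <= 2%:E * \int[mu]_x (cmod (f x))%:E)%E.
Proof.
move=> mf; have [foo|] := ltP (\int[mu]_x (cmod (f x))%:E)%E +oo%E; last first.
  by rewrite leye_eq => /eqP ->; rewrite mulry gtr0_sg// mul1e leey.
have fi : cintegrable mu f by apply/cintegrableP.
have ci := cintegrable_cmod fi.
rewrite -(fineK (integrable_fin_num measurableT ci)) -EFinM lee_fin.
rewrite mulr_natl mulr2n; case: fi => f1 f2; apply: le_cmod_ReIm => /=.
  apply: le_trans (le_normr_Rintegral measurableT f1) _.
  apply: le_Rintegral => //; first exact: integrable_norm.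
  by move=> x _; exact: norm_Re_le.
apply: le_trans (le_normr_Rintegral measurableT f2) _.
apply: le_Rintegral => //; first exact: integrable_norm.
by move=> x _; exact: norm_Im_le.
Qed.

Lemma cmod_cintegral_leR f (g : T -> R) (M : R) : cmeasurable f ->
  (forall x, cmod (f x) <= g x) -> measurable_fun setT g ->
  (\int[mu]_x (g x)%:E <= M%:E)%E -> cmod (cintegral mu f) <= 2 * M.
Proof.
move=> mf fg mg gM; rewrite -lee_fin (le_trans (cmod_cintegral_le mf))//.
rewrite EFinM lee_wpmul2l ?lee_fin// (le_trans _ gM)//.
apply: ge0_le_integral => //.
- by move=> x _; rewrite lee_fin cmod_ge0.
- exact/measurable_EFinP/measurable_cmod.
- exact/measurable_EFinP.
- by move=> x _; rewrite lee_fin.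
Qed.

Lemma ae_eq_cintegral f g : cmeasurable f -> cmeasurable g ->
  {ae mu, forall x, f x = g x} -> cintegral mu f = cintegral mu g.
Proof.
move=> [f1 f2] [g1 g2] fg; apply: complexP => /=; rewrite /Rintegral; congr fine;
  (apply: ae_eq_integral => //; first exact/measurable_EFinP;
    first exact/measurable_EFinP);
  by apply: filterS fg => x /= -> _.
Qed.

End CIntegral.

(** Stated through the modulus of the difference so that estimates apply directly; [ccvgP] passes to
    real and imaginary parts. *)
Definition ccvg {R : realType} {I : Type} (F : set_system I) (u : I -> R[i]) (l : R[i]) :=
  (fun t => cmod (u t - l)) @ F --> (0 : R).

Section CCvg.
Context {R : realType} {I : Type} (F : set_system I) {FF : ProperFilter F}.
Implicit Types (u v : I -> R[i]) (l : R[i]).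

Lemma ccvgP u l : ccvg F u l <->
  (complex.Re (u t) @[t --> F] --> complex.Re l) /\
  (complex.Im (u t) @[t --> F] --> complex.Im l).
Proof.
split=> [ul|[u1 u2]].
  split; apply/subr_cvg0/norm_cvg0P; apply: (squeeze_cvgr _ (cvg_cst 0) ul);
    apply: nearW => t; rewrite normr_ge0 /=.
    by rewrite -ReB norm_Re_le.
  by rewrite -ImB norm_Im_le.
have {}u1 : `|complex.Re (u t) - complex.Re l| @[t --> F] --> (0 : R).
  by apply/norm_cvg0P; apply/subr_cvg0.
have {}u2 : `|complex.Im (u t) - complex.Im l| @[t --> F] --> (0 : R).
  by apply/norm_cvg0P; apply/subr_cvg0.
have := cvgD u1 u2; rewrite addr0 => /(_ _)-u12.
apply: (squeeze_cvgr _ (cvg_cst 0) u12).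
apply: nearW => t; rewrite cmod_ge0 /= (le_trans (cmod_le_ReIm _))//.
by rewrite ReB ImB.
Qed.

Lemma ccvg_unique u l l' : ccvg F u l -> ccvg F u l' -> l = l'.
Proof.
move=> /ccvgP[u1 u2] /ccvgP[v1 v2]; apply: complexP.
  exact: (cvg_unique _ u1 v1).
exact: (cvg_unique _ u2 v2).
Qed.

Lemma ccvg_cst l : ccvg F (fun=> l) l.
Proof.
by rewrite /ccvg; under eq_fun do rewrite subrr cmod0; exact: cvg_cst.
Qed.

Lemma ccvg_le u l (e : I -> R) : (\forall t \near F, cmod (u t - l) <= e t) ->
  e @ F --> (0 : R) -> ccvg F u l.
Proof.
move=> ule e0; apply: (squeeze_cvgr _ (cvg_cst 0) e0).
by apply: filterS ule => t ->; rewrite cmod_ge0.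
Qed.

Lemma ccvgD u v l l' : ccvg F u l -> ccvg F v l' ->
  ccvg F (fun t => u t + v t) (l + l').
Proof.
move=> ul vl; apply: (@ccvg_le _ _ (fun t => cmod (u t - l) + cmod (v t - l'))).
  by apply: nearW => t; rewrite opprD addrACA cmodD_le.
by rewrite -[0]addr0; exact: cvgD.
Qed.

Lemma ccvgZ u l (z : R[i]) : ccvg F u l -> ccvg F (fun t => z * u t) (z * l).
Proof.
move=> ul; apply: (@ccvg_le _ _ (fun t => cmod z * cmod (u t - l))).
  by apply: nearW => t; rewrite -mulrBr cmodM.
by rewrite -(mulr0 (cmod z)); apply: cvgM => //; exact: cvg_cst.
Qed.

Lemma ccvgN u l : ccvg F u l -> ccvg F (fun t => - u t) (- l).
Proof.
by move=> /(ccvgZ (-1)); rewrite mulN1r; under eq_fun do rewrite mulN1r.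
Qed.

Lemma ccvg_lim_le u l (M : R) : ccvg F u l -> (\forall t \near F, cmod (u t) <= M) ->
  cmod l <= M.
Proof.
move=> ul uM; apply/ler_addgt0Pr => e e0.
have /cvgrPdist_lt/(_ _ e0) ul' := ul.
near F => t.
have -> : l = u t - (u t - l) by rewrite opprB addrC subrK.
rewrite (le_trans (cmodB_le _ _))// lerD//.
  by near: t.
rewrite ltW//; near: t; apply: filterS ul' => t.
by rewrite sub0r normrN ger0_norm// cmod_ge0.
Unshelve. all: by end_near. Qed.
End CCvg.

Section CDominated.
Context {R : realType} d (T : measurableType d).
Variable mu : {measure set T -> \bar R}.

Lemma cdominated_cvg (f : nat -> T -> R[i]) (l : T -> R[i]) (g : T -> R) :
  (forall n, cmeasurable (f n)) -> cmeasurable l ->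
  (forall x, ccvg \oo (f ^~ x) (l x)) ->
  mu.-integrable setT (fun x => (g x)%:E) ->
  (forall n x, cmod (f n x) <= g x) ->
  cintegrable mu l /\ ccvg \oo (fun n => cintegral mu (f n)) (cintegral mu l).
Proof.
move=> mf ml fl ig fg.
have il : cintegrable mu l.
  apply: le_cintegrable ml ig _ => x.
  by apply: ccvg_lim_le (fl x) _; apply: nearW => n.
split => //; apply/ccvgP; case: il => i1 i2; split => /=.
- apply: fine_cvg; rewrite fineK; last exact: integrable_fin_num.
  apply: (@dominated_cvg _ _ _ mu setT measurableT
    (fun n x => (complex.Re (f n x))%:E) _ (fun x => (g x)%:E)) => //.
  + by move=> n; apply/measurable_EFinP; have [] := mf n.
  + by move=> x _; apply/cvg_EFin; [exact: nearW|have /ccvgP[] := fl x].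
  + by move=> n x _; rewrite lee_fin (le_trans (norm_Re_le _)).
- apply: fine_cvg; rewrite fineK; last exact: integrable_fin_num.
  apply: (@dominated_cvg _ _ _ mu setT measurableT
    (fun n x => (complex.Im (f n x))%:E) _ (fun x => (g x)%:E)) => //.
  + by move=> n; apply/measurable_EFinP; have [] := mf n.
  + by move=> x _; apply/cvg_EFin; [exact: nearW|have /ccvgP[] := fl x].
  + by move=> n x _; rewrite lee_fin (le_trans (norm_Im_le _)).
Qed.

End CDominated.

(** * Fubini for functions with real and complex values *)

Section CFubini.
Context {R : realType} d1 d2 (T1 : measurableType d1) (T2 : measurableType d2).
Variables (m1 : {sigma_finite_measure set T1 -> \bar R})
          (m2 : {sigma_finite_measure set T2 -> \bar R}).
Local Notation m12 := (m1 \x m2)%E.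

(** Covers the slices with infinite integral, which [fine] sends to 0. *)
Lemma abse_fine_le (x : \bar R) : (`|(fine x)%:E| <= `|x|)%E.
Proof. by case: x => [r| |] //=; rewrite ?normr0 ?leey. Qed.

(** The real-valued slice integral agrees with the extended one only where the latter is finite;
    integrability makes this almost everywhere. *)
Lemma Rfubini1 (f : T1 * T2 -> R) : m12.-integrable setT (EFin \o f) ->
  m1.-integrable setT (EFin \o (fun x => \int[m2]_y f (x, y))) /\
  \int[m12]_z f z = \int[m1]_x \int[m2]_y f (x, y).
Proof.
move=> fi; have iF := integrable_fubini_F fi.
have mF := measurable_int _ iF.
have aeF : ae_eq m1 setT (fubini_F m2 (EFin \o f))
    (EFin \o (fun x => \int[m2]_y f (x, y))).
  have [N [mN N0 sN]] := integrable_ae measurableT iF.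
  exists N; split => // x /= nx; apply: sN => /= fx; apply: nx => _.
  by rewrite /Rintegral fineK//; exact: fx.
have mG : measurable_fun setT (EFin \o (fun x => \int[m2]_y f (x, y))).
  apply/measurable_EFinP; exact: (measurableT_comp (fine_measurable measurableT) mF).
split.
  apply: (le_integrable measurableT mG _ iF) => x _ /=; exact: abse_fine_le.
rewrite /Rintegral -(integral12_prod_meas1 fi); congr fine.
by apply: ae_eq_integral.
Qed.

Lemma Rfubini2 (f : T1 * T2 -> R) : m12.-integrable setT (EFin \o f) ->
  m2.-integrable setT (EFin \o (fun y => \int[m1]_x f (x, y))) /\
  \int[m12]_z f z = \int[m2]_y \int[m1]_x f (x, y).
Proof.
move=> fi; have mF := measurable_fubini_G fi; have mf := measurable_int _ fi.
(* The slice integral is dominated by that of the absolute value, whose integral in [y] is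
   finite. *)
have iF : m2.-integrable setT (fubini_G m1 (EFin \o f)).
  apply/integrableP; split => //.
  have := (integrable21ltyP m1 m2 mf).1 fi; apply: le_lt_trans.
  apply: ge0_le_integral => //; first exact: measurableT_comp.
  - apply: (measurable_fun_fubini_tonelli_G (abse \o (EFin \o f))) => [|z];
      [exact: measurableT_comp|exact: abse_ge0].
  - move=> y _; apply: le_abse_integral => //.
    by apply: (measurableT_comp mf); exact: measurable_pair2.
have aeF : ae_eq m2 setT (fubini_G m1 (EFin \o f))
    (EFin \o (fun y => \int[m1]_x f (x, y))).
  have [N [mN N0 sN]] := integrable_ae measurableT iF.
  exists N; split => // x /= nx; apply: sN => /= fx; apply: nx => _.
  by rewrite /Rintegral fineK//; exact: fx.
have mG : measurable_fun setT (EFin \o (fun y => \int[m1]_x f (x, y))).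
  apply/measurable_EFinP; exact: (measurableT_comp (fine_measurable measurableT) mF).
split.
  apply: (le_integrable measurableT mG _ iF) => x _ /=; exact: abse_fine_le.
rewrite /Rintegral -(integral21_prod_meas1 fi); congr fine.
by apply: ae_eq_integral.
Qed.

Lemma cfubini1 (f : T1 * T2 -> R[i]) : cintegrable m12 f ->
  cintegrable m1 (fun x => cintegral m2 (fun y => f (x, y))) /\
  cintegral m12 f = cintegral m1 (fun x => cintegral m2 (fun y => f (x, y))).
Proof.
by move=> [/Rfubini1[i1 e1] /Rfubini1[i2 e2]]; split; [split|apply: complexP].
Qed.

Lemma cfubini2 (f : T1 * T2 -> R[i]) : cintegrable m12 f ->
  cintegrable m2 (fun y => cintegral m1 (fun x => f (x, y))) /\
  cintegral m12 f = cintegral m2 (fun y => cintegral m1 (fun x => f (x, y))).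
Proof.
by move=> [/Rfubini2[i1 e1] /Rfubini2[i2 e2]]; split; [split|apply: complexP].
Qed.

Lemma cfubini (f : T1 * T2 -> R[i]) : cintegrable m12 f ->
  cintegral m1 (fun x => cintegral m2 (fun y => f (x, y))) =
  cintegral m2 (fun y => cintegral m1 (fun x => f (x, y))).
Proof. by move=> fi; rewrite -(cfubini1 fi).2 (cfubini2 fi).2. Qed.

Lemma integrable_prodM (g : T1 -> R) (k : T2 -> R) :
  m1.-integrable setT (EFin \o g) -> m2.-integrable setT (EFin \o k) ->
  m12.-integrable setT (fun z => (g z.1 * k z.2)%:E).
Proof.
move=> ig ik.
have mg : measurable_fun setT g by apply/measurable_EFinP/(measurable_int m1).
have mk : measurable_fun setT k by apply/measurable_EFinP/(measurable_int m2).
apply/integrable12ltyP.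
  apply/measurable_EFinP; apply: measurable_funM.
    exact: (measurableT_comp mg measurable_fst).
  exact: (measurableT_comp mk measurable_snd).
have nk : (\int[m2]_y `|(k y)%:E| < +oo)%E by have /integrableP[] := ik.
have ng : (\int[m1]_y `|(g y)%:E| < +oo)%E by have /integrableP[] := ig.
have fk : (\int[m2]_y `|(k y)%:E|)%E \is a fin_num.
  by rewrite ge0_fin_numE// integral_ge0.
rewrite (eq_integral (fun x => `|(g x)%:E| * \int[m2]_y `|(k y)%:E|)%E); last first.
  move=> x _; under eq_integral do rewrite EFinM abseM /=.
  rewrite ge0_integralZl//.
  by apply/measurable_EFinP; exact: measurableT_comp.
rewrite ge0_integralZr//.
- by rewrite muleC lte_mul_pinfty// integral_ge0.
- by apply/measurable_EFinP; exact: measurableT_comp.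
- exact: integral_ge0.
Qed.

Lemma le_cintegrable_prod (f : T1 * T2 -> R[i]) (g : T1 -> R) (k : T2 -> R) :
  cmeasurable f -> m1.-integrable setT (EFin \o g) -> m2.-integrable setT (EFin \o k) ->
  (forall x y, cmod (f (x, y)) <= g x * k y) -> cintegrable m12 f.
Proof.
move=> mf ig ik fgk; apply: (le_cintegrable mf (integrable_prodM ig ik)) => -[x y].
exact: fgk.
Qed.

Lemma cmeasurable_pair1 (f : T1 * T2 -> R[i]) x :
  cmeasurable f -> cmeasurable (fun y => f (x, y)).
Proof.
move=> mf; apply: (cmeasurable_comp mf); exact: measurable_pair1.
Qed.

Lemma cmeasurable_pair2 (f : T1 * T2 -> R[i]) y :
  cmeasurable f -> cmeasurable (fun x => f (x, y)).
Proof.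
move=> mf; apply: (cmeasurable_comp mf); exact: measurable_pair2.
Qed.

(** With no integrability at hand, Tonelli is applied to the positive and negative parts
    separately. *)
Lemma measurable_Rfubini1 (f : T1 * T2 -> R) : measurable_fun setT f ->
  measurable_fun setT (fun x => \int[m2]_y f (x, y)).
Proof.
move=> mf; have mfE : measurable_fun setT (EFin \o f) by exact/measurable_EFinP.
have mp : measurable_fun setT (fubini_F m2 (EFin \o f)^\+%E).
  by apply: measurable_fun_fubini_tonelli_F => //; exact: measurable_funepos.
have mn : measurable_fun setT (fubini_F m2 (EFin \o f)^\-%E).
  by apply: measurable_fun_fubini_tonelli_F => //; exact: measurable_funeneg.
have mF : measurable_fun setT (fubini_F m2 (EFin \o f)).
  rewrite (_ : fubini_F m2 (EFin \o f) = (fun x => fubini_F m2 (EFin \o f)^\+%E x - fubini_F m2 (EFin \o f)^\-%E x)%E).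
    exact: emeasurable_funB.
  by apply/funext => x; rewrite /fubini_F [LHS]integralE; congr (_ - _)%E; apply: eq_integral => y _; rewrite ?funeposE ?funenegE.
exact: (measurableT_comp (fine_measurable measurableT) mF).
Qed.

Lemma measurable_Rfubini2 (f : T1 * T2 -> R) : measurable_fun setT f ->
  measurable_fun setT (fun y => \int[m1]_x f (x, y)).
Proof.
move=> mf; have mfE : measurable_fun setT (EFin \o f) by exact/measurable_EFinP.
have mp : measurable_fun setT (fubini_G m1 (EFin \o f)^\+%E).
  by apply: measurable_fun_fubini_tonelli_G => //; exact: measurable_funepos.
have mn : measurable_fun setT (fubini_G m1 (EFin \o f)^\-%E).
  by apply: measurable_fun_fubini_tonelli_G => //; exact: measurable_funeneg.
have mF : measurable_fun setT (fubini_G m1 (EFin \o f)).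
  rewrite (_ : fubini_G m1 (EFin \o f) = (fun x => fubini_G m1 (EFin \o f)^\+%E x - fubini_G m1 (EFin \o f)^\-%E x)%E).
    exact: emeasurable_funB.
  by apply/funext => x; rewrite /fubini_G [LHS]integralE; congr (_ - _)%E; apply: eq_integral => y _; rewrite ?funeposE ?funenegE.
exact: (measurableT_comp (fine_measurable measurableT) mF).
Qed.

Lemma cmeasurable_cfubini1 (f : T1 * T2 -> R[i]) : cmeasurable f ->
  cmeasurable (fun x => cintegral m2 (fun y => f (x, y))).
Proof.
by move=> [f1 f2]; split => /=; [exact: (measurable_Rfubini1 f1)|exact: (measurable_Rfubini1 f2)].
Qed.

Lemma cmeasurable_cfubini2 (f : T1 * T2 -> R[i]) : cmeasurable f ->
  cmeasurable (fun y => cintegral m1 (fun x => f (x, y))).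
Proof.
by move=> [f1 f2]; split => /=; [exact: (measurable_Rfubini2 f1)|exact: (measurable_Rfubini2 f2)].
Qed.

End CFubini.

Section NonnegIntegral.
Context {R : realType} d (T : measurableType d).
Variable mu : {measure set T -> \bar R}.
Implicit Types f g : T -> R.

Lemma ge0_integralZ_EFin (a : R) f : 0 <= a -> measurable_fun setT f ->
  (forall x, 0 <= f x) -> (\int[mu]_x (a * f x)%:E = a%:E * \int[mu]_x (f x)%:E)%E.
Proof.
move=> a0 mf f0; under eq_integral do rewrite EFinM.
by rewrite ge0_integralZl_EFin// => [x _|]; [rewrite lee_fin|exact/measurable_EFinP].
Qed.

Lemma ge0_integralD_EFin f g : measurable_fun setT f -> measurable_fun setT g ->
  (forall x, 0 <= f x) -> (forall x, 0 <= g x) ->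
  (\int[mu]_x (f x + g x)%:E = \int[mu]_x (f x)%:E + \int[mu]_x (g x)%:E)%E.
Proof.
move=> mf mg f0 g0; under eq_integral do rewrite EFinD.
by rewrite ge0_integralD// => [x _||x _|]; rewrite ?lee_fin//; exact/measurable_EFinP.
Qed.

Lemma ge0_le_integral_EFin f g : measurable_fun setT f -> measurable_fun setT g ->
  (forall x, 0 <= f x) -> (forall x, f x <= g x) ->
  (\int[mu]_x (f x)%:E <= \int[mu]_x (g x)%:E)%E.
Proof.
move=> mf mg f0 fg; apply: ge0_le_integral => //.
- by move=> x _; rewrite lee_fin.
- exact/measurable_EFinP.
- exact/measurable_EFinP.
- by move=> x _; rewrite lee_fin.
Qed.

End NonnegIntegral.

(** * Borel sets of the plane in the product sigma-algebra *)

Section PlaneMeasurable.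
Context {R : realType}.

(** An open set is the union of the boxes with rational centre and radius [1 / (k + 1)] that it
    contains, a countable family. This links the topology of the plane to the product
    sigma-algebra. *)
Lemma open_measurable2 (U : set (R * R)) : open U -> measurable U.
Proof.
move=> oU.
pose B (q : rat * rat * nat) : set (R * R) :=
  ball (ratr q.1.1 : R) q.2.+1%:R^-1 `*` ball (ratr q.1.2 : R) q.2.+1%:R^-1.
pose C q := if `[< B q `<=` U >] then B q else set0.
rewrite (_ : U = \bigcup_q C q); last first.
  apply/seteqP; split=> [[x y] Uxy|z [q _]]; last first.
    by rewrite /C; case: asboolP => // BU Bz; exact: BU.
  have /nbhs_ballP[e /= e0 eU] : nbhs (x, y) U by apply: open_nbhs_nbhs.
  (* Half of [e], because two points of a box are compared through its rational centre. *)
  have [n] : exists n : nat, n.+1%:R^-1 < e / 2.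
    have e20 : 0 < e / 2 by rewrite divr_gt0.
    have [n _ /(_ n (leqnn _)) /= h] := near_infty_natSinv_lt (PosNum e20).
    by exists n.
  move=> ne; pose r : R := n.+1%:R^-1.
  have r0 : 0 < r by rewrite invr_gt0.
  have rr : forall z, z - r < z + r by move=> z; rewrite ltrD2l gtrN.
  have [q1 q1x] := rat_in_itvoo (rr x); have [q2 q2y] := rat_in_itvoo (rr y).
  have dq (z q : R) : q \in `]z - r, z + r[ -> `|q - z| < r.
    by rewrite in_itv /= -ltr_distlC distrC.
  move: (dq _ _ q1x) (dq _ _ q2y) => {}q1x {}q2y.
  exists (q1, q2, n) => //; rewrite /C; case: asboolP => [_|[]].
    by split; rewrite -ball_normE.
  move=> [u v] []; rewrite -!ball_normE /= => qu qv; apply: eU.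
  have tri (z q w : R) : `|q - z| < r -> `|q - w| < r -> `|z - w| < e.
    move=> zq qw; rewrite (le_lt_trans (ler_distD q _ _))// distrC.
    by rewrite (lt_trans (ltrD zq qw))// -mulr2n -mulr_natr -ltr_pdivlMr.
  by split; rewrite -ball_normE /=; [exact: tri q1x qu|exact: tri q2y qv].
apply: countable_bigcupT_measurable; first exact: countableP.
move=> q; rewrite /C; case: asboolP => // _.
by apply: measurableX; exact: measurable_ball.
Qed.

Lemma continuous_measurable2 (f : R * R -> R) :
  continuous f -> measurable_fun setT f.
Proof.
move=> cf; apply: (measurability _ (RGenOInfty.measurableE R)) => _ [_ [x ->] <-].
rewrite setTI; apply: open_measurable2.
by apply: open_comp => //; move=> ? _; exact: cf.
Qed.

Lemma ccontinuous_measurable2 (f : R * R -> R[i]) : ccontinuous f -> cmeasurable f.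
Proof. by move=> [f1 f2]; split; exact: continuous_measurable2. Qed.

Lemma ccontinuous_measurable (f : R -> R[i]) : ccontinuous f -> cmeasurable f.
Proof. by move=> [f1 f2]; split; exact: continuous_measurable_fun. Qed.

End PlaneMeasurable.

Section PlaneFubini.
Context {R : realType}.
Local Notation mu := (@lebesgue_measure R).
Local Notation leb2 := (@leb2 R).

Lemma leb2_fubini1 (f : R * R -> R[i]) : cintegrable leb2 f ->
  cintegrable mu (fun x : R => cintegral mu (fun y : R => f (x, y))) /\
  cintegral leb2 f = cintegral mu (fun x : R => cintegral mu (fun y : R => f (x, y))).
Proof. exact: cfubini1. Qed.

Lemma leb2_fubini2 (f : R * R -> R[i]) : cintegrable leb2 f ->
  cintegrable mu (fun y : R => cintegral mu (fun x : R => f (x, y))) /\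
  cintegral leb2 f = cintegral mu (fun y : R => cintegral mu (fun x : R => f (x, y))).
Proof. exact: cfubini2. Qed.

Lemma leb2_fubini (f : R * R -> R[i]) : cintegrable leb2 f ->
  cintegral mu (fun x : R => cintegral mu (fun y : R => f (x, y))) =
  cintegral mu (fun y : R => cintegral mu (fun x : R => f (x, y))).
Proof. by move=> fi; rewrite -(leb2_fubini1 fi).2 (leb2_fubini2 fi).2. Qed.

Lemma leb2_le_cintegrable (f : R * R -> R[i]) (g k : R -> R) :
  cmeasurable f -> mu.-integrable setT (EFin \o g) -> mu.-integrable setT (EFin \o k) ->
  (forall x y, cmod (f (x, y)) <= g x * k y) -> cintegrable leb2 f.
Proof. exact: (@le_cintegrable_prod _ _ _ _ _ mu mu f g k). Qed.

Lemma leb2_tonelli1 (f : R * R -> R) : measurable_fun setT f -> (forall p, 0 <= f p) ->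
  (\int[leb2]_p (f p)%:E = \int[mu]_x \int[mu]_y (f (x, y))%:E)%E.
Proof.
move=> mf f0; apply: (@fubini_tonelli1 _ _ _ _ _ mu mu (EFin \o f)) => //; exact/measurable_EFinP.
Qed.

Lemma leb2_tonelli2 (f : R * R -> R) : measurable_fun setT f -> (forall p, 0 <= f p) ->
  (\int[leb2]_p (f p)%:E = \int[mu]_y \int[mu]_x (f (x, y))%:E)%E.
Proof.
move=> mf f0; apply: (@fubini_tonelli2 _ _ _ _ _ mu mu (EFin \o f)) => //; exact/measurable_EFinP.
Qed.

Lemma cmeasurable_leb1 (f : R * R -> R[i]) : cmeasurable f ->
  cmeasurable (fun x : R => cintegral mu (fun y : R => f (x, y))).
Proof. exact: (@cmeasurable_cfubini1 _ _ _ _ _ mu f). Qed.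

Lemma cmeasurable_leb2 (f : R * R -> R[i]) : cmeasurable f ->
  cmeasurable (fun y : R => cintegral mu (fun x : R => f (x, y))).
Proof. exact: (@cmeasurable_cfubini2 _ _ _ _ _ mu f). Qed.

End PlaneFubini.

(** * Derivatives of complex functions of a real variable *)

Section CDerive.
Context {R : realType}.
Implicit Types (f g : R -> R[i]) (x : R) (a b z : R[i]).

Definition is_cderive f x a : Prop :=
  is_derive x 1 (fun t => complex.Re (f t)) (complex.Re a) /\
  is_derive x 1 (fun t => complex.Im (f t)) (complex.Im a).

Lemma is_cderive_eq f x a b : is_cderive f x a -> a = b -> is_cderive f x b.
Proof. by move=> + <-. Qed.

Lemma is_cderive_cst z x : is_cderive (fun=> z) x 0.
Proof. by split; exact: is_derive_cst. Qed.

Lemma is_cderive_real (f : R -> R) x (d : R) :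
  is_derive x 1 f d -> is_cderive (fun t => (f t)%:C) x d%:C.
Proof. by move=> fd; split => //=; exact: is_derive_cst. Qed.

Lemma is_cderiveD f g x a b : is_cderive f x a -> is_cderive g x b ->
  is_cderive (fun t => f t + g t) x (a + b).
Proof.
move=> [f1 f2] [g1 g2]; split; rewrite cpartE.
  by under eq_fun do rewrite ReD; exact: is_deriveD.
by under eq_fun do rewrite ImD; exact: is_deriveD.
Qed.

Lemma is_cderiveM f g x a b : is_cderive f x a -> is_cderive g x b ->
  is_cderive (fun t => f t * g t) x (f x * b + a * g x).
Proof.
move=> [f1 f2] [g1 g2]; split; rewrite !cpartE.
  under eq_fun do rewrite ReM.
  apply: (is_derive_eq (is_deriveB (is_deriveM f1 g1) (is_deriveM f2 g2))).
  by rewrite /GRing.scale /=; ring.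
under eq_fun do rewrite ImM.
apply: (is_derive_eq (is_deriveD (is_deriveM f1 g2) (is_deriveM f2 g1))).
by rewrite /GRing.scale /=; ring.
Qed.

Lemma is_cderiveZ z f x a : is_cderive f x a -> is_cderive (fun t => z * f t) x (z * a).
Proof.
move=> fa; apply: (is_cderive_eq (is_cderiveM (is_cderive_cst z x) fa)).
by rewrite mul0r addr0.
Qed.

Lemma is_cderiveX f n x a : is_cderive f x a ->
  is_cderive (fun t => f t ^+ n) x (n%:R * f x ^+ n.-1 * a).
Proof.
move=> fa; elim: n => [|n ih].
  by under eq_fun do rewrite expr0; rewrite !mul0r; exact: is_cderive_cst.
under eq_fun do rewrite exprS.
apply: (is_cderive_eq (is_cderiveM fa ih)) => /=.
case: n {ih} => [|n]; first by rewrite !mul0r mulr0 add0r expr0 !mul1r mulr1.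
by rewrite /= -natr1 exprS; ring.
Qed.

Lemma is_cderive_cexp f x a : is_cderive f x a ->
  is_cderive (fun t => cexp (f t)) x (cexp (f x) * a).
Proof.
move=> [f1 f2].
have e1 := is_derive1_comp (is_derive_expR (complex.Re (f x))) f1.
have c1 := is_derive1_comp (is_derive_cos (complex.Im (f x))) f2.
have s1 := is_derive1_comp (is_derive_sin (complex.Im (f x))) f2.
have h : is_cderive (fun t => (expR (complex.Re (f t)))%:C) x
    (expR (complex.Re (f x)) * complex.Re a)%:C by exact: is_cderive_real.
have k : is_cderive (fun t => cis (complex.Im (f t))) x
  ((- sin (complex.Im (f x)) * complex.Im a) +i* (cos (complex.Im (f x)) * complex.Im a)) by split.
apply: (is_cderive_eq (is_cderiveM h k)).
by rewrite /cexp /cis; apply: complexP; rewrite !cpartE /=; ring.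
Qed.

(** Writing the inverse as the conjugate times [1 / N], with [N] the squared modulus, reduces the
    rule to products and one real quotient. *)
Lemma is_cderiveV f x a : f x != 0 -> is_cderive f x a ->
  is_cderive (fun t => (f t)^-1) x (- a / f x ^+ 2).
Proof.
move=> fx0 [f1 f2].
pose N t := complex.Re (f t) ^+ 2 + complex.Im (f t) ^+ 2.
have N0 : N x != 0.
  by rewrite /N -cmod_sqr expf_neq0// cmod_eq0.
have dN : is_derive x 1 N (2 * (complex.Re (f x) * complex.Re a + complex.Im (f x) * complex.Im a)).
  apply: (is_derive_eq (is_deriveD (@is_deriveX _ _ _ 2 _ _ _ f1) (@is_deriveX _ _ _ 2 _ _ _ f2))).
  by rewrite /GRing.scale /=; ring.
have dNV := is_deriveV N0 dN.
have h : is_cderive (fun t => ((N t)^-1)%:C) x (- N x ^- 2 *: (2 * (complex.Re (f x) * complex.Re a + complex.Im (f x) * complex.Im a)))%:C.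
  exact: is_cderive_real.
have k : is_cderive (fun t => conjc (f t)) x (conjc a).
  split; rewrite ?conjc_ReE ?conjc_ImE.
    by under eq_fun do rewrite conjc_ReE.
  by under eq_fun do rewrite conjc_ImE; exact: is_deriveN.
have e : (fun t => (f t)^-1) = (fun t => conjc (f t) * ((N t)^-1)%:C).
  apply/funext => t; rewrite /N; case: (f t) => u v.
  by apply: complexP; rewrite !cpartE /=; ring.
rewrite e; apply: (is_cderive_eq (is_cderiveM k h)).
have e2 : (f x ^+ 2)^-1 = (conjc (f x) * ((N x)^-1)%:C) ^+ 2.
  by rewrite -exprVn; congr (_ ^+ 2); exact: (congr1 (fun g => g x) e).
rewrite e2 /GRing.scale /=.
(* Clearing the denominator leaves a polynomial identity in the parts of [f x] and [a]. *)
apply: (mulIf (_ : (N x)%:C ^+ 2 != 0)).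
  by rewrite expf_neq0//; apply/eqP => /complexI/eqP; exact/negP.
have NV : ((N x)^-1)%:C * (N x)%:C = 1 by rewrite -rmorphM mulVf.
have NV2 : (N x ^- 2)%:C * (N x)%:C ^+ 2 = 1.
  by rewrite -rmorphXn -rmorphM mulVf// expf_neq0.
rewrite mulrDl rmorphM rmorphN.
rewrite [X in X + _](_ : _ = - 2 * (complex.Re (f x) * complex.Re a + complex.Im (f x) * complex.Im a)%:C * conjc (f x) *
  ((N x ^- 2)%:C * (N x)%:C ^+ 2)); last by rewrite rmorphM /=; ring.
rewrite [X in _ + X](_ : _ = conjc a * (N x)%:C *
  (((N x)^-1)%:C * (N x)%:C)); last by ring.
rewrite [RHS](_ : _ = - a * conjc (f x) ^+ 2 * (((N x)^-1)%:C * (N x)%:C) ^+ 2); last by ring.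
rewrite NV NV2 expr1n /N; case: (f x) => u v; case: a {f1 f2 dN dNV h k} => c d.
by apply: complexP; rewrite !cpartE /=; ring.
Qed.

Lemma is_cderive_cvg f x a : is_cderive f x a -> {for x, continuous (fun t => complex.Re (f t))} /\
  {for x, continuous (fun t => complex.Im (f t))}.
Proof.
move=> [[f1 _] [f2 _]].
by split; apply: differentiable_continuous; exact/derivable1_diffP.
Qed.

Lemma is_cderive_ccontinuous f (f' : R -> R[i]) :
  (forall x, is_cderive f x (f' x)) -> ccontinuous f.
Proof. by move=> df; split => x; have [] := is_cderive_cvg (df x). Qed.

End CDerive.

(** * The fundamental theorem of calculus on lines and rays *)

Section FTC.
Context {R : realType}.
Local Notation mu := (@lebesgue_measure R).

Lemma RFTC_itv (F f : R -> R) (a b : R) : a < b ->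
  (forall x : R, is_derive x (1 : R) F (f x)) -> continuous f ->
  \int[mu]_(x in `[a, b]) f x = F b - F a.
Proof.
move=> ab dF cf.
have cF : continuous F.
  by move=> x; apply: differentiable_continuous; apply/derivable1_diffP; have [] := dF x.
rewrite /Rintegral (@continuous_FTC2 _ f F)//.
- exact: continuous_subspaceT.
- split.
  + by move=> x _; have [] := dF x.
  + by apply: cvg_at_right_filter; exact: cF.
  + by apply: cvg_at_left_filter; exact: cF.
- by move=> x _; rewrite derive1E; have [_ ->] := dF x.
Qed.

(** The domain [p] is exhausted by the intervals [[a n, b n]], and the restrictions converge
    dominatedly, with the absolute value of the integrand as majorant. The line and the closed rays
    are all instances. *)
Lemma RFTC_lim (F f : R -> R) (p : R -> bool) (a b : nat -> R) (l : R) :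
  measurable_fun setT p ->
  mu.-integrable setT (fun x => (if p x then f x else 0)%:E) ->
  (forall x : R, is_derive x (1 : R) F (f x)) -> continuous f ->
  (forall n, a n < b n) -> (forall n x, a n <= x <= b n -> p x) ->
  (forall x, p x -> \forall n \near \oo, a n <= x <= b n) ->
  F (b n) - F (a n) @[n --> \oo] --> l ->
  \int[mu]_x (if p x then f x else 0) = l.
Proof.
move=> mp fi dF cf ab sub near Fl.
have mf := continuous_measurable_fun cf.
pose fn n x := (f \_ `[a n, b n]) x.
have e n : \int[mu]_x fn n x = F (b n) - F (a n).
  by rewrite -(RFTC_itv (ab n) dF cf) [RHS]Rintegral_mkcond.
have h : \int[mu]_x fn n x @[n --> \oo] --> \int[mu]_x (if p x then f x else 0).
  apply: fine_cvg; rewrite fineK; last exact: integrable_fin_num.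
  apply: (@dominated_cvg _ _ _ mu setT measurableT (fun n x => (fn n x)%:E)
    (fun x => (if p x then f x else 0)%:E) (fun x => `|if p x then f x else 0|%:E)) => //.
  - move=> n; apply/measurable_EFinP; rewrite /fn.
    apply: (measurable_restrictT f _).1 => //; exact: measurable_funTS.
  - move=> x _; apply: cvg_near_cst; case: ifPn => px.
      near=> n; congr EFin; rewrite /fn patchE ifT// inE /= in_itv /=.
      by near: n; exact: near.
    apply: nearW => n; rewrite /fn patchE; case: ifPn => //; rewrite inE /= in_itv /=.
    by move=> /sub; rewrite (negbTE px).
  - exact: integrable_norm.
  - move=> n x _; rewrite lee_fin /fn patchE; case: ifPn; last by rewrite normr0.
    by rewrite inE /= in_itv /= => /sub ->.
rewrite (_ : (fun n => _) = (fun n => F (b n) - F (a n))) in h; last exact/funext.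
exact: (cvg_unique _ h Fl).
Unshelve. all: by end_near. Qed.

Lemma cFTC_lim (F f : R -> R[i]) (p : R -> bool) (a b : nat -> R) (l : R[i]) :
  measurable_fun setT p ->
  cintegrable mu (fun x => if p x then f x else 0) ->
  (forall x, is_cderive F x (f x)) -> ccontinuous f ->
  (forall n, a n < b n) -> (forall n x, a n <= x <= b n -> p x) ->
  (forall x, p x -> \forall n \near \oo, a n <= x <= b n) ->
  ccvg \oo (fun n => F (b n) - F (a n)) l ->
  cintegral mu (fun x => if p x then f x else 0) = l.
Proof.
move=> mp [i1 i2] dF [c1 c2] ab sub near /ccvgP[l1 l2].
have e1 : (fun x => complex.Re (if p x then f x else 0)) =
   (fun x => if p x then complex.Re (f x) else 0) by apply/funext => x; case: ifP.
have e2 : (fun x => complex.Im (if p x then f x else 0)) =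
   (fun x => if p x then complex.Im (f x) else 0) by apply/funext => x; case: ifP.
apply: complexP => /=.
  rewrite e1; apply: (RFTC_lim (F := fun x => complex.Re (F x)) (a := a) (b := b)) => //.
  - by apply: eq_integrable i1 => // x _; case: ifP.
  - by move=> x; have [] := dF x.
  - by under eq_fun do rewrite -ReB.
rewrite e2; apply: (RFTC_lim (F := fun x => complex.Im (F x)) (a := a) (b := b)) => //.
- by apply: eq_integrable i2 => // x _; case: ifP.
- by move=> x; have [] := dF x.
- by under eq_fun do rewrite -ImB.
Qed.

Lemma near_natr_ge (x : R) : \forall n \near \oo, x <= n%:R.
Proof.
exists (Num.bound `|x|) => // n /= xn.
rewrite (le_trans (ler_norm x))// (le_trans (ltW (archi_boundP (normr_ge0 x))))//.
by rewrite ler_nat.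
Qed.

Lemma cFTC_line (F f : R -> R[i]) (l : R[i]) :
  cintegrable mu f -> (forall x, is_cderive F x (f x)) -> ccontinuous f ->
  ccvg \oo (fun n => F n.+1%:R - F (- n.+1%:R)) l -> cintegral mu f = l.
Proof.
move=> fi dF cf Fl.
apply: (@cFTC_lim F f xpredT (fun n => - n.+1%:R) (fun n => n.+1%:R)) => //.
  by move=> n; rewrite gtrN.
move=> x _; near=> n; rewrite -ler_norml.
have : `|x| <= n%:R by near: n; exact: near_natr_ge.
by move=> /le_trans; apply; rewrite ler_nat.
Unshelve. all: by end_near. Qed.

Lemma cFTC_ray (F f : R -> R[i]) (l : R[i]) :
  cintegrable mu (fun x => if 0 <= x then f x else 0) ->
  (forall x, is_cderive F x (f x)) -> ccontinuous f ->
  ccvg \oo (fun n => F n.+1%:R) l ->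
  cintegral mu (fun x => if 0 <= x then f x else 0) = l - F 0.
Proof.
move=> fi dF cf Fl.
apply: (@cFTC_lim F f (fun x => 0 <= x) (fun=> 0) (fun n => n.+1%:R)) => //.
- exact: measurable_fun_ler.
- by move=> n x /andP[].
- move=> x x0; near=> n; rewrite x0 /=.
  have : `|x| <= n%:R by near: n; exact: near_natr_ge.
  rewrite ger0_norm// => /le_trans; apply; rewrite ler_nat//.
- by apply: ccvgD => //; exact: ccvg_cst.
Unshelve. all: by end_near. Qed.

Lemma cFTC_rayN (F f : R -> R[i]) (l : R[i]) :
  cintegrable mu (fun x => if x <= 0 then f x else 0) ->
  (forall x, is_cderive F x (f x)) -> ccontinuous f ->
  ccvg \oo (fun n => F (- n.+1%:R)) l ->
  cintegral mu (fun x => if x <= 0 then f x else 0) = F 0 - l.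
Proof.
move=> fi dF cf Fl.
apply: (@cFTC_lim F f (fun x => x <= 0) (fun n => - n.+1%:R) (fun=> 0)) => //.
- exact: measurable_fun_ler.
- by move=> n x /andP[].
- move=> x x0; near=> n; rewrite x0 andbT.
  have : `|x| <= n%:R by near: n; exact: near_natr_ge.
  by rewrite ler0_norm// => h; rewrite lerNl (le_trans h)// ler_nat.
- apply: ccvgD; first exact: ccvg_cst.
  exact: ccvgN.
Unshelve. all: by end_near. Qed.

(** The end point 0 is a null set, so the open ray is reduced to the closed one. *)
Lemma cFTC_rayNo (F f : R -> R[i]) (l : R[i]) :
  cintegrable mu (fun x => if x < 0 then f x else 0) ->
  (forall x, is_cderive F x (f x)) -> ccontinuous f ->
  ccvg \oo (fun n => F (- n.+1%:R)) l ->
  cintegral mu (fun x => if x < 0 then f x else 0) = F 0 - l.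
Proof.
move=> fi dF cf Fl.
have mf : cmeasurable f by case: cf => c1 c2; split; exact: continuous_measurable_fun.
have mf0 : cmeasurable (fun x : R => if x <= 0 then f x else 0).
  by apply: cmeasurable_if => //; exact: measurable_fun_ler.
have ae : {ae mu, forall x, (if x < 0 then f x else 0) = (if x <= 0 then f x else 0)}.
  exists [set 0]; split => //; first exact: lebesgue_measure_set1.
  move=> x /= xN; apply/eqP; apply: contra_notT xN => x0.
  by rewrite (lt_neqAle x) x0.
have mf1 := cintegrable_measurable fi.
rewrite (ae_eq_cintegral mf1 mf0 ae); apply: cFTC_rayN => //.
have /cintegrableP[_ foo] := fi; apply/cintegrableP; split => //.
rewrite (_ : integral _ _ _ = \int[mu]_x (cmod (if x < 0 then f x else 0))%:E)%E//.
apply: ae_eq_integral => //; [exact/measurable_EFinP/measurable_cmod..|].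
case: ae => N [mN N0 sN]; exists N; split => // x /= h; apply: sN => /= e.
by apply: h => _; rewrite e.
Qed.

End FTC.

(** * Oscillatory integrals as functions of their phase *)

Section Osc.
Context {R : realType} d (T : measurableType d).
Variable mu : {measure set T -> \bar R}.

(** The radius [r] depends on [U] and [w] but not on the phases: it comes from dominated convergence
    to 0 of [min(2, 2 w / (n + 1)) |U|]. The minimum with 2 makes integrability of [U] alone
    sufficient. *)
Lemma cis_integral_modulus (U : T -> R[i]) (w : T -> R) :
  cintegrable mu U -> measurable_fun setT w -> (forall k, 0 <= w k) ->
  forall e : R, 0 < e -> exists2 r : R, 0 < r & forall th1 th2 : T -> R,
    measurable_fun setT th1 -> measurable_fun setT th2 ->
    (forall k, `|th1 k - th2 k| <= r * w k) ->
    cmod (cintegral mu (fun k => cis (th1 k) * U k) -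
          cintegral mu (fun k => cis (th2 k) * U k)) < e.
Proof.
move=> iU mw w0 e e0.
have mU := cintegrable_measurable iU.
pose g (n : nat) k : R[i] := (Num.min 2 (2 * (n.+1%:R^-1 * w k)) * cmod (U k))%:C.
have mg n : measurable_fun setT (fun k => Num.min 2 (2 * (n.+1%:R^-1 * w k)) * cmod (U k)).
  apply: measurable_funM; last exact: measurable_cmod.
  apply: measurable_minr => //; apply: measurable_funM => //.
  exact: measurable_funM.
have g0 n k : 0 <= Num.min 2 (2 * (n.+1%:R^-1 * w k)) * cmod (U k).
  by rewrite mulr_ge0 ?cmod_ge0// le_min ler0n /= mulr_ge0// mulr_ge0// invr_ge0.
have gle n k : cmod (g n k) <= 2 * cmod (U k).
  by rewrite cmodR ger0_norm// ler_wpM2r ?cmod_ge0// ge_min lexx.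
have i2 : mu.-integrable setT (fun k => (2 * cmod (U k))%:E).
  by under eq_fun do rewrite EFinM; apply: integrableZl => //; exact: cintegrable_cmod.
have [] := @cdominated_cvg _ _ _ mu g (fun=> 0) (fun k => 2 * cmod (U k)) _ _ _ i2 gle.
- by move=> n; exact: cmeasurable_real.
- exact: cmeasurable_cst.
- move=> k; apply: (@ccvg_le _ _ _ _ _ _ (fun n => n.+1%:R^-1 * (2 * w k * cmod (U k)))).
    apply: nearW => n; rewrite subr0 cmodR ger0_norm// [leRHS]mulrA ler_wpM2r ?cmod_ge0//.
    by rewrite ge_min; apply/orP; right; rewrite mulrCA.
  rewrite -(mul0r (2 * w k * cmod (U k))); apply: cvgM; last exact: cvg_cst.
  exact: cvg_harmonic.
move=> _; rewrite cintegral0 /ccvg; under eq_fun do rewrite subr0.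
move=> /cvgrPdist_lt/(_ (e / 4)); rewrite divr_gt0// => /(_ isT)[N _ /(_ N (leqnn _))] /=.
rewrite sub0r normrN ger0_norm ?cmod_ge0// => gN.
exists N.+1%:R^-1 => [|th1 th2 m1 m2 th12]; first by rewrite invr_gt0.
have c1 th : measurable_fun setT th -> cintegrable mu (fun k => cis (th k) * U k).
  move=> mth; apply: (@cintegrableMl _ _ _ _ _ _ 1) => //; first exact: cmeasurable_cis.
  by move=> k; rewrite cmod_cis.
rewrite -cintegralB; [|exact: c1|exact: c1].
have ig : mu.-integrable setT (fun k => (Num.min 2 (2 * (N.+1%:R^-1 * w k)) * cmod (U k))%:E).
  apply: (le_integrable measurableT _ _ i2); first exact/measurable_EFinP.
  move=> k _; rewrite lee_fin (ger0_norm (g0 _ _)).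
  by rewrite (le_trans _ (ler_norm _))//; have := gle N k; rewrite cmodR ger0_norm.
apply: (@le_lt_trans _ _ (2 * \int[mu]_k (Num.min 2 (2 * (N.+1%:R^-1 * w k)) * cmod (U k)))).
  apply: (@cmod_cintegral_leR _ _ _ mu _ (fun k => Num.min 2 (2 * (N.+1%:R^-1 * w k)) * cmod (U k))) => //.
  - by apply: cmeasurableB; apply: cmeasurableM => //; exact: cmeasurable_cis.
  - move=> k; rewrite -mulrBl cmodM ler_wpM2r ?cmod_ge0// le_min; apply/andP; split.
      by rewrite (le_trans (cmodB_le _ _))// !cmod_cis.
    by rewrite (le_trans (cis_lip _ _))// ler_wpM2l.
  - by rewrite /Rintegral fineK//; exact: integrable_fin_num.
have -> : \int[mu]_k (Num.min 2 (2 * (N.+1%:R^-1 * w k)) * cmod (U k)) =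
  complex.Re (cintegral mu (g N)) by [].
have := le_lt_trans (le_trans (ler_norm _) (norm_Re_le _)) gN.
lra.
Qed.

Lemma cis_integral_ccontinuous (V : pseudoMetricNormedZmodType R) (th : V -> T -> R)
    (U : T -> R[i]) (w : T -> R) :
  cintegrable mu U -> measurable_fun setT w -> (forall k, 0 <= w k) ->
  (forall p, measurable_fun setT (th p)) ->
  (forall p q k, `|th p k - th q k| <= `|p - q| * w k) ->
  ccontinuous (fun p => cintegral mu (fun k => cis (th p k) * U k)).
Proof.
move=> iU mw w0 mth thw.
suff h p : ccvg (nbhs p) (fun p => cintegral mu (fun k => cis (th p k) * U k))
    (cintegral mu (fun k => cis (th p k) * U k)).
  by split => p; have /ccvgP[] := h p.
apply/cvgrPdist_lt => e e0.
have [r r0 hr] := cis_integral_modulus iU mw w0 e0.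
have B : \forall q \near p, `|p - q| <= r.
  by apply/nbhs_normP; exists r => // q /= /ltW.
apply: filterS B => q pq; rewrite sub0r normrN ger0_norm ?cmod_ge0//.
apply: hr => // k; rewrite distrC (le_trans (thw _ _ _))// ler_wpM2r//.
Qed.

End Osc.

(** * Real majorants and the Japanese bracket *)

Section RealIntegrals.
Context {R : realType}.
Local Notation mu := (@lebesgue_measure R).

Lemma is_derive_continuous (F f : R -> R) :
  (forall x : R, is_derive x (1 : R) F (f x)) -> continuous F.
Proof.
move=> dF x; apply: differentiable_continuous; apply/derivable1_diffP.
by have [] := dF x.
Qed.

(** Monotone convergence over growing symmetric intervals: a bounded primitive bounds the integral,
    so that integrability is a consequence and not an assumption. *)
Lemma ge0_FTC_bound (F f : R -> R) (M : R) :
  continuous f -> (forall x, 0 <= f x) ->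
  (forall x : R, is_derive x (1 : R) F (f x)) -> (forall x, `|F x| <= M) ->
  (\int[mu]_x (f x)%:E <= (2 * M)%:E)%E.
Proof.
move=> cf f0 dF FM.
have mf : measurable_fun setT f := continuous_measurable_fun cf.
pose I (n : nat) : set R := [set` `[- n.+1%:R, n.+1%:R]].
have IT : \bigcup_n I n = setT.
  apply/seteqP; split => // x _.
  have [N _ /(_ N (leqnn _)) /= h] := near_natr_ge `|x|.
  by exists N => //; rewrite /I /= in_itv /= -ler_norml (le_trans h)// ler_nat.
have h := @ge0_nondecreasing_set_cvg_integral _ (measurableTypeR R) _ I (EFin \o f) mu.
have {}h : (\int[mu]_(x in I n) (f x)%:E)%E @[n --> \oo] --> (\int[mu]_x (f x)%:E)%E.
  rewrite IT in h; apply: h.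
  - move=> m n mn; apply/subsetPset => x; rewrite /I /= !in_itv /= -!ler_norml.
    by move=> /le_trans; apply; rewrite ler_nat.
  - by move=> n; exact: measurable_itv.
  - by move=> n; apply/measurable_EFinP; exact: measurable_funTS.
  - by move=> n x _; rewrite lee_fin.
have cF := is_derive_continuous dF.
apply: (cvge_to_le h); apply: nearW => n.
have nn : - n.+1%:R < n.+1%:R :> R by rewrite gtrN.
rewrite /I (@continuous_FTC2 _ f F)//.
- rewrite -EFinB lee_fin mulr_natl mulr2n.
  by rewrite (le_trans (ler_norm _))// (le_trans (ler_normB _ _))// lerD.
- exact: continuous_subspaceT.
- split.
  + by move=> x _; have [] := dF x.
  + by apply: cvg_at_right_filter; exact: cF.
  + by apply: cvg_at_left_filter; exact: cF.
- by move=> x _; rewrite derive1E; have [_ ->] := dF x.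
Qed.

Lemma integrable_le_bound (f g : R -> R) (M : R) : measurable_fun setT f ->
  (forall x, `|f x| <= g x) -> measurable_fun setT g ->
  (\int[mu]_x (g x)%:E <= M%:E)%E -> mu.-integrable setT (EFin \o f).
Proof.
move=> mf fg mg gM; apply/integrableP; split; first exact/measurable_EFinP.
apply: (@le_lt_trans _ _ (\int[mu]_x (g x)%:E)%E).
  apply: ge0_le_integral => //; first exact/measurable_EFinP/measurableT_comp.
    exact/measurable_EFinP.
  by move=> x _; rewrite lee_fin.
by apply: (le_lt_trans gM); rewrite ltry.
Qed.

Lemma japE (x : R) : jap x ^+ 2 = 1 + x ^+ 2.
Proof. by rewrite sqr_sqrtr// addr_ge0// sqr_ge0. Qed.
Lemma jap_ge1 (x : R) : 1 <= jap x.
Proof. by rewrite -sqrtr1 ler_wsqrtr// lerDl sqr_ge0. Qed.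
Lemma jap_gt0 (x : R) : 0 < jap x. Proof. exact: lt_le_trans (jap_ge1 x). Qed.
Lemma jap_ge0 (x : R) : 0 <= jap x. Proof. exact: ltW (jap_gt0 x). Qed.
Lemma norm_le_jap (x : R) : `|x| <= jap x.
Proof. by rewrite -sqrtr_sqr ler_wsqrtr// lerDr. Qed.
Lemma jap_le1D (x : R) : jap x <= 1 + `|x|.
Proof.
rewrite -ler_sqr ?nnegrE ?jap_ge0 ?addr_ge0// japE sqrrD real_normK ?num_real//.
by rewrite expr1n mul1r -addrA lerD2l lerDr mulrn_wge0.
Qed.
Lemma japN (x : R) : jap (- x) = jap x. Proof. by rewrite /jap sqrrN. Qed.

Lemma is_derive_inv1sq (a x : R) : a != 0 ->
  is_derive x (1 : R) (fun x => atan (a * x) / a) (1 + (a * x) ^+ 2)^-1.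
Proof.
move=> a0; have d1 : is_derive x (1 : R) (fun x => a * x) a.
  apply: (is_derive_eq (is_deriveZ a (is_derive_id x (1 : R)))).
  by rewrite /GRing.scale /= mulr1.
have d2 := is_derive1_comp (is_derive1_atan (a * x)) d1.
have d3 := is_deriveZ a^-1 d2.
rewrite (_ : (fun x => _) = a^-1 \*: (atan \o (fun x : R => a * x))); last first.
  by apply/funext => y /=; rewrite mulrC.
apply: (is_derive_eq d3); rewrite /GRing.scale /=; rewrite mulrC mulfK//.
Qed.

Lemma norm_atan_le (x : R) : `|atan x| <= pi / 2.
Proof. by rewrite ler_norml ltW ?atan_gtNpi2// ltW// atan_ltpi2. Qed.

Lemma inv1sq_continuous (a : R) : continuous (fun x : R => (1 + (a * x) ^+ 2)^-1).
Proof.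
move=> x; apply: cvgV; first by rewrite gt_eqF// ltr_pwDl// sqr_ge0.
apply: cvgD; first exact: cvg_cst.
by apply: (@cvg_comp _ _ _ (fun x : R => a * x) (fun x => x ^+ 2));
  [apply: cvgM; [exact: cvg_cst|exact: cvg_id]|exact: exprn_continuous].
Qed.

Lemma inv1sq_ge0 (a x : R) : 0 <= (1 + (a * x) ^+ 2)^-1.
Proof. by rewrite invr_ge0 addr_ge0// sqr_ge0. Qed.

Lemma inv1sq_integral (a : R) : 0 < a ->
  (\int[mu]_x ((1 + (a * x) ^+ 2)^-1)%:E <= (pi / a)%:E)%E.
Proof.
move=> a0; rewrite (_ : pi / a = 2 * (pi / 2 / a)); last by field; rewrite gt_eqF.
apply: (ge0_FTC_bound (@inv1sq_continuous a) (@inv1sq_ge0 a)).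
  by move=> x; apply: is_derive_inv1sq; rewrite gt_eqF.
have ai0 : 0 <= a^-1 by rewrite invr_ge0 ltW.
move=> x; rewrite normrM (ger0_norm ai0).
by rewrite ler_wpM2r// norm_atan_le.
Qed.

Lemma inv1sq_integrable (a : R) : 0 < a ->
  mu.-integrable setT (EFin \o (fun x : R => (1 + (a * x) ^+ 2)^-1)).
Proof.
move=> a0; have mc := continuous_measurable_fun (@inv1sq_continuous a).
apply: (integrable_le_bound mc _ mc (inv1sq_integral a0)) => x.
by rewrite ger0_norm// inv1sq_ge0.
Qed.

(** The terms of orders [k] and [k + 2] of the exponential series bound [y ^ k] and [y ^ (k + 2)] by
    factorials times [exp y]; the two bounds are added. *)
Lemma pow_expRN_le (y : R) (k : nat) : 0 <= y ->
  y ^+ k * expR (- y) <= (k`! + k.+2`!)%:R / (1 + y ^+ 2).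
Proof.
move=> y0; have p j : y ^+ j <= j`!%:R * expR y.
  case: j => [|j]; first by rewrite expr0 mul1r -expR0 ler_expR.
  rewrite mulrC -ler_pdivrMr ?ltr0n ?fact_gt0//.
  by rewrite (le_trans _ (expR_ge1Dxn j y0))// lerDr.
rewrite ler_pdivlMr ?ltr_pwDl ?sqr_ge0// expRN mulrAC.
rewrite ler_pdivrMr ?expR_gt0// mulrDr mulr1 -exprD addn2 natrD mulrDl.
by rewrite lerD.
Qed.

Lemma expRN_le1 (y : R) : 0 <= y -> expR (- y) <= 1.
Proof. by move=> y0; rewrite -expR0 ler_expR oppr_le0. Qed.

End RealIntegrals.

(** * Exponential integrals on half-lines *)

Section OneSided.
Context {R : realType}.
Local Notation mu := (@lebesgue_measure R).

Lemma is_cderive_scale (z : R[i]) (x : R) :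
  is_cderive (fun x : R => z * x%:C) x z.
Proof.
apply: (is_cderive_eq (is_cderiveZ z (is_cderive_real (is_derive_id x (1 : R))))).
by rewrite mulr1.
Qed.

Lemma is_cderive_expl (z : R[i]) (x : R) :
  is_cderive (fun x : R => cexp (z * x%:C)) x (z * cexp (z * x%:C)).
Proof.
by apply: (is_cderive_eq (is_cderive_cexp (is_cderive_scale z x))); rewrite mulrC.
Qed.

Lemma is_cderive_polyexp (z : R[i]) k (x : R) :
  is_cderive (fun x : R => x%:C ^+ k * cexp (z * x%:C)) x
    (k%:R * x%:C ^+ k.-1 * cexp (z * x%:C) + z * (x%:C ^+ k * cexp (z * x%:C))).
Proof.
have h := is_cderiveX k (is_cderive_real (is_derive_id x (1 : R))).
apply: (is_cderive_eq (is_cderiveM h (is_cderive_expl z x))).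
by rewrite /= mulr1; ring.
Qed.

Lemma polyexp_ccontinuous (z : R[i]) k :
  ccontinuous (fun x : R => x%:C ^+ k * cexp (z * x%:C)).
Proof. exact: is_cderive_ccontinuous (is_cderive_polyexp z k). Qed.

Lemma polyexp_le (z : R[i]) k (x : R) : x <= 0 -> 0 < complex.Re z ->
  cmod (x%:C ^+ k * cexp (z * x%:C)) <=
  (k`! + k.+2`!)%:R * (complex.Re z) ^- k * (1 + (complex.Re z * x) ^+ 2)^-1.
Proof.
move=> x0 z0; rewrite cmodM cmodX cmodR cmod_cexp.
have -> : complex.Re (z * x%:C) = - (complex.Re z * `|x|).
  by rewrite cpartE /= ler0_norm//; ring.
have y0 : 0 <= complex.Re z * `|x| by rewrite mulr_ge0// ltW.
have := pow_expRN_le k y0; rewrite !exprMn real_normK ?num_real// => h.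
rewrite mulrAC ler_pdivlMr ?exprn_gt0// mulrAC [X in X * _]mulrC.
exact: h.
Qed.

Lemma polyexp_integrable (z : R[i]) k : 0 < complex.Re z ->
  cintegrable mu (fun x : R => if x < 0 then x%:C ^+ k * cexp (z * x%:C) else 0).
Proof.
move=> z0; have cf := polyexp_ccontinuous z k.
apply: (@le_cintegrable _ _ _ mu _ (fun x => (k`! + k.+2`!)%:R * (complex.Re z) ^- k * (1 + (complex.Re z * x) ^+ 2)^-1)).
- apply: cmeasurable_if; [exact: measurable_fun_ltr|exact: ccontinuous_measurable|exact: cmeasurable_cst].
- under eq_fun do rewrite EFinM.
  by apply: integrableZl => //; exact: inv1sq_integrable.
- move=> x; case: ifPn => [/ltW x0|_]; first exact: polyexp_le.
  by rewrite cmod0 !mulr_ge0// ?inv1sq_ge0// invr_ge0 exprn_ge0// ltW.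
Qed.

Lemma polyexp_cvg0 (z : R[i]) k : 0 < complex.Re z ->
  ccvg \oo (fun n : nat => (- n.+1%:R)%:C ^+ k * cexp (z * (- n.+1%:R)%:C)) 0.
Proof.
move=> z0; pose C := (k`! + k.+2`!)%:R * (complex.Re z) ^- k * (complex.Re z) ^- 2.
apply: (@ccvg_le _ _ _ _ _ _ (fun n => C * n.+1%:R^-1)); last first.
  by rewrite -(mulr0 C); apply: cvgM; [exact: cvg_cst|exact: cvg_harmonic].
apply: nearW => n; rewrite subr0.
have n0 : 0 < n.+1%:R :> R by [].
have nn : - n.+1%:R <= 0 :> R by rewrite oppr_le0 ltW.
rewrite (le_trans (polyexp_le k nn z0))//.
rewrite /C -[leRHS]mulrA ler_wpM2l//.
  by rewrite mulr_ge0// invr_ge0 exprn_ge0// ltW.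
rewrite -invfM lef_pV2 ?posrE ?mulr_gt0 ?exprn_gt0 ?ltr_pwDl ?sqr_ge0//.
rewrite mulrN sqrrN exprMn ler_wpDl// ler_wpM2l ?sqr_ge0//.
by rewrite expr2 ler_peMl ?ler1n// ltW.
Qed.

(** Induction on [k] by parts. The boundary term of [x ^ (k + 1) exp(z x)] vanishes both at 0 and at
    minus infinity. *)
Lemma polyexp_integral (z : R[i]) k : 0 < complex.Re z ->
  cintegral mu (fun x : R => if x < 0 then x%:C ^+ k * cexp (z * x%:C) else 0) =
  (-1) ^+ k * k`!%:R / z ^+ k.+1.
Proof.
move=> z0; have zn0 : z != 0 by apply: contraTneq z0 => ->; rewrite ltxx.
elim: k => [|k ih].
  pose F (x : R) := z^-1 * (x%:C ^+ 0 * cexp (z * x%:C)).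
  rewrite (@cFTC_rayNo _ F _ 0)//; first last.
  - by rewrite /F -(mulr0 z^-1); apply: ccvgZ; exact: polyexp_cvg0.
  - exact: polyexp_ccontinuous.
  - move=> x; apply: (is_cderive_eq (is_cderiveZ z^-1 (is_cderive_polyexp z 0 x))).
    by rewrite !mul0r add0r mulKf.
  - exact: polyexp_integrable.
  by rewrite /F mulr0 cexp0 subr0 expr0 !mulr1 expr1 mul1r.
(* The derivative of [x ^ (k + 1) exp(z x)] is solved for the term carrying the highest power. *)
have e : (fun x : R => if x < 0 then x%:C ^+ k.+1 * cexp (z * x%:C) else 0) =
  (fun x : R => z^-1 * (if x < 0 then (k.+1%:R * x%:C ^+ k.+1.-1 * cexp (z * x%:C) + z * (x%:C ^+ k.+1 * cexp (z * x%:C))) else 0)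
   - (k.+1%:R / z) * (if x < 0 then x%:C ^+ k * cexp (z * x%:C) else 0)).
  apply/funext => x; case: ifP => _; last by rewrite !mulr0 subr0.
  rewrite mulrDr mulKf//=; ring.
have i1 : cintegrable mu (fun x : R => if x < 0 then (k.+1%:R * x%:C ^+ k.+1.-1 * cexp (z * x%:C) + z * (x%:C ^+ k.+1 * cexp (z * x%:C))) else 0).
  have -> : (fun x : R => if x < 0 then (k.+1%:R * x%:C ^+ k.+1.-1 * cexp (z * x%:C) + z * (x%:C ^+ k.+1 * cexp (z * x%:C))) else 0) =
   (fun x => k.+1%:R * (if x < 0 then x%:C ^+ k * cexp (z * x%:C) else 0) + z * (if x < 0 then x%:C ^+ k.+1 * cexp (z * x%:C) else 0)).
    by apply/funext => x; case: ifP => _; rewrite ?mulr0 ?addr0//= !mulrA.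
  by apply: cintegrableD; apply: cintegrableZ; exact: polyexp_integrable.
rewrite e cintegralB; first last.
  - by apply: cintegrableZ; exact: polyexp_integrable.
  - exact: cintegrableZ.
rewrite cintegralZ// cintegralZ; last exact: polyexp_integrable.
rewrite ih (@cFTC_rayNo _ (fun x : R => x%:C ^+ k.+1 * cexp (z * x%:C)) _ 0)//; first last.
- exact: polyexp_cvg0.
- apply: is_cderive_ccontinuous => x; apply: is_cderiveD.
    have h := is_cderiveZ k.+1%:R (is_cderive_polyexp z k x).
    by apply: (is_cderive_eq (_ : is_cderive _ _ _)); [under eq_fun do rewrite -mulrA; exact: h|].
  exact: (is_cderiveZ z (is_cderive_polyexp z k.+1 x)).
- exact: is_cderive_polyexp.
rewrite exprS !mul0r subrr mulr0 sub0r factS natrM !exprS.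
by field; rewrite zn0 expf_neq0.
Qed.

Lemma cexp_ray_integral (z : R[i]) : complex.Re z < 0 ->
  cintegrable mu (fun x : R => if 0 <= x then cexp (z * x%:C) else 0) /\
  cintegral mu (fun x : R => if 0 <= x then cexp (z * x%:C) else 0) = - z^-1.
Proof.
move=> z0; have zn0 : z != 0 by apply: contraTneq z0 => ->; rewrite ltxx.
have cE : ccontinuous (fun x : R => cexp (z * x%:C)).
  exact: is_cderive_ccontinuous (is_cderive_expl z).
have z0' : 0 < - complex.Re z by rewrite oppr_gt0.
have ple (x : R) : 0 <= x -> cmod (cexp (z * x%:C)) <= 3 * (1 + (- complex.Re z * x) ^+ 2)^-1.
  move=> x0; rewrite cmod_cexp.
  have := @pow_expRN_le R (- complex.Re z * x) 0 (mulr_ge0 (ltW z0') x0).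
  rewrite expr0 mul1r (_ : - _ = complex.Re (z * x%:C)); last by rewrite cpartE /=; ring.
  by move=> /le_trans; apply.
have ii : cintegrable mu (fun x : R => if 0 <= x then cexp (z * x%:C) else 0).
  apply: (@le_cintegrable _ _ _ mu _ (fun x => 3 * (1 + (- complex.Re z * x) ^+ 2)^-1)).
  - apply: cmeasurable_if; [exact: measurable_fun_ler|exact: ccontinuous_measurable|exact: cmeasurable_cst].
  - under eq_fun do rewrite EFinM.
    by apply: integrableZl => //; exact: inv1sq_integrable.
  - move=> x; case: ifPn => [/ple//|_].
    by rewrite cmod0 !mulr_ge0// ?inv1sq_ge0.
split=> //; pose F (x : R) := z^-1 * cexp (z * x%:C).
rewrite (@cFTC_ray _ F _ 0)//.
- by rewrite /F mulr0 cexp0 mulr1 sub0r.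
- move=> x; apply: (is_cderive_eq (is_cderiveZ z^-1 (is_cderive_expl z x))).
  by rewrite mulKf.
- rewrite /F -(mulr0 z^-1); apply: ccvgZ.
  apply: (@ccvg_le _ _ _ _ _ _ (fun n => 3 * (complex.Re z) ^- 2 * n.+1%:R^-1)); last first.
    by rewrite -(mulr0 (3 * (complex.Re z) ^- 2)); apply: cvgM; [exact: cvg_cst|exact: cvg_harmonic].
  apply: nearW => n; rewrite subr0 (le_trans (ple _ _))// -mulrA ler_wpM2l// -invfM.
  have zz : 0 < complex.Re z ^+ 2 by rewrite exprn_even_gt0//= lt_eqF.
  have zn : 0 < complex.Re z ^+ 2 * n.+1%:R by rewrite mulr_gt0.
  rewrite lef_pV2 ?posrE ?ltr_pwDl ?sqr_ge0//.
  rewrite exprMn sqrrN ler_wpDl// ler_wpM2l ?sqr_ge0//.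
  by rewrite expr2 ler_peMl ?ler1n// ltW.
Qed.

End OneSided.

(** * Fourier transform and Schwartz functions *)

Section Inversion.
Context {R : realType}.
Local Notation mu := (@lebesgue_measure R).

Lemma fourier1E (f : R -> R[i]) (xi : R) :
  fourier1 f xi = cintegral mu (fun x => cis (- (x * xi)) * f x).
Proof. by apply: eq_cintegral => x; rewrite cexp_Ni. Qed.

Definition ifourier1 (U : R -> R[i]) (x : R) : R[i] :=
  cintegral mu (fun xi => cis (x * xi) * U xi).

(** Equal to [2 pi] times the Poisson kernel of the half-plane at height [e]; it is the transform of
    [exp(- e |xi|)]. *)
Definition poisson (e u : R) : R := 2 * e / (e ^+ 2 + u ^+ 2).

Lemma measurable_expRN (e : R) : measurable_fun setT (fun xi : R => expR (- (e * `|xi|))).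
Proof.
apply: measurableT_comp => //; apply: measurable_funN; apply: measurable_funM => //.
Qed.

Lemma integrable_expRN (e : R) : 0 < e ->
  mu.-integrable setT (EFin \o (fun xi : R => expR (- (e * `|xi|)))).
Proof.
move=> e0.
have i3 : mu.-integrable setT (fun x : R => (3 * (1 + (e * x) ^+ 2)^-1)%:E).
  under eq_fun do rewrite EFinM.
  by apply: integrableZl => //; exact: inv1sq_integrable.
apply: (le_integrable measurableT _ _ i3).
  by apply/measurable_EFinP; exact: measurable_expRN.
move=> x _ /=; rewrite lee_fin (ger0_norm (expR_ge0 _)).
rewrite (le_trans _ (ler_norm _))//.
have := @pow_expRN_le R (e * `|x|) 0 (mulr_ge0 (ltW e0) (normr_ge0 _)).
by rewrite expr0 mul1r exprMn real_normK ?num_real// -exprMn.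
Qed.

Lemma cintegrable_expRN (e : R) : 0 < e ->
  cintegrable mu (fun xi : R => (expR (- (e * `|xi|)))%:C).
Proof.
move=> e0; apply: (@le_cintegrable _ _ _ mu _ (fun xi => expR (- (e * `|xi|)))).
- by apply: cmeasurable_real; exact: measurable_expRN.
- exact: integrable_expRN.
- by move=> xi; rewrite cmodR ger0_norm// expR_ge0.
Qed.

Lemma poisson_fourier (e u : R) : 0 < e ->
  cintegral mu (fun xi => cis (u * xi) * (expR (- (e * `|xi|)))%:C) =
  (poisson e u)%:C.
Proof.
move=> e0; pose z1 : R[i] := (- e) +i* u; pose z2 : R[i] := e +i* u.
have r1 : complex.Re z1 < 0 by rewrite /= oppr_lt0.
have r2 : 0 < complex.Re z2 by [].
have [i1 e1] := cexp_ray_integral r1.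
have i2 := polyexp_integrable 0 r2; have e2 := polyexp_integral 0 r2.
rewrite (_ : (fun xi => _) = (fun xi : R => (if 0 <= xi then cexp (z1 * xi%:C) else 0) +
   (if xi < 0 then xi%:C ^+ 0 * cexp (z2 * xi%:C) else 0))); last first.
  apply/funext => xi; rewrite ltNge; case: lerP => x0 /=.
    rewrite addr0 ger0_norm// /cexp !cpartE /= mulrC; congr ((expR _)%:C * _).
      by rewrite mulr0 subr0 mulNr.
    by rewrite mulr0 add0r.
  rewrite add0r expr0 mul1r ltr0_norm// /cexp !cpartE /= mulrC; congr ((expR _)%:C * _).
    by rewrite mulr0 subr0 mulrN opprK.
  by rewrite mulr0 add0r.
rewrite cintegralD// e1 e2 expr0 expr1 !mul1r /poisson.
have d0 : e ^+ 2 + u ^+ 2 != 0 by rewrite gt_eqF// ltr_pwDl ?sqr_ge0// exprn_gt0.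
apply: complexP; rewrite !cpartE /= sqrrN; field; exact: d0.
Qed.

Lemma poisson_ge0 (e u : R) : 0 < e -> 0 <= poisson e u.
Proof. by move=> e0; rewrite divr_ge0 ?mulr_ge0 ?addr_ge0 ?sqr_ge0// ltW. Qed.

Lemma measurable_poisson (e x : R) : measurable_fun setT (fun y : R => poisson e (x - y)).
Proof.
rewrite /poisson; apply: measurable_funM => //; apply: measurable_fun_inv.
by apply: measurable_funD => //; apply: measurable_funX; apply: measurable_funB.
Qed.

Lemma poissonE (e u : R) : 0 < e -> poisson e u = 2 / e * (1 + (e^-1 * u) ^+ 2)^-1.
Proof.
move=> e0; have d0 : e ^+ 2 + u ^+ 2 != 0 by rewrite gt_eqF// ltr_pwDl ?sqr_ge0// exprn_gt0.
rewrite /poisson; field; rewrite gt_eqF//= d0 /=; exact: contra d0.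
Qed.

Lemma poisson_continuous (e x : R) : 0 < e -> continuous (fun y => poisson e (x - y)).
Proof.
move=> e0; rewrite (_ : (fun y => _) = (fun y => 2 / e * (1 + (e^-1 * (x - y)) ^+ 2)^-1)); last first.
  by apply/funext => y; rewrite poissonE.
move=> y; apply: cvgM; first exact: cvg_cst.
apply: (@cvg_comp _ _ _ (fun y : R => x - y) (fun u => (1 + (e^-1 * u) ^+ 2)^-1)).
  by apply: cvgB; [exact: cvg_cst|exact: cvg_id].
exact: inv1sq_continuous.
Qed.

Lemma is_derive_poisson (e x y : R) : 0 < e ->
  is_derive y (1 : R) (fun y => 2 * atan (e^-1 * (y - x))) (poisson e (x - y)).
Proof.
move=> e0; have d1 : is_derive y (1 : R) (fun y => e^-1 * (y - x)) e^-1.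
  apply: (is_derive_eq (is_deriveZ e^-1 (is_deriveB (is_derive_id y (1 : R)) (is_derive_cst x y (1 : R))))).
  by rewrite /GRing.scale /= subr0 mulr1.
have d2 := is_deriveZ 2 (@is_derive1_comp R atan (fun y => e^-1 * (y - x)) y _ _ (is_derive1_atan (e^-1 * (y - x))) d1).
apply: (is_derive_eq d2); rewrite poissonE// /GRing.scale /= -(opprB x y) mulrN sqrrN.
by rewrite mulrA mulrAC.
Qed.

Lemma poisson_integral (e x : R) : 0 < e ->
  (\int[mu]_y (poisson e (x - y))%:E = (2 * pi)%:E)%E.
Proof.
move=> e0; have cp := @poisson_continuous e x e0.
have p0 y : 0 <= poisson e (x - y) by exact: poisson_ge0.
have le : (\int[mu]_y (poisson e (x - y))%:E <= (2 * pi)%:E)%E.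
  apply: (ge0_FTC_bound cp p0 (fun y => is_derive_poisson x y e0)) => y.
  rewrite normrM ger0_norm// (_ : pi = 2 * (pi / 2)); last by field.
  by rewrite ler_wpM2l// norm_atan_le.
have ii : mu.-integrable setT (EFin \o (fun y => poisson e (x - y))).
  have mp := continuous_measurable_fun cp.
  by apply: (integrable_le_bound mp _ mp le) => y; rewrite ger0_norm.
rewrite -(fineK (integrable_fin_num measurableT ii)); congr EFin.
have := @RFTC_lim R (fun y => 2 * atan (e^-1 * (y - x))) (fun y => poisson e (x - y))
  xpredT (fun n => x - n.+1%:R) (fun n => x + n.+1%:R) (2 * pi).
apply => //.
- by move=> y; exact: is_derive_poisson.
- by move=> n; rewrite ltrD2l gtrN.
- move=> y _; near=> n.
  have : `|y - x| <= n%:R by near: n; exact: near_natr_ge.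
  rewrite ler_distl => /andP[a b]; apply/andP; split.
    by rewrite (le_trans _ a)// lerD2l lerN2 ler_nat.
  by rewrite (le_trans b)// lerD2l ler_nat.
- have -> : (fun n : nat => 2 * atan (e^-1 * (x + n.+1%:R - x)) - 2 * atan (e^-1 * (x - n.+1%:R - x))) =
     (fun n : nat => 4 * atan (e^-1 * n.+1%:R)).
    apply/funext => n; rewrite (addrC x) addrK (addrAC x) subrr sub0r mulrN atanN; ring.
  rewrite (_ : 2 * pi = 4 * (pi / 2)); last by field.
  apply: cvgM; first exact: cvg_cst.
  apply: (@cvg_comp _ _ _ (fun n : nat => e^-1 * n.+1%:R) atan _ +oo); last exact: cvgy_atan.
  apply/cvgryPge => A; near=> n.
  rewrite mulrC ler_pdivlMr//.
  have : A * e <= n%:R by near: n; exact: near_natr_ge.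
  by move=> /le_trans; apply; rewrite ler_nat.
Unshelve. all: by end_near. Qed.

Lemma measurable_cis_mul : cmeasurable (fun p : R * R => cis (p.1 * p.2)).
Proof.
apply: cmeasurable_cis; apply: measurable_funM; [exact: measurable_fst|exact: measurable_snd].
Qed.

Lemma cintegrable_cis (th : R -> R) (f : R -> R[i]) : measurable_fun setT th ->
  cintegrable mu f -> cintegrable mu (fun x => cis (th x) * f x).
Proof.
move=> mth; apply: (@cintegrableMl _ _ _ _ _ _ 1); first exact: cmeasurable_cis.
by move=> x; rewrite cmod_cis.
Qed.

Lemma measurable_mulr2 (a : R) : measurable_fun setT (fun x : R => x * a).
Proof. exact: measurable_funM. Qed.

Lemma cintegrable_fourier (f : R -> R[i]) (xi : R) :
  cintegrable mu f -> cintegrable mu (fun x => cis (- (x * xi)) * f x).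
Proof.
apply: cintegrable_cis; apply: measurable_funN; exact: measurable_mulr2.
Qed.

Lemma cintegrable_ifourier (f : R -> R[i]) (x : R) :
  cintegrable mu f -> cintegrable mu (fun xi => cis (x * xi) * f xi).
Proof. by apply: cintegrable_cis; exact: measurable_funM. Qed.

Lemma cmeasurable_fourier1 (f : R -> R[i]) : cmeasurable f -> cmeasurable (fourier1 f).
Proof.
move=> mf; have -> : fourier1 f = fun xi => cintegral mu (fun x => cis (- (x * xi)) * f x).
  by apply/funext => xi; exact: fourier1E.
apply: (@cmeasurable_leb2 _ (fun p : R * R => cis (- (p.1 * p.2)) * f p.1)).
apply: cmeasurableM; last exact: (cmeasurable_comp mf measurable_fst).
apply: cmeasurable_cis; apply: measurable_funN.
by apply: measurable_funM; [exact: measurable_fst|exact: measurable_snd].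
Qed.

(** The damping [exp(- e |xi|)] makes the double integrand absolutely integrable, so Fubini turns
    the damped inverse transform into a Poisson average of [f]. *)
Lemma abel_sum_fourier (f : R -> R[i]) (e x : R) : 0 < e -> cintegrable mu f ->
  cintegral mu (fun xi => cis (x * xi) * ((expR (- (e * `|xi|)))%:C * fourier1 f xi)) =
  cintegral mu (fun y => (poisson e (x - y))%:C * f y).
Proof.
move=> e0 fi; have mf := cintegrable_measurable fi.
pose g (p : R * R) := cis ((x - p.2) * p.1) * (expR (- (e * `|p.1|)))%:C * f p.2.
have mg : cmeasurable g.
  apply: cmeasurableM; last exact: (cmeasurable_comp mf measurable_snd).
  apply: cmeasurableM.
    apply: cmeasurable_cis; apply: measurable_funM; last exact: measurable_fst.
    by apply: measurable_funB => //; exact: measurable_snd.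
  apply: cmeasurable_real; apply: (measurableT_comp (measurable_expRN e) measurable_fst).
have ig : cintegrable (@leb2 R) g.
  apply: (@leb2_le_cintegrable _ g (fun xi => expR (- (e * `|xi|))) (fun y => cmod (f y))) => //; [exact: integrable_expRN|exact: cintegrable_cmod|move=> u v].
  by rewrite /g /= !cmodM cmod_cis mul1r cmodR ger0_norm// expR_ge0.
have := leb2_fubini ig; rewrite /g /= => h.
transitivity (cintegral mu (fun xi => cintegral mu (fun y =>
   cis ((x - y) * xi) * (expR (- (e * `|xi|)))%:C * f y))).
  apply: eq_cintegral => xi; rewrite fourier1E.
  have H1 := cintegrable_fourier xi fi.
  rewrite -(cintegralZ _ H1) -(cintegralZ _ (cintegrableZ _ H1)).
  apply: eq_cintegral => y; rewrite mulrBl cisD; ring.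
rewrite h; apply: eq_cintegral => y.
have H : cintegrable mu (fun xi : R => cis ((x - y) * xi) * (expR (- (e * `|xi|)))%:C).
  apply: cintegrable_ifourier; exact: cintegrable_expRN.
by rewrite (cintegralZr _ H) poisson_fourier.
Qed.
(** Away from the peak, the first bound is integrable in [u] and will multiply the constant [f x];
    the second is uniform and will multiply the integrable function [f]. *)
Lemma poisson_tail (e d u : R) : 0 < e -> 0 < d -> d <= `|u| ->
  poisson e u <= e * (2 * (1 + d ^- 2) * (1 + u ^+ 2)^-1) /\ poisson e u <= e * (2 * (d ^- 2)).
Proof.
move=> e0 d0 du.
have d2 : d ^+ 2 <= u ^+ 2 by rewrite -[leRHS]real_normK ?num_real// lerXn2r ?nnegrE// ltW.
have u0 : 0 < u ^+ 2 by rewrite (lt_le_trans _ d2)// exprn_gt0.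
have p1 : poisson e u <= 2 * e / u ^+ 2.
  have eu : 0 < e ^+ 2 + u ^+ 2 by rewrite addr_gt0// exprn_gt0.
  rewrite /poisson ler_pM2l ?mulr_gt0// lef_pV2 ?posrE//.
  by rewrite lerDr sqr_ge0.
split; apply: (le_trans p1).
  rewrite (_ : e * _ = 2 * e * ((1 + d ^- 2) / (1 + u ^+ 2))); last by ring.
  rewrite ler_pM2l ?mulr_gt0// -[leLHS]mul1r ler_pdivrMr// mulrAC.
  have uu : 0 < 1 + u ^+ 2 by rewrite addr_gt0.
  rewrite ler_pdivlMr// mul1r mulrDl mul1r [leRHS]addrC lerD2r.
  by rewrite mulrC ler_pdivlMr ?exprn_gt0// mul1r.
rewrite (_ : e * _ = 2 * e * (d ^- 2)); last by ring.
by rewrite ler_pM2l ?mulr_gt0// lef_pV2 ?posrE// exprn_gt0.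
Qed.

(** The damped integrals [A n] tend to the undamped one by dominated convergence, and to [2 pi f x]
    because the Poisson kernels concentrate at [x]. Continuity is asked at [x] alone, since the
    inversion is applied later to one-sided exponentials, treated off 0. *)
Theorem fourier1_inversion (f : R -> R[i]) (x : R) :
  cintegrable mu f -> cintegrable mu (fourier1 f) -> ccvg (nbhs x) f (f x) ->
  ifourier1 (fourier1 f) x = (2 * pi)%:C * f x.
Proof.
move=> fi Fi fx; have mf := cintegrable_measurable fi.
have mF := cintegrable_measurable Fi.
pose e (n : nat) : R := n.+1%:R^-1.
have e0 n : 0 < e n by rewrite invr_gt0.
pose A n := cintegral mu (fun xi => cis (x * xi) * ((expR (- (e n * `|xi|)))%:C * fourier1 f xi)).
have mcis : measurable_fun setT (fun xi : R => x * xi) by exact: measurable_funM.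
have [_ A1] : cintegrable mu (fun xi => cis (x * xi) * fourier1 f xi) /\
    ccvg \oo A (ifourier1 (fourier1 f) x).
  apply: (@cdominated_cvg _ _ _ mu _ _ (fun xi => cmod (fourier1 f xi))).
  - move=> n; apply: cmeasurableM; first exact: cmeasurable_cis.
    by apply: cmeasurableM => //; apply: cmeasurable_real; exact: measurable_expRN.
  - by apply: cmeasurableM => //; exact: cmeasurable_cis.
  - move=> xi; apply: (@ccvg_le _ _ _ _ _ _ (fun n => `|xi| * cmod (fourier1 f xi) * e n)).
      apply: nearW => n; rewrite -mulrBr -{2}[fourier1 f xi]mul1r -mulrBl !cmodM cmod_cis mul1r.
      rewrite mulrAC ler_wpM2r ?cmod_ge0// -[1]/(1%:C) -rmorphB cmodR.
      have y0 : 0 <= e n * `|xi| by rewrite mulr_ge0// ltW.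
      rewrite distrC ger0_norm ?subr_ge0 ?expRN_le1// mulrC.
      by rewrite lerBlDr -lerBlDl -[1 - _]/(1 + - _) expR_ge1Dx.
    rewrite -(mulr0 (`|xi| * cmod (fourier1 f xi))).
    by apply: cvgM; [exact: cvg_cst|exact: cvg_harmonic].
  - exact: cintegrable_cmod.
  - move=> n xi; rewrite !cmodM cmod_cis mul1r cmodR ger0_norm ?expR_ge0//.
    rewrite -[leRHS]mul1r ler_wpM2r ?cmod_ge0// expRN_le1// mulr_ge0// ltW//.
apply: (ccvg_unique A1).
have AE n : A n = cintegral mu (fun y => (poisson (e n) (x - y))%:C * f y).
  exact: abel_sum_fourier.
have pi_ n : mu.-integrable setT (EFin \o (fun y => poisson (e n) (x - y))).
  have mp := measurable_poisson (e n) x.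
  have le : (\int[mu]_y (poisson (e n) (x - y))%:E <= (2 * pi)%:E)%E by rewrite poisson_integral.
  by apply: (integrable_le_bound mp _ mp le) => y; rewrite ger0_norm ?poisson_ge0.
have cpi n : cintegrable mu (fun y => (poisson (e n) (x - y))%:C).
  apply: (le_cintegrable _ (pi_ n)); first by apply: cmeasurable_real; exact: measurable_poisson.
  by move=> y; rewrite cmodR ger0_norm ?poisson_ge0.
have cpE n : cintegral mu (fun y => (poisson (e n) (x - y))%:C) = (2 * pi)%:C.
  by apply: complexP; rewrite /= /Rintegral ?poisson_integral ?integral0_eq.
have pM n y : cmod (poisson (e n) (x - y))%:C <= 2 / e n.
  rewrite cmodR ger0_norm ?poisson_ge0// poissonE// -[leRHS]mulr1 ler_pM2l ?divr_gt0//.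
  by rewrite invf_le1 ?lerDl ?ltr_pwDl ?sqr_ge0.
have pi0 : 0 < pi :> R by exact: pi_gt0.
have E4 (p t u : R) : 0 < p -> 2 * (t / (8 * p) * (2 * p) + u) = t / 2 + 2 * u.
  by move=> p0; field; exact: lt0r_neq0.
apply/cvgrPdist_le => eta eta0.
(* With this choice the part near [x] contributes [2 * eta' * 2 pi = eta / 2], and the tail may use
   the other half. *)
pose eta' := eta / (8 * pi).
have eta'0 : 0 < eta' by rewrite divr_gt0// mulr_gt0.
have /cvgrPdist_lt/(_ _ eta'0)/nbhs_ballP[d /= d0 fd] := fx.
have {}fd y : `|x - y| < d -> cmod (f y - f x) <= eta'.
  move=> xy; have := fd y; rewrite -ball_normE /= => /(_ xy).
  by rewrite sub0r normrN ger0_norm ?cmod_ge0// => /ltW.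
pose g y := cmod (f y) * (2 * (d ^- 2)) + cmod (f x) * (2 * (1 + d ^- 2) * (1 + (1 * (y - x)) ^+ 2)^-1).
have mg : measurable_fun setT g.
  apply: measurable_funD; apply: measurable_funM => //; first exact: measurable_cmod.
  apply: measurable_funM => //; apply: measurable_fun_inv; apply: measurable_funD => //.
  by apply: measurable_funX; apply: measurable_funM => //; exact: measurable_funB.
have g0 y : 0 <= g y.
  by rewrite addr_ge0// mulr_ge0 ?cmod_ge0// ?mulr_ge0 ?invr_ge0 ?addr_ge0 ?sqr_ge0 ?invr_ge0 ?sqr_ge0.
have bnd n y : cmod ((poisson (e n) (x - y))%:C * (f y - f x)) <=
    eta' * poisson (e n) (x - y) + e n * g y.
  rewrite cmodM cmodR ger0_norm ?poisson_ge0//.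
  have [xy|xy] := ltP `|x - y| d.
    rewrite mulrC (le_trans (ler_wpM2r (poisson_ge0 _ (e0 n)) (fd _ xy)))// lerDl.
    by rewrite mulr_ge0// ltW.
  have [t1 t2] := poisson_tail (e0 n) d0 xy.
  rewrite (le_trans (ler_wpM2l (poisson_ge0 _ (e0 n)) (cmodB_le _ _)))//.
  apply: (@le_trans _ _ (e n * g y)); last first.
    by rewrite lerDr mulr_ge0 ?poisson_ge0// ltW.
  rewrite mulrDr /g mulrDr; apply: lerD.
    by rewrite mulrC (mulrCA (e n)) ler_wpM2l ?cmod_ge0.
  rewrite mulrC (mulrCA (e n)) ler_wpM2l ?cmod_ge0// mul1r -(opprB x y) sqrrN//.
(* The integral of [g] is independent of [n], so the tail is of order [e n]. *)
have [G GE] : exists G, (\int[mu]_y (g y)%:E = G%:E)%E.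
  have ig : mu.-integrable setT (EFin \o g).
    rewrite /g /comp; under eq_fun do rewrite EFinD.
    apply: integrableD => //.
      under eq_fun do rewrite mulrC EFinM.
      by apply: integrableZl => //; exact: cintegrable_cmod.
    under eq_fun do rewrite EFinM.
    apply: integrableZl => //; under eq_fun do rewrite EFinM.
    apply: integrableZl => //.
    have h : (fun y : R => ((1 + (1 * (y - x)) ^+ 2)^-1)%:E) = (fun y => (2^-1 * poisson 1 (x - y))%:E).
      apply/funext => y; rewrite poissonE// divr1 mulKf// invr1 !mul1r.
      by rewrite -(opprB x y) sqrrN.
    rewrite h; under eq_fun do rewrite EFinM.
    apply: integrableZl => //; have := pi_ 0%N; rewrite /e invr1; exact.
  by exists (fine (\int[mu]_y (g y)%:E)); rewrite fineK//; exact: integrable_fin_num.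
near=> n.
rewrite sub0r normrN ger0_norm ?cmod_ge0// AE.
have ipf : cintegrable mu (fun y => (poisson (e n) (x - y))%:C * f y).
  apply: (@cintegrableMl _ _ _ _ _ _ (2 / e n)) => //.
  by apply: cmeasurable_real; exact: measurable_poisson.
have ipx := cintegrableZ (f x) (cpi n).
have -> : (2 * pi)%:C * f x = cintegral mu (fun y => f x * (poisson (e n) (x - y))%:C).
  by rewrite (cintegralZ _ (cpi n)) cpE mulrC.
rewrite -(cintegralB ipf ipx).
apply: (@le_trans _ _ (2 * (eta' * (2 * pi) + e n * G))).
  apply: (@cmod_cintegral_leR _ _ _ mu _ (fun y => eta' * poisson (e n) (x - y) + e n * g y)).
  - apply: cmeasurableB; apply: cmeasurableM => //; by apply: cmeasurable_real; exact: measurable_poisson.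
  - by move=> y; rewrite (mulrC (f x)) -mulrBr.
  - apply: measurable_funD; apply: measurable_funM => //; exact: measurable_poisson.
  - have ep0 y : 0 <= eta' * poisson (e n) (x - y) by rewrite mulr_ge0 ?poisson_ge0// ltW.
    have eg0 y : 0 <= e n * g y by rewrite mulr_ge0// ltW.
    have mp := measurable_poisson (e n) x.
    have mep : measurable_fun setT (fun y : R => eta' * poisson (e n) (x - y)) by exact: measurable_funM.
    have meg : measurable_fun setT (fun y : R => e n * g y) by exact: measurable_funM.
    rewrite (@ge0_integralD_EFin _ _ _ mu _ _ mep meg ep0 eg0).
    rewrite (@ge0_integralZ_EFin _ _ _ mu _ _ (ltW eta'0) mp) ?(@ge0_integralZ_EFin _ _ _ mu _ _ (ltW (e0 n)) mg)//.
      by rewrite poisson_integral// GE.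
    by move=> y; exact: poisson_ge0.
have nG : e n * G <= eta / 4.
  have [GG|GG] := leP G 0.
    by rewrite (le_trans (mulr_ge0_le0 (ltW (e0 n)) GG))// divr_ge0// ltW.
  rewrite /e mulrC ler_pdivrMr// mulrC -ler_pdivrMr ?divr_gt0//.
  have : G / (eta / 4) <= n%:R by near: n; exact: near_natr_ge.
  by move=> /le_trans; apply; rewrite ler_nat.
have -> : 2 * (eta' * (2 * pi) + e n * G) = eta / 2 + 2 * (e n * G).
  by apply: E4.
have E5 (t u : R) : u <= t / 4 -> t / 2 + 2 * u <= t by lra.
exact: E5.
Unshelve. all: by end_near. Qed.

End Inversion.

Section CContinuous.
Context {R : realType} {T : topologicalType}.
Implicit Types f g : T -> R[i].

Lemma ccontinuous_cst (z : R[i]) : ccontinuous (fun _ : T => z).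
Proof. by split => x; exact: cvg_cst. Qed.

Lemma ccontinuousD f g : ccontinuous f -> ccontinuous g ->
  ccontinuous (fun x => f x + g x).
Proof.
move=> [f1 f2] [g1 g2]; split => x; under eq_fun do rewrite cpartE.
  by apply: cvgD; [exact: f1|exact: g1].
by apply: cvgD; [exact: f2|exact: g2].
Qed.

Lemma ccontinuousM f g : ccontinuous f -> ccontinuous g ->
  ccontinuous (fun x => f x * g x).
Proof.
move=> [f1 f2] [g1 g2]; split => x; under eq_fun do rewrite cpartE.
  by apply: cvgB; apply: cvgM; [exact: f1|exact: g1|exact: f2|exact: g2].
by apply: cvgD; apply: cvgM; [exact: f1|exact: g2|exact: f2|exact: g1].
Qed.

Lemma ccontinuousZ (z : R[i]) f : ccontinuous f -> ccontinuous (fun x => z * f x).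
Proof. by apply: ccontinuousM; exact: ccontinuous_cst. Qed.

End CContinuous.

(** * From compactly supported to Schwartz functions *)

Section CompactSupport.
Context {R : realType} {V : normedModType R}.
Implicit Types f : V -> R[i].

Lemma cderiv_outside f (A : set V) (v : V) : closed A ->
  (forall p, ~ A p -> f p = 0) -> forall p, ~ A p -> cderiv v f p = 0.
Proof.
move=> cA fA p Ap; have nA : \forall q \near p, f q = 0.
  have : nbhs p (~` A) by apply: open_nbhs_nbhs; split => //; exact: closed_openC.
  by apply: filterS => q; exact: fA.
rewrite /cderiv; apply: complexP => /=.
  rewrite (@near_eq_derive _ _ _ _ (cst (0 : R))) ?derive_cst//.
  by apply: filterS nA => q ->.
rewrite (@near_eq_derive _ _ _ _ (cst (0 : R))) ?derive_cst//.
by apply: filterS nA => q ->.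
Qed.

Lemma cderivs_outside f (vs : seq V) p : ~ csupp f p -> cderivs vs f p = 0.
Proof.
elim: vs p => [|v vs ih] p fp /=; last first.
  by apply: cderiv_outside ih _ fp; exact: closed_closure.
by apply/eqP; apply: contra_notT fp => fp; exact: subset_closure.
Qed.

Lemma continuous_cmod f : ccontinuous f -> continuous (fun p => cmod (f p)).
Proof.
move=> [c1 c2] p.
rewrite (_ : (fun p => _) = @Num.sqrt R \o
  (fun q => complex.Re (f q) * complex.Re (f q) + complex.Im (f q) * complex.Im (f q))); last first.
  by apply/funext => q; rewrite cmodE.
apply: continuous_comp; last exact: sqrt_continuous.
by apply: cvgD; apply: cvgM; [exact: c1|exact: c1|exact: c2|exact: c2].
Qed.

(** Every derivative vanishes off the compact support, on which the weighted modulus attains its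
    maximum; an empty support is treated apart. *)
Lemma schwartz_of_compact f : csmooth f -> compact (csupp f) -> schwartz f.
Proof.
move=> sf cf; split=> // vs k; have [[c1 c2] _] := sf vs.
pose g p : R := `|p| ^+ k * cmod (cderivs vs f p).
have cg : continuous g.
  move=> p; apply: cvgM.
    apply: (@cvg_comp _ _ _ (fun p : V => `|p|) (fun x : R => x ^+ k)); first exact: norm_continuous.
    exact: exprn_continuous.
  by apply: continuous_cmod.
have [A0|/set0P A0] := eqVneq (csupp f) set0.
  exists 0 => p; rewrite cderivs_outside ?cmod0 ?mulr0// A0//.
have [c _ cmax] := compact_EVT_max A0 cf (continuous_subspaceT cg).
exists (g c) => p; have [Ap|Ap] := pselect (csupp f p).
  by apply: cmax; rewrite inE.
rewrite cderivs_outside ?cmod0 ?mulr0// /g mulr_ge0 ?cmod_ge0//.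
Qed.

Lemma schwartz_deriv f (v : V) : schwartz f -> schwartz (cderiv v f).
Proof.
have e vs : cderivs vs (cderiv v f) = cderivs (rcons vs v) f.
  by rewrite /cderivs -cats1 foldr_cat.
by move=> [sf bf]; split => [vs|vs k]; rewrite e; [exact: sf|exact: bf].
Qed.

End CompactSupport.

(** * Schwartz functions on the line and distributional transforms *)

Section FourierDeriv.
Context {R : realType}.
Local Notation mu := (@lebesgue_measure R).

Lemma le_inv1sq_integrable (f : R -> R[i]) (M : R) : cmeasurable f ->
  (forall x, cmod (f x) <= M * (1 + x ^+ 2)^-1) -> cintegrable mu f.
Proof.
move=> mf fM; apply: (@le_cintegrable _ _ _ mu _ (fun x => M * (1 + (1 * x) ^+ 2)^-1)) => //.
  under eq_fun do rewrite EFinM.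
  by apply: integrableZl => //; exact: inv1sq_integrable.
by move=> x; rewrite mul1r.
Qed.

Lemma inv1sq_cvg0 (M : R) :
  (fun n : nat => M * (1 + n.+1%:R ^+ 2)^-1) @ \oo --> (0 : R).
Proof.
rewrite -(mulr0 M); apply: cvgM; first exact: cvg_cst.
apply: (squeeze_cvgr _ (cvg_cst 0) cvg_harmonic).
apply: nearW => n; rewrite invr_ge0 addr_ge0 ?sqr_ge0//=.
rewrite lef_pV2 ?posrE ?ltr_pwDl ?sqr_ge0//.
by rewrite (@le_trans _ _ (n.+1%:R ^+ 2))// ?lerDr// expr2 ler_peMl// ler1n.
Qed.

Lemma cmod_cintegral_inv1sq (f : R -> R[i]) (M : R) : cmeasurable f ->
  (forall x, cmod (f x) <= M * (1 + x ^+ 2)^-1) -> cmod (cintegral mu f) <= 2 * (M * pi).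
Proof.
move=> mf fM.
have M0 : 0 <= M by have := fM 0; rewrite expr0n addr0 invr1 mulr1; exact/le_trans/cmod_ge0.
have mc := continuous_measurable_fun (@inv1sq_continuous R 1).
apply: (@cmod_cintegral_leR _ _ _ mu _ (fun x => M * (1 + (1 * x) ^+ 2)^-1)) => //.
- by move=> x; rewrite mul1r.
- exact: measurable_funM.
- rewrite (@ge0_integralZ_EFin _ _ _ mu _ _ M0 mc) => [|x]; last exact: inv1sq_ge0.
  rewrite EFinM lee_wpmul2l ?lee_fin//.
  by have := @inv1sq_integral R 1 ltr01; rewrite divr1.
Qed.

(** Integration by parts: the product of [f] with the exponential vanishes at both ends, so its
    derivative has integral 0. *)
Lemma fourier1_deriv (f f' : R -> R[i]) (M M' : R) (xi : R) :
  (forall x, is_cderive f x (f' x)) -> ccontinuous f' ->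
  (forall x, cmod (f x) <= M * (1 + x ^+ 2)^-1) ->
  (forall x, cmod (f' x) <= M' * (1 + x ^+ 2)^-1) ->
  fourier1 f' xi = 'i%C * xi%:C * fourier1 f xi.
Proof.
move=> df cf' fM f'M.
have mf := ccontinuous_measurable (is_cderive_ccontinuous df).
have mf' := ccontinuous_measurable cf'.
have fi := le_inv1sq_integrable mf fM; have fi' := le_inv1sq_integrable mf' f'M.
pose E x : R[i] := cexp ((- 'i%C * xi%:C) * x%:C).
have EE x : E x = cis (- (x * xi)).
  by rewrite /E -mulrA -rmorphM (mulrC xi) cexp_Ni.
have H1 := cintegrable_fourier xi fi; have H2 := cintegrable_fourier xi fi'.
have dE x : is_cderive E x ((- 'i%C * xi%:C) * E x) by exact: is_cderive_expl.
have H : cintegral mu (fun x => E x * f' x + ((- 'i%C * xi%:C) * E x) * f x) = 0.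
  apply: (@cFTC_line _ (fun x => E x * f x)).
  - apply: cintegrableD; first by under eq_fun do rewrite EE.
    by under eq_fun do rewrite EE -mulrA; exact: cintegrableZ.
  - by move=> x; exact: is_cderiveM.
  - have cE : ccontinuous E by exact: is_cderive_ccontinuous dE.
    have cf : ccontinuous f by exact: is_cderive_ccontinuous df.
    by apply: ccontinuousD; apply: ccontinuousM => //; exact: ccontinuousZ.
  - apply: (@ccvg_le _ _ _ _ _ _ (fun n : nat => M * (1 + n.+1%:R ^+ 2)^-1 + M * (1 + n.+1%:R ^+ 2)^-1)).
      apply: nearW => n; rewrite subr0 (le_trans (cmodB_le _ _))// lerD//.
        by rewrite cmodM EE cmod_cis mul1r.
      by rewrite cmodM EE cmod_cis mul1r (le_trans (fM _))// sqrrN.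
    by rewrite -[0]addr0; apply: cvgD; exact: inv1sq_cvg0.
rewrite !fourier1E; apply/eqP; rewrite -subr_eq0 -(cintegralZ _ H1).
rewrite -(cintegralB H2 (cintegrableZ _ H1)) -H; apply/eqP; apply: eq_cintegral => x.
by rewrite EE; ring.
Qed.

Definition deriv1 (f : R -> R[i]) (n : nat) := cderivs (nseq n (1 : R)) f.

Lemma deriv1_is_cderive (f : R -> R[i]) n x : csmooth f ->
  is_cderive (deriv1 f n) x (deriv1 f n.+1 x).
Proof.
move=> sf; have [_ /(_ x 1)[d1 d2]] := sf (nseq n (1 : R)).
by split => /=; exact: derivableP.
Qed.

Lemma deriv1_ccontinuous (f : R -> R[i]) n : csmooth f -> ccontinuous (deriv1 f n).
Proof. by move=> sf; have [] := sf (nseq n (1 : R)). Qed.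

Lemma schwartz_bound (f : R -> R[i]) n : schwartz f ->
  exists M, forall x, cmod (deriv1 f n x) <= M * (1 + x ^+ 2)^-1.
Proof.
move=> [_ bf]; have [M0 h0] := bf (nseq n (1 : R)) 0%N; have [M2 h2] := bf (nseq n (1 : R)) 2%N.
exists (M0 + M2) => x; rewrite ler_pdivlMr ?ltr_pwDl ?sqr_ge0// mulrDr mulr1 lerD//.
  by have := h0 x; rewrite expr0 mul1r.
by have := h2 x; rewrite real_normK ?num_real// mulrC.
Qed.

Lemma schwartz_integrable (f : R -> R[i]) : schwartz f -> cintegrable mu f.
Proof.
move=> sf; have [M fM] := schwartz_bound 0 sf; have [cf _] := sf.
exact: le_inv1sq_integrable (ccontinuous_measurable (deriv1_ccontinuous 0 cf)) fM.
Qed.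

Lemma schwartz_fourier_deriv (f : R -> R[i]) n xi : schwartz f ->
  fourier1 (deriv1 f n) xi = ('i%C * xi%:C) ^+ n * fourier1 f xi.
Proof.
move=> sf; have [cf _] := sf; elim: n => [|n ih]; first by rewrite expr0 mul1r.
have [M1 f1] := schwartz_bound n sf; have [M2 f2] := schwartz_bound n.+1 sf.
rewrite (@fourier1_deriv (deriv1 f n) _ M1 M2)//.
- by rewrite ih exprS mulrA.
- by move=> x; exact: deriv1_is_cderive.
- exact: deriv1_ccontinuous.
Qed.

Lemma schwartz_fourier_le (f : R -> R[i]) n : schwartz f ->
  exists M, forall xi, `|xi| ^+ n * cmod (fourier1 f xi) <= M.
Proof.
move=> sf; have [M fM] := schwartz_bound n sf; have [cf _] := sf.
exists (2 * (M * pi)) => xi.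
have -> : `|xi| ^+ n * cmod (fourier1 f xi) = cmod (fourier1 (deriv1 f n) xi).
  by rewrite schwartz_fourier_deriv// cmodM cmodX cmodM cmodi mul1r cmodR.
have mf := ccontinuous_measurable (deriv1_ccontinuous n cf).
rewrite fourier1E; apply: cmod_cintegral_inv1sq.
  apply: cmeasurableM => //; apply: cmeasurable_cis; apply: measurable_funN; exact: measurable_mulr2.
by move=> x; rewrite cmodM cmod_cis mul1r.
Qed.

Lemma schwartz_fourier_integrable (f : R -> R[i]) : schwartz f -> cintegrable mu (fourier1 f).
Proof.
move=> sf; have [M0 h0] := schwartz_fourier_le 0 sf; have [M2 h2] := schwartz_fourier_le 2 sf.
apply: (@le_inv1sq_integrable _ (M0 + M2)).
  exact: cmeasurable_fourier1 (cintegrable_measurable (schwartz_integrable sf)).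
move=> x; rewrite ler_pdivlMr ?ltr_pwDl ?sqr_ge0// mulrDr mulr1 lerD//.
  by have := h0 x; rewrite expr0 mul1r.
by have := h2 x; rewrite real_normK ?num_real// mulrC.
Qed.

Lemma ccontinuous_ccvg (f : R -> R[i]) x : ccontinuous f -> ccvg (nbhs x) f (f x).
Proof. by move=> [f1 f2]; apply/ccvgP; split; [exact: f1|exact: f2]. Qed.

Lemma schwartz_inversion (f : R -> R[i]) x : schwartz f ->
  ifourier1 (fourier1 f) x = (2 * pi)%:C * f x.
Proof.
move=> sf; apply: fourier1_inversion.
- exact: schwartz_integrable.
- exact: schwartz_fourier_integrable.
- by apply: ccontinuous_ccvg; exact: (deriv1_ccontinuous 0 (proj1 sf)).
Qed.

Lemma ccontinuous_ifourier1 (U : R -> R[i]) : cintegrable mu U -> ccontinuous (ifourier1 U).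
Proof.
move=> iU; apply: (@cis_integral_ccontinuous _ _ _ mu _ (fun x xi : R => x * xi) _ (fun xi => `|xi|)) => //.
- exact: normr_measurable.
- by move=> x; exact: mulrl_measurable.
- suff e (x y xi : R) : `|x * xi - y * xi| <= `|x - y| * `|xi| by exact: e.
  by rewrite -mulrBl normrM.
Qed.

Lemma cmod_ifourier1_le (U : R -> R[i]) : cintegrable mu U ->
  exists M, forall x, cmod (ifourier1 U x) <= M.
Proof.
move=> iU; have ii := cintegrable_cmod iU; have mU := cintegrable_measurable iU.
exists (2 * fine (\int[mu]_x (cmod (U x))%:E)) => x.
apply: (@cmod_cintegral_leR _ _ _ mu _ (fun x => cmod (U x))).
- by apply: cmeasurableM => //; apply: cmeasurable_cis; exact: measurable_funM.
- by move=> y; rewrite cmodM cmod_cis mul1r.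
- exact: measurable_cmod.
- by rewrite fineK//; exact: integrable_fin_num.
Qed.

Lemma tempered1_bounded (u : R -> R[i]) (M : R) : cmeasurable u ->
  (forall x, cmod (u x) <= M) -> tempered1 u.
Proof.
move=> mu_ uM; split => // phi /schwartz_integrable ip.
exact: (@cintegrableMl _ _ _ mu phi u M mu_ uM ip).
Qed.

Lemma schwartz_bounded (f : R -> R[i]) : schwartz f -> exists M, forall x, cmod (f x) <= M.
Proof.
by move=> [_ /(_ [::] 0%N)[M h]]; exists M => x; have := h x; rewrite expr0 mul1r.
Qed.

Lemma schwartz_measurable (f : R -> R[i]) : schwartz f -> cmeasurable f.
Proof. by move=> [sf _]; exact: ccontinuous_measurable (deriv1_ccontinuous 0 sf). Qed.

Lemma tempered1_integrable (U : R -> R[i]) : cintegrable mu U -> tempered1 U.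
Proof.
move=> iU; split; first exact: cintegrable_measurable iU.
move=> phi sphi; have [M pM] := schwartz_bounded sphi.
exact: (@cintegrableMr _ _ _ mu U phi M (schwartz_measurable sphi) pM iU).
Qed.

Lemma realc_invK (a : R) : a != 0 -> (a^-1)%:C * a%:C = 1 :> R[i].
Proof. by move=> a0; rewrite -rmorphM mulVf. Qed.

Lemma twopi_neq0 : 2 * pi != 0 :> R.
Proof. by rewrite gt_eqF// mulr_gt0// pi_gt0. Qed.

Lemma twopi_invK : ((2 * pi)^-1)%:C * (2 * pi)%:C = 1 :> R[i].
Proof. exact: realc_invK twopi_neq0. Qed.

(** Fubini moves the exponential onto the transform of the test function, where inversion recovers
    [phi]. Only [U] is integrable; its inverse transform is merely bounded and continuous. *)
Lemma is_fourier1_ifourier1 (U : R -> R[i]) : cintegrable mu U ->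
  is_fourier1 (fun x => ((2 * pi)^-1)%:C * ifourier1 U x) U.
Proof.
move=> iU; have cU := ccontinuous_ifourier1 iU; have mU := cintegrable_measurable iU.
have mi : cmeasurable (ifourier1 U) by exact: ccontinuous_measurable.
split.
- have [M UM] := cmod_ifourier1_le iU.
  apply: (@tempered1_bounded _ (cmod ((2 * pi)^-1)%:C * M)).
    by apply: cmeasurableM => //; exact: cmeasurable_cst.
  by move=> x; rewrite cmodM ler_wpM2l// cmod_ge0.
- exact: tempered1_integrable.
- move=> phi sphi.
  have ip := schwartz_fourier_integrable sphi.
  have mp := cintegrable_measurable ip.
  pose g (p : R * R) := cis (p.1 * p.2) * U p.2 * fourier1 phi p.1.
  have mg : cmeasurable g.
    apply: cmeasurableM; last exact: (cmeasurable_comp mp measurable_fst).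
    by apply: cmeasurableM; [exact: measurable_cis_mul|exact: (cmeasurable_comp mU measurable_snd)].
  have ig : cintegrable (@leb2 R) g.
    apply: (@leb2_le_cintegrable _ g (fun x => cmod (fourier1 phi x)) (fun y => cmod (U y))) => //.
    - exact: cintegrable_cmod.
    - exact: cintegrable_cmod.
    - by move=> u v; rewrite /g /= !cmodM cmod_cis mul1r mulrC.
  have F := leb2_fubini ig; rewrite /g /= in F.
  have L (xi : R) : cintegral mu (fun x : R => cis (x * xi) * U xi * fourier1 phi x) = (2 * pi)%:C * (U xi * phi xi).
    have H : cintegrable mu (fun x => cis (xi * x) * fourier1 phi x) by exact: cintegrable_ifourier.
    have := schwartz_inversion xi sphi; rewrite /ifourier1 => E.
    rewrite mulrCA -E -(cintegralZ _ H); apply: eq_cintegral => x; rewrite (mulrC xi); ring.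
  have K (x : R) : cintegral mu (fun xi : R => cis (x * xi) * U xi * fourier1 phi x) = ifourier1 U x * fourier1 phi x.
    by have H := cintegrable_ifourier x iU; rewrite (cintegralZr _ H).
  have [_ tU] := tempered1_integrable iU; have Up := tU _ sphi.
  transitivity (((2 * pi)^-1)%:C * cintegral mu (fun xi : R => (2 * pi)%:C * (U xi * phi xi))).
    by rewrite (cintegralZ _ Up) mulrA twopi_invK mul1r.
  have -> : (fun xi : R => (2 * pi)%:C * (U xi * phi xi)) = (fun xi : R => cintegral mu (fun x : R => cis (x * xi) * U xi * fourier1 phi x)).
    by apply/funext => xi; rewrite L.
  rewrite -F.
  have -> : (fun x : R => cintegral mu (fun xi : R => cis (x * xi) * U xi * fourier1 phi x)) = (fun x => ifourier1 U x * fourier1 phi x).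
    by apply/funext => x; rewrite K.
  have [M UM] := cmod_ifourier1_le iU.
  have H := @cintegrableMl _ _ _ mu _ _ M mi UM ip.
  rewrite -(cintegralZ _ H).
  by apply: eq_cintegral => x; rewrite mulrA.
Qed.

End FourierDeriv.

Section ProductSwap.
Context d (T : measurableType d) {R : realType} (m : {sigma_finite_measure set T -> \bar R}).

Lemma product_sigma_finite : sigma_finite setT (m \x m)%E.
Proof.
have /sigma_finiteP[F [FT ndF mF]] := sigma_finiteT m.
have cover x : exists n, F n x by have : setT x := I; rewrite FT => -[n _ Fx]; exists n.
exists (fun n => F n `*` F n) => [|n].
  apply/seteqP; split => // -[x y] _; have [[k Fx] [l Fy]] := (cover x, cover y).
  exists (maxn k l) => //; split.
    exact: (subsetPset _ _ (ndF k _ (leq_maxl k l))).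
  exact: (subsetPset _ _ (ndF l _ (leq_maxr k l))).
have [mFn Fn] := mF n; split; first exact: measurableX.
by rewrite product_measure1E// lte_mul_pinfty// ge0_fin_numE.
Qed.

(* The canonical sigma-finite structure on [\x] found by unification is the one
   for subprobabilities, so it has to be given explicitly. *)
Definition product_sigma_finite_measure : {sigma_finite_measure set (T * T)%type -> \bar R} :=
  HB.pack_for {sigma_finite_measure set (T * T)%type -> \bar R} (m \x m)%E
    (Measure_isSigmaFinite.Build _ _ _ (m \x m)%E product_sigma_finite).

Lemma cfubini_prod_swap (g : T * T -> T * T -> R[i]) (a b : T * T -> R) :
  cmeasurable (fun z : (T * T) * (T * T) => g z.1 z.2) ->
  (m \x m)%E.-integrable setT (EFin \o a) -> (m \x m)%E.-integrable setT (EFin \o b) ->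
  (forall p k, cmod (g p k) <= a p * b k) ->
  cintegral (m \x m)%E (fun p => cintegral (m \x m)%E (g p)) =
  cintegral (m \x m)%E (fun k => cintegral (m \x m)%E (g ^~ k)).
Proof.
move=> mg ia ib gab.
have H := @le_cintegrable_prod _ _ _ _ _ product_sigma_finite_measure product_sigma_finite_measure
  _ a b mg ia ib gab.
exact: (cfubini H).
Qed.

End ProductSwap.

(** * The Fourier transform on the plane *)

Section PlaneFourier.
Context {R : realType}.
Local Notation mu := (@lebesgue_measure R).
Local Notation leb2 := (@leb2 R).

Definition phase (p k : R * R) : R := p.1 * k.1 + p.2 * k.2.

Lemma fourier2E (f : R * R -> R[i]) k :
  fourier2 f k = cintegral leb2 (fun p => cis (- phase p k) * f p).
Proof. by apply: eq_cintegral => p; rewrite cexp_Ni. Qed.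

Definition ifourier2 (U : R * R -> R[i]) (p : R * R) : R[i] :=
  cintegral leb2 (fun k => cis (phase p k) * U k).

Lemma measurable_phase (p : R * R) : measurable_fun setT (phase p).
Proof.
apply: measurable_funD; apply: measurable_funM => //.
Qed.

Lemma measurable_phase2 (k : R * R) : measurable_fun setT (fun p => phase p k).
Proof.
apply: measurable_funD; apply: measurable_funM => //.
Qed.

Lemma cintegrable_ifourier2 (U : R * R -> R[i]) p :
  cintegrable leb2 U -> cintegrable leb2 (fun k => cis (phase p k) * U k).
Proof.
move=> iU; apply: (@cintegrableMl _ _ _ leb2 U _ 1) => //.
  by apply: cmeasurable_cis; exact: measurable_phase.
by move=> k; rewrite cmod_cis.
Qed.

Lemma cintegrable_fourier2 (f : R * R -> R[i]) k :
  cintegrable leb2 f -> cintegrable leb2 (fun p => cis (- phase p k) * f p).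
Proof.
move=> fi; apply: (@cintegrableMl _ _ _ leb2 f _ 1) => //.
  by apply: cmeasurable_cis; apply: measurable_funN; exact: measurable_phase2.
by move=> p; rewrite cmod_cis.
Qed.

Lemma norm_fst_le (p : R * R) : `|p.1| <= `|p|.
Proof. by rewrite prod_normE le_max lexx. Qed.
Lemma norm_snd_le (p : R * R) : `|p.2| <= `|p|.
Proof. by rewrite prod_normE le_max lexx orbT. Qed.

Lemma ccontinuous_ifourier2 (U : R * R -> R[i]) : cintegrable leb2 U -> ccontinuous (ifourier2 U).
Proof.
move=> iU; apply: (@cis_integral_ccontinuous _ _ _ leb2 _ phase _ (fun k => `|k.1| + `|k.2|)) => //.
- by apply: measurable_funD; apply: measurableT_comp => //; exact: normr_measurable.
- exact: measurable_phase.
- suff e (p q k : R * R) : `|phase p k - phase q k| <= `|p - q| * (`|k.1| + `|k.2|) by exact: e.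
  rewrite /phase opprD addrACA -!mulrBl (le_trans (ler_normD _ _))// !normrM mulrDr.
  by rewrite lerD// ler_wpM2r//; [exact: (norm_fst_le (p - q))|exact: (norm_snd_le (p - q))].
Qed.

Lemma cmod_ifourier2_le (U : R * R -> R[i]) : cintegrable leb2 U ->
  exists M, forall x, cmod (ifourier2 U x) <= M.
Proof.
move=> iU; have ii := cintegrable_cmod iU; have mU := cintegrable_measurable iU.
exists (2 * fine (\int[leb2]_x (cmod (U x))%:E)) => x.
apply: (@cmod_cintegral_leR _ _ _ leb2 _ (fun x => cmod (U x))).
- by apply: cmeasurableM => //; apply: cmeasurable_cis; exact: measurable_phase.
- by move=> y; rewrite cmodM cmod_cis mul1r.
- exact: measurable_cmod.
- by rewrite fineK//; exact: integrable_fin_num.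
Qed.

Lemma is_derive_slice1 (f : R * R -> R) (x t d : R) :
  is_derive (x, t) ((1, 0) : R * R) f d -> is_derive x (1 : R) (fun x => f (x, t)) d.
Proof.
move=> [d1 d2].
have e : (fun h : R => h^-1 *: (f (h *: ((1, 0) : R * R) + (x, t)) - f (x, t))) =
  (fun h => h^-1 *: (f (h *: (1 : R) + x, t) - f (x, t))).
  apply/funext => h; congr (_ *: (f _ - _)).
  by apply/pair_equal_spec; split => //=; rewrite scaler0 add0r.
split; first by move: d1; rewrite /derivable e.
by move: d2; rewrite /derive e.
Qed.

Lemma is_derive_slice2 (f : R * R -> R) (x t d : R) :
  is_derive (x, t) ((0, 1) : R * R) f d -> is_derive t (1 : R) (fun t => f (x, t)) d.
Proof.
move=> [d1 d2].
have e : (fun h : R => h^-1 *: (f (h *: ((0, 1) : R * R) + (x, t)) - f (x, t))) =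
  (fun h => h^-1 *: (f (x, h *: (1 : R) + t) - f (x, t))).
  apply/funext => h; congr (_ *: (f _ - _)).
  by apply/pair_equal_spec; split => //=; rewrite scaler0 add0r.
split; first by move: d1; rewrite /derivable e.
by move: d2; rewrite /derive e.
Qed.

Lemma csmooth_derive1 (f : R * R -> R[i]) x t : csmooth f ->
  is_cderive (fun x => f (x, t)) x (dx f (x, t)).
Proof.
move=> sf; have [_ /(_ (x, t) (1, 0))[d1 d2]] := sf [::]; split.
  exact: (@is_derive_slice1 (fun q => complex.Re (f q)) _ _ _ (derivableP d1)).
exact: (@is_derive_slice1 (fun q => complex.Im (f q)) _ _ _ (derivableP d2)).
Qed.

Lemma csmooth_derive2 (f : R * R -> R[i]) x t : csmooth f ->
  is_cderive (fun t => f (x, t)) t (dt f (x, t)).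
Proof.
move=> sf; have [_ /(_ (x, t) (0, 1))[d1 d2]] := sf [::]; split.
  exact: (@is_derive_slice2 (fun q => complex.Re (f q)) _ _ _ (derivableP d1)).
exact: (@is_derive_slice2 (fun q => complex.Im (f q)) _ _ _ (derivableP d2)).
Qed.

Lemma schwartz2_ccontinuous (f : R * R -> R[i]) : schwartz f -> ccontinuous f.
Proof. by move=> [sf _]; have [] := sf [::]. Qed.

Lemma schwartz2_measurable (f : R * R -> R[i]) : schwartz f -> cmeasurable f.
Proof. by move=> /schwartz2_ccontinuous; exact: ccontinuous_measurable2. Qed.

Lemma schwartz2_bounded (f : R * R -> R[i]) : schwartz f -> exists M, forall x, cmod (f x) <= M.
Proof.
by move=> [_ /(_ [::] 0%N)[M h]]; exists M => x; have := h x; rewrite expr0 mul1r.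
Qed.

(** A product majorant, so that integrability on the plane and on every slice follows from one
    integral on the line. *)
Definition bump2 (p : R * R) : R := (1 + p.1 ^+ 2)^-1 * (1 + p.2 ^+ 2)^-1.

Lemma schwartz2_bound (f : R * R -> R[i]) : schwartz f ->
  exists M, forall p, cmod (f p) <= M * bump2 p.
Proof.
move=> [_ bf]; have [M0 h0] := bf [::] 0%N; have [M2 h2] := bf [::] 2%N.
have [M4 h4] := bf [::] 4%N.
(* The reciprocal of [bump2 p] is at most [(1 + |p|^2)^2] for the maximum norm; expanding the square
   calls for the decay orders 0, 2 and 4. *)
exists (M0 + 2 * M2 + M4) => p; rewrite /bump2 -invfM.
have a0 : 0 < 1 + p.1 ^+ 2 by rewrite ltr_pwDl// sqr_ge0.
have b0 : 0 < 1 + p.2 ^+ 2 by rewrite ltr_pwDl// sqr_ge0.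
rewrite ler_pdivlMr ?mulr_gt0//.
have l1 : p.1 ^+ 2 <= `|p| ^+ 2.
  by rewrite -[leLHS]real_normK ?num_real// lerXn2r ?nnegrE// norm_fst_le.
have l2 : p.2 ^+ 2 <= `|p| ^+ 2.
  by rewrite -[leLHS]real_normK ?num_real// lerXn2r ?nnegrE// norm_snd_le.
apply: (@le_trans _ _ (cmod (f p) * (1 + `|p| ^+ 2) ^+ 2)).
  by rewrite ler_wpM2l ?cmod_ge0// expr2 ler_pM ?lerD2l// ltW.
have -> : cmod (f p) * (1 + `|p| ^+ 2) ^+ 2 = `|p| ^+ 0 * cmod (f p) +
  2 * (`|p| ^+ 2 * cmod (f p)) + `|p| ^+ 4 * cmod (f p) by ring.
by apply: lerD; [apply: lerD; [exact: h0|rewrite ler_wpM2l//; exact: h2]|exact: h4].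
Qed.

Lemma inv1sq1_integrable : mu.-integrable setT (EFin \o (fun x : R => (1 + x ^+ 2)^-1)).
Proof.
have := @inv1sq_integrable R 1 ltr01.
by rewrite /comp; under eq_fun do rewrite mul1r.
Qed.

Lemma bump2_cintegrable (f : R * R -> R[i]) (M : R) : cmeasurable f ->
  (forall p, cmod (f p) <= M * bump2 p) -> cintegrable leb2 f.
Proof.
move=> mf fM.
apply: (@leb2_le_cintegrable _ f (fun x => M * (1 + x ^+ 2)^-1) (fun x => (1 + x ^+ 2)^-1)) => //.
- rewrite /comp; under eq_fun do rewrite EFinM.
  by apply: integrableZl => //; exact: inv1sq1_integrable.
- exact: inv1sq1_integrable.
- by move=> x y; rewrite (le_trans (fM _))// /bump2 mulrA.
Qed.

Lemma schwartz2_integrable (f : R * R -> R[i]) : schwartz f -> cintegrable leb2 f.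
Proof.
move=> sf; have [M fM] := schwartz2_bound sf.
exact: bump2_cintegrable (schwartz2_measurable sf) fM.
Qed.

Lemma bump2_slice1 (p1 p2 : R) : bump2 (p1, p2) <= (1 + p1 ^+ 2)^-1.
Proof.
rewrite /bump2 /= -[leRHS]mulr1 ler_wpM2l ?invr_ge0 ?addr_ge0 ?sqr_ge0//.
by rewrite invf_le1 ?ltr_pwDl ?sqr_ge0// lerDl sqr_ge0.
Qed.

Lemma bump2_slice2 (p1 p2 : R) : bump2 (p1, p2) <= (1 + p2 ^+ 2)^-1.
Proof. by have := bump2_slice1 p2 p1; rewrite /bump2 /= mulrC. Qed.

Lemma schwartz_slice1_integrable (f : R * R -> R[i]) (t : R) : schwartz f ->
  cintegrable mu (fun x => f (x, t)).
Proof.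
move=> sf; have [M fM] := schwartz2_bound sf.
have M0 : 0 <= M.
  have := fM (0, 0); rewrite /bump2 /= expr0n addr0 invr1 !mulr1; exact/le_trans/cmod_ge0.
apply: (@le_inv1sq_integrable _ _ M).
  have [[c1 c2] mf] := (schwartz2_ccontinuous sf, schwartz2_measurable sf).
  apply: ccontinuous_measurable; apply: is_cderive_ccontinuous => x.
  exact: csmooth_derive1 (proj1 sf).
by move=> x; rewrite (le_trans (fM _))// ler_wpM2l// bump2_slice1.
Qed.

Lemma schwartz_slice2_integrable (f : R * R -> R[i]) (x : R) : schwartz f ->
  cintegrable mu (fun t => f (x, t)).
Proof.
move=> sf; have [M fM] := schwartz2_bound sf.
have M0 : 0 <= M.
  have := fM (0, 0); rewrite /bump2 /= expr0n addr0 invr1 !mulr1; exact/le_trans/cmod_ge0.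
apply: (@le_inv1sq_integrable _ _ M).
  apply: ccontinuous_measurable; apply: is_cderive_ccontinuous => t.
  exact: csmooth_derive2 (proj1 sf).
by move=> t; rewrite (le_trans (fM _))// ler_wpM2l// bump2_slice2.
Qed.

(** Partial transforms. The one taken in the variable of a derivative is made the inner one, so that
    the one-dimensional rule applies to it. *)
Definition fourier_x (f : R * R -> R[i]) (xi t : R) := fourier1 (fun x => f (x, t)) xi.
Definition fourier_t (f : R * R -> R[i]) (tau x : R) := fourier1 (fun t => f (x, t)) tau.

Lemma fourier2_xt (f : R * R -> R[i]) (xi tau : R) : schwartz f ->
  fourier2 f (xi, tau) = fourier1 (fourier_x f xi) tau.
Proof.
move=> sf; have fi := schwartz2_integrable sf.
rewrite fourier2E (leb2_fubini2 (cintegrable_fourier2 _ fi)).2 fourier1E.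
apply: eq_cintegral => t; rewrite /fourier_x fourier1E.
rewrite -(cintegralZ _ (cintegrable_fourier xi (schwartz_slice1_integrable t sf))).
by apply: eq_cintegral => x; rewrite /phase /= opprD cisD mulrA (mulrC (cis _) (cis _)).
Qed.

Lemma fourier2_tx (f : R * R -> R[i]) (xi tau : R) : schwartz f ->
  fourier2 f (xi, tau) = fourier1 (fourier_t f tau) xi.
Proof.
move=> sf; have fi := schwartz2_integrable sf.
rewrite fourier2E (leb2_fubini1 (cintegrable_fourier2 _ fi)).2 fourier1E.
apply: eq_cintegral => x; rewrite /fourier_t fourier1E.
rewrite -(cintegralZ _ (cintegrable_fourier tau (schwartz_slice2_integrable x sf))).
by apply: eq_cintegral => t; rewrite /phase /= opprD cisD mulrA.
Qed.

Lemma schwartz_slice1_ccontinuous (f : R * R -> R[i]) t : schwartz f -> ccontinuous (fun x : R => f (x, t)).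
Proof. by move=> sf; apply: is_cderive_ccontinuous => x; exact: csmooth_derive1 (proj1 sf). Qed.

Lemma schwartz_slice2_ccontinuous (f : R * R -> R[i]) x : schwartz f -> ccontinuous (fun t : R => f (x, t)).
Proof. by move=> sf; apply: is_cderive_ccontinuous => t; exact: csmooth_derive2 (proj1 sf). Qed.

Lemma bump2_ge0 p : 0 <= bump2 p.
Proof. by rewrite mulr_ge0// invr_ge0 addr_ge0// sqr_ge0. Qed.

Lemma schwartz2_slices (f : R * R -> R[i]) : schwartz f -> exists2 M, 0 <= M &
  [/\ forall x t, cmod (f (x, t)) <= M * (1 + t ^+ 2)^-1 * (1 + x ^+ 2)^-1,
      forall x t, cmod (f (x, t)) <= M * (1 + x ^+ 2)^-1 &
      forall x t, cmod (f (x, t)) <= M * (1 + t ^+ 2)^-1].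
Proof.
move=> sf; have [M fM] := schwartz2_bound sf.
have M0 : 0 <= M.
  have := fM (0, 0); rewrite /bump2 /= expr0n addr0 invr1 !mulr1; exact/le_trans/cmod_ge0.
exists M => //; split => x t; rewrite (le_trans (fM _))//.
- by rewrite /bump2 /= -mulrA (mulrC (1 + t ^+ 2)^-1).
- by rewrite ler_wpM2l// bump2_slice1.
- by rewrite ler_wpM2l// bump2_slice2.
Qed.

Lemma cmeasurable_fourier_x (f : R * R -> R[i]) xi : cmeasurable f -> cmeasurable (fourier_x f xi).
Proof.
move=> mf; rewrite (_ : fourier_x f xi = fun t => cintegral mu (fun x : R => cis (- (x * xi)) * f (x, t))).
  apply: (@cmeasurable_leb2 _ (fun p : R * R => cis (- (p.1 * xi)) * f p)).
  apply: cmeasurableM => //; apply: cmeasurable_cis; apply: measurable_funN.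
  by apply: measurable_funM => //; exact: measurable_fst.
by apply/funext => t; exact: fourier1E.
Qed.

Lemma cmeasurable_fourier_t (f : R * R -> R[i]) tau : cmeasurable f -> cmeasurable (fourier_t f tau).
Proof.
move=> mf; rewrite (_ : fourier_t f tau = fun x => cintegral mu (fun t : R => cis (- (t * tau)) * f (x, t))).
  apply: (@cmeasurable_leb1 _ (fun p : R * R => cis (- (p.2 * tau)) * f p)).
  apply: cmeasurableM => //; apply: cmeasurable_cis; apply: measurable_funN.
  by apply: measurable_funM => //; exact: measurable_snd.
by apply/funext => t; exact: fourier1E.
Qed.

Lemma fourier_x_le (f : R * R -> R[i]) : schwartz f ->
  exists M, forall xi t, cmod (fourier_x f xi t) <= M * (1 + t ^+ 2)^-1.
Proof.
move=> sf; have [M M0 [fM _ _]] := schwartz2_slices sf.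
exists (2 * (M * pi)) => xi t.
have -> : 2 * (M * pi) * (1 + t ^+ 2)^-1 = 2 * (M * (1 + t ^+ 2)^-1 * pi) by ring.
rewrite /fourier_x fourier1E; apply: cmod_cintegral_inv1sq.
  exact: (cintegrable_measurable (cintegrable_fourier xi (schwartz_slice1_integrable t sf))).
by move=> x; rewrite cmodM cmod_cis mul1r.
Qed.

Lemma fourier_t_le (f : R * R -> R[i]) : schwartz f ->
  exists M, forall tau x, cmod (fourier_t f tau x) <= M * (1 + x ^+ 2)^-1.
Proof.
move=> sf; have [M M0 [fM _ _]] := schwartz2_slices sf.
exists (2 * (M * pi)) => tau x.
have -> : 2 * (M * pi) * (1 + x ^+ 2)^-1 = 2 * (M * (1 + x ^+ 2)^-1 * pi) by ring.
rewrite /fourier_t fourier1E; apply: cmod_cintegral_inv1sq.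
  exact: (cintegrable_measurable (cintegrable_fourier tau (schwartz_slice2_integrable x sf))).
by move=> t; rewrite cmodM cmod_cis mul1r mulrAC.
Qed.

Lemma fourier_x_integrable (f : R * R -> R[i]) xi : schwartz f -> cintegrable mu (fourier_x f xi).
Proof.
move=> sf; have [M fM] := fourier_x_le sf.
exact: le_inv1sq_integrable (cmeasurable_fourier_x xi (schwartz2_measurable sf)) (fM xi).
Qed.

Lemma fourier_t_integrable (f : R * R -> R[i]) tau : schwartz f -> cintegrable mu (fourier_t f tau).
Proof.
move=> sf; have [M fM] := fourier_t_le sf.
exact: le_inv1sq_integrable (cmeasurable_fourier_t tau (schwartz2_measurable sf)) (fM tau).
Qed.

Lemma fourier_x_dx (f : R * R -> R[i]) (xi t : R) : schwartz f ->
  fourier_x (dx f) xi t = 'i%C * xi%:C * fourier_x f xi t.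
Proof.
move=> sf; have sdf : schwartz (dx f) by exact: schwartz_deriv.
have [M M0 [_ fM _]] := schwartz2_slices sf; have [M' M'0 [_ fM' _]] := schwartz2_slices sdf.
apply: (@fourier1_deriv _ (fun x => f (x, t)) (fun x => dx f (x, t)) M M') => //.
- by move=> x; exact: csmooth_derive1 (proj1 sf).
- exact: schwartz_slice1_ccontinuous.
Qed.

Lemma fourier_t_dt (f : R * R -> R[i]) (tau x : R) : schwartz f ->
  fourier_t (dt f) tau x = 'i%C * tau%:C * fourier_t f tau x.
Proof.
move=> sf; have sdf : schwartz (dt f) by exact: schwartz_deriv.
have [M M0 [_ _ fM]] := schwartz2_slices sf; have [M' M'0 [_ _ fM']] := schwartz2_slices sdf.
apply: (@fourier1_deriv _ (fun t => f (x, t)) (fun t => dt f (x, t)) M M') => //.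
- by move=> t; exact: csmooth_derive2 (proj1 sf).
- exact: schwartz_slice2_ccontinuous.
Qed.

Lemma fourier1Z (z : R[i]) (f : R -> R[i]) xi : cintegrable mu f ->
  fourier1 (fun x => z * f x) xi = z * fourier1 f xi.
Proof.
move=> fi; rewrite !fourier1E -(cintegralZ _ (cintegrable_fourier xi fi)).
by apply: eq_cintegral => x; rewrite mulrCA.
Qed.

Lemma fourier2_dx (f : R * R -> R[i]) k : schwartz f ->
  fourier2 (dx f) k = 'i%C * k.1%:C * fourier2 f k.
Proof.
case: k => xi tau sf; have sdf : schwartz (dx f) by exact: schwartz_deriv.
rewrite !fourier2_xt// -fourier1Z; last exact: fourier_x_integrable.
by congr fourier1; apply/funext => t; exact: fourier_x_dx.
Qed.

Lemma fourier2_dt (f : R * R -> R[i]) k : schwartz f ->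
  fourier2 (dt f) k = 'i%C * k.2%:C * fourier2 f k.
Proof.
case: k => xi tau sf; have sdf : schwartz (dt f) by exact: schwartz_deriv.
rewrite !fourier2_tx// -fourier1Z; last exact: fourier_t_integrable.
by congr fourier1; apply/funext => t; exact: fourier_t_dt.
Qed.

Lemma schwartz_dx (f : R * R -> R[i]) : schwartz f -> schwartz (dx f).
Proof. exact: schwartz_deriv. Qed.
Lemma schwartz_dt (f : R * R -> R[i]) : schwartz f -> schwartz (dt f).
Proof. exact: schwartz_deriv. Qed.

Lemma fourier2_bounded (f : R * R -> R[i]) : cintegrable leb2 f ->
  exists M, forall k, cmod (fourier2 f k) <= M.
Proof.
move=> fi; have [M fM] := cmod_ifourier2_le fi; exists M => k.
have := fM (- k.1, - k.2); rewrite fourier2E; congr (cmod _ <= _).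
by apply: eq_cintegral => p; congr (cis _ * _); rewrite /phase /=; ring.
Qed.

(** Two derivatives in [x], two in [t], and all four together multiply the modulus of the transform
    by [k1^2], [k2^2] and [k1^2 k2^2]. With the plain sup bound these are the terms of
    [(1 + k1^2) (1 + k2^2)]. *)
Lemma schwartz_fourier2_le (f : R * R -> R[i]) : schwartz f ->
  exists M, forall k, cmod (fourier2 f k) <= M * bump2 k.
Proof.
move=> sf; have [M0 h0] := fourier2_bounded (schwartz2_integrable sf).
have sx := schwartz_dx (schwartz_dx sf); have st := schwartz_dt (schwartz_dt sf).
have sxt := schwartz_dx (schwartz_dx st).
have [M1 h1] := fourier2_bounded (schwartz2_integrable sx).
have [M2 h2] := fourier2_bounded (schwartz2_integrable st).
have [M3 h3] := fourier2_bounded (schwartz2_integrable sxt).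
exists (M0 + M1 + M2 + M3) => k.
have a0 : 0 < 1 + k.1 ^+ 2 by rewrite ltr_pwDl// sqr_ge0.
have b0 : 0 < 1 + k.2 ^+ 2 by rewrite ltr_pwDl// sqr_ge0.
rewrite /bump2 -invfM ler_pdivlMr ?mulr_gt0//.
have ci (x : R) : cmod ('i%C * x%:C) = `|x| by rewrite cmodM cmodi mul1r cmodR.
have nn (x : R) : `|x| * `|x| = x ^+ 2 by rewrite -expr2 real_normK ?num_real.
have ex g : schwartz g -> cmod (fourier2 (dx (dx g)) k) = k.1 ^+ 2 * cmod (fourier2 g k).
  by move=> sg; rewrite (fourier2_dx k (schwartz_dx sg)) (fourier2_dx k sg) !(cmodM, cmodi, cmodR) !mul1r mulrA nn.
have et g : schwartz g -> cmod (fourier2 (dt (dt g)) k) = k.2 ^+ 2 * cmod (fourier2 g k).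
  by move=> sg; rewrite (fourier2_dt k (schwartz_dt sg)) (fourier2_dt k sg) !(cmodM, cmodi, cmodR) !mul1r mulrA nn.
have g0 := h0 k; have g1 := h1 k; have g2 := h2 k; have g3 := h3 k.
rewrite (ex _ sf) in g1; rewrite (et _ sf) in g2; rewrite (ex _ st) (et _ sf) mulrA in g3.
have -> : cmod (fourier2 f k) * ((1 + k.1 ^+ 2) * (1 + k.2 ^+ 2)) =
  cmod (fourier2 f k) + k.1 ^+ 2 * cmod (fourier2 f k) + k.2 ^+ 2 * cmod (fourier2 f k) +
  k.1 ^+ 2 * (k.2 ^+ 2) * cmod (fourier2 f k) by ring.
exact: lerD (lerD (lerD g0 g1) g2) g3.
Qed.

Lemma cmeasurable_fourier2 (f : R * R -> R[i]) : cintegrable leb2 f -> cmeasurable (fourier2 f).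
Proof.
move=> fi; have [c1 c2] := ccontinuous_ifourier2 fi.
have mi : cmeasurable (ifourier2 f) by exact: ccontinuous_measurable2.
have -> : fourier2 f = fun k => ifourier2 f (- k.1, - k.2).
  apply/funext => k; rewrite fourier2E.
  by apply: eq_cintegral => p; congr (cis _ * _); rewrite /phase /=; ring.
apply: (cmeasurable_comp mi); apply: measurable_fun_pair; apply: measurable_funN => //.
Qed.

Lemma schwartz_fourier2_integrable (f : R * R -> R[i]) : schwartz f -> cintegrable leb2 (fourier2 f).
Proof.
move=> sf; have [M fM] := schwartz_fourier2_le sf.
by apply: (bump2_cintegrable _ fM); exact: cmeasurable_fourier2 (schwartz2_integrable sf).
Qed.

(** The mean value theorem is applied to each part, hence the factor 2. *)
Lemma cmvt (f f' : R -> R[i]) (M : R) (a b : R) :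
  (forall x, is_cderive f x (f' x)) -> (forall x, cmod (f' x) <= M) ->
  cmod (f b - f a) <= 2 * (M * `|b - a|).
Proof.
wlog ab : a b / a <= b => [h|] df fM.
  have [/h|/ltW/h] := leP a b; first exact.
  by rewrite cmodBC distrC; exact.
have M0 : 0 <= M by exact: le_trans (cmod_ge0 _) (fM 0).
have h (g g' : R -> R) : (forall x : R, is_derive x (1 : R) g (g' x)) -> (forall x, `|g' x| <= M) ->
    `|g b - g a| <= M * `|b - a|.
  move=> dg gM; move: ab; rewrite le_eqVlt => /predU1P[->|ab]; first by rewrite !subrr normr0 mulr0.
  have [c _ ->] := @MVT R g g' a b ab (fun x _ => dg x) (continuous_subspaceT (is_derive_continuous dg)).
  by rewrite normrM ler_wpM2r.
rewrite mulr_natl mulr2n; apply: le_cmod_ReIm; rewrite ?ReB ?ImB.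
  apply: (h (fun x => complex.Re (f x)) (fun x => complex.Re (f' x))) => x; first by have [] := df x.
  exact: le_trans (norm_Re_le _) (fM x).
apply: (h (fun x => complex.Im (f x)) (fun x => complex.Im (f' x))) => x; first by have [] := df x.
exact: le_trans (norm_Im_le _) (fM x).
Qed.

(** Continuity in [t] is what the one-dimensional inversion asks of the partial transform in
    [schwartz2_inversion]. *)
Lemma fourier_x_ccvg (f : R * R -> R[i]) xi t : schwartz f ->
  ccvg (nbhs t) (fourier_x f xi) (fourier_x f xi t).
Proof.
move=> sf; have sdf := schwartz_dt sf.
have [M M0 [_ fM _]] := schwartz2_slices sdf.
have i1 t := cintegrable_fourier xi (schwartz_slice1_integrable t sf).
apply: (@ccvg_le _ _ _ _ _ _ (fun s => 4 * M * pi * `|s - t|)).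
  apply: nearW => s; rewrite /fourier_x !fourier1E -(cintegralB (i1 s) (i1 t)).
  have -> : 4 * M * pi * `|s - t| = 2 * (2 * M * `|s - t| * pi) by ring.
  apply: cmod_cintegral_inv1sq.
    exact: (cintegrable_measurable (cintegrableB (i1 s) (i1 t))).
  move=> x; rewrite -mulrBr cmodM cmod_cis mul1r.
  have := @cmvt (fun t => f (x, t)) (fun t => dt f (x, t)) (M * (1 + x ^+ 2)^-1) t s.
  move=> /(_ (fun t => csmooth_derive2 x t (proj1 sf)) (fun t => fM x t)) /le_trans; apply.
  by rewrite le_eqVlt; apply/orP; left; apply/eqP; ring.
rewrite -(mulr0 (4 * M * pi)); apply: cvgM; first exact: cvg_cst.
by apply/norm_cvg0P; apply/subr_cvg0; exact: cvg_id.
Qed.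

(** The inversion on the line is used twice: in [tau] at each fixed [xi], for the partial transform
    in [x], and then in [xi] at fixed [t]. *)
Lemma schwartz2_inversion (f : R * R -> R[i]) p : schwartz f ->
  ifourier2 (fourier2 f) p = ((2 * pi) ^+ 2)%:C * f p.
Proof.
case: p => x t sf; have iF := schwartz_fourier2_integrable sf.
have [M fM] := schwartz_fourier2_le sf.
have mF := cintegrable_measurable iF.
have M0 : 0 <= M.
  have := fM (0, 0); rewrite /bump2 /= expr0n addr0 invr1 !mulr1; exact/le_trans/cmod_ge0.
rewrite /ifourier2 (leb2_fubini1 (cintegrable_ifourier2 _ iF)).2.
have iFxi xi : cintegrable mu (fun tau => fourier2 f (xi, tau)).
  apply: (@le_inv1sq_integrable _ _ M); first exact: (cmeasurable_pair1 xi mF).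
  by move=> tau; rewrite (le_trans (fM _))// ler_wpM2l// bump2_slice2.
have e xi : fourier1 (fourier_x f xi) = fun tau => fourier2 f (xi, tau).
  by apply/funext => tau; rewrite fourier2_xt.
have inner xi : cintegral mu (fun tau : R => cis (phase (x, t) (xi, tau)) * fourier2 f (xi, tau)) =
    (2 * pi)%:C * (cis (x * xi) * fourier1 (fun x => f (x, t)) xi).
  have := @fourier1_inversion R (fourier_x f xi) t (fourier_x_integrable xi sf).
  rewrite e => /(_ (iFxi xi) (fourier_x_ccvg xi t sf)) E.
  rewrite mulrCA -[X in _ = _ * X]E -(cintegralZ _ (cintegrable_ifourier t (iFxi xi))).
  by apply: eq_cintegral => tau; rewrite /phase /= cisD mulrA.
transitivity (cintegral mu (fun xi : R => (2 * pi)%:C * (cis (x * xi) * fourier1 (fun x => f (x, t)) xi))).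
  by apply: eq_cintegral => xi; exact: inner.
have sx := schwartz_dx (schwartz_dx sf).
have if1 := schwartz_slice1_integrable t sf.
(* Two derivatives in [x] give the decay in [xi]. *)
have iF1 : cintegrable mu (fourier1 (fun x => f (x, t))).
  have [A hA] := fourier_x_le sf; have [B hB] := fourier_x_le sx.
  apply: (@le_inv1sq_integrable _ _ ((A + B) * (1 + t ^+ 2)^-1)).
    exact: cmeasurable_fourier1 (cintegrable_measurable if1).
  move=> xi; rewrite ler_pdivlMr ?ltr_pwDl ?sqr_ge0// mulrDr mulr1 mulrDl lerD//; first exact: hA.
  have := hB xi t; rewrite !fourier_x_dx//; last exact: schwartz_dx.
  by rewrite !cmodM cmodi !mul1r cmodR mulrA -expr2 real_normK ?num_real// mulrC.
rewrite (cintegralZ _ (cintegrable_ifourier x iF1)).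
have -> : ((2 * pi) ^+ 2)%:C = (2 * pi)%:C * (2 * pi)%:C :> R[i] by rewrite -rmorphM expr2.
rewrite -[RHS]mulrA; congr (_ * _).
apply: (@fourier1_inversion R (fun x => f (x, t)) x if1 iF1).
by apply: ccontinuous_ccvg; exact: schwartz_slice1_ccontinuous.
Qed.

Lemma leb2_swap (g : R * R -> R * R -> R[i]) (a b : R * R -> R) :
  cmeasurable (fun z : (R * R) * (R * R) => g z.1 z.2) ->
  leb2.-integrable setT (EFin \o a) -> leb2.-integrable setT (EFin \o b) ->
  (forall p k, cmod (g p k) <= a p * b k) ->
  cintegral leb2 (fun p => cintegral leb2 (g p)) =
  cintegral leb2 (fun k => cintegral leb2 (g ^~ k)).
Proof.
move=> mg ia ib gab.
exact: (@cfubini_prod_swap _ _ _ mu g a b).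
Qed.

Lemma tempered2_bounded (u : R * R -> R[i]) (M : R) : cmeasurable u ->
  (forall x, cmod (u x) <= M) -> tempered2 u.
Proof.
move=> mu_ uM; split => // phi /schwartz2_integrable ip.
exact: (@cintegrableMl _ _ _ leb2 phi u M mu_ uM ip).
Qed.

Lemma tempered2_integrable (U : R * R -> R[i]) : cintegrable leb2 U -> tempered2 U.
Proof.
move=> iU; split; first exact: cintegrable_measurable iU.
move=> phi sphi; have [M pM] := schwartz2_bounded sphi.
exact: (@cintegrableMr _ _ _ leb2 U phi M (schwartz2_measurable sphi) pM iU).
Qed.

Lemma measurable_phase_pair : measurable_fun setT (fun z : (R * R) * (R * R) => phase z.1 z.2).
Proof.
apply: measurable_funD; apply: measurable_funM; apply: measurableT_comp => //;
  by [exact: measurable_fst|exact: measurable_snd].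
Qed.

(* the pairing identity, with the kernel [exp(i p.k)] moved from [U] to [phi] *)
Lemma ifourier2_pairing (U phi : R * R -> R[i]) :
  cintegrable leb2 U -> cintegrable leb2 phi ->
  cintegral leb2 (fun p => ifourier2 U p * phi p) =
  cintegral leb2 (fun k => U k * ifourier2 phi k).
Proof.
move=> iU ip; have mU := cintegrable_measurable iU; have mp := cintegrable_measurable ip.
have := @leb2_swap (fun p k => cis (phase p k) * U k * phi p) (fun p => cmod (phi p)) (fun k => cmod (U k)).
move=> /(_ _ (cintegrable_cmod ip) (cintegrable_cmod iU)) H.
transitivity (cintegral leb2 (fun p => cintegral leb2 (fun k => cis (phase p k) * U k * phi p))).
  by apply: eq_cintegral => p; rewrite (cintegralZr _ (cintegrable_ifourier2 p iU)).
rewrite H; last 2 first.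
- apply: cmeasurableM; last exact: (cmeasurable_comp mp measurable_fst).
  apply: cmeasurableM; last exact: (cmeasurable_comp mU measurable_snd).
  by apply: cmeasurable_cis; exact: measurable_phase_pair.
- by move=> p k; rewrite !cmodM cmod_cis mul1r mulrC.
apply: eq_cintegral => k; rewrite -(cintegralZ _ (cintegrable_ifourier2 k ip)).
by apply: eq_cintegral => p; rewrite /phase (mulrC k.1) (mulrC k.2); ring.
Qed.

Lemma is_fourier2_ifourier2 (U : R * R -> R[i]) : cintegrable leb2 U ->
  is_fourier2 (fun p => ((2 * pi) ^- 2)%:C * ifourier2 U p) U.
Proof.
move=> iU; have mi : cmeasurable (ifourier2 U) := ccontinuous_measurable2 (ccontinuous_ifourier2 iU).
have [M UM] := cmod_ifourier2_le iU.
split.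
- apply: (@tempered2_bounded _ (cmod ((2 * pi) ^- 2)%:C * M)).
    by apply: cmeasurableM => //; exact: cmeasurable_cst.
  by move=> x; rewrite cmodM ler_wpM2l// cmod_ge0.
- exact: tempered2_integrable.
- move=> phi sphi; have ip := schwartz_fourier2_integrable sphi.
  have [_ tU] := tempered2_integrable iU; have Up := tU _ sphi.
  have Z : ((2 * pi) ^- 2)%:C * ((2 * pi) ^+ 2)%:C = 1 :> R[i].
    by apply: realc_invK; rewrite expf_neq0// twopi_neq0.
  transitivity (((2 * pi) ^- 2)%:C * cintegral leb2 (fun k => ((2 * pi) ^+ 2)%:C * (U k * phi k))).
    by rewrite (cintegralZ _ Up) mulrA Z mul1r.
  have H := @cintegrableMl _ _ _ leb2 _ _ M mi UM ip.
  transitivity (((2 * pi) ^- 2)%:C * cintegral leb2 (fun p => ifourier2 U p * fourier2 phi p)).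
    congr (_ * _); rewrite ifourier2_pairing//; apply: eq_cintegral => k.
    by rewrite schwartz2_inversion// mulrCA.
  by rewrite -(cintegralZ _ H); apply: eq_cintegral => p; rewrite mulrA.
Qed.

End PlaneFourier.

(** * Test functions built from polynomials and exponentials *)

Section TestFunctions.
Context {R : realType}.
Local Notation mu := (@lebesgue_measure R).
Implicit Types p q : {poly R}.

(** A family stable under differentiation, so that smoothness is immediate; as soon as [q] dominates
    the square, its members are Schwartz functions. *)
Definition polyexpr p q (y : R) : R := p.[y] * expR (- q.[y]).

Lemma is_derive_horner p (y : R) : is_derive y (1 : R) (fun x => p.[x]) p^`().[y].
Proof.
split; first exact: derivable_horner.
by rewrite -derive1E derivE.
Qed.

Lemma is_derive_polyexpr p q (y v : R) :
  is_derive y v (polyexpr p q) (polyexpr (v *: (p^`() - p * q^`())) q y).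
Proof.
have d1 : is_derive y (1 : R) (polyexpr p q) (polyexpr (p^`() - p * q^`()) q y).
  have dN := is_deriveN (is_derive_horner q y).
  have dE : is_derive y (1 : R) (fun x => expR (- q.[x])) (- q^`().[y] * expR (- q.[y])).
    apply: is_derive_eq; rewrite /GRing.scale /=; ring.
  apply: is_derive_eq (is_deriveM (is_derive_horner p y) dE) _.
  by rewrite /polyexpr hornerD hornerN hornerM /GRing.scale /=; ring.
have df : differentiable (polyexpr p q) y by apply/derivable1_diffP; have [] := d1.
split; first exact: diff_derivable.
rewrite deriveE// -[v]mulr1 [LHS]linearZ -deriveE//; have [_ ->] := d1.
by rewrite /polyexpr hornerZ mulr1 -mulrA.
Qed.

Definition cpolyexp p q (y : R) : R[i] := (polyexpr p q y)%:C.

Lemma is_derive_cst0 (y v : R) : is_derive y v (fun _ : R => 0 : R) 0.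
Proof. exact: is_derive_cst. Qed.

Lemma cderiv_cpolyexp p q v : cderiv v (cpolyexp p q) = cpolyexp (v *: (p^`() - p * q^`())) q.
Proof.
apply/funext => y; rewrite /cderiv /cpolyexp; apply: complexP => /=.
  by have [_ ->] := is_derive_polyexpr p q y v.
by have [_ ->] := is_derive_cst0 y v.
Qed.

Lemma cderivs_cpolyexp vs p q : exists p', cderivs vs (cpolyexp p q) = cpolyexp p' q.
Proof.
elim: vs => [|v vs [p' ih]]; first by exists p.
by rewrite /= ih cderiv_cpolyexp; eexists.
Qed.

Lemma csmooth_cpolyexp p q : csmooth (cpolyexp p q).
Proof.
move=> vs; have [p' ->] := cderivs_cpolyexp vs p q; split.
  split; last exact: cst_continuous.
  by apply: is_derive_continuous => y; exact: is_derive_polyexpr.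
by move=> y v; split => /=; [have [] := is_derive_polyexpr p' q y v|have [] := is_derive_cst0 y v].
Qed.

Lemma exprn_expRN_le (y : R) (k : nat) : `|y| ^+ k * expR (- y ^+ 2) <= (1 + k`! + k.+2`!)%:R.
Proof.
have y2 : 0 <= y ^+ 2 by rewrite sqr_ge0.
have e0 := expR_ge0 (- y ^+ 2); have e1 := expRN_le1 y2.
have b : `|y| ^+ k <= 1 + (y ^+ 2) ^+ k.
  have [l1|l1] := leP `|y| 1.
    by apply: ler_wpDr; [rewrite exprn_ge0|rewrite exprn_ile1].
  rewrite ler_wpDl// -[y ^+ 2]real_normK ?num_real// -exprM mulnC.
  by apply: ler_weXn2l; [exact: ltW|rewrite leq_pmulr].
apply: (@le_trans _ _ ((1 + (y ^+ 2) ^+ k) * expR (- y ^+ 2))); first by rewrite ler_wpM2r.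
rewrite mulrDl mul1r -addnA natrD lerD//.
apply: (le_trans (pow_expRN_le k y2)).
rewrite ler_pdivrMr ?ltr_pwDl ?sqr_ge0// ler_peMr// lerDl sqr_ge0//.
Qed.

Lemma polyexpr_le p q (k : nat) : (forall y, y ^+ 2 <= q.[y]) ->
  exists M, forall y, `|y| ^+ k * `|polyexpr p q y| <= M.
Proof.
move=> hq; exists (\sum_(i < size p) `|p`_i| * (1 + (k + i)`! + (k + i).+2`!)%:R) => y.
rewrite /polyexpr normrM (ger0_norm (expR_ge0 _)) horner_coef.
apply: (@le_trans _ _ (`|y| ^+ k * ((\sum_(i < size p) `|p`_i| * `|y| ^+ i) * expR (- y ^+ 2)))).
  rewrite ler_wpM2l ?exprn_ge0// ler_pM ?expR_ge0//.
    apply: (le_trans (ler_norm_sum _ _ _)); apply: ler_sum => i _.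
    by rewrite normrM normrX.
  by rewrite ler_expR lerN2.
rewrite mulr_suml mulr_sumr; apply: ler_sum => i _.
have -> : `|y| ^+ k * (`|p`_i| * `|y| ^+ i * expR (- y ^+ 2)) = `|p`_i| * (`|y| ^+ (k + i) * expR (- y ^+ 2)).
  by rewrite exprD; ring.
by rewrite ler_wpM2l// exprn_expRN_le.
Qed.

Lemma schwartz_cpolyexp p q : (forall y, y ^+ 2 <= q.[y]) -> schwartz (cpolyexp p q).
Proof.
move=> hq; split; first exact: csmooth_cpolyexp.
move=> vs k; have [p' ->] := cderivs_cpolyexp vs p q.
have [M hM] := polyexpr_le p' k hq; exists M => y.
by rewrite /cpolyexp cmodR.
Qed.

(* [gauss_bump c r n] tends to [exp(-y^2)] times the indicator of ]c-r, c+r[ *)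
Definition bump_poly (c r : R) (n : nat) : {poly R} :=
  'X^2 + ((('X - c%:P) * (r^-1)%:P) ^+ 2) ^+ n.

Lemma bump_polyE c r n y : (bump_poly c r n).[y] = y ^+ 2 + (((y - c) / r) ^+ 2) ^+ n.
Proof. by rewrite /bump_poly !(hornerE, horner_exp). Qed.

Lemma bump_poly_ge c r n y : y ^+ 2 <= (bump_poly c r n).[y].
Proof. by rewrite bump_polyE lerDl exprn_ge0// sqr_ge0. Qed.

(** The value [u = 1] is excluded because the limit there is [exp(-1)]; it corresponds to the end
    points of an interval. *)
Lemma expRN_exp_cvg (u : R) : 0 <= u -> u != 1 ->
  expR (- u ^+ n) @[n --> \oo] --> (if u < 1 then 1 else 0 : R).
Proof.
move=> u0 u1; case: ltP => [ul|ug].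
  have u0' : - u ^+ n @[n --> \oo] --> (- 0 : R).
    by apply: cvgN; apply: cvg_expr; rewrite ger0_norm.
  rewrite oppr0 in u0'; have := cvg_comp _ _ u0' (@continuous_expR R 0).
  by rewrite expR0.
have ug1 : 1 < u by rewrite lt_neqAle eq_sym u1.
have up : 0 < u by exact: lt_trans ug1.
apply: (@squeeze_cvgr _ _ _ _ (fun=> 0) (fun n => u^-1 ^+ n)).
- apply: nearW => n; rewrite expR_ge0 /= exprVn expRN lef_pV2 ?posrE ?expR_gt0 ?exprn_gt0//.
  by rewrite (le_trans _ (expR_ge1Dx _))// lerDr.
- exact: cvg_cst.
- by apply: cvg_expr; rewrite ger0_norm ?invr_ge0// invf_lt1.
Qed.

End TestFunctions.

(** * Uniqueness of the distributional transform *)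

Section Uniqueness.
Context {R : realType}.
Local Notation mu := (@lebesgue_measure R).

(** The primitive from minus infinity is constant, while its derivative is [g] almost everywhere by
    Lebesgue differentiation. *)
Lemma ae_zero_itv (g : R -> R) : mu.-integrable setT (EFin \o g) ->
  (forall a b, a < b -> \int[mu]_(x in `]a, b[) g x = 0) -> {ae mu, forall x, g x = 0}.
Proof.
move=> ig g0.
have ig' (A : set R) : measurable A -> mu.-integrable A (EFin \o g).
  by move=> mA; exact: (integrableS measurableT).
have loc : locally_integrable setT g by apply: open_integrable_locally => //; exact: openT.
have [N [mN N0 sN]] := FTC1Ny (fun y => ig' _ (measurable_itv `]-oo, y])) loc.
exists N; split => // x /= gx; apply: sN => /= -[_ Fx]; apply: gx; rewrite -Fx.
set F := (fun x : R => _).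
have cF a b : a < b -> F b = F a.
  move=> ab; apply/eqP; rewrite -subr_eq0 /F.
  have igb : mu.-integrable `]-oo, b] (EFin \o g) by exact: ig'.
  rewrite (Rintegral_itvB igb)//; last by rewrite bnd_simp ltW.
  by rewrite -Rintegral_itv_bndo_bndc ?g0//; apply: ig'.
have -> : F = fun=> F x.
  apply/funext => y; have [/cF //|/cF //|->//] := ltgtP x y.
by rewrite derive1_cst.
Qed.

(** The test functions [exp(- y^2 - ((y - c) / r)^(2 n))] tend, off two points, to [exp(- y^2)]
    times the indicator of the interval of centre [c] and radius [r]. Hence [g = w exp(- y^2)] has
    integral 0 over every bounded open interval. *)
Lemma test_ae_zero (w : R -> R) : measurable_fun setT w ->
  (forall p q, (forall y, y ^+ 2 <= q.[y]) -> mu.-integrable setT (EFin \o (fun y => w y * polyexpr p q y)) /\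
    \int[mu]_y (w y * polyexpr p q y) = 0) ->
  {ae mu, forall x, w x = 0}.
Proof.
move=> mw hw; pose g y := w y * polyexpr 1 'X^2 y.
have [ig _] : mu.-integrable setT (EFin \o g) /\ \int[mu]_y g y = 0.
  by apply: hw => y; rewrite hornerXn.
have mg : measurable_fun setT g.
  apply: measurable_funM => //; apply: continuous_measurable_fun.
  by apply: is_derive_continuous => y; exact: is_derive_polyexpr.
suff [N [mN N0 sN]] : {ae mu, forall x, g x = 0}.
  exists N; split => // x /= wx; apply: sN => /= gx; apply: wx.
  move/eqP: gx; rewrite /g /polyexpr hornerC mul1r mulf_eq0 => /orP[/eqP//|].
  by rewrite gt_eqF// expR_gt0.
apply: ae_zero_itv => // a b ab.
pose c := (a + b) / 2; pose r := (b - a) / 2.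
have r0 : 0 < r by rewrite divr_gt0 ?subr_gt0.
pose e n y := expR (- (((y - c) / r) ^+ 2) ^+ n).
have me n : measurable_fun setT (e n).
  have -> : e n = polyexpr 1 (((('X - c%:P) * (r^-1)%:P) ^+ 2) ^+ n).
    by apply/funext => y; rewrite /e /polyexpr !(hornerE, horner_exp).
  apply: continuous_measurable_fun.
  by apply: is_derive_continuous => y; exact: is_derive_polyexpr.
have ge n : \int[mu]_y (g y * e n y) = 0.
  have [_ <-] := hw 1 _ (bump_poly_ge c r n).
  congr Rintegral; apply/funext => y.
  by rewrite /g /polyexpr hornerXn hornerC !mul1r bump_polyE opprD expRD mulrA.
have e01 n y : 0 <= e n y <= 1.
  by rewrite expR_ge0 expRN_le1// exprn_ge0// sqr_ge0.
have itvE y : (((y - c) / r) ^+ 2 < 1) = (a < y < b).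
  rewrite -[X in _ < X](expr1n _ 2) -[X in X < _]real_normK ?num_real//.
  rewrite ltr_pXn2r ?nnegrE// normrM (gtr0_norm (_ : 0 < r^-1)) ?invr_gt0//.
  rewrite ltr_pdivrMr// mul1r ltr_norml /c /r.
  by apply/andP/andP => -[]; split; lra.
have itv1 y : ((y - c) / r) ^+ 2 = 1 -> y = a \/ y = b.
  move=> /eqP; rewrite sqrf_eq1 => /orP[]/eqP/(congr1 (fun z => z * r)).
    by rewrite divfK ?gt_eqF// mul1r /c /r => E; right; lra.
  by rewrite divfK ?gt_eqF// /c /r => E; left; lra.
pose G y := (g \_ `]a, b[%classic) y.
have mG : measurable_fun setT (EFin \o G).
  by apply/measurable_EFinP; apply: (measurable_restrictT _ (measurable_itv _)).1; exact: measurable_funTS.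
have mge n : measurable_fun setT (EFin \o (fun y => g y * e n y)).
  by apply/measurable_EFinP; exact: measurable_funM.
have f_f : {ae mu, forall y, setT y -> (g y * e n y)%:E @[n --> \oo] --> (G y)%:E}.
  exists [set a; b]; split; [exact: measurableU|by rewrite measureU0//; exact: lebesgue_measure_set1|].
  move=> y /= ny; apply: contrapT => yab; apply: ny => _.
  apply: cvg_EFin; first exact: nearW.
  rewrite (_ : G y = g y * (if ((y - c) / r) ^+ 2 < 1 then 1 else 0)); last first.
    rewrite itvE /G patchE; case: (boolP (a < y < b)) => h.
      by rewrite mem_set ?mulr1// /= in_itv.
    by rewrite memNset ?mulr0//= in_itv/=; apply/negP.
  apply: cvgM; first exact: cvg_cst.
  apply: expRN_exp_cvg; first by rewrite sqr_ge0.
  by apply/eqP => /itv1; exact: yab.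
have f_g : {ae mu, forall y n, setT y -> (`|(g y * e n y)%:E| <= `|g y|%:E)%E}.
  apply: aeW => y n _; rewrite lee_fin normrM ler_piMr//.
  by have /andP[h1 h2] := e01 n y; rewrite ger0_norm.
have [_ _ cv] := @dominated_convergence _ _ _ mu setT measurableT (fun n y => (g y * e n y)%:E)
  (fun y => (G y)%:E) (fun y => `|g y|%:E) mge mG f_f (integrable_norm ig) f_g.
have E : (\int[mu]_y (G y)%:E = 0)%E.
  apply: (cvg_unique _ cv); first exact: ereal_hausdorff.
  rewrite (_ : (fun n => _) = fun=> 0%E); first exact: cvg_cst.
  apply/funext => n; have := ge n; rewrite /Rintegral.
  move=> h; rewrite -[LHS]fineK ?h//.
  have ie : mu.-integrable setT (fun y => (g y * e n y)%:E).
    apply: (le_integrable measurableT _ _ ig).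
      exact: mge.
    move=> y _; rewrite /= lee_fin normrM ler_piMr//.
    by have /andP[h1 h2] := e01 n y; rewrite ger0_norm.
  exact: integrable_fin_num.
by rewrite Rintegral_mkcond /Rintegral /G E.
Qed.

Lemma tempered1_ae_zero (W : R -> R[i]) : tempered1 W ->
  (forall phi, schwartz phi -> cintegral mu (fun x => W x * phi x) = 0) ->
  {ae mu, forall x, W x = 0}.
Proof.
move=> [[mW1 mW2] tW] hW.
have h1 : {ae mu, forall x, complex.Re (W x) = 0}.
  apply: test_ae_zero => // p q /(schwartz_cpolyexp p) sp.
  have e : (fun y => complex.Re (W y) * polyexpr p q y) = (fun y => complex.Re (W y * cpolyexp p q y)).
    by apply/funext => y; rewrite ReM /cpolyexp /= mulr0 subr0.
  have [i1 _] := tW _ sp; have := hW _ sp => /(congr1 (@complex.Re R)) /= E.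
  by rewrite e; split.
have h2 : {ae mu, forall x, complex.Im (W x) = 0}.
  apply: test_ae_zero => // p q /(schwartz_cpolyexp p) sp.
  have e : (fun y => complex.Im (W y) * polyexpr p q y) = (fun y => complex.Im (W y * cpolyexp p q y)).
    by apply/funext => y; rewrite ImM /cpolyexp /= mulr0 add0r.
  have [_ i1] := tW _ sp; have := hW _ sp => /(congr1 (@complex.Im R)) /= E.
  by rewrite e; split.
have [N1 [m1 z1 s1]] := h1; have [N2 [m2 z2 s2]] := h2.
exists (N1 `|` N2); split; [exact: measurableU|by rewrite measureU0|].
move=> x /= Wx; apply: contrapT => /not_orP[n1 n2]; apply: Wx; apply: complexP.
  by apply: contrapT => r; apply: n1; exact: s1.
by apply: contrapT => r; apply: n2; exact: s2.
Qed.

Lemma is_fourier1_unique (u U V : R -> R[i]) : is_fourier1 u U -> is_fourier1 u V ->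
  {ae mu, forall x, U x = V x}.
Proof.
move=> [_ [mU tU] hU] [_ [mV tV] hV].
have E phi x : (U x - V x) * phi x = U x * phi x - V x * phi x by rewrite mulrBl.
have [N [mN N0 sN]] : {ae mu, forall x, U x - V x = 0}.
  apply: tempered1_ae_zero.
    split; first exact: cmeasurableB.
    by move=> phi sp; under eq_fun do rewrite E; apply: cintegrableB; [exact: tU|exact: tV].
  move=> phi sp; under eq_fun do rewrite E.
  by rewrite (cintegralB (tU _ sp) (tV _ sp)) hU// hV// subrr.
exists N; split => // x /= UV; apply: sN => /= /eqP; rewrite subr_eq0 => /eqP.
exact: UV.
Qed.

Lemma schwartz_is_fourier1 (f : R -> R[i]) : schwartz f -> is_fourier1 f (fourier1 f).
Proof.
move=> sf; have := is_fourier1_ifourier1 (schwartz_fourier_integrable sf).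
congr is_fourier1; apply/funext => x.
by rewrite schwartz_inversion// mulrA twopi_invK mul1r.
Qed.

End Uniqueness.

(** * Sobolev norms *)

Section L2.
Context d (T : measurableType d) {R : realType} (mu : {measure set T -> \bar R}).
Implicit Types f g : T -> R.

Lemma Lnorm2_sqr f : ('N[mu]_2%:E[EFin \o f] `^ 2 = \int[mu]_x (f x ^+ 2)%:E)%E.
Proof.
rewrite poweR_Lnorm//; apply: eq_integral => x _ /=.
by rewrite powR_mulrn// real_normK ?num_real.
Qed.

Lemma cauchy_schwarz f g : measurable_fun setT f -> measurable_fun setT g ->
  (forall x, 0 <= f x) -> (forall x, 0 <= g x) ->
  ((\int[mu]_x (f x * g x)%:E) `^ 2 <= (\int[mu]_x (f x ^+ 2)%:E) * (\int[mu]_x (g x ^+ 2)%:E))%E.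
Proof.
move=> mf mg f0 g0.
have h2 : (2^-1 + 2^-1 = 1 :> R)%R by lra.
have := @hoelder _ _ _ mu f g 2 2 mf mg (ltr0Sn _ _) (ltr0Sn _ _) h2.
have -> : ('N[mu]_1 [EFin \o (f \* g)%R] = \int[mu]_x (f x * g x)%:E)%E.
  by rewrite Lnorm1; apply: eq_integral => x _ /=; rewrite ger0_norm// mulr_ge0.
move=> H; rewrite -!Lnorm2_sqr -poweRM ?Lnorm_ge0//.
apply: gt0_ler_poweR => //; rewrite in_itv /= leey ?andbT.
  by apply: integral_ge0 => x _; rewrite lee_fin mulr_ge0.
by rewrite mule_ge0// Lnorm_ge0.
Qed.

Lemma Lnorm2_le_sqr (N A : \bar R) (C : R) : 0 <= C -> (0 <= N)%E -> (0 <= A)%E ->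
  (N `^ 2 <= (C ^+ 2)%:E * A `^ 2)%E -> (N <= C%:E * A)%E.
Proof.
move=> C0 N0 A0 h.
have K (x : \bar R) : (0 <= x)%E -> ((x `^ 2) `^ 2^-1 = x)%E.
  by move=> x0; rewrite -poweRrM mulfV// poweRe1.
rewrite -(K N N0) -(K (C%:E * A)%E) ?mule_ge0//.
apply: gt0_ler_poweR => //; rewrite ?in_itv /= ?leey ?andbT ?poweR_ge0//.
by rewrite poweRM// poweR_EFin powR_mulrn.
Qed.

End L2.

Section Sobolev.
Context {R : realType}.
Local Notation mu := (@lebesgue_measure R).

(** Estimates are proved on squared norms, which are plain integrals; [Hhat_sqr] converts. *)
Definition Hsq (s : R) (U : R -> R[i]) : \bar R := (\int[mu]_xi ((jap xi `^ s * cmod (U xi)) ^+ 2)%:E)%E.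

Definition Hhat (s : R) (U : R -> R[i]) : \bar R :=
  Lnorm mu 2%:E (fun xi => (jap xi `^ s * cmod (U xi))%:E).

Lemma Hhat_sqr s U : (Hhat s U `^ 2 = Hsq s U)%E.
Proof. exact: (Lnorm2_sqr mu (fun xi => jap xi `^ s * cmod (U xi))). Qed.

Lemma Hnorm_le s (u U : R -> R[i]) : is_fourier1 u U -> (Hnorm s u <= Hhat s U)%E.
Proof. by move=> uU; apply: ereal_inf_lbound; exists U. Qed.

Lemma Hnorm_ge0 s (u : R -> R[i]) : (0 <= Hnorm s u)%E.
Proof. by apply: le_ereal_inf_tmp => _ [U _ <-]; exact: Lnorm_ge0. Qed.

Lemma measurable_jap : measurable_fun setT (@jap R).
Proof.
apply: continuous_measurable_fun => x; apply: (@continuous_comp _ _ _ (fun x : R => 1 + x ^+ 2) Num.sqrt).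
  by apply: cvgD; [exact: cvg_cst|exact: exprn_continuous].
exact: sqrt_continuous.
Qed.

Lemma measurable_jap_powR (s : R) : measurable_fun setT (fun x : R => jap x `^ s).
Proof. exact: (measurableT_comp (measurable_powR s) measurable_jap). Qed.

Lemma ae_eq_Hhat s U V : cmeasurable U -> cmeasurable V -> {ae mu, forall x, U x = V x} ->
  Hhat s U = Hhat s V.
Proof.
move=> mU mV [N [mN N0 sN]].
have E : (Hsq s U = Hsq s V)%E.
  have m W : cmeasurable W -> measurable_fun setT (fun xi => ((jap xi `^ s * cmod (W xi)) ^+ 2)%:E).
    move=> mW; apply/measurable_EFinP; apply: measurable_funX; apply: measurable_funM.
      exact: measurable_jap_powR.
    exact: measurable_cmod.
  apply: ae_eq_integral => //; [exact: m|exact: m|].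
  exists N; split => // x /= h; apply: sN => /= e; apply: h => _; by rewrite e.
have K (x : \bar R) : (0 <= x)%E -> ((x `^ 2) `^ 2^-1 = x)%E.
  by move=> x0; rewrite -poweRrM mulfV// poweRe1.
by rewrite -[LHS]K ?Lnorm_ge0// -[RHS]K ?Lnorm_ge0// !Hhat_sqr E.
Qed.

(** The norm of the datum stands on the right of the estimates, where the infimum has to be bounded
    from below. By uniqueness every representative of the transform gives the same value. *)
Lemma Hnorm_schwartz s (h : R -> R[i]) : schwartz h -> Hnorm s h = Hhat s (fourier1 h).
Proof.
move=> sh; have fh := schwartz_is_fourier1 sh.
apply/eqP; rewrite eq_le Hnorm_le//=; apply: le_ereal_inf_tmp => _ [U hU <-].
rewrite -/(Hhat s U) (@ae_eq_Hhat s U (fourier1 h))//; first by have [_ []] := hU.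
  by have [_ []] := fh.
exact: is_fourier1_unique hU fh.
Qed.

Lemma Hnorm_multiplier s C (h u U : R -> R[i]) : 0 <= C -> schwartz h -> is_fourier1 u U ->
  (forall xi, xi != 0 -> cmod (U xi) <= C * cmod (fourier1 h xi)) ->
  (Hnorm s u <= C%:E * Hnorm s h)%E.
Proof.
move=> C0 sh uU UC; rewrite (Hnorm_schwartz _ sh).
apply: (le_trans (Hnorm_le s uU)).
have m W : cmeasurable W -> measurable_fun setT (fun xi => (jap xi `^ s * cmod (W xi)) ^+ 2).
  move=> mW; apply: measurable_funX; apply: measurable_funM; first exact: measurable_jap_powR.
  exact: measurable_cmod.
have mh : cmeasurable (fourier1 h) by have [_ []] := schwartz_is_fourier1 sh.
have mU : cmeasurable U by have [_ []] := uU.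
apply: Lnorm2_le_sqr => //; rewrite ?Lnorm_ge0// !Hhat_sqr.
rewrite /Hsq -ge0_integralZ_EFin//; [|by rewrite sqr_ge0|exact: m|by move=> x; rewrite sqr_ge0].
apply: ae_ge0_le_integral => //.
- by move=> x _; rewrite lee_fin sqr_ge0.
- by apply/measurable_EFinP; exact: m.
- by move=> x _; rewrite lee_fin mulr_ge0// sqr_ge0.
- by apply/measurable_EFinP; apply: measurable_funM => //; exact: m.
exists [set 0]; split => //; first exact: lebesgue_measure_set1.
move=> x /= nx; apply: contrapT => /eqP x0; apply: nx => _.
rewrite lee_fin -exprMn lerXn2r ?nnegrE ?mulr_ge0 ?powR_ge0 ?cmod_ge0//.
by rewrite mulrCA ler_wpM2l ?powR_ge0// UC.
Qed.

Lemma conjcM (z w : R[i]) : conjc (z * w) = conjc z * conjc w.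
Proof. by case: z => a b; case: w => c d; apply: complexP => /=; ring. Qed.

Lemma cmod_sqr_integrable (u : R -> R[i]) (M : R) : cintegrable mu u ->
  (forall x, cmod (u x) <= M) -> mu.-integrable setT (fun x => (cmod (u x) ^+ 2)%:E).
Proof.
move=> iu uM.
have H : mu.-integrable setT (fun x => (M%:E * (cmod (u x))%:E)%E).
  by apply: integrableZl => //; exact: cintegrable_cmod.
apply: (le_integrable measurableT _ _ H).
  apply/measurable_EFinP; apply: measurable_funX; apply: measurable_cmod.
  exact: cintegrable_measurable iu.
have M0 : 0 <= M by exact: le_trans (cmod_ge0 _) (uM 0).
move=> x _; rewrite -EFinM !abse_EFin lee_fin !ger0_norm ?sqr_ge0 ?mulr_ge0 ?cmod_ge0//.
by rewrite expr2 ler_wpM2r ?cmod_ge0.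
Qed.

(** Fubini for [conj(h x) exp(i x xi) h^(xi)]: the inner integral is [|h^|^2] in one order and, by
    inversion, [2 pi |h|^2] in the other. *)
Lemma plancherel_schwartz (h : R -> R[i]) : schwartz h ->
  (\int[mu]_xi (cmod (fourier1 h xi) ^+ 2)%:E = (2 * pi)%:E * \int[mu]_x (cmod (h x) ^+ 2)%:E)%E.
Proof.
move=> sh; have iH := schwartz_fourier_integrable sh; have ih := schwartz_integrable sh.
have mH := cintegrable_measurable iH; have mh := cintegrable_measurable ih.
pose g (p : R * R) := conjc (h p.2) * (cis (p.2 * p.1) * fourier1 h p.1).
have mg : cmeasurable g.
  apply: cmeasurableM; first by apply: cmeasurable_conj; exact: (cmeasurable_comp mh measurable_snd).
  apply: cmeasurableM; last exact: (cmeasurable_comp mH measurable_fst).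
  by apply: cmeasurable_cis; apply: measurable_funM; [exact: measurable_snd|exact: measurable_fst].
have ig : cintegrable (@leb2 R) g.
  apply: (@leb2_le_cintegrable _ g (fun x => cmod (fourier1 h x)) (fun y => cmod (h y))) => //.
  - exact: cintegrable_cmod.
  - exact: cintegrable_cmod.
  - by move=> u v; rewrite /g /= !cmodM cmod_cis cmod_conj mul1r mulrC.
have F := leb2_fubini ig; rewrite /g /= in F.
have L (xi : R) : cintegral mu (fun x : R => conjc (h x) * (cis (x * xi) * fourier1 h xi)) =
    (cmod (fourier1 h xi) ^+ 2)%:C.
  have H := cintegrable_fourier xi ih.
  rewrite -mulc_conj mulrC [in RHS]fourier1E -(cintegral_conj H) -(cintegralZr _ (cintegrable_conj H)).
  apply: eq_cintegral => x; rewrite -fourier1E conjcM cis_conj opprK mulrA.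
  by congr (_ * _); rewrite mulrC.
have K (x : R) : cintegral mu (fun xi : R => conjc (h x) * (cis (x * xi) * fourier1 h xi)) =
    (2 * pi)%:C * (cmod (h x) ^+ 2)%:C.
  have H := cintegrable_ifourier x iH.
  have E := schwartz_inversion x sh; rewrite /ifourier1 in E.
  by rewrite (cintegralZ _ H) E -mulc_conj mulrCA [conjc _ * _]mulrC.

have K' x : cintegral mu (fun xi : R => conjc (h x) * (cis (x * xi) * fourier1 h xi)) =
    ((2 * pi) * (cmod (h x) ^+ 2))%:C by rewrite K -rmorphM.
have J1 : mu.-integrable setT (fun x => (cmod (fourier1 h x) ^+ 2)%:E).
  have [M hM] := schwartz_fourier_le 0 sh.
  by apply: (cmod_sqr_integrable (M := M) iH) => x; have := hM x; rewrite expr0 mul1r.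
have J2 : mu.-integrable setT (fun x => (cmod (h x) ^+ 2)%:E).
  have [M hM] := schwartz_bounded sh; exact: cmod_sqr_integrable ih hM.
have {}F : cintegral mu (fun xi : R => (cmod (fourier1 h xi) ^+ 2)%:C) =
    cintegral mu (fun x : R => ((2 * pi) * (cmod (h x) ^+ 2))%:C).
  by rewrite -(eq_cintegral mu L) -(eq_cintegral mu K').
move: F => /(congr1 (@complex.Re R)) /=; rewrite /Rintegral /= => F.
rewrite -ge0_integralZ_EFin//; last 3 first.
- by rewrite mulr_ge0// pi_ge0.
- by apply: measurable_funX; exact: measurable_cmod.
- by move=> x; rewrite sqr_ge0.
have J3 : mu.-integrable setT (fun x => (2 * pi * cmod (h x) ^+ 2)%:E).
  have : mu.-integrable setT (fun x => ((2 * pi)%:E * (cmod (h x) ^+ 2)%:E)%E) by exact: integrableZl.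
  by apply: eq_integrable.
rewrite -(fineK (integrable_fin_num measurableT J1)) F.
exact: (fineK (integrable_fin_num measurableT J3)).
Qed.

End Sobolev.

(** * The symbol of the boundary forcing operator *)

Section CubeRoot.
Context {R : realType}.
Local Notation mu := (@lebesgue_measure R).

(** The triple angle formula with [cos pi = -1] reads [(c + 1) (2 c - 1)^2 = 0], and [c] is
    positive. *)
Lemma cos_pi3 : cos (pi / 3) = 2^-1 :> R.
Proof.
have pi0 : 0 < pi :> R := pi_gt0 R.
have c0 : 0 < cos (pi / 3) :> R by apply: cos_gt0_pihalf; apply/andP; split; lra.
have h : cos (pi / 3 + (pi / 3 + pi / 3)) = -1 :> R.
  by rewrite (_ : pi / 3 + _ = pi) ?cospi//; field.
move: h; rewrite !(cosD, sinD); set c := cos _; set s := sin _ => h.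
have cs : s ^+ 2 = 1 - c ^+ 2 by exact: sin2cos2.
have {}h : (c + 1) * (2 * c - 1) ^+ 2 = 0.
  have -> : (c + 1) * (2 * c - 1) ^+ 2 = 4 * c ^+ 3 - 3 * c + 1 by ring.
  have -> : 4 * c ^+ 3 - 3 * c = c * (c * c - s * s) - s * (s * c + c * s) - 3 * c * (1 - c ^+ 2 - s ^+ 2) by ring.
  by rewrite cs h; ring.
move/eqP: h; rewrite mulf_eq0 gt_eqF ?addr_gt0//= sqrf_eq0 subr_eq0 => /eqP h.
by lra.
Qed.

Lemma sin_pi3 : sin (pi / 3) = Num.sqrt 3 / 2 :> R.
Proof.
have pi0 : 0 < pi :> R := pi_gt0 R.
have s0 : 0 < sin (pi / 3) :> R by apply: sin_gt0_pihalf; apply/andP; split; lra.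
have q0 : 0 <= Num.sqrt 3 / 2 :> R by rewrite divr_ge0 ?sqrtr_ge0.
apply/eqP; rewrite -(@eqrXn2 _ 2 _ _ _ (ltW s0) q0)// sin2cos2 cos_pi3 exprMn sqr_sqrtr//.
by apply/eqP; field.
Qed.

Definition crt (tau : R) : R := `|tau| `^ 3^-1.

Lemma crt_ge0 tau : 0 <= crt tau. Proof. exact: powR_ge0. Qed.
Lemma crt_gt0 tau : tau != 0 -> 0 < crt tau.
Proof. by move=> t0; rewrite powR_gt0// normr_gt0. Qed.
Lemma crt0 : crt 0 = 0.
Proof. by rewrite /crt normr0 powR0// invr_neq0. Qed.
Lemma crtX3 tau : crt tau ^+ 3 = `|tau|.
Proof. by rewrite -powR_mulrn ?powR_ge0// -powRrM mulVf// powRr1. Qed.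
Lemma crtN tau : crt (- tau) = crt tau. Proof. by rewrite /crt normrN. Qed.

Lemma measurable_crt : measurable_fun setT crt.
Proof. exact: (measurableT_comp (measurable_powR 3^-1) (@normr_measurable R setT)). Qed.

Definition rot (tau : R) : R[i] := if 0 < tau then 1 else cis (- (pi / 3)).

Lemma rhoE tau : rho tau = (crt tau)%:C * rot tau.
Proof. by rewrite /rho /rot /crt; case: ifP => _; rewrite ?mulr1// cexp_Ni. Qed.

Lemma cmod_rot tau : cmod (rot tau) = 1.
Proof. by rewrite /rot; case: ifP => _; rewrite ?cmod1 ?cmod_cis. Qed.

Lemma cmod_rho tau : cmod (rho tau) = crt tau.
Proof. by rewrite rhoE cmodM cmodR cmod_rot mulr1 ger0_norm// crt_ge0. Qed.

Lemma rho_eq0 (tau : R) : (rho tau == 0) = (tau == 0).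
Proof.
rewrite -cmod_eq0 cmod_rho; apply/eqP/eqP => [h|->]; last exact: crt0.
by apply/eqP; apply: contraT => /crt_gt0; rewrite h ltxx.
Qed.

Lemma Re_rho tau : complex.Re (rho tau) = (if 0 < tau then 1 else 2^-1) * crt tau.
Proof.
by rewrite rhoE /rot; case: ifP => _; rewrite !cpartE /= ?cosN ?cos_pi3; ring.
Qed.

(** The argument of [rho] is 0 or [- pi / 3], so the pole [- i rho] keeps to a fixed sector of the
    lower half-plane. *)
Lemma Re_rho_ge tau : crt tau / 2 <= complex.Re (rho tau).
Proof. by have := crt_ge0 tau; rewrite Re_rho; case: ifP => _; lra. Qed.

Lemma cis_pi : cis pi = -1 :> R[i].
Proof. by apply: complexP; rewrite /= ?cospi ?sinpi ?oppr0. Qed.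

Lemma rhoX3 (tau : R) : rho tau ^+ 3 = tau%:C.
Proof.
rewrite rhoE exprMn -rmorphXn crtX3 /rot; case: ltP => [/gtr0_norm ->|t0]; first by rewrite expr1n mulr1.
rewrite ler0_norm// !exprS expr0 mulr1 -!cisD.
rewrite (_ : - (pi / 3) + _ = - pi :> R); last by field.
by rewrite cisN cis_pi invrN invr1 mulrN1 -rmorphN opprK.
Qed.

Lemma omegaE : omega = (- 2^-1) +i* (Num.sqrt 3 / 2) :> R[i].
Proof.
rewrite /omega cexp_i (_ : 2 * pi / 3 = pi / 3 + pi / 3); last by field.
have q : Num.sqrt 3 ^+ 2 = 3 :> R by rewrite sqr_sqrtr.
apply: complexP; rewrite /= ?cosD ?sinD cos_pi3 sin_pi3; last by field.
have -> : 2^-1 / 2 - Num.sqrt 3 / 2 * (Num.sqrt 3 / 2) = 4^-1 - Num.sqrt 3 ^+ 2 / 4 :> R by field.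
by rewrite q; field.
Qed.

Lemma omegaX3 : omega ^+ 3 = 1 :> R[i].
Proof.
rewrite /omega cexp_i !exprS expr0 mulr1 -!cisD.
rewrite (_ : 2 * pi / 3 + _ = pi + pi); last by field.
by rewrite cisD cis_pi; ring.
Qed.

Lemma cmod_omega : cmod omega = 1 :> R.
Proof. by rewrite /omega cexp_i cmod_cis. Qed.

Lemma omega_neq0 : omega != 0 :> R[i].
Proof. by rewrite -cmod_eq0 cmod_omega oner_eq0. Qed.

(** The argument of [omega rho] is [2 pi / 3] or [pi / 3], according to the sign of [tau], and the
    two sines are equal. *)
Lemma Im_omega_rho tau : complex.Im (omega * rho tau) = Num.sqrt 3 / 2 * crt tau.
Proof.
rewrite omegaE rhoE /rot; case: ifP => _; rewrite !cpartE /=; first by ring.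
by rewrite cosN sinN cos_pi3 sin_pi3; field.
Qed.

Lemma sqrt3_ge1 : 1 <= Num.sqrt 3 :> R.
Proof. by rewrite -[leLHS]sqrtr1 ler_wsqrtr// ler1n. Qed.

(* A point at height at least half its modulus stays away from the real axis. *)
Lemma cmod_shift_ge (z : R[i]) (x : R) : cmod z <= 2 * `|complex.Im z| ->
  `|x| + cmod z <= 5 * cmod (x%:C + z).
Proof.
move=> hz; have h1 := norm_Im_le (x%:C + z); rewrite ImD /= add0r in h1.
have h2 : `|x| <= cmod (x%:C + z) + cmod z.
  have := cmodB_le (x%:C + z) z; rewrite addrK cmodR; exact.
by lra.
Qed.

Lemma cmod_sub_omega_rho (xi tau : R) : `|xi| + crt tau <= 5 * cmod (xi%:C - omega * rho tau).
Proof.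
have := @cmod_shift_ge (- (omega * rho tau)) xi.
rewrite cmodN cmodM cmod_omega cmod_rho mul1r; apply.
rewrite ImN normrN Im_omega_rho; have := crt_ge0 tau; have := sqrt3_ge1 => h3 h0.
rewrite ger0_norm; nra.
Qed.

Lemma cmod_add_i_rho (xi tau : R) : `|xi| + crt tau <= 5 * cmod (xi%:C + 'i%C * rho tau).
Proof.
have := @cmod_shift_ge ('i%C * rho tau) xi.
rewrite cmodM cmodi cmod_rho mul1r; apply.
rewrite ImM /= mul0r add0r mul1r; have := Re_rho_ge tau; have := crt_ge0 tau => h h2.
by rewrite ger0_norm; lra.
Qed.

Lemma sub_omega_rho_neq0 (xi tau : R) : tau != 0 -> xi%:C - omega * rho tau != 0.
Proof.
move=> /crt_gt0 t0; rewrite -cmod_eq0; apply: contraTneq (cmod_sub_omega_rho xi tau) => ->.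
by rewrite mulr0 -ltNge ltr_pwDr.
Qed.

Lemma add_i_rho_neq0 (xi tau : R) : tau != 0 -> xi%:C + 'i%C * rho tau != 0.
Proof.
move=> /crt_gt0 t0; rewrite -cmod_eq0; apply: contraTneq (cmod_add_i_rho xi tau) => ->.
by rewrite mulr0 -ltNge ltr_pwDr.
Qed.

Lemma measurable_rho : cmeasurable (@rho R).
Proof.
rewrite (_ : rho = fun tau => (crt tau)%:C * rot tau); last by apply/funext => t; exact: rhoE.
apply: cmeasurableM; first by apply: cmeasurable_real; exact: measurable_crt.
by apply: cmeasurable_if; [exact: measurable_fun_ltr|exact: cmeasurable_cst|exact: cmeasurable_cst].
Qed.

End CubeRoot.

(** * Size of the symbol *)

Section Symbol.
Context {R : realType} (m n : nat).
Hypothesis hmn : (m + 4 <= n)%N.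
Local Notation mu := (@lebesgue_measure R).
Local Notation K := (@symb_K R m n).
Local Notation c := (@symb_c R m n).

Lemma symb_K0 xi : K xi 0 = 0.
Proof. by rewrite /symb_K (_ : rho 0 = 0) ?invr0 ?mul0r//; apply/eqP; rewrite rho_eq0. Qed.

(** The form homogeneous of degree -1 in [(xi, rho)], in which both poles are visible. *)
Lemma symb_KE xi tau : tau != 0 ->
  K xi tau = c * xi%:C ^+ m * rho tau ^+ (n - m) /
    ((xi%:C + 'i%C * rho tau) ^+ n * (xi%:C - omega * rho tau)).
Proof.
move=> t0; have r0 : rho tau != 0 by rewrite rho_eq0.
have h1 := add_i_rho_neq0 xi t0; have h2 := sub_omega_rho_neq0 xi t0.
rewrite /symb_K /symb_a.
have -> : xi%:C / rho tau + 'i%C = (xi%:C + 'i%C * rho tau) / rho tau by field.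
have -> : xi%:C / rho tau - omega = (xi%:C - omega * rho tau) / rho tau by field.
have nE : n = (m + (n - m))%N by lia.
rewrite !expr_div_n [X in _ / (_ / rho tau ^+ X)]nE exprD.
field.
by apply/and5P; split; rewrite ?expf_neq0.
Qed.

(** There is one factor 5, from [cmod_shift_ge], for each of the [n + 1] linear factors of the
    denominator. Locking keeps the product opaque in later rewriting. *)
Definition CK : R := locked (cmod c * 5 ^+ n.+1).

Lemma CK_ge0 : 0 <= CK.
Proof. by rewrite /CK -lock mulr_ge0 ?cmod_ge0 ?exprn_ge0. Qed.

Lemma cmod_K_le xi tau :
  cmod (K xi tau) <= CK * (`|xi| ^+ m * crt tau ^+ (n - m) / (`|xi| + crt tau) ^+ n.+1).
Proof.
have [->|t0] := eqVneq tau 0.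
  rewrite symb_K0 cmod0 mulr_ge0 ?CK_ge0// divr_ge0 ?mulr_ge0 ?exprn_ge0 ?addr_ge0 ?crt_ge0//.
have T0 := crt_gt0 t0; have S0 : 0 < `|xi| + crt tau by rewrite ltr_pwDr.
rewrite (symb_KE _ t0) /CK -lock; move: (c) => c0; rewrite !(cmodM, cmodV, cmodX) cmodR cmod_rho.
have h1 := cmod_add_i_rho xi tau; have h2 := cmod_sub_omega_rho xi tau.
set A := cmod (_ + _) in h1 *; set B := cmod (_ - _) in h2 *.
have A0 : 0 < A by lra. 
have B0 : 0 < B by lra.
set P := `|xi| ^+ m * _; have P0 : 0 <= P by rewrite mulr_ge0 ?exprn_ge0 ?crt_ge0.
set S := `|xi| + _ in S0 h1 h2 *.
have AB : (S / 5) ^+ n.+1 <= A ^+ n * B.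
  have S5 : 0 <= S / 5 by rewrite divr_ge0 ?ltW.
  by rewrite exprSr ler_pM ?exprn_ge0// ?lerXn2r ?nnegrE//; lra.
have -> : cmod c0 * `|xi| ^+ m * crt tau ^+ (n - m) / (A ^+ n * B) = cmod c0 * P * (A ^+ n * B)^-1.
  by rewrite /P mulrA.
have -> : cmod c0 * 5 ^+ n.+1 * (P / S ^+ n.+1) = cmod c0 * P * ((S / 5) ^+ n.+1)^-1.
  by rewrite expr_div_n; field; rewrite !expf_neq0// gt_eqF.
apply: ler_wpM2l; first by rewrite mulr_ge0 ?cmod_ge0.
by rewrite lef_pV2// posrE ?mulr_gt0 ?exprn_gt0// divr_gt0.
Qed.

(** After multiplication by [xi ^ j] the decay is of order [n + 1 - m - j], at least 2 for [j <= 3].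
    The quadratic kernel is thus a majorant, and homogeneity fixes the power of [crt tau]. *)
Lemma cmod_xiK_le j xi tau : (j <= 3)%N -> tau != 0 ->
  `|xi| ^+ j * cmod (K xi tau) <= CK * crt tau ^+ j * ((crt tau)^-1 * (1 + ((crt tau)^-1 * xi) ^+ 2)^-1).
Proof.
move=> j3 t0; have T0 := crt_gt0 t0; set T := crt tau in T0 *.
apply: (@le_trans _ _ (`|xi| ^+ j * (CK * (`|xi| ^+ m * T ^+ (n - m) / (`|xi| + T) ^+ n.+1)))).
  by rewrite ler_wpM2l ?exprn_ge0// cmod_K_le.
rewrite mulrCA -[leRHS]mulrA; apply: ler_wpM2l; first exact: CK_ge0.
have x0 : 0 <= `|xi| := normr_ge0 xi; have S0 : 0 < `|xi| + T by rewrite ltr_pwDr.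
have -> : T ^+ j * (T^-1 * (1 + (T^-1 * xi) ^+ 2)^-1) = T ^+ j.+1 / (T ^+ 2 + `|xi| ^+ 2).
  rewrite real_normK ?num_real// (exprS T j); field.
  by rewrite !gt_eqF//= ltr_pwDl ?exprn_gt0 ?sqr_ge0.
rewrite ler_pdivlMr ?ltr_pwDl ?exprn_gt0 ?exprn_ge0//.
(* [k] counts the powers left over once two are reserved for the kernel; it is a natural number
   because [j <= 3] and [m + 4 <= n]. *)
have [k [nE nE2]] : exists k, (n - m = j.+1 + k)%N /\ (n.+1 = j + m + k + 2)%N.
  by exists (n - m - j.+1)%N; split; lia.
rewrite nE nE2 mulrA -mulrAC [X in X <= _](_ : _ = 
  (`|xi| ^+ (j + m) * T ^+ k) / (`|xi| + T) ^+ (j + m + k) *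
  ((T ^+ 2 + `|xi| ^+ 2) / (`|xi| + T) ^+ 2) * T ^+ j.+1); last first.
  rewrite !exprD; field.
  by rewrite !expf_neq0 ?gt_eqF.
have T1 := ltW T0; have S1 := ltW S0.
apply: ler_piMl; first by rewrite exprn_ge0.
apply: mulr_ile1.
- by rewrite divr_ge0 ?mulr_ge0 ?exprn_ge0.
- by rewrite divr_ge0 ?addr_ge0 ?exprn_ge0.
- rewrite ler_pdivrMr ?exprn_gt0// mul1r [leRHS]exprD ler_pM ?exprn_ge0//.
    by rewrite lerXn2r ?nnegrE// lerDl.
  by rewrite lerXn2r ?nnegrE// lerDr.
- rewrite ler_pdivrMr ?exprn_gt0// mul1r sqrrD.
  have : 0 <= `|xi| * T by rewrite mulr_ge0.
  by rewrite -mulr_natl => h; lra.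
Qed.

Lemma cmeasurable_K2 : cmeasurable (fun p : R * R => K p.1 p.2).
Proof.
have mr : cmeasurable (fun p : R * R => rho p.2) := cmeasurable_comp measurable_rho measurable_snd.
have mx : cmeasurable (fun p : R * R => (p.1)%:C : R[i]) by apply: cmeasurable_real; exact: measurable_fst.
have mz : cmeasurable (fun p : R * R => (p.1)%:C / rho p.2).
  by apply: cmeasurableM => //; exact: cmeasurableV.
rewrite /symb_K /symb_a; apply: cmeasurableM; first exact: cmeasurableV.
apply: cmeasurableM; last by apply: cmeasurableV; apply: cmeasurableB => //; exact: cmeasurable_cst.
apply: cmeasurableM; first exact: cmeasurable_cst.
apply: cmeasurableM; first exact: cmeasurableX.
by apply: cmeasurableV; apply: cmeasurableX; apply: cmeasurableD => //; exact: cmeasurable_cst.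
Qed.

Lemma cmeasurable_K1 (tau : R) : cmeasurable (fun xi : R => K xi tau).
Proof. exact: (cmeasurable_pair2 tau cmeasurable_K2). Qed.

End Symbol.

(** * Functions exponential on each side of 0 *)

Section OneSidedTransform.
Context {R : realType}.
Local Notation mu := (@lebesgue_measure R).
Implicit Types (a z b : R[i]) (s : nat -> R[i]).

Lemma cintegrable_sum N (f : nat -> R -> R[i]) : (forall j, cintegrable mu (f j)) ->
  cintegrable mu (fun x => \sum_(j < N) f j x).
Proof.
move=> fi; elim: N => [|N ih].
  by under eq_fun do rewrite big_ord0; exact: cintegrable0.
by under eq_fun do rewrite big_ord_recr; exact: cintegrableD.
Qed.

Lemma cintegral_sum N (f : nat -> R -> R[i]) : (forall j, cintegrable mu (f j)) ->
  cintegral mu (fun x => \sum_(j < N) f j x) = \sum_(j < N) cintegral mu (f j).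
Proof.
move=> fi; elim: N => [|N ih].
  by under eq_fun do rewrite big_ord0; rewrite cintegral0 big_ord0.
under eq_fun do rewrite big_ord_recr; rewrite big_ord_recr /= -ih.
exact: cintegralD (cintegrable_sum N fi) (fi N).
Qed.

Definition ray_exp a (x : R) : R[i] := if 0 <= x then cexp (a * x%:C) else 0.
Definition ray_polyexp z j (x : R) : R[i] := if x < 0 then x%:C ^+ j * cexp (z * x%:C) else 0.
Definition one_sided b a s z N (x : R) : R[i] :=
  b * ray_exp a x + \sum_(j < N) s j * ray_polyexp z j x.

Lemma cis_cexp (z : R[i]) (x xi : R) :
  cis (- (x * xi)) * cexp (z * x%:C) = cexp ((z - 'i%C * xi%:C) * x%:C).
Proof.
rewrite -cexp_Ni -cexpD; congr cexp.
by rewrite rmorphM /=; ring.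
Qed.

Lemma Re_sub_i z (xi : R) : complex.Re (z - 'i%C * xi%:C) = complex.Re z.
Proof. by rewrite ReB ReM /= mul0r mulr0 subrr subr0. Qed.

Lemma fourier1_ray_exp a xi : complex.Re a < 0 ->
  fourier1 (ray_exp a) xi = - (a - 'i%C * xi%:C)^-1.
Proof.
move=> a0; have a0' : complex.Re (a - 'i%C * xi%:C) < 0 by rewrite Re_sub_i.
have [_ <-] := cexp_ray_integral a0'; rewrite fourier1E; apply: eq_cintegral => x.
by rewrite /ray_exp; case: ifP => _; rewrite ?mulr0// cis_cexp.
Qed.

Lemma fourier1_ray_polyexp z j xi : 0 < complex.Re z ->
  fourier1 (ray_polyexp z j) xi = (-1) ^+ j * j`!%:R / (z - 'i%C * xi%:C) ^+ j.+1.
Proof.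
move=> z0; rewrite -polyexp_integral ?Re_sub_i// fourier1E; apply: eq_cintegral => x.
by rewrite /ray_polyexp; case: ifP => _; rewrite ?mulr0// mulrCA cis_cexp.
Qed.

Lemma ray_exp_integrable a : complex.Re a < 0 -> cintegrable mu (ray_exp a).
Proof. by move=> /cexp_ray_integral[]. Qed.

Lemma one_sided_integrable b a s z N : complex.Re a < 0 -> 0 < complex.Re z ->
  cintegrable mu (one_sided b a s z N).
Proof.
move=> a0 z0; apply: cintegrableD; first by apply: cintegrableZ; exact: ray_exp_integrable.
apply: (@cintegrable_sum N (fun j x => s j * ray_polyexp z j x)) => j.
by apply: cintegrableZ; exact: polyexp_integrable.
Qed.

Lemma fourier1_one_sided b a s z N xi : complex.Re a < 0 -> 0 < complex.Re z ->
  fourier1 (one_sided b a s z N) xi = - b / (a - 'i%C * xi%:C) +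
    \sum_(j < N) s j * ((-1) ^+ j * j`!%:R / (z - 'i%C * xi%:C) ^+ j.+1).
Proof.
move=> a0 z0; have ia := ray_exp_integrable a0.
have iz j : cintegrable mu (ray_polyexp z j) := polyexp_integrable j z0.
have E (x : R) : cis (- (x * xi)) * one_sided b a s z N x =
    b * (cis (- (x * xi)) * ray_exp a x) + \sum_(j < N) s j * (cis (- (x * xi)) * ray_polyexp z j x).
  rewrite /one_sided mulrDr mulrCA mulr_sumr; congr (_ + _).
  by apply: eq_bigr => j _; rewrite mulrCA.
rewrite fourier1E (eq_cintegral mu E).
have i1 := cintegrableZ b (cintegrable_fourier xi ia).
have i2 j := cintegrableZ (s j) (cintegrable_fourier xi (iz j)).
rewrite (cintegralD i1 (cintegrable_sum N i2)) (cintegralZ _ (cintegrable_fourier xi ia)).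
rewrite -(fourier1E (ray_exp a)) fourier1_ray_exp// mulrN mulNr; congr (_ + _).
rewrite (cintegral_sum N i2); apply: eq_bigr => j _.
by rewrite (cintegralZ _ (cintegrable_fourier xi (iz j))) -fourier1E fourier1_ray_polyexp.
Qed.

Lemma one_sided_gt0 b a s z N x : 0 <= x -> one_sided b a s z N x = b * cexp (a * x%:C).
Proof.
move=> x0; rewrite /one_sided /ray_exp x0 big1 ?addr0// => j _.
by rewrite /ray_polyexp ltNge x0 mulr0.
Qed.

Lemma one_sided_lt0 b a s z N x : x < 0 ->
  one_sided b a s z N x = \sum_(j < N) s j * (x%:C ^+ j * cexp (z * x%:C)).
Proof.
move=> x0; rewrite /one_sided /ray_exp leNgt x0 mulr0 add0r; apply: eq_bigr => j _.
by rewrite /ray_polyexp x0.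
Qed.

Lemma ccvg_near_eq (I : Type) (F : set_system I) {FF : Filter F} (u v : I -> R[i]) l :
  (\forall t \near F, u t = v t) -> ccvg F v l -> ccvg F u l.
Proof.
move=> uv; rewrite /ccvg => h.
apply: cvg_trans h; apply: near_eq_cvg.
by apply: filterS uv => t ->.
Qed.

Lemma ccvg_comp (f : R -> R[i]) (u : nat -> R) (x : R) : ccontinuous f ->
  u k @[k --> \oo] --> x -> ccvg \oo (fun k => f (u k)) (f x).
Proof. by move=> cf ux; have := cvg_comp _ _ ux (ccontinuous_ccvg x cf). Qed.

Lemma ccontinuous_sum N (f : nat -> R -> R[i]) : (forall j, ccontinuous (f j)) ->
  ccontinuous (fun x => \sum_(j < N) f j x).
Proof.
move=> fi; elim: N => [|N ih].
  by under eq_fun do rewrite big_ord0; exact: ccontinuous_cst.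
by under eq_fun do rewrite big_ord_recr; exact: ccontinuousD.
Qed.

Lemma one_sided_ccvg b a s z N x : x != 0 ->
  ccvg (nbhs x) (one_sided b a s z N) (one_sided b a s z N x).
Proof.
move=> x0; have [xn|xp|xe] := ltgtP x 0; last by rewrite xe eqxx in x0.
- rewrite one_sided_lt0//; apply: (@ccvg_near_eq _ _ _ _
    (fun x => \sum_(j < N) s j * (x%:C ^+ j * cexp (z * x%:C)))).
    by near=> t; rewrite one_sided_lt0//; near: t; exact: lt_nbhsl.
  apply: (ccontinuous_ccvg x); apply: (@ccontinuous_sum N (fun j x => s j * (x%:C ^+ j * cexp (z * x%:C)))) => j.
  by apply: ccontinuousZ; exact: polyexp_ccontinuous.
- rewrite one_sided_gt0; last exact: ltW.
  apply: (@ccvg_near_eq _ _ _ _ (fun x => b * cexp (a * x%:C))).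
    by near=> t; rewrite one_sided_gt0// ltW//; near: t; exact: lt_nbhsr.
  apply: (ccontinuous_ccvg x); apply: ccontinuousZ.
  apply: is_cderive_ccontinuous => y; exact: is_cderive_expl.
Unshelve. all: by end_near. Qed.

(** The inverse transform is guessed, its transform is computed, and inversion is applied; this
    takes the place of a residue computation. *)
Lemma one_sided_inversion b a s z N (U : R -> R[i]) x : complex.Re a < 0 -> 0 < complex.Re z ->
  x != 0 -> cintegrable mu U ->
  (forall xi, U xi = - b / (a - 'i%C * xi%:C) +
    \sum_(j < N) s j * ((-1) ^+ j * j`!%:R / (z - 'i%C * xi%:C) ^+ j.+1)) ->
  ifourier1 U x = (2 * pi)%:C * one_sided b a s z N x.
Proof.
move=> a0 z0 x0 iU UE.
have e : fourier1 (one_sided b a s z N) = U.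
  by apply/funext => xi; rewrite fourier1_one_sided// UE.
rewrite -e; apply: fourier1_inversion; rewrite ?e//; first exact: one_sided_integrable.
exact: one_sided_ccvg.
Qed.

End OneSidedTransform.

Section PartialFractions.
Context {F : fieldType}.

(** For a single pole the coefficients are the Taylor coefficients of [Q] at [- u], in reverse
    order. *)
Lemma partial_fraction (Q : {poly F}) (u : F) n : (size Q <= n)%N ->
  exists q : nat -> F, forall x, x + u != 0 ->
    Q.[x] / (x + u) ^+ n = \sum_(j < n) q j / (x + u) ^+ j.+1.
Proof.
move=> sQ; pose P := Q \Po ('X - u%:P).
have sP : (size P <= n)%N by rewrite size_comp_poly2// size_XsubC.
exists (fun j => P`_(n - j.+1)) => x xu.
have -> : Q.[x] = P.[x + u] by rewrite /P horner_comp !hornerE addrK.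
rewrite (horner_coef_wide _ sP) mulr_suml (reindex_inj rev_ord_inj) /=.
apply: eq_bigr => j _; rewrite -[LHS]mulrA; congr (_ * _).
have nE : n = ((n - j.+1) + j.+1)%N by rewrite subnK.
rewrite [X in _ / _ ^+ X]nE exprD invfM mulrA divff ?mul1r//.
by rewrite expf_neq0.
Qed.

End PartialFractions.

(** * The inverse transform of the symbol in the space variable *)

Section Profile.
Context {R : realType} (m n : nat).
Hypothesis hmn : (m + 4 <= n)%N.
Local Notation mu := (@lebesgue_measure R).
Local Notation K := (@symb_K R m n).
Local Notation c := (@symb_c R m n).

(** By [a(omega) = - i], the polynomial [c X^m + i (X + i)^n] vanishes at [omega]. Dividing it by
    [X - omega] leaves a numerator of degree below [n] over [(zeta + i)^n]. *)
Lemma symb_factor : exists q : nat -> R[i], forall zeta, zeta + 'i%C != 0 -> zeta != omega ->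
  symb_a m n zeta / (zeta - omega) = - 'i%C / (zeta - omega) +
    \sum_(j < n) q j / (zeta + 'i%C) ^+ j.+1.
Proof.
pose N : {poly R[i]} := c *: 'X^m + 'i%C *: ('X + 'i%:P) ^+ n.
have NE z : N.[z] = c * z ^+ m + 'i%C * (z + 'i%C) ^+ n.
  by rewrite /N !(hornerE, horner_exp).
have /factor_theorem[Q NQ] : root N omega.
  rewrite /root NE /symb_c; apply/eqP.
  have w0 : omega != 0 :> R[i] := omega_neq0; field.
  by rewrite expf_neq0.
have sN : (size N <= n.+1)%N.
  rewrite (leq_trans (size_polyD _ _))// geq_max; apply/andP; split.
    by rewrite (leq_trans (size_scale_leq _ _))// size_polyXn; lia.
  rewrite (leq_trans (size_scale_leq _ _))// -[X in 'X + X]opprK -polyCN size_exp_XsubC//.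
have sQ : (size Q <= n)%N.
  have [->|Q0] := eqVneq Q 0; first by rewrite size_poly0.
  by move: sN; rewrite NQ size_Mmonic ?monicXsubC// size_XsubC addn2.
have [q hq] := partial_fraction 'i%C sQ; exists q => z zi zw.
have zw' : z - omega != 0 by rewrite subr_eq0.
have E : Q.[z] * (z - omega) = c * z ^+ m + 'i%C * (z + 'i%C) ^+ n.
  by rewrite -NE NQ hornerM hornerXsubC.
rewrite -hq// /symb_a.
have -> : Q.[z] = (c * z ^+ m + 'i%C * (z + 'i%C) ^+ n) / (z - omega) by rewrite -E mulfK.
field.
by rewrite zw' expf_neq0.
Qed.

(** Since [omega^3 = 1], the factor [1 - zeta^3] contains [zeta - omega]. What remains has a
    numerator of degree [m + 2], still below [n]. *)
Lemma airy_symb_factor : exists q : nat -> R[i], forall zeta, zeta + 'i%C != 0 -> zeta != omega ->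
  (1 - zeta ^+ 3) * (symb_a m n zeta / (zeta - omega)) = \sum_(j < n) q j / (zeta + 'i%C) ^+ j.+1.
Proof.
pose Q : {poly R[i]} := - c *: ('X^m * ('X^2 + omega *: 'X + (omega ^+ 2)%:P)).
have QE z : Q.[z] = - c * (z ^+ m * (z ^+ 2 + omega * z + omega ^+ 2)).
  by rewrite /Q !(hornerE, horner_exp).
have sQ : (size Q <= n)%N.
  rewrite (leq_trans (size_scale_leq _ _))// (leq_trans (size_polyMleq _ _))// size_polyXn.
  have : (size ('X^2 + omega *: 'X + (omega ^+ 2)%:P : {poly R[i]})%R <= 3)%N.
    rewrite (leq_trans (size_polyD _ _))// geq_max (leq_trans (size_polyC_leq1 _))// andbT.
    rewrite (leq_trans (size_polyD _ _))// geq_max size_polyXn/= (leq_trans (size_scale_leq _ _))//.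
    by rewrite size_polyX.
  by move: hmn => h1 h2; lia.
have [q hq] := partial_fraction 'i%C sQ; exists q => z zi zw.
have zw' : z - omega != 0 by rewrite subr_eq0.
rewrite -hq// QE /symb_a.
have -> : 1 - z ^+ 3 = - ((z - omega) * (z ^+ 2 + omega * z + omega ^+ 2)).
  by rewrite -(omegaX3 (R := R)); ring.
field.
by rewrite zw' expf_neq0.
Qed.

Lemma K_integrable tau : cintegrable mu (fun xi => K xi tau).
Proof.
have [->|t0] := eqVneq tau 0; first by under eq_fun do rewrite symb_K0; exact: cintegrable0.
have T0 := crt_gt0 t0.
have ii := inv1sq_integrable (_ : 0 < (crt tau)^-1).
apply: (@le_cintegrable _ _ _ mu _ (fun xi => CK m n * (crt tau)^-1 * (1 + ((crt tau)^-1 * xi) ^+ 2)^-1)).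
- exact: cmeasurable_K1.
- have : mu.-integrable setT (fun xi => ((CK m n * (crt tau)^-1)%:E * ((1 + ((crt tau)^-1 * xi) ^+ 2)^-1)%:E)%E).
    by apply: integrableZl => //; apply: ii; rewrite invr_gt0.
  by apply: eq_integrable.
- by move=> xi; have := cmod_xiK_le hmn xi (isT : (0 <= 3)%N) t0; rewrite !expr0 mul1r mulr1 mulrA.
Qed.

Lemma xi3K_integrable tau : cintegrable mu (fun xi => (xi ^+ 3)%:C * K xi tau).
Proof.
have [->|t0] := eqVneq tau 0; first by under eq_fun do rewrite symb_K0 mulr0; exact: cintegrable0.
have T0 := crt_gt0 t0.
have ii := inv1sq_integrable (_ : 0 < (crt tau)^-1).
apply: (@le_cintegrable _ _ _ mu _ (fun xi => CK m n * crt tau ^+ 3 * (crt tau)^-1 * (1 + ((crt tau)^-1 * xi) ^+ 2)^-1)).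
- apply: cmeasurableM; last exact: cmeasurable_K1.
  by apply: cmeasurable_real; exact: measurable_funX.
- have : mu.-integrable setT (fun xi => ((CK m n * crt tau ^+ 3 * (crt tau)^-1)%:E * ((1 + ((crt tau)^-1 * xi) ^+ 2)^-1)%:E)%E).
    by apply: integrableZl => //; apply: ii; rewrite invr_gt0.
  by apply: eq_integrable.
- by move=> xi; have := cmod_xiK_le hmn xi (isT : (3 <= 3)%N) t0; rewrite cmodM cmodR normrX mulrA.
Qed.

Lemma Re_ray_lt0 (tau : R) : tau != 0 -> complex.Re ('i%C * omega * rho tau) < 0.
Proof.
move=> /crt_gt0 t0; rewrite -mulrA ReM /= mul0r mul1r sub0r Im_omega_rho oppr_lt0.
by rewrite mulr_gt0// divr_gt0// sqrtr_gt0.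
Qed.

Lemma Re_rho_gt0 (tau : R) : tau != 0 -> 0 < complex.Re (rho tau).
Proof. by move=> /crt_gt0 t0; have := Re_rho_ge tau; lra. Qed.

Definition profile (p : nat -> R[i]) (tau x : R) : R[i] :=
  one_sided 1 ('i%C * omega * rho tau) (fun j => p j * rho tau ^+ j) (rho tau) n x.

(** From [rho - i xi = - i (xi + i rho)]: powers of [- i] and of [rho] translate the partial
    fractions in [zeta] into the transforms of [x^j exp(rho x)] on the negative half-line. *)
Lemma coef_convert (q : nat -> R[i]) (tau xi : R) j : tau != 0 ->
  (rho tau)^-1 * (q j / (xi%:C / rho tau + 'i%C) ^+ j.+1) =
  (q j * (- 'i%C) ^+ j.+1 / ((-1) ^+ j * j`!%:R)) * rho tau ^+ j *
    ((-1) ^+ j * j`!%:R / (rho tau - 'i%C * xi%:C) ^+ j.+1).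
Proof.
move=> t0; have r0 : rho tau != 0 by rewrite rho_eq0.
have h1 := add_i_rho_neq0 xi t0.
have -> : rho tau - 'i%C * xi%:C = - 'i%C * (xi%:C + 'i%C * rho tau).
  have ii : 'i%C * 'i%C = -1 :> R[i] by rewrite -expr2 sqr_i.
  by rewrite mulrDr mulNr [- 'i%C * ('i%C * _)]mulrA [- 'i%C * 'i%C]mulNr ii opprK mul1r addrC.
have -> : xi%:C / rho tau + 'i%C = (xi%:C + 'i%C * rho tau) / rho tau by field.
have f0 : j`!%:R != 0 :> R[i] by rewrite pnatr_eq0 -lt0n fact_gt0.
have s0 : (-1) ^+ j != 0 :> R[i] by rewrite expf_neq0// oppr_eq0 oner_eq0.
have i0 : - 'i%C != 0 :> R[i] by rewrite oppr_eq0 -cmod_eq0 cmodi oner_eq0.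
rewrite expr_div_n exprMn [rho tau ^+ j.+1]exprS; field.
by rewrite !expf_neq0 ?f0 ?s0 ?r0.
Qed.

Lemma div_not_root (xi tau : R) : tau != 0 ->
  xi%:C / rho tau + 'i%C != 0 /\ xi%:C / rho tau != omega.
Proof.
move=> t0; have r0 : rho tau != 0 by rewrite rho_eq0.
have h1 := add_i_rho_neq0 xi t0; have h2 := sub_omega_rho_neq0 xi t0.
split.
  have -> : xi%:C / rho tau + 'i%C = (xi%:C + 'i%C * rho tau) / rho tau by field.
  by rewrite mulf_neq0// invr_neq0.
by apply: contra h2 => /eqP <-; rewrite mulfVK// subrr.
Qed.

(** The coefficients [p] depend neither on [tau] nor on [x]. For fixed [x] the profile is therefore
    a combination, with constant coefficients, of explicit functions of [rho tau], the form required
    for causality. *)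
Lemma K_profile : exists p : nat -> R[i], forall tau x, tau != 0 ->
  ifourier1 (fun xi => K xi tau) x = (2 * pi)%:C * profile p tau x.
Proof.
have [q hq] := symb_factor.
pose p j := q j * (- 'i%C) ^+ j.+1 / ((-1) ^+ j * j`!%:R).
exists p => tau x t0.
have KE xi : K xi tau = - 1 / ('i%C * omega * rho tau - 'i%C * xi%:C) +
    \sum_(j < n) p j * rho tau ^+ j * ((-1) ^+ j * j`!%:R / (rho tau - 'i%C * xi%:C) ^+ j.+1).
  have [n1 n2] := div_not_root xi t0.
  rewrite /symb_K hq// mulrDr mulr_sumr; congr (_ + _); last first.
    by apply: eq_bigr => j _; rewrite coef_convert.
  have h2 := sub_omega_rho_neq0 xi t0.
  have r0 : rho tau != 0 by rewrite rho_eq0.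
  have -> : 'i%C * omega * rho tau - 'i%C * xi%:C = - 'i%C * (xi%:C - omega * rho tau) by ring.
  have -> : xi%:C / rho tau - omega = (xi%:C - omega * rho tau) / rho tau by field.
  have i0 : 'i%C != 0 :> R[i] by rewrite -cmod_eq0 cmodi oner_eq0.
  have ii : 'i%C * 'i%C = -1 :> R[i] by rewrite -expr2 sqr_i.
  have -> : -1 / (- 'i%C * (xi%:C - omega * rho tau)) = - 'i%C / (xi%:C - omega * rho tau).
    rewrite -[X in X / _]ii; field.
    by rewrite h2 i0.
  field.
  by rewrite h2 r0.
have H y : y != 0 -> ifourier1 (fun xi => K xi tau) y = (2 * pi)%:C * profile p tau y.
  move=> y0; apply: one_sided_inversion => //; [exact: Re_ray_lt0|exact: Re_rho_gt0|exact: K_integrable].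
have [->|] := eqVneq x 0; last exact: H.
(* both sides are continuous from the right at 0 *)
rewrite /profile one_sided_gt0// mul1r mulr0 cexp0 mulr1.
pose u k : R := k.+1%:R^-1.
have u0 : u k @[k --> \oo] --> (0 : R) by exact: cvg_harmonic.
have L : ccvg \oo (fun k => ifourier1 (fun xi => K xi tau) (u k)) (ifourier1 (fun xi => K xi tau) 0).
  by apply: (ccvg_comp _ u0); apply: ccontinuous_ifourier1; exact: K_integrable.
have r : ccvg \oo (fun k => ifourier1 (fun xi => K xi tau) (u k)) (2 * pi)%:C.
  rewrite (_ : (fun k => _) = fun k => (2 * pi)%:C * cexp ('i%C * omega * rho tau * (u k)%:C)); last first.
    apply/funext => k; rewrite H ?invr_eq0 ?pnatr_eq0// /profile one_sided_gt0 ?mul1r//.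
    by rewrite invr_ge0.
  have E0 : cexp ('i%C * omega * rho tau * (0 : R)%:C) = 1 by rewrite rmorph0 mulr0 cexp0.
  rewrite -[X in ccvg _ _ X]mulr1; apply: ccvgZ; rewrite -E0.
  have ce : ccontinuous (fun x : R => cexp ('i%C * omega * rho tau * x%:C)).
    apply: is_cderive_ccontinuous => y; exact: is_cderive_expl.
  exact: (ccvg_comp ce u0).
exact: (ccvg_unique L r).
Qed.

(** Without a pole in the upper half-plane the coefficient of the exponential on the right is 0, and
    the profile lives on [x < 0]. *)
Lemma airy_K_vanish tau x : 0 < x ->
  ifourier1 (fun xi => (tau - xi ^+ 3)%:C * K xi tau) x = 0.
Proof.
move=> x0; have [->|t0] := eqVneq tau 0.
  rewrite /ifourier1; under eq_cintegral do rewrite symb_K0 !mulr0; exact: cintegral0.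
have [q hq] := airy_symb_factor.
pose p j := q j * (- 'i%C) ^+ j.+1 / ((-1) ^+ j * j`!%:R).
have r0 : rho tau != 0 by rewrite rho_eq0.
have KE xi : (tau - xi ^+ 3)%:C * K xi tau = - 0 / ('i%C * omega * rho tau - 'i%C * xi%:C) +
    \sum_(j < n) (rho tau ^+ 3 * (p j * rho tau ^+ j)) * ((-1) ^+ j * j`!%:R / (rho tau - 'i%C * xi%:C) ^+ j.+1).
  have [n1 n2] := div_not_root xi t0.
  rewrite oppr0 mul0r add0r /symb_K.
  have -> : (tau - xi ^+ 3)%:C = rho tau ^+ 3 * (1 - (xi%:C / rho tau) ^+ 3).
    by rewrite rmorphB rmorphXn expr_div_n /= -rhoX3; field.
  rewrite -mulrA [X in _ * X]mulrCA hq// 2!mulr_sumr; apply: eq_bigr => j _.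
  by rewrite coef_convert// !mulrA.
rewrite (@one_sided_inversion _ 0 ('i%C * omega * rho tau) (fun j => rho tau ^+ 3 * (p j * rho tau ^+ j)) (rho tau) n).
- by rewrite one_sided_gt0 ?mul0r ?mulr0// ltW.
- exact: Re_ray_lt0.
- exact: Re_rho_gt0.
- by rewrite gt_eqF.
- have := cintegrableB (cintegrableZ tau%:C (K_integrable tau)) (xi3K_integrable tau).
  by under eq_fun do rewrite -mulrBl -rmorphB.
- exact: KE.
Qed.

End Profile.

(** * Traces and the equation *)

Section CauchyKernel.
Context {R : realType}.
Local Notation mu := (@lebesgue_measure R).
Local Notation leb2 := (@leb2 R).

(* with the junk value [0^-1 = 0] this is 0 at [tau = 0] *)
Definition ckern (tau xi : R) : R := (crt tau)^-1 * (1 + ((crt tau)^-1 * xi) ^+ 2)^-1.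

Lemma ckern_ge0 tau xi : 0 <= ckern tau xi.
Proof. by rewrite mulr_ge0 ?invr_ge0 ?crt_ge0 ?inv1sq_ge0// addr_ge0// sqr_ge0. Qed.

Lemma measurable_ckern2 : measurable_fun setT (fun p : R * R => ckern p.2 p.1).
Proof.
have mT : measurable_fun setT (fun p : R * R => (crt p.2)^-1).
  by apply: measurable_fun_inv; exact: (measurableT_comp measurable_crt measurable_snd).
apply: measurable_funM => //; apply: measurable_fun_inv; apply: measurable_funD => //.
by apply: measurable_funX; apply: measurable_funM => //; exact: measurable_fst.
Qed.

Lemma measurable_ckern tau : measurable_fun setT (ckern tau).
Proof.
apply: measurable_funM => //; apply: measurable_fun_inv; apply: measurable_funD => //.
by apply: measurable_funX; exact: measurable_funM.
Qed.

Lemma ckern_integral tau : (\int[mu]_xi (ckern tau xi)%:E <= pi%:E)%E.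
Proof.
have [->|t0] := eqVneq tau 0.
  rewrite (_ : (fun _ => _) = fun=> 0%E) ?integral0 ?lee_fin ?pi_ge0//.
  by apply/funext => x; rewrite /ckern crt0 invr0 mul0r.
have T0 := crt_gt0 t0; have Ti : 0 < (crt tau)^-1 by rewrite invr_gt0.
rewrite /ckern ge0_integralZ_EFin; first last.
- by move=> x; exact: inv1sq_ge0.
- exact: (continuous_measurable_fun (@inv1sq_continuous R (crt tau)^-1)).
- exact: ltW.
apply: (@le_trans _ _ ((crt tau)^-1%:E * (pi / (crt tau)^-1)%:E)%E).
  by rewrite lee_pmul2l// inv1sq_integral.
by rewrite -EFinM lee_fin mulrC invrK mulfK// gt_eqF.
Qed.

(** The integral of [ckern tau] is at most [pi] for every [tau], so integrability on the plane is
    reduced to that of the weight in [tau]. *)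
Lemma ckern_dominated (f : R * R -> R[i]) (w : R -> R) : cmeasurable f ->
  mu.-integrable setT (EFin \o w) -> (forall tau, 0 <= w tau) ->
  (forall xi tau, cmod (f (xi, tau)) <= w tau * ckern tau xi) -> cintegrable leb2 f.
Proof.
move=> mf iw w0 fw.
have mw : measurable_fun setT w by apply/measurable_EFinP; exact: measurable_int iw.
have mg : measurable_fun setT (fun p : R * R => w p.2 * ckern p.2 p.1).
  apply: measurable_funM; last exact: measurable_ckern2.
  exact: (measurableT_comp mw measurable_snd).
have g0 (p : R * R) : 0 <= w p.2 * ckern p.2 p.1 by rewrite mulr_ge0// ckern_ge0.
apply: (@le_cintegrable _ _ _ leb2 _ (fun p => w p.2 * ckern p.2 p.1)) => //; last first.
  by case=> xi tau; exact: fw.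
apply/integrableP; split; first exact/measurable_EFinP.
rewrite (_ : (fun x => _) = fun p : R * R => (w p.2 * ckern p.2 p.1)%:E); last first.
  by apply/funext => p /=; rewrite ger0_norm.
rewrite leb2_tonelli2//=.
apply: (@le_lt_trans _ _ (\int[mu]_tau (w tau * pi)%:E)%E).
  apply: ge0_le_integral => //.
  - by move=> tau _; apply: integral_ge0 => xi _; rewrite lee_fin mulr_ge0// ckern_ge0.
  - apply: (@measurable_fun_fubini_tonelli_G _ _ _ _ _ mu (fun p : R * R => (w p.2 * ckern p.2 p.1)%:E)).
      exact/measurable_EFinP.
    by move=> p; rewrite lee_fin.
  - by apply/measurable_EFinP; exact: measurable_funM.
  - move=> tau _; rewrite ge0_integralZ_EFin//; [|exact: measurable_ckern|by move=> x; exact: ckern_ge0].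
    by rewrite EFinM lee_wpmul2l ?lee_fin// ckern_integral.
have : mu.-integrable setT (fun tau => (w tau * pi)%:E).
  have : mu.-integrable setT (fun tau => (pi%:E * (w tau)%:E)%E) by exact: integrableZl.
  by apply: eq_integrable => // x _; rewrite -EFinM mulrC.
move=> /integrableP[_]; congr (_ < _)%E; apply: eq_integral => x _.
by rewrite /= ger0_norm// mulr_ge0// pi_ge0.
Qed.

End CauchyKernel.

Section Decay.
Context {R : realType}.
Local Notation mu := (@lebesgue_measure R).

Lemma jap_exp_le (x : R) N : jap x ^+ N <= 2 ^+ N * (1 + `|x| ^+ N).
Proof.
apply: (@le_trans _ _ ((1 + `|x|) ^+ N)).
  by rewrite lerXn2r ?nnegrE ?jap_ge0 ?addr_ge0// jap_le1D.
have [x1|x1] := leP `|x| 1.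
  apply: (@le_trans _ _ (2 ^+ N)); last by rewrite ler_peMr ?exprn_ge0// lerDl exprn_ge0.
  by rewrite lerXn2r ?nnegrE ?addr_ge0//; lra.
apply: (@le_trans _ _ ((2 * `|x|) ^+ N)); last by rewrite exprMn ler_wpM2l ?exprn_ge0// lerDr.
by rewrite lerXn2r ?nnegrE ?addr_ge0 ?mulr_ge0//; lra.
Qed.

Lemma schwartz_fourier_jap (h : R -> R[i]) N : schwartz h ->
  exists2 M, 0 <= M & forall xi, jap xi ^+ N * cmod (fourier1 h xi) <= M.
Proof.
move=> sh; have [M0 h0] := schwartz_fourier_le 0 sh; have [M1 h1] := schwartz_fourier_le N sh.
have b xi : jap xi ^+ N * cmod (fourier1 h xi) <= 2 ^+ N * (M0 + M1).
  apply: (@le_trans _ _ (2 ^+ N * (1 + `|xi| ^+ N) * cmod (fourier1 h xi))).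
    by rewrite ler_wpM2r ?cmod_ge0// jap_exp_le.
  rewrite -mulrA ler_wpM2l ?exprn_ge0// mulrDl lerD//.
  by have := h0 xi; rewrite expr0.
exists (2 ^+ N * (M0 + M1)) => //; apply: le_trans (b 0).
by rewrite mulr_ge0 ?exprn_ge0 ?jap_ge0 ?cmod_ge0.
Qed.

Lemma crt_le_jap (tau : R) : crt tau <= jap tau.
Proof.
have [t1|t1] := leP (crt tau) 1; first exact: le_trans (jap_ge1 _).
apply: le_trans (norm_le_jap tau); rewrite -crtX3.
by rewrite -[leLHS]expr1 ler_weXn2l// ltW.
Qed.

Lemma crt_exp_le_jap (tau : R) j : crt tau ^+ j <= jap tau ^+ j.
Proof. by rewrite lerXn2r ?nnegrE ?crt_ge0 ?jap_ge0// crt_le_jap. Qed.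

Lemma crt_fourier_integrable (h : R -> R[i]) j : schwartz h ->
  mu.-integrable setT (EFin \o (fun tau => crt tau ^+ j * cmod (fourier1 h tau))).
Proof.
move=> sh; have [M M0 hM] := schwartz_fourier_jap (j + 2) sh.
have ii : cintegrable mu (fun tau => (crt tau ^+ j * cmod (fourier1 h tau))%:C).
  apply: (@le_inv1sq_integrable _ _ M).
    apply: cmeasurable_real; apply: measurable_funM; first by apply: measurable_funX; exact: measurable_crt.
    apply: measurable_cmod; exact: cintegrable_measurable (schwartz_fourier_integrable sh).
  move=> x; rewrite cmodR ger0_norm; last by rewrite mulr_ge0 ?cmod_ge0 ?exprn_ge0 ?crt_ge0.
  rewrite ler_pdivlMr ?ltr_pwDl ?sqr_ge0// -japE (le_trans _ (hM x))//.
  rewrite exprD mulrAC ler_wpM2r ?cmod_ge0// ler_wpM2r ?exprn_ge0 ?jap_ge0//.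
  exact: crt_exp_le_jap.
by have [] := ii.
Qed.

(** One spare factor [jap] suffices, [jap ^- 2] being integrable. *)
Lemma Hhat_fin (U : R -> R[i]) s (M : R) : cmeasurable U ->
  (forall xi, jap xi `^ s * cmod (U xi) * jap xi <= M) -> (Hhat s U < +oo)%E.
Proof.
move=> mU hM.
have : (Hsq s U < +oo)%E.
  have mf : measurable_fun setT (fun xi => (jap xi `^ s * cmod (U xi)) ^+ 2).
    apply: measurable_funX; apply: measurable_funM; first exact: measurable_jap_powR.
    exact: measurable_cmod.
  have ii : cintegrable mu (fun xi => ((jap xi `^ s * cmod (U xi)) ^+ 2)%:C).
    apply: (@le_inv1sq_integrable _ _ (M ^+ 2)); first exact: cmeasurable_real.
    move=> x; rewrite cmodR ger0_norm ?sqr_ge0// ler_pdivlMr ?ltr_pwDl ?sqr_ge0//.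
    rewrite -japE -exprMn lerXn2r ?nnegrE//.
      by rewrite !mulr_ge0 ?powR_ge0 ?cmod_ge0 ?jap_ge0.
    apply: le_trans (hM 0); by rewrite !mulr_ge0 ?powR_ge0 ?cmod_ge0 ?jap_ge0.
  have [i1 _] := ii; rewrite /Hsq; have /integrableP[_] := i1.
  by congr (_ < _)%E; apply: eq_integral => x _; rewrite /= ger0_norm// sqr_ge0.
by rewrite -Hhat_sqr; apply: lty_poweRy.
Qed.

Lemma jap_powR_le (s : R) : exists N, forall x : R, jap x `^ s <= jap x ^+ N.
Proof.
exists (Num.bound `|s|) => x; rewrite -powR_mulrn ?jap_ge0//.
apply: ler_powR; first exact: jap_ge1.
by rewrite (le_trans (ler_norm s))// ltW// archi_boundP.
Qed.

Lemma Hhat_schwartz_fin (h : R -> R[i]) s j : schwartz h ->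
  (Hhat s (fun tau => ((crt tau ^+ j)%:C * fourier1 h tau)%R) < +oo)%E.
Proof.
move=> sh; have [N hN] := jap_powR_le s; have [M M0 hM] := schwartz_fourier_jap (N + j + 1) sh.
apply: (@Hhat_fin _ s M).
  apply: cmeasurableM; last exact: cintegrable_measurable (schwartz_fourier_integrable sh).
  by apply: cmeasurable_real; apply: measurable_funX; exact: measurable_crt.
move=> x; rewrite cmodM cmodR ger0_norm ?exprn_ge0 ?crt_ge0//; apply: le_trans (hM x).
rewrite !exprD expr1 -!mulrA ler_pM ?powR_ge0//.
  by rewrite !mulr_ge0 ?exprn_ge0 ?crt_ge0 ?cmod_ge0 ?jap_ge0.
rewrite ler_pM ?exprn_ge0 ?crt_ge0//; first by rewrite !mulr_ge0 ?cmod_ge0 ?jap_ge0.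
  exact: crt_exp_le_jap.
by rewrite mulrC.
Qed.

End Decay.

(** * Traces, equation and slices of the forcing term *)

Section Forcing.
Context {R : realType} (m n : nat).
Hypothesis hmn : (m + 4 <= n)%N.
Local Notation mu := (@lebesgue_measure R).
Local Notation leb2 := (@leb2 R).
Local Notation K := (@symb_K R m n).
Local Notation CK := (@CK R m n).
Implicit Types h : R -> R[i].

Definition fsymb h (k : R * R) : R[i] := fourier1 h k.2 * K k.1 k.2.

Lemma bforceE h p : bforce m n h p = ((2 * pi) ^- 2)%:C * ifourier2 (fsymb h) p.
Proof. by congr (_ * _); apply: eq_cintegral => k; rewrite cexp_i. Qed.

Lemma cmod_xiK_ckern j xi tau : (j <= 3)%N ->
  `|xi| ^+ j * cmod (K xi tau) <= CK * crt tau ^+ j * ckern tau xi.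
Proof.
move=> j3; have [->|t0] := eqVneq tau 0; last exact: cmod_xiK_le.
by rewrite symb_K0 cmod0 mulr0 mulr_ge0 ?ckern_ge0// mulr_ge0 ?CK_ge0 ?exprn_ge0 ?crt_ge0.
Qed.

Lemma cmeasurable_fsymb h : schwartz h -> cmeasurable (fsymb h).
Proof.
move=> sh; apply: cmeasurableM; last exact: cmeasurable_K2.
exact: (cmeasurable_comp (cintegrable_measurable (schwartz_fourier_integrable sh)) measurable_snd).
Qed.

(** The powers of [xi] become powers of [crt tau], and those of [tau] are cubes of it, whence the
    exponent [j + 3 l]; the rapid decay of the transform of [h] absorbs them. *)
Lemma fsymb_integrable h (j l : nat) : schwartz h -> (j <= 3)%N ->
  cintegrable leb2 (fun k => (k.1 ^+ j)%:C * (k.2 ^+ l)%:C * fsymb h k).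
Proof.
move=> sh j3; have iw := crt_fourier_integrable (j + 3 * l) sh.
apply: (@ckern_dominated _ _ (fun tau => CK * (crt tau ^+ (j + 3 * l) * cmod (fourier1 h tau)))).
- apply: cmeasurableM; last exact: cmeasurable_fsymb.
  apply: cmeasurableM; apply: cmeasurable_real; apply: measurable_funX; [exact: measurable_fst|exact: measurable_snd].
- have : mu.-integrable setT (fun tau => (CK%:E * (crt tau ^+ (j + 3 * l) * cmod (fourier1 h tau))%:E)%E).
    exact: integrableZl.
  by apply: eq_integrable.
- by move=> tau; rewrite !mulr_ge0 ?CK_ge0 ?exprn_ge0 ?crt_ge0 ?cmod_ge0.
- move=> xi tau; rewrite /fsymb /= exprD exprM crtX3.
  have -> : cmod ((xi ^+ j)%:C * (tau ^+ l)%:C * (fourier1 h tau * K xi tau)) =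
      (`|xi| ^+ j * `|tau| ^+ l) * (cmod (fourier1 h tau) * cmod (K xi tau)).
    by rewrite cmodM (cmodM _ (K xi tau)) cmodM !cmodR !normrX.
  have := cmod_xiK_ckern xi tau j3.
  have a0 : 0 <= `|tau| ^+ l * cmod (fourier1 h tau) by rewrite mulr_ge0 ?exprn_ge0 ?cmod_ge0.
  move=> /(ler_wpM2l a0) H.
  by apply: le_trans (le_trans H _); rewrite le_eqVlt; apply/orP; left; apply/eqP; ring.
Qed.

Lemma fsymb_integrable0 h : schwartz h -> cintegrable leb2 (fsymb h).
Proof.
move=> sh; have := @fsymb_integrable h 0 0 sh isT.
by under eq_fun do rewrite !expr0 mul1r mul1r.
Qed.

Lemma bforce_ccontinuous h : schwartz h -> ccontinuous (bforce m n h).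
Proof.
move=> sh; rewrite (_ : bforce m n h = fun p => ((2 * pi) ^- 2)%:C * ifourier2 (fsymb h) p).
  by apply: ccontinuousZ; apply: ccontinuous_ifourier2; exact: fsymb_integrable0.
by apply/funext => p; exact: bforceE.
Qed.

(** The multiplier that takes the transform of [h] to the transform in time of the trace at [x]. *)
Definition trace_symb (x tau : R) : R[i] := ((2 * pi)^-1)%:C * ifourier1 (fun xi => K xi tau) x.

Lemma pi_inv2 (z : R[i]) : ((2 * pi) ^- 2)%:C * z = ((2 * pi)^-1)%:C * (((2 * pi)^-1)%:C * z).
Proof. by rewrite mulrA -rmorphM -invfM expr2. Qed.

Lemma cmeasurable_trace_symb x : cmeasurable (trace_symb x).
Proof.
apply: cmeasurableM; first exact: cmeasurable_cst.
apply: (@cmeasurable_leb2 _ (fun p : R * R => cis (x * p.1) * K p.1 p.2)).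
apply: cmeasurableM; last exact: cmeasurable_K2.
by apply: cmeasurable_cis; apply: measurable_funM => //; exact: measurable_fst.
Qed.

(** The factor 2 of the complex integral bound and the integral [pi] of the kernel cancel exactly
    against [2 pi]. *)
Lemma cmod_xiK_integral_le (f : R -> R[i]) (c tau : R) j : (j <= 3)%N -> 0 <= c -> cmeasurable f ->
  (forall xi, cmod (f xi) <= c * (`|xi| ^+ j * cmod (K xi tau))) ->
  cmod (((2 * pi)^-1)%:C * cintegral mu f) <= c * CK * crt tau ^+ j.
Proof.
move=> j3 c0 mf fc; have pi0 : 0 < pi :> R := pi_gt0 R.
have A0 : 0 <= c * CK * crt tau ^+ j.
  apply: mulr_ge0; last by rewrite exprn_ge0 ?crt_ge0.
  by apply: mulr_ge0 => //; exact: CK_ge0.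
have pi2 : 0 < 2 * pi :> R by rewrite mulr_gt0.
rewrite cmodM cmodR gtr0_norm ?invr_gt0// mulrC ler_pdivrMr//.
have -> : c * CK * crt tau ^+ j * (2 * pi) = 2 * (c * CK * crt tau ^+ j * pi) by ring.
apply: (@cmod_cintegral_leR _ _ _ mu f (fun xi => c * CK * crt tau ^+ j * ckern tau xi)) => //.
- move=> xi; apply: (le_trans (fc xi)); rewrite -2!mulrA; apply: ler_wpM2l => //.
  by rewrite mulrA; exact: cmod_xiK_ckern.
- by apply: measurable_funM => //; exact: measurable_ckern.
- rewrite ge0_integralZ_EFin//; [|exact: measurable_ckern|by move=> xi; exact: ckern_ge0].
  rewrite [leRHS]EFinM; apply: lee_wpmul2l; first by rewrite lee_fin.
  exact: ckern_integral.
Qed.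

Lemma cmeasurable_cisK (x tau : R) : cmeasurable (fun xi : R => cis (x * xi) * K xi tau).
Proof.
apply: cmeasurableM; last exact: cmeasurable_K1.
by apply: cmeasurable_cis; exact: measurable_funM.
Qed.

Lemma cmod_trace_symb x tau : cmod (trace_symb x tau) <= CK.
Proof.
rewrite -[leRHS]mul1r -[leRHS]mulr1 -(expr0 (crt tau)).
apply: cmod_xiK_integral_le => //; first exact: cmeasurable_cisK.
by move=> xi; rewrite cmodM cmod_cis !mul1r.
Qed.

(** The Lipschitz bound of [cis] costs one power of [xi], hence one power of [crt tau]. *)
Lemma cmod_trace_symbB x x0 tau :
  cmod (trace_symb x tau - trace_symb x0 tau) <= 2 * CK * `|x - x0| * crt tau.
Proof.
have iK y := cintegrable_ifourier y (K_integrable hmn tau).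
have -> : trace_symb x tau - trace_symb x0 tau =
  ((2 * pi)^-1)%:C * cintegral mu (fun xi => cis (x * xi) * K xi tau - cis (x0 * xi) * K xi tau).
  by rewrite (cintegralB (iK x) (iK x0)) -mulrBr.
have -> : 2 * CK * `|x - x0| * crt tau = 2 * `|x - x0| * CK * crt tau ^+ 1 by ring.
apply: cmod_xiK_integral_le => //; first by apply: cmeasurableB; exact: cmeasurable_cisK.
move=> xi; rewrite -mulrBl cmodM mulrA ler_wpM2r ?cmod_ge0// (le_trans (cis_lip _ _))//.
by rewrite -mulrBl normrM mulrA.
Qed.

Lemma trace_integrable h x : schwartz h -> cintegrable mu (fun tau => fourier1 h tau * trace_symb x tau).
Proof.
move=> sh; apply: (@cintegrableMr _ _ _ mu (fourier1 h) (trace_symb x) CK).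
- exact: cmeasurable_trace_symb.
- exact: cmod_trace_symb.
- exact: schwartz_fourier_integrable.
Qed.

Lemma bforce_traceE h x t : schwartz h ->
  bforce m n h (x, t) = ((2 * pi)^-1)%:C * ifourier1 (fun tau => fourier1 h tau * trace_symb x tau) t.
Proof.
move=> sh; have iU := fsymb_integrable0 sh.
rewrite bforceE pi_inv2; congr (_ * _).
rewrite /ifourier2 (leb2_fubini2 (cintegrable_ifourier2 _ iU)).2.
have iT := cintegrable_ifourier t (trace_integrable x sh).
have E (tau : R) : cintegral mu (fun xi : R => cis (phase (x, t) (xi, tau)) * fsymb h (xi, tau)) =
   (2 * pi)%:C * (cis (t * tau) * (fourier1 h tau * trace_symb x tau)).
  rewrite /trace_symb [(2 * pi)%:C * _]mulrCA !mulrA.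
  have -> : cis (t * tau) * (2 * pi)%:C * fourier1 h tau * ((2 * pi)^-1)%:C = cis (t * tau) * fourier1 h tau.
    rewrite -[RHS]mulr1 -(@twopi_invK R); ring.
  rewrite -(cintegralZ _ (cintegrable_ifourier x (K_integrable hmn tau))).
  by apply: eq_cintegral => xi; rewrite /phase /= cisD /fsymb /=; ring.
rewrite (eq_cintegral mu E) (cintegralZ _ iT) mulrA twopi_invK mul1r.
by [].
Qed.

Lemma bforce_trace_fourier h x : schwartz h ->
  is_fourier1 (fun t => bforce m n h (x, t)) (fun tau => fourier1 h tau * trace_symb x tau).
Proof.
move=> sh; have := is_fourier1_ifourier1 (trace_integrable x sh).
by congr is_fourier1; apply/funext => t; rewrite bforce_traceE.
Qed.

Lemma bforce_traceB_fourier h x x0 : schwartz h ->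
  is_fourier1 (fun t => bforce m n h (x, t) - bforce m n h (x0, t))
    (fun tau => fourier1 h tau * (trace_symb x tau - trace_symb x0 tau)).
Proof.
move=> sh; have i1 := trace_integrable x sh; have i0 := trace_integrable x0 sh.
have := is_fourier1_ifourier1 (cintegrableB i1 i0).
have -> : (fun tau => fourier1 h tau * trace_symb x tau - fourier1 h tau * trace_symb x0 tau) =
  (fun tau => fourier1 h tau * (trace_symb x tau - trace_symb x0 tau)).
  by apply/funext => tau; rewrite mulrBr.
congr is_fourier1; apply/funext => t; rewrite !bforce_traceE// -mulrBr; congr (_ * _).
rewrite /ifourier1 -(cintegralB (cintegrable_ifourier t i1) (cintegrable_ifourier t i0)).
by apply: eq_cintegral => tau; rewrite !mulrBr.
Qed.

Lemma Hnorm_trace_le h x alpha : schwartz h ->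
  (Hnorm alpha (fun t => bforce m n h (x, t)) <= CK%:E * Hnorm alpha h)%E.
Proof.
move=> sh; have F := bforce_trace_fourier x sh.
apply: (@Hnorm_multiplier _ alpha CK h _ _ (CK_ge0 _ _) sh F) => tau _.
by rewrite cmodM mulrC ler_wpM2r ?cmod_ge0// cmod_trace_symb.
Qed.

Lemma Hnorm_schwartz_fin h alpha : schwartz h -> (Hnorm alpha h < +oo)%E.
Proof.
move=> sh; rewrite (Hnorm_schwartz _ sh); have := Hhat_schwartz_fin alpha 0 sh.
by under [fun tau => _]eq_fun do rewrite expr0 mul1r.
Qed.

(** The trace is even Lipschitz in [x]: up to a constant, the Lipschitz constant is the norm of
    [crt tau] times the transform of [h], finite by rapid decay. *)
Lemma Hnorm_trace_cvg h x0 alpha : schwartz h ->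
  Hnorm alpha (fun t => bforce m n h (x, t) - bforce m n h (x0, t)) @[x --> x0] --> 0%E.
Proof.
move=> sh; have fin := Hhat_schwartz_fin alpha 1 sh.
set A := Hhat _ _ in fin; have A0 : (0 <= A)%E by exact: Lnorm_ge0.
have Afin : A \is a fin_num by rewrite ge0_fin_numE.
have le x : (Hnorm alpha (fun t => (bforce m n h (x, t) - bforce m n h (x0, t))%R) <=
    (2 * CK * `|x - x0| * fine A)%:E)%E.
  apply: (le_trans (Hnorm_le alpha (bforce_traceB_fourier x x0 sh))).
  have c0 : 0 <= 2 * CK * `|x - x0| by apply: mulr_ge0 => //; apply: mulr_ge0 => //; exact: CK_ge0.
  rewrite EFinM fineK//; apply: Lnorm2_le_sqr => //; first exact: Lnorm_ge0.
  rewrite !Hhat_sqr /Hsq.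
  have mh := cintegrable_measurable (schwartz_fourier_integrable sh).
  have mH U : cmeasurable U -> measurable_fun setT (fun xi : R => (jap xi `^ alpha * cmod (U xi)) ^+ 2).
    by move=> mU; apply: measurable_funX; apply: measurable_funM; [exact: measurable_jap_powR|exact: measurable_cmod].
  have mT : cmeasurable (fun tau => (crt tau ^+ 1)%:C * fourier1 h tau).
    by apply: cmeasurableM => //; apply: cmeasurable_real; apply: measurable_funX; exact: measurable_crt.
  rewrite -ge0_integralZ_EFin//; first last.
  - by move=> tau; exact: sqr_ge0.
  - exact: mH.
  - exact: sqr_ge0.
  apply: ge0_le_integral_EFin.
  - apply: mH; apply: cmeasurableM => //; apply: cmeasurableB; exact: cmeasurable_trace_symb.
  - by apply: measurable_funM => //; exact: mH.
  - by move=> tau; exact: sqr_ge0.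
  - move=> tau; rewrite -exprMn.
    have j0 : 0 <= jap tau `^ alpha by exact: powR_ge0.
    have g0 : 0 <= cmod (fourier1 h tau) by exact: cmod_ge0.
    have H := cmod_trace_symbB x x0 tau.
    rewrite cmodM (cmodM _ (fourier1 h tau)) cmodR expr1 (ger0_norm (crt_ge0 tau)).
    have T0 := crt_ge0 tau; have b0 := cmod_ge0 (trace_symb x tau - trace_symb x0 tau).
    have a1 : 0 <= jap tau `^ alpha * (crt tau * cmod (fourier1 h tau)) by rewrite mulr_ge0// mulr_ge0.
    apply: lerXn2r; rewrite ?nnegrE.
    - by rewrite mulr_ge0// mulr_ge0.
    - exact: mulr_ge0.
    rewrite [leRHS]mulrCA; apply: ler_wpM2l => //; rewrite mulrC [leRHS]mulrA.
    exact: ler_wpM2r.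
apply: (@squeeze_cvge _ _ _ _ (fun=> 0%E) _ (fun x => (2 * CK * `|x - x0| * fine A)%:E)).
- by apply: nearW => x; rewrite Hnorm_ge0 le.
- exact: cvg_cst.
- apply: cvg_EFin; first exact: nearW.
  have L : 2 * CK * `|x - x0| * fine A @[x --> x0] --> 2 * CK * 0 * fine A.
    apply: cvgM; last exact: cvg_cst.
    apply: cvgM; first exact: cvg_cst.
    by apply/norm_cvg0P; apply/subr_cvg0; exact: cvg_id.
  by rewrite mulr0 mul0r in L; exact: L.
Qed.

Lemma trace_symb0 (tau : R) : tau != 0 -> trace_symb 0 tau = 1.
Proof.
move=> t0; have [p hp] := @K_profile R m n hmn.
rewrite /trace_symb hp// mulrA twopi_invK mul1r /profile one_sided_gt0//.
by rewrite rmorph0 mulr0 cexp0 mulr1.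
Qed.

Lemma trace_symb_ge0 (x tau : R) : 0 <= x -> tau != 0 ->
  trace_symb x tau = cexp ('i%C * x%:C * omega * rho tau).
Proof.
move=> x0 t0; have [p hp] := @K_profile R m n hmn.
rewrite /trace_symb hp// mulrA twopi_invK mul1r /profile one_sided_gt0// mul1r.
by congr cexp; ring.
Qed.

Lemma ae_cintegral_neq0 (f g : R -> R[i]) : cmeasurable f -> cmeasurable g ->
  (forall x, x != 0 -> f x = g x) -> cintegral mu f = cintegral mu g.
Proof.
move=> mf mg fg; apply: ae_eq_cintegral => //.
exists [set 0]; split => //; first exact: lebesgue_measure_set1.
by move=> x /= nx; apply: contrapT => /eqP x0; apply: nx; exact: fg.
Qed.

Lemma bforce_x0 h t : schwartz h -> bforce m n h (0, t) = h t.
Proof.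
move=> sh; have iH := schwartz_fourier_integrable sh; have mH := cintegrable_measurable iH.
have mc : cmeasurable (fun tau : R => cis (t * tau)) by apply: cmeasurable_cis; exact: measurable_funM.
rewrite bforce_traceE// (_ : ifourier1 _ t = ifourier1 (fourier1 h) t).
  by rewrite schwartz_inversion// mulrA twopi_invK mul1r.
apply: ae_cintegral_neq0; [|exact: cmeasurableM|].
  apply: cmeasurableM => //; apply: cmeasurableM => //; exact: cmeasurable_trace_symb.
by move=> tau t0; rewrite trace_symb0// mulr1.
Qed.

Lemma cmeasurable_ray_symb (x : R) : cmeasurable (fun tau : R => cexp ('i%C * x%:C * omega * rho tau)).
Proof.
by apply: cmeasurable_cexp; apply: cmeasurableM; [exact: cmeasurable_cst|exact: measurable_rho].
Qed.

Lemma bforce_explicit h x t : schwartz h -> 0 <= x ->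
  bforce m n h (x, t) = ((2 * pi)^-1)%:C * cintegral mu (fun tau =>
    cexp ('i%C * (t * tau)%:C) * fourier1 h tau * cexp ('i%C * x%:C * omega * rho tau)).
Proof.
move=> sh x0; have iH := schwartz_fourier_integrable sh; have mH := cintegrable_measurable iH.
have mc : cmeasurable (fun tau : R => cis (t * tau)) by apply: cmeasurable_cis; exact: measurable_funM.
rewrite bforce_traceE//; congr (_ * _); apply: ae_cintegral_neq0.
- apply: cmeasurableM => //; apply: cmeasurableM => //; exact: cmeasurable_trace_symb.
- under eq_fun do rewrite cexp_i.
  by apply: cmeasurableM; [exact: cmeasurableM|exact: cmeasurable_ray_symb].
- by move=> tau t0; rewrite trace_symb_ge0// mulrA cexp_i.
Qed.

Lemma cmod_ray_symb (x tau : R) : cmod (cexp ('i%C * x%:C * omega * rho tau)) =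
  expR (- (Num.sqrt 3 / 2) * `|tau| `^ 3^-1 * x).
Proof.
rewrite cmod_cexp; congr expR.
have -> : 'i%C * x%:C * omega * rho tau = 'i%C * (x%:C * (omega * rho tau)) by ring.
rewrite ReM /= mul0r mul1r sub0r ImM /= mul0r addr0 Im_omega_rho /crt.
ring.
Qed.

(** The symbol of [d_t + d_x^3] is [i tau + (i xi)^3 = i (tau - xi^3)]. *)
Definition airy_symb h (k : R * R) : R[i] := 'i%C * (k.2 - k.1 ^+ 3)%:C * fsymb h k.

Lemma airy_symb_integrable h : schwartz h -> cintegrable leb2 (airy_symb h).
Proof.
move=> sh; have i1 := @fsymb_integrable h 0 1 sh isT; have i2 := @fsymb_integrable h 3 0 sh isT.
have := cintegrableZ 'i%C (cintegrableB i1 i2).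
rewrite (_ : (fun _ => _) = airy_symb h)//; apply/funext => k.
rewrite /airy_symb (expr0 k.1) (expr0 k.2) (expr1 k.2) rmorphB /=.
have -> : (1 : R)%:C = 1 :> R[i] by [].
ring.
Qed.

Lemma ifourier2_fourier2 (f : R * R -> R[i]) k : ifourier2 f k = fourier2 f (- k.1, - k.2).
Proof.
rewrite fourier2E; apply: eq_cintegral => p; congr (cis _ * _).
by rewrite /phase /=; ring.
Qed.

Lemma fourier2_NB (f g : R * R -> R[i]) q : cintegrable leb2 f -> cintegrable leb2 g ->
  fourier2 (fun p => - f p - g p) q = - fourier2 f q - fourier2 g q.
Proof.
move=> /(cintegrable_fourier2 q) f1 /(cintegrable_fourier2 q) g1.
rewrite (fourier2E f) (fourier2E g) (fourier2E (fun p => - f p - g p)).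
rewrite -(cintegralN f1) -(cintegralB (cintegrableN f1) g1).
by apply: eq_cintegral => p; rewrite mulrBr mulrN.
Qed.

(** Both sides are paired on the frequency side. There the transform of [phi] is taken at the
    reflected frequency, where the adjoint [- d_t - d_x^3] again acts as [i (tau - xi^3)]. *)
Lemma airy_dist_bforce h : schwartz h ->
  airy_dist setT (bforce m n h) (fun p => ((2 * pi) ^- 2)%:C * ifourier2 (airy_symb h) p).
Proof.
move=> sh phi cphi kphi _; have sphi := schwartz_of_compact cphi kphi.
have iU := fsymb_integrable0 sh; have iA := airy_symb_integrable sh.
have s1 := schwartz_dt sphi; have s3 := schwartz_dx (schwartz_dx (schwartz_dx sphi)).
have i1 := schwartz2_integrable s1; have i3 := schwartz2_integrable s3.
have ip := schwartz2_integrable sphi.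
pose psi p := - dt phi p - dx (dx (dx phi)) p.
have ipsi : cintegrable leb2 psi by apply: cintegrableB => //; exact: cintegrableN.
have Zl (U f : R * R -> R[i]) : cintegrable leb2 U -> cintegrable leb2 f ->
    cintegral leb2 (fun p => ((2 * pi) ^- 2)%:C * ifourier2 U p * f p) =
    ((2 * pi) ^- 2)%:C * cintegral leb2 (fun k => U k * ifourier2 f k).
  move=> iV jf; have mi : cmeasurable (ifourier2 U) := ccontinuous_measurable2 (ccontinuous_ifourier2 iV).
  have [M UM] := cmod_ifourier2_le iV.
  rewrite -ifourier2_pairing// -(cintegralZ _ (@cintegrableMl _ _ _ leb2 f _ M mi UM jf)).
  by apply: eq_cintegral => p; rewrite mulrA.
rewrite (_ : (fun p => bforce m n h p * _) = fun p => ((2 * pi) ^- 2)%:C * ifourier2 (fsymb h) p * psi p); last first.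
  by apply/funext => p; rewrite bforceE.
rewrite (Zl _ _ iU ipsi) (Zl _ _ iA ip); congr (_ * _); apply: eq_cintegral => k.
rewrite (ifourier2_fourier2 psi) (ifourier2_fourier2 phi).
set q := (- k.1, - k.2).
have -> : fourier2 psi q = 'i%C * (k.2 - k.1 ^+ 3)%:C * fourier2 phi q.
  have -> : fourier2 psi q = - fourier2 (dt phi) q - fourier2 (dx (dx (dx phi))) q.
    exact: fourier2_NB.
  rewrite (fourier2_dt q sphi) (fourier2_dx q (schwartz_dx (schwartz_dx sphi))).
  rewrite (fourier2_dx q (schwartz_dx sphi)) (fourier2_dx q sphi) /q /=.
  rewrite !rmorphN rmorphB rmorphXn /=.
  have ii : 'i%C * 'i%C = -1 :> R[i] by rewrite -expr2 sqr_i.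
  have E (a b w : R[i]) : - ('i%C * - b * w) - 'i%C * - a * ('i%C * - a * ('i%C * - a * w)) =
    'i%C * b * w + ('i%C * 'i%C) * 'i%C * a ^+ 3 * w by ring.
  by rewrite E ii; ring.
by rewrite /airy_symb; ring.
Qed.

Lemma airy_vanish h x t : schwartz h -> 0 < x -> ifourier2 (airy_symb h) (x, t) = 0.
Proof.
move=> sh x0; have iA := airy_symb_integrable sh.
rewrite /ifourier2 (leb2_fubini2 (cintegrable_ifourier2 _ iA)).2.
rewrite -[RHS](cintegral0 mu); apply: eq_cintegral => tau.
have iK : cintegrable mu (fun xi => (tau - xi ^+ 3)%:C * K xi tau).
  have := cintegrableB (cintegrableZ tau%:C (K_integrable hmn tau)) (xi3K_integrable hmn tau).
  by under eq_fun do rewrite -mulrBl -rmorphB.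
transitivity (cis (t * tau) * 'i%C * fourier1 h tau * ifourier1 (fun xi => (tau - xi ^+ 3)%:C * K xi tau) x).
  rewrite -(cintegralZ _ (cintegrable_ifourier x iK)); apply: eq_cintegral => xi.
  by rewrite /phase /= cisD /airy_symb /fsymb /=; ring.
by rewrite airy_K_vanish// mulr0.
Qed.

(** The transform in [x] of the forcing term at time [t]. *)
Definition space_symb h (t xi : R) : R[i] :=
  ((2 * pi)^-1)%:C * cintegral mu (fun tau => cis (t * tau) * fsymb h (xi, tau)).

Lemma space_symb_integrable h t : schwartz h -> cintegrable mu (space_symb h t).
Proof.
move=> sh; have iU := fsymb_integrable0 sh.
have [H _] := leb2_fubini1 (cintegrable_ifourier2 (0, t) iU).
apply: cintegrableZ; move: H; congr (cintegrable mu); apply/funext => xi.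
by apply: eq_cintegral => tau; rewrite /phase /= mul0r add0r.
Qed.

(** For [xi] different from 0 this bounds the symbol uniformly in [tau], so that each slice in [tau]
    is integrable. *)
Lemma cmod_K_inv (xi tau : R) : cmod (K xi tau) <= CK * (`|xi| + crt tau)^-1.
Proof.
have x0 := normr_ge0 xi; have T0 := crt_ge0 tau.
have S0 : 0 <= `|xi| + crt tau by rewrite addr_ge0.
apply: (le_trans (cmod_K_le hmn xi tau)); apply: ler_wpM2l; first exact: CK_ge0.
have [Sz|Sn] := eqVneq (`|xi| + crt tau) 0.
  by rewrite Sz expr0n /= invr0 mulr0.
have S1 : 0 < `|xi| + crt tau by rewrite lt_neqAle eq_sym Sn.
rewrite ler_pdivrMr ?exprn_gt0// exprS mulKf//.
have nE : (n = m + (n - m))%N by lia.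
rewrite [X in _ <= _ ^+ X]nE exprD ler_pM ?exprn_ge0//.
  by rewrite lerXn2r ?nnegrE// lerDl.
by rewrite lerXn2r ?nnegrE// lerDr.
Qed.

Lemma fsymb_slice_integrable h xi : schwartz h -> xi != 0 -> cintegrable mu (fun tau => fsymb h (xi, tau)).
Proof.
move=> sh x0; apply: (@cintegrableMr _ _ _ mu (fourier1 h) (fun tau => K xi tau) (CK * `|xi|^-1)).
- exact: (cmeasurable_pair1 xi (@cmeasurable_K2 R m n)).
- move=> tau; apply: (le_trans (cmod_K_inv xi tau)); apply: ler_wpM2l; first exact: CK_ge0.
  rewrite lef_pV2 ?posrE ?normr_gt0//; last by rewrite ltr_wpDr ?crt_ge0// normr_gt0.
  by rewrite lerDl crt_ge0.
- exact: schwartz_fourier_integrable.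
Qed.

Lemma bforce_spaceE h x t : schwartz h ->
  bforce m n h (x, t) = ((2 * pi)^-1)%:C * ifourier1 (space_symb h t) x.
Proof.
move=> sh; have iU := fsymb_integrable0 sh.
rewrite bforceE pi_inv2; congr (_ * _).
rewrite /ifourier2 (leb2_fubini1 (cintegrable_ifourier2 _ iU)).2.
have iS := cintegrable_ifourier x (space_symb_integrable t sh).
have [iF _] := leb2_fubini1 (cintegrable_ifourier2 (x, t) iU).
rewrite -(cintegralZ _ iF); apply: ae_cintegral_neq0.
- exact: cintegrable_measurable (cintegrableZ _ iF).
- exact: cintegrable_measurable iS.
move=> xi x0; rewrite /space_symb mulrCA; congr (_ * _).
rewrite -(cintegralZ _ (cintegrable_ifourier t (fsymb_slice_integrable sh x0))).
by apply: eq_cintegral => tau; rewrite /phase /= cisD mulrA.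
Qed.

Lemma bforce_space_fourier h t : schwartz h ->
  is_fourier1 (fun x => bforce m n h (x, t)) (space_symb h t).
Proof.
move=> sh; have := is_fourier1_ifourier1 (space_symb_integrable t sh).
by congr is_fourier1; apply/funext => x; rewrite bforce_spaceE.
Qed.

Lemma bforce_spaceB_fourier h t t0 : schwartz h ->
  is_fourier1 (fun x => bforce m n h (x, t) - bforce m n h (x, t0))
    (fun xi => space_symb h t xi - space_symb h t0 xi).
Proof.
move=> sh; have i1 := space_symb_integrable t sh; have i0 := space_symb_integrable t0 sh.
have := is_fourier1_ifourier1 (cintegrableB i1 i0).
congr is_fourier1; apply/funext => x; rewrite !bforce_spaceE// -mulrBr; congr (_ * _).
rewrite /ifourier1 -(cintegralB (cintegrable_ifourier x i1) (cintegrable_ifourier x i0)).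
by apply: eq_cintegral => tau; rewrite !mulrBr.
Qed.

Lemma bforce_fourier2 h : schwartz h -> is_fourier2 (bforce m n h) (fsymb h).
Proof.
move=> sh; have := is_fourier2_ifourier2 (fsymb_integrable0 sh).
by congr is_fourier2; apply/funext => p; rewrite bforceE.
Qed.

End Forcing.

(** * Causality *)

Section LocalFTC.
Context {R : realType}.
Local Notation mu := (@lebesgue_measure R).

Lemma cmod_nat (k : nat) : cmod (k%:R : R[i]) = k%:R :> R.
Proof. by rewrite -(rmorph_nat (real_complex R)) cmodR ger0_norm. Qed.

Lemma RFTC_seg (F f : R -> R) (a b : R) : a < b ->
  (forall x, a <= x <= b -> is_derive x (1 : R) F (f x)) ->
  (forall x, a <= x <= b -> {for x, continuous f}) ->
  \int[mu]_(x in `[a, b]) f x = F b - F a.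
Proof.
move=> ab dF cf.
have cF x : a <= x <= b -> {for x, continuous F}.
  by move=> /dF h; apply: differentiable_continuous; apply/derivable1_diffP; have [] := h.
rewrite /Rintegral (@continuous_FTC2 _ f F)//.
- apply: continuous_in_subspaceT => x; rewrite inE /= in_itv /=; exact: cf.
- split.
  + by move=> x; rewrite in_itv /= => /andP[/ltW h1 /ltW h2]; have [|] := dF x _; rewrite ?h1.
  + by apply: cvg_at_right_filter; apply: cF; rewrite lexx ltW.
  + by apply: cvg_at_left_filter; apply: cF; rewrite lexx ltW.
- move=> x; rewrite in_itv /= => /andP[/ltW h1 /ltW h2]; rewrite derive1E.
  by have [|_ ->] := dF x _; rewrite ?h1.
Qed.

Lemma cFTC_seg (F f : R -> R[i]) (a b : R) : a < b ->
  (forall x, a <= x <= b -> is_cderive F x (f x)) ->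
  (forall x, a <= x <= b -> ccvg (nbhs x) f (f x)) ->
  cintegral mu (fun x => if a <= x <= b then f x else 0) = F b - F a.
Proof.
move=> ab dF cf.
have E (g : R -> R) : \int[mu]_x (if a <= x <= b then g x else 0) = \int[mu]_(x in `[a, b]) g x.
  rewrite [RHS]Rintegral_mkcond; congr Rintegral; apply/funext => x.
  rewrite patchE; case: ifPn => h; first by rewrite mem_set//= in_itv.
  by rewrite memNset//= in_itv /=; apply/negP.
apply: complexP; rewrite /= ?ReB ?ImB.
  have d1 (x : R) : a <= x <= b -> is_derive x (1 : R) (fun x => complex.Re (F x)) (complex.Re (f x)).
    by move=> /dF [].
  have k1 (x : R) : a <= x <= b -> {for x, continuous (fun x => complex.Re (f x))}.
    by move=> /cf /ccvgP[].
  rewrite -(RFTC_seg ab d1 k1) -E; congr Rintegral; apply/funext => x; by case: ifP.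
have d1 (x : R) : a <= x <= b -> is_derive x (1 : R) (fun x => complex.Im (F x)) (complex.Im (f x)).
  by move=> /dF [].
have k1 (x : R) : a <= x <= b -> {for x, continuous (fun x => complex.Im (f x))}.
  by move=> /cf /ccvgP[].
rewrite -(RFTC_seg ab d1 k1) -E; congr Rintegral; apply/funext => x; by case: ifP.
Qed.

(** Meant for primitives differentiable on the open half-line only, as those involving [crt]. The
    intervals [[1 / (k + 2), k + 2]] are never degenerate, since 1 is interior to each. *)
Lemma cFTC_oray (F f : R -> R[i]) (l : R[i]) :
  cintegrable mu (fun x => if 0 < x then f x else 0) ->
  (forall x : R, 0 < x -> is_cderive F x (f x)) ->
  (forall x : R, 0 < x -> ccvg (nbhs x) f (f x)) ->
  ccvg \oo (fun k : nat => F k.+2%:R - F k.+2%:R^-1) l ->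
  cintegral mu (fun x => if 0 < x then f x else 0) = l.
Proof.
move=> fi dF cf Fl.
pose ak (k : nat) : R := k.+2%:R^-1; pose bk (k : nat) : R := k.+2%:R.
have b1 k : 1 < bk k by rewrite ltr1n.
have a0 k : 0 < ak k by rewrite invr_gt0.
have a1 k : ak k < 1 by rewrite /ak invf_lt1 ?ltr1n ?ltr0n.
pose fk k x := if ak k <= x <= bk k then f x else 0.
have fkE k x : fk k x = if ak k <= x <= bk k then (if 0 < x then f x else 0) else 0.
  by rewrite /fk; case: ifPn => // /andP[h _]; rewrite (lt_le_trans (a0 k)).
have H k : cintegral mu (fk k) = F (bk k) - F (ak k).
  apply: cFTC_seg; first exact: lt_trans (a1 k) (b1 k).
    by move=> x /andP[h _]; apply: dF; exact: lt_le_trans h.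
  by move=> x /andP[h _]; apply: cf; exact: lt_le_trans h.
have mfi := cintegrable_measurable fi.
have C : ccvg \oo (fun k => cintegral mu (fk k)) (cintegral mu (fun x => if 0 < x then f x else 0)).
  suff [] : cintegrable mu (fun x : R => if 0 < x then f x else 0) /\
    ccvg \oo (fun k => cintegral mu (fk k)) (cintegral mu (fun x : R => if 0 < x then f x else 0)) by [].
  apply: (@cdominated_cvg _ _ _ mu fk _ (fun x => cmod (if 0 < x then f x else 0))).
  - move=> k; rewrite (funext (fkE k)); apply: cmeasurable_if; [|exact: mfi|exact: cmeasurable_cst].
    by apply: measurable_and; apply: measurable_fun_ler.
  - exact: mfi.
  - move=> x; apply: (@ccvg_near_eq _ _ _ _ _ (fun=> if 0 < x then f x else 0)); last exact: ccvg_cst.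
    case: ltP => x0; last first.
      by apply: nearW => k; rewrite fkE ltNge x0 /=; case: ifP.
    have := near_natr_ge x; have := near_natr_ge x^-1; apply: filterS2 => k h1 h2.
    have h3 : k%:R <= k.+2%:R :> R by rewrite ler_nat; lia.
    rewrite /fk /ak /bk (le_trans h2 h3) andbT.
    by rewrite -[X in _ <= X]invrK lef_pV2 ?posrE ?invr_gt0// (le_trans h1 h3).
  - exact: cintegrable_cmod.
  - by move=> k x; rewrite fkE; case: ifP => _; rewrite ?cmod0 ?cmod_ge0.
have C' : ccvg \oo (fun k => cintegral mu (fk k)) l.
  by rewrite (funext H).
exact: (ccvg_unique C C').
Qed.

Lemma Rintegral_opp (f : R -> R) : mu.-integrable setT (EFin \o f) ->
  \int[mu]_x f (- x) = \int[mu]_x f x.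
Proof.
move=> fi; rewrite /Rintegral; congr fine.
pose g (x : measurableTypeR R) : measurableTypeR R := - x.
have mg : measurable_fun setT g by exact: oppr_measurable.
have mf : measurable_fun setT (EFin \o f) by exact: measurable_int fi.
have mfg : measurable_fun setT ((EFin \o f) \o g) by exact: measurableT_comp.
have e : ((EFin \o f) \o g) \o g = EFin \o f by apply/funext => x /=; rewrite /g opprK.
have ig : mu.-integrable (g @^-1` setT) (((EFin \o f) \o g) \o g) by rewrite e preimage_setT.
transitivity (\int[pushforward mu g]_(x in setT) ((EFin \o f) \o g) x)%E.
  by apply: eq_measure_integral => //= A mA _; exact/esym/lebesgue_measureN.
rewrite (@integral_pushforward _ _ _ _ _ g mg mu setT _ mfg ig measurableT).
by rewrite e preimage_setT.
Qed.

Lemma cintegral_opp (f : R -> R[i]) : cintegrable mu f -> cintegral mu (fun x => f (- x)) = cintegral mu f.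
Proof. by move=> [f1 f2]; rewrite /cintegral (Rintegral_opp f1) (Rintegral_opp f2). Qed.

End LocalFTC.

Section Differentiable.
Context {R : realType}.
Implicit Types f g : R -> R[i].

(** The derivative is forgotten: it serves for proving the continuity of expressions whose
    derivative need not be computed. *)
Definition cdiff f x := exists a, is_cderive f x a.

Lemma cdiff_ccvg f x : cdiff f x -> ccvg (nbhs x) f (f x).
Proof. by move=> [a /is_cderive_cvg[h1 h2]]; apply/ccvgP. Qed.
Lemma cdiff_cst z x : cdiff (fun=> z) x. Proof. by eexists; exact: is_cderive_cst. Qed.
Lemma cdiffD f g x : cdiff f x -> cdiff g x -> cdiff (fun t => f t + g t) x.
Proof. by move=> [a h1] [b h2]; eexists; exact: is_cderiveD h1 h2. Qed.
Lemma cdiffM f g x : cdiff f x -> cdiff g x -> cdiff (fun t => f t * g t) x.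
Proof. by move=> [a h1] [b h2]; eexists; exact: is_cderiveM h1 h2. Qed.
Lemma cdiffX f n x : cdiff f x -> cdiff (fun t => f t ^+ n) x.
Proof. by move=> [a h1]; eexists; exact: is_cderiveX h1. Qed.
Lemma cdiffV f x : f x != 0 -> cdiff f x -> cdiff (fun t => (f t)^-1) x.
Proof. by move=> f0 [a h1]; eexists; exact: is_cderiveV f0 h1. Qed.
Lemma cdiff_cexp f x : cdiff f x -> cdiff (fun t => cexp (f t)) x.
Proof. by move=> [a h1]; eexists; exact: is_cderive_cexp h1. Qed.

End Differentiable.

(** * Rotation of a half-line through the lower half-plane *)

Section RayRotation.
Context {R : realType}.
Local Notation mu := (@lebesgue_measure R).
Local Notation leb2 := (@leb2 R).

(** The cube roots, with argument divided by 3, of the points of the closed lower half-plane. *)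
Definition lower_sector (w : R[i]) :=
  exists s psi, [/\ 0 <= s, - (pi / 3) <= psi <= 0 & w = s%:C * cis psi].

Variables (G G' : R[i] -> R[i]) (M c : R).
Hypothesis Gbnd : forall w, lower_sector w -> cmod (G w) <= M /\ cmod (G' w) <= M.
(** Holomorphy of [G], expressed as the chain rule along real curves. *)
Hypothesis Gder : forall w (t : R) a, is_cderive w t a -> is_cderive (fun t => G (w t)) t (G' (w t) * a).
Hypothesis G'dif : forall w (t : R), cdiff w t -> cdiff (fun t => G' (w t)) t.
Hypothesis Gmeas : forall d (T : measurableType d) (w : T -> R[i]), cmeasurable w ->
  cmeasurable (fun t => G (w t)) /\ cmeasurable (fun t => G' (w t)).
Hypothesis c0 : c <= 0.

(* With z = w^3, [kA] is f(z) = exp(i c z) (1 + i z)^-3 G(z^(1/3)) and [kB] is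
   d/dz (z f).  Hence in polar coordinates z = r exp(i phi) the function [rayD]
   is the derivative of z f along rays, and -i times that of f exp(i phi) in phi. *)
Definition kden (w : R[i]) : R[i] := 1 + 'i%C * w ^+ 3.
Definition kexp (w : R[i]) : R[i] := cexp ('i%C * c%:C * w ^+ 3).
Definition kA w := kexp w * kden w ^- 3 * G w.
Definition kB w := kexp w * kden w ^- 3 *
  ((1 + 'i%C * c%:C * w ^+ 3 - 3 * 'i%C * w ^+ 3 * (kden w)^-1) * G w + 3^-1 * w * G' w).

Definition raypt (r phi : R) : R[i] := (crt r)%:C * cis (phi / 3).

Lemma raypt3 r phi : 0 <= r -> raypt r phi ^+ 3 = r%:C * cis phi.
Proof.
move=> r0; rewrite /raypt exprMn -rmorphXn crtX3 ger0_norm//; congr (_ * _).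
by rewrite !exprS expr0 mulr1 -!cisD; congr cis; field.
Qed.

Lemma raypt_sector r phi : - pi <= phi <= 0 -> lower_sector (raypt r phi).
Proof.
move=> /andP[h1 h2]; exists (crt r), (phi / 3); split => //; first exact: crt_ge0.
by apply/andP; split; lra.
Qed.

Lemma Im_raypt3 r phi : 0 <= r -> - pi <= phi <= 0 -> complex.Im (raypt r phi ^+ 3) <= 0.
Proof.
move=> r0 /andP[h1 h2]; rewrite raypt3// ImM /= mul0r addr0.
have : 0 <= sin (- phi) by apply: sin_ge0_pi; apply/andP; split; lra.
by rewrite sinN => h; rewrite mulr_ge0_le0//; lra.
Qed.

(** For [Im z <= 0], [|1 + i z|^2 = 1 - 2 Im z + |z|^2] is at least [1 + |z|^2]. *)
Lemma kden_ge r phi : 0 <= r -> - pi <= phi <= 0 -> jap r <= cmod (kden (raypt r phi)).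
Proof.
move=> r0 h; have i0 := Im_raypt3 r0 h.
rewrite -ler_sqr ?nnegrE ?jap_ge0 ?cmod_ge0// japE /kden.
have E : cmod (raypt r phi ^+ 3) ^+ 2 = r ^+ 2.
  by rewrite raypt3// cmodM cmodR cmod_cis mulr1 real_normK ?num_real.
move: i0 E; case: (raypt r phi ^+ 3) => a b /= b0; rewrite !cmod_sqr !cpartE /= => E.
nra.
Qed.

(** The exponent [i c z] has real part [- c Im z], nonpositive because neither [c] nor [Im z] is
    positive. *)
Lemma kexp_le r phi : 0 <= r -> - pi <= phi <= 0 -> cmod (kexp (raypt r phi)) <= 1.
Proof.
move=> r0 h; have i0 := Im_raypt3 r0 h; rewrite /kexp cmod_cexp.
suff : complex.Re ('i%C * c%:C * raypt r phi ^+ 3) <= 0.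
  by move=> le0; rewrite -[leRHS](@expR0 R) ler_expR.
move: (raypt r phi ^+ 3) i0 => z z0.
rewrite -mulrA ReM /= mul0r mul1r sub0r ImM /= mul0r addr0.
by rewrite oppr_le0 mulr_le0.
Qed.

Lemma kden_neq0 r phi : 0 <= r -> - pi <= phi <= 0 -> kden (raypt r phi) != 0.
Proof.
by move=> r0 h; rewrite -cmod_eq0 gt_eqF// (lt_le_trans (jap_gt0 r))// kden_ge.
Qed.

Lemma cmod_raypt r phi : cmod (raypt r phi) = crt r.
Proof. by rewrite cmodM cmodR cmod_cis mulr1 ger0_norm// crt_ge0. Qed.

Lemma M_ge0 : 0 <= M.
Proof.
have s0 : lower_sector 0.
  by exists 0, 0; split; rewrite ?mul0r// lexx andbT; have := pi_gt0 R; lra.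
by have [+ _] := Gbnd s0; exact/le_trans/cmod_ge0.
Qed.

Lemma kA_le r phi : 0 <= r -> - pi <= phi <= 0 ->
  cmod (kA (raypt r phi)) <= M * jap r ^- 3.
Proof.
move=> r0 h; rewrite /kA cmodM (cmodM (kexp _)) cmodV cmodX.
have e1 := kexp_le r0 h; have q1 := kden_ge r0 h; have [g1 _] := Gbnd (raypt_sector r h).
have J := jap_gt0 r.
rewrite mulrC ler_pM ?mulr_ge0 ?cmod_ge0 ?invr_ge0 ?exprn_ge0 ?cmod_ge0//.
rewrite -[leRHS]mul1r ler_pM ?cmod_ge0 ?invr_ge0 ?exprn_ge0 ?cmod_ge0//.
have q0 := lt_le_trans J q1.
by rewrite lef_pV2 ?posrE ?exprn_gt0// lerXn2r ?nnegrE ?jap_ge0 ?cmod_ge0.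
Qed.

(** The bracket in [kB] grows at most like [<r>]: the exponential contributes [|c| r], the factor
    [w G'] a cube root, the rest is bounded. Against [<r>^-3] this leaves the integrable
    [<r>^-2]. *)
Lemma kB_le r phi : 0 <= r -> - pi <= phi <= 0 ->
  cmod (kB (raypt r phi)) <= M * (5 + `|c|) * (1 + r ^+ 2)^-1.
Proof.
move=> r0 h; rewrite /kB cmodM (cmodM (kexp _)) cmodV cmodX.
have e1 := kexp_le r0 h; have q1 := kden_ge r0 h; have [g1 g2] := Gbnd (raypt_sector r h).
have J := jap_gt0 r; have J1 := jap_ge1 r; have rJ := norm_le_jap r; rewrite ger0_norm// in rJ.
have TJ := crt_le_jap r.
set w := raypt r phi in e1 q1 g1 g2 *; set q := cmod (kden w) in q1 *.
have q0 : 0 < q by exact: lt_le_trans q1.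
have w3 : cmod (w ^+ 3) = r by rewrite raypt3// cmodM cmodR cmod_cis mulr1 ger0_norm.
have B1 : cmod (1 + 'i%C * c%:C * w ^+ 3 - 3 * 'i%C * w ^+ 3 * (kden w)^-1) <= 4 + `|c| * r.
  rewrite (le_trans (cmodB_le _ _))//.
  have -> : 4 + `|c| * r = (1 + `|c| * r) + 3 by ring.
  rewrite lerD//.
    by rewrite (le_trans (cmodD_le _ _))// cmod1 cmodM (cmodM 'i%C) cmodi cmodR w3 mul1r.
  rewrite cmodM (cmodM _ (w ^+ 3)) (cmodM 3) cmodi w3 mulr1 cmodV -/q.
  rewrite cmod_nat -mulrA ler_piMr// ler_pdivrMr// mul1r; lra.
have B2 : cmod (3^-1 * w) <= jap r.
  rewrite cmodM cmod_raypt cmodV cmod_nat.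
  have := crt_ge0 r; lra.
have M0 := M_ge0.
have B3 : cmod ((1 + 'i%C * c%:C * w ^+ 3 - 3 * 'i%C * w ^+ 3 * (kden w)^-1) * G w + 3^-1 * w * G' w)
    <= M * (5 + `|c|) * jap r.
  rewrite (le_trans (cmodD_le _ _))// (cmodM _ (G w)) (cmodM _ (G' w)).
  apply: (@le_trans _ _ ((4 + `|c| * r) * M + jap r * M)).
    by rewrite lerD// ler_pM ?cmod_ge0.
  rewrite -mulrDl mulrC -mulrA ler_wpM2l//.
  have : `|c| * r <= `|c| * jap r by rewrite ler_wpM2l.
  lra.
have -> : M * (5 + `|c|) * (1 + r ^+ 2)^-1 = (1 * jap r ^- 3) * (M * (5 + `|c|) * jap r).
  rewrite -japE; field; rewrite gt_eqF//.
have q1' : q ^- 3 <= jap r ^- 3.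
  by rewrite lef_pV2 ?posrE ?exprn_gt0// lerXn2r ?nnegrE ?jap_ge0 ?cmod_ge0.
have qi : 0 <= q ^- 3 by rewrite invr_ge0 exprn_ge0 ?cmod_ge0.
apply: ler_pM => //; [by rewrite mulr_ge0 ?cmod_ge0|exact: cmod_ge0|].
by apply: ler_pM => //; exact: cmod_ge0.
Qed.

(** Stated for logarithmic derivatives [w' = l w] so as to serve both directions: [l = i / 3] in the
    angle and [l = 1 / (3 r)] in the radius. *)
Lemma kA_der (w : R -> R[i]) (t : R) (l : R[i]) : kden (w t) != 0 ->
  is_cderive w t (l * w t) ->
  is_cderive (fun t => kA (w t)) t (3 * l * (kB (w t) - kA (w t))).
Proof.
move=> q0 dw; have d3 := is_cderiveX 3 dw.
have de := is_cderive_cexp (is_cderiveZ ('i%C * c%:C) d3).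
have dq := is_cderiveD (is_cderive_cst 1 t) (is_cderiveZ 'i%C d3).
have dV := is_cderiveV q0 dq.
have dV3 := is_cderiveX 3 dV.
have dA := is_cderiveM (is_cderiveM de dV3) (Gder dw).
have e : (fun t => kA (w t)) = (fun t => cexp ('i%C * c%:C * w t ^+ 3) * (1 + 'i%C * w t ^+ 3)^-1 ^+ 3 * G (w t)).
  by apply/funext => s; rewrite /kA /kexp /kden exprVn.
rewrite e; apply: (is_cderive_eq dA); rewrite /kB /kA /kexp.
rewrite -[1 + 'i%C * w t ^+ 3]/(kden (w t)) !exprVn /=.
set E := cexp _; set q := kden (w t) in q0 *.
field.
by rewrite q0.
Qed.

Lemma raypt_der_phi r (phi : R) : is_cderive (raypt r) phi ('i%C / 3 * raypt r phi).
Proof.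
have e : raypt r = fun phi => (crt r)%:C * cexp ('i%C * (3^-1)%:C * phi%:C).
  by apply/funext => p; rewrite /raypt -cexp_i; congr (_ * cexp _); rewrite rmorphM /=; ring.
rewrite e; apply: (is_cderive_eq (is_cderiveZ _ (is_cderive_expl _ _))).
have -> : (3^-1)%:C = 3^-1 :> R[i] by rewrite fmorphV rmorph_nat.
by ring.
Qed.

Lemma is_derive_crt (r : R) : 0 < r -> is_derive r (1 : R) (@crt R) (crt r / (3 * r)).
Proof.
move=> r0; have d := is_derive1_powR 3^-1 r0.
have e : crt r / (3 * r) = 3^-1 * r `^ (3^-1 - 1).
  rewrite /crt gtr0_norm// powRD; last by rewrite (gt_eqF r0) implybT.
  by rewrite powRN powRr1 ?(ltW r0)//; field; rewrite gt_eqF.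
rewrite e; apply: near_eq_is_derive d.
near=> y; rewrite /crt gtr0_norm//; near: y; exact: lt_nbhsr.
Unshelve. all: by end_near. Qed.

Lemma raypt_der_r r (phi : R) : 0 < r -> is_cderive (raypt ^~ phi) r ((3 * r%:C)^-1 * raypt r phi).
Proof.
move=> r0; have d := is_cderive_real (is_derive_crt r0).
apply: (is_cderive_eq (is_cderiveM d (is_cderive_cst (cis (phi / 3)) r))).
have rn : r%:C != 0 :> R[i] by rewrite -cmod_eq0 cmodR normr_eq0 gt_eqF.
rewrite /raypt mulr0 add0r !rmorphM fmorphV rmorphM rmorph_nat /=.
field.
by rewrite rn.
Qed.

Lemma rot_der (phi : R) : is_cderive cis phi ('i%C * cis phi).
Proof.
have e : cis = fun phi : R => cexp ('i%C * phi%:C) by apply/funext => p; rewrite cexp_i.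
by rewrite e; exact: is_cderive_expl.
Qed.

Definition rayD r phi : R[i] := kB (raypt r phi) * cis phi.

Lemma rayD_der_phi r (phi : R) : 0 < r -> - pi <= phi <= 0 ->
  is_cderive (fun phi => kA (raypt r phi) * cis phi) phi ('i%C * rayD r phi).
Proof.
move=> r0 h; have q0 := kden_neq0 (ltW r0) h.
apply: (is_cderive_eq (is_cderiveM (kA_der q0 (raypt_der_phi r phi)) (rot_der phi))).
by rewrite /rayD; field.
Qed.

Lemma rayD_der_r r (phi : R) : 0 < r -> - pi <= phi <= 0 ->
  is_cderive (fun r => r%:C * (kA (raypt r phi) * cis phi)) r (rayD r phi).
Proof.
move=> r0 h; have q0 := kden_neq0 (ltW r0) h.
have dA := @kA_der (raypt ^~ phi) r _ q0 (raypt_der_r phi r0).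
have rn : r%:C != 0 :> R[i] by rewrite -cmod_eq0 cmodR normr_eq0 gt_eqF.
apply: (is_cderive_eq (is_cderiveM (is_cderive_real (is_derive_id r (1 : R)))
  (is_cderiveM dA (is_cderive_cst (cis phi) r)))).
rewrite /rayD (_ : (1 : R)%:C = 1)//; field.
by rewrite rn.
Qed.

Lemma kB_cdiff (w : R -> R[i]) (t : R) : kden (w t) != 0 -> cdiff w t -> cdiff (fun t => kB (w t)) t.
Proof.
move=> q0 dw; have d3 := cdiffX 3 dw.
have dq : cdiff (fun t => kden (w t)) t.
  by apply: cdiffD; [exact: cdiff_cst|apply: cdiffM => //; exact: cdiff_cst].
have dV := cdiffV q0 dq.
have dG : cdiff (fun t => G (w t)) t by have [a /Gder h] := dw; eexists; exact: h.
have e : (fun t => kB (w t)) = (fun t => kexp (w t) * (kden (w t))^-1 ^+ 3 *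
  ((1 + 'i%C * c%:C * w t ^+ 3 + (- (3 * 'i%C)) * w t ^+ 3 * (kden (w t))^-1) * G (w t) + 3^-1 * w t * G' (w t))).
  by apply/funext => s; rewrite /kB exprVn !mulNr.
rewrite e; apply: cdiffM.
  apply: cdiffM; last exact: cdiffX.
  by apply: cdiff_cexp; apply: cdiffM => //; exact: cdiff_cst.
apply: cdiffD.
  apply: cdiffM => //; apply: cdiffD.
    by apply: cdiffD; [exact: cdiff_cst|apply: cdiffM => //; exact: cdiff_cst].
  by apply: cdiffM => //; apply: cdiffM => //; exact: cdiff_cst.
by apply: cdiffM; [apply: cdiffM => //; exact: cdiff_cst|exact: G'dif].
Qed.

Lemma rayD_ccvg_phi r (phi : R) : 0 < r -> - pi <= phi <= 0 -> ccvg (nbhs phi) (rayD r) (rayD r phi).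
Proof.
move=> r0 h; apply: cdiff_ccvg; apply: cdiffM; last by eexists; exact: rot_der.
by apply: kB_cdiff; [exact: kden_neq0 (ltW r0) h|eexists; exact: raypt_der_phi].
Qed.

Lemma rayD_ccvg_r (r phi : R) : 0 < r -> - pi <= phi <= 0 -> ccvg (nbhs r) (rayD ^~ phi) (rayD r phi).
Proof.
move=> r0 h; apply: cdiff_ccvg; apply: cdiffM; last exact: cdiff_cst.
by apply: (@kB_cdiff (raypt ^~ phi)); [exact: kden_neq0 (ltW r0) h|eexists; exact: raypt_der_r].
Qed.

Lemma cmeasurable_rayD : cmeasurable (fun p : R * R => rayD p.1 p.2).
Proof.
have mw : cmeasurable (fun p : R * R => raypt p.1 p.2).
  apply: cmeasurableM; first by apply: cmeasurable_real; exact: (measurableT_comp measurable_crt measurable_fst).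
  by apply: cmeasurable_cis; apply: measurable_funM => //; exact: measurable_snd.
have [mG mG'] := Gmeas mw; have mw3 := cmeasurableX 3 mw.
have mq : cmeasurable (fun p : R * R => kden (raypt p.1 p.2)).
  by apply: cmeasurableD; [exact: cmeasurable_cst|apply: cmeasurableM => //; exact: cmeasurable_cst].
have mqV := cmeasurableV mq.
apply: cmeasurableM; last by apply: cmeasurable_cis; exact: measurable_snd.
apply: cmeasurableM.
  apply: cmeasurableM.
    by apply: cmeasurable_cexp; apply: cmeasurableM => //; exact: cmeasurable_cst.
  by apply: cmeasurableV; exact: cmeasurableX.
apply: cmeasurableD.
  apply: cmeasurableM => //; apply: cmeasurableB.
    by apply: cmeasurableD; [exact: cmeasurable_cst|apply: cmeasurableM => //; exact: cmeasurable_cst].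
  by apply: cmeasurableM => //; apply: cmeasurableM => //; exact: cmeasurable_cst.
by apply: cmeasurableM => //; apply: cmeasurableM => //; exact: cmeasurable_cst.
Qed.

(** The cut-off to [r > 0], [- pi <= phi <= 0] describes the lower half-plane in polar
    coordinates. *)
Definition rayT (p : R * R) : R[i] :=
  if 0 < p.1 then (if - pi <= p.2 <= 0 then rayD p.1 p.2 else 0) else 0.

Lemma cmod_rayD r phi : 0 <= r -> - pi <= phi <= 0 ->
  cmod (rayD r phi) <= M * (5 + `|c|) * (1 + r ^+ 2)^-1.
Proof. by move=> r0 h; rewrite /rayD cmodM cmod_cis mulr1 kB_le. Qed.

Lemma rayT_integrable : cintegrable leb2 rayT.
Proof.
have C0 : 0 <= M * (5 + `|c|) by rewrite mulr_ge0 ?M_ge0// addr_ge0.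
(* The factor [1 + pi^2] supplies the decay in [phi] that the product majorant [bump2] asks for, as
   [|phi| <= pi]. *)
pose C := M * (5 + `|c|) * (1 + pi ^+ 2).
apply: (@bump2_cintegrable _ _ C).
  apply: cmeasurable_if; last exact: cmeasurable_cst.
    by apply: measurable_fun_ltr => //; exact: measurable_fst.
  apply: cmeasurable_if; last exact: cmeasurable_cst.
    by apply: measurable_and; apply: measurable_fun_ler => //; exact: measurable_snd.
  exact: cmeasurable_rayD.
case=> r phi; have p0 := pi_ge0 R.
have b0 : 0 <= C * bump2 (r, phi) by rewrite mulr_ge0 ?bump2_ge0// mulr_ge0// addr_ge0 ?sqr_ge0.
rewrite /rayT /=; case: ifPn => r0; last by rewrite cmod0.
case: ifPn => h; last by rewrite cmod0.
apply: (le_trans (cmod_rayD (ltW r0) h)).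
rewrite /C /bump2 /= -!mulrA ler_wpM2l ?M_ge0// ler_wpM2l ?addr_ge0// mulrCA.
rewrite ler_peMr ?invr_ge0 ?addr_ge0 ?sqr_ge0// ler_pdivlMr ?ltr_pwDl ?sqr_ge0// mul1r lerD2l.
by case/andP: h => h1 h2; rewrite -sqrrN lerXn2r ?nnegrE//; lra.
Qed.

(** The function [f] of the polar picture at a real point [z = tau]; [rho] is the boundary value of
    the cube root from below. *)
Definition rayF (tau : R) : R[i] := cis (c * tau) * (1 + 'i%C * tau%:C) ^- 3 * G (rho tau).

Lemma rayF_raypt0 (r : R) : 0 < r -> kA (raypt r 0) * cis 0 = rayF r.
Proof.
move=> r0; have p0 : - pi <= (0 : R) <= 0 by rewrite lexx oppr_le0 pi_ge0.
rewrite cis0 mulr1 /kA /kexp /kden raypt3 ?ltW// cis0 mulr1 /rayF.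
rewrite (_ : 'i%C * c%:C * r%:C = 'i%C * (c * r)%:C); last by rewrite rmorphM mulrA.
rewrite cexp_i; congr (_ * G _).
by rewrite /raypt mul0r cis0 mulr1 rhoE /rot r0 mulr1.
Qed.

Lemma rayF_rayptN (r : R) : 0 < r -> kA (raypt r (- pi)) * cis (- pi) = - rayF (- r).
Proof.
move=> r0; rewrite cisN cis_pi invrN invr1 mulrN1; congr (- _).
rewrite /kA /kexp /kden raypt3 ?ltW// cisN cis_pi invrN invr1 mulrN1 /rayF.
rewrite -rmorphN (_ : 'i%C * c%:C * (- r)%:C = 'i%C * (c * - r)%:C); last by rewrite rmorphM mulrA.
rewrite cexp_i; congr (_ * G _).
by rewrite rhoE /rot ltNge oppr_le0 ltW//= crtN /raypt mulNr.
Qed.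

(** In the angle, the boundary terms at 0 and [- pi] are the values of [rayF] at [r] and [- r]; the
    sign [exp(- i pi) = -1] turns their difference into a sum. *)
Lemma rayT_phi (r : R) : 0 < r ->
  'i%C * cintegral mu (fun phi : R => rayT (r, phi)) = rayF r + rayF (- r).
Proof.
move=> r0; have p0 : - pi < (0 : R) by rewrite oppr_lt0 pi_gt0.
have ii : 'i%C * 'i%C = -1 :> R[i] by rewrite -expr2 sqr_i.
have -> : cintegral mu (fun phi : R => rayT (r, phi)) =
    - 'i%C * (kA (raypt r 0) * cis 0) - - 'i%C * (kA (raypt r (- pi)) * cis (- pi)).
  rewrite -(@cFTC_seg _ (fun phi => - 'i%C * (kA (raypt r phi) * cis phi)) (rayD r))//.
  - by apply: eq_cintegral => phi; rewrite /rayT /= r0.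
  - move=> phi h; apply: (is_cderive_eq (is_cderiveZ (- 'i%C) (rayD_der_phi r0 h))).
    by rewrite mulrA mulNr ii opprK mul1r.
  - by move=> phi h; exact: rayD_ccvg_phi.
rewrite (rayF_raypt0 r0) (rayF_rayptN r0) -mulrBr mulrA mulrN ii opprK mul1r opprK.
by [].
Qed.

(** In the radius, the primitive [r f exp(i phi)] vanishes at 0 and at infinity. *)
Lemma rayT_r (phi : R) : cintegral mu (fun r : R => rayT (r, phi)) = 0.
Proof.
have [h|h] := boolP (- pi <= phi <= 0); last first.
  rewrite -[RHS](cintegral0 mu); apply: eq_cintegral => r.
  by rewrite /rayT /= (negbTE h); case: ifP.
have e (r : R) : rayT (r, phi) = if 0 < r then rayD r phi else 0 by rewrite /rayT /= h.
have M0 := M_ge0.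
have C0 : 0 <= M * (5 + `|c|) by rewrite mulr_ge0// addr_ge0.
have it : cintegrable mu (fun r : R => if 0 < r then rayD r phi else 0).
  apply: (@le_inv1sq_integrable _ _ (M * (5 + `|c|))).
    by rewrite -(funext e); exact: (cmeasurable_pair2 phi (cintegrable_measurable rayT_integrable)).
  move=> r; case: ifPn => r0; first exact: cmod_rayD (ltW r0) h.
  by rewrite cmod0 mulr_ge0// invr_ge0 addr_ge0// sqr_ge0.
rewrite (eq_cintegral mu e).
have bH (r : R) : 0 < r -> cmod (r%:C * (kA (raypt r phi) * cis phi)) <= M * (r * jap r ^- 3).
  move=> r0; rewrite cmodM cmodR gtr0_norm// cmodM cmod_cis mulr1 mulrCA.
  by rewrite ler_wpM2l ?(ltW r0)// kA_le ?(ltW r0).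
apply: (@cFTC_oray _ (fun r => r%:C * (kA (raypt r phi) * cis phi)) (rayD ^~ phi)) => //.
- by move=> r r0; exact: rayD_der_r.
- by move=> r r0; exact: rayD_ccvg_r.
(* Each of the end points [k + 2] and [1 / (k + 2)] contributes at most [M / (k + 1)]. *)
apply: (@ccvg_le _ _ _ _ _ _ (fun k => M * 2 * k.+1%:R^-1)); last first.
  by rewrite -(mulr0 (M * 2)); apply: cvgM; [exact: cvg_cst|exact: cvg_harmonic].
apply: nearW => k; rewrite subr0 (le_trans (cmodB_le _ _))//.
have k0 : 0 < k.+2%:R :> R by [].
have ki : 0 < k.+2%:R^-1 :> R by rewrite invr_gt0.
apply: (le_trans (lerD (bH _ k0) (bH _ ki))).
have kk : k.+2%:R^-1 <= k.+1%:R^-1 :> R by rewrite lef_pV2 ?posrE// ler_nat.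
have J3 (r : R) : 1 <= jap r ^+ 3 by rewrite exprn_ege1// jap_ge1.
have J3p (r : R) : 0 < jap r ^+ 3 by rewrite exprn_gt0// jap_gt0.
have b1 : k.+2%:R * jap k.+2%:R ^- 3 <= k.+1%:R^-1 :> R.
  apply: (le_trans _ kk); rewrite ler_pdivrMr//.
  have := norm_le_jap (k.+2%:R : R); rewrite ger0_norm// => J.
  rewrite -ler_pdivrMl ?invr_gt0// invrK -expr2.
  apply: (@le_trans _ _ (jap k.+2%:R ^+ 2)); first by rewrite lerXn2r ?nnegrE ?jap_ge0.
  by rewrite ler_weXn2l// jap_ge1.
have b2 : k.+2%:R^-1 * jap k.+2%:R^-1 ^- 3 <= k.+1%:R^-1 :> R.
  by apply: (le_trans _ kk); rewrite ler_piMr ?(ltW ki)// invf_le1.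
rewrite -mulrDr -mulrA; apply: ler_wpM2l => //.
by apply: (le_trans (lerD b1 b2)); rewrite -mulr2n mulr_natl.
Qed.

Lemma rho_sector (tau : R) : lower_sector (rho tau).
Proof.
exists (crt tau), (if 0 < tau then 0 else - (pi / 3)); have p0 := pi_ge0 R; split.
- exact: crt_ge0.
- by case: ifP => _; apply/andP; split; lra.
- by rewrite rhoE /rot; case: ifP => _; rewrite ?cis0.
Qed.

Lemma cmod_1Di (tau : R) : cmod (1 + 'i%C * tau%:C) = jap tau.
Proof. by rewrite cmodE !cpartE /= /jap; congr Num.sqrt; ring. Qed.

Lemma cmeasurable_rayF : cmeasurable rayF.
Proof.
apply: cmeasurableM; last by have [] := Gmeas measurable_rho.
apply: cmeasurableM; first by apply: cmeasurable_cis; exact: measurable_funM.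
apply: cmeasurableV; apply: cmeasurableX; apply: cmeasurableD; first exact: cmeasurable_cst.
by apply: cmeasurableM; [exact: cmeasurable_cst|exact: cmeasurable_real].
Qed.

Lemma cmod_rayF (tau : R) : cmod (rayF tau) <= M * (1 + tau ^+ 2)^-1.
Proof.
have [g _] := Gbnd (rho_sector tau); have J := jap_gt0 tau; have J1 := jap_ge1 tau.
rewrite /rayF cmodM (cmodM (cis _)) cmod_cis mul1r cmodV cmodX cmod_1Di mulrC -japE.
rewrite ler_pM ?cmod_ge0 ?invr_ge0 ?exprn_ge0 ?jap_ge0// lef_pV2 ?posrE ?exprn_gt0//.
by rewrite ler_weXn2l.
Qed.

Lemma rayF_integrable : cintegrable mu rayF.
Proof. exact: le_inv1sq_integrable cmeasurable_rayF cmod_rayF. Qed.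

Lemma rayFN_integrable : cintegrable mu (fun tau => rayF (- tau)).
Proof.
apply: (@le_inv1sq_integrable _ _ M).
  by apply: (cmeasurable_comp cmeasurable_rayF); exact: oppr_measurable.
by move=> tau; rewrite -[in X in _ <= X]sqrrN cmod_rayF.
Qed.

(** Fubini for [rayT]: integrating in the radius first gives 0, integrating in the angle first
    gives, up to a factor [i], the integral of [rayF r + rayF (- r)] over [r > 0], which is that of
    [rayF] over the line. *)
Lemma ray_rotation : cintegral mu rayF = 0.
Proof.
have iF := rayF_integrable.
have Z : cintegral mu (fun r : R => if 0 < r then rayF r + rayF (- r) else 0) = 0.
  have F2 := leb2_fubini rayT_integrable.
  have [i1 _] := leb2_fubini1 rayT_integrable.
  rewrite (_ : (fun r => _) = fun r : R => 'i%C * cintegral mu (fun phi : R => rayT (r, phi))); last first.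
    apply/funext => r; case: ifPn => r0; first by rewrite rayT_phi.
    have -> : cintegral mu (fun phi : R => rayT (r, phi)) = cintegral mu (fun=> 0).
      by apply: eq_cintegral => phi; rewrite /rayT /= (negbTE r0).
    by rewrite cintegral0 mulr0.
  by rewrite (cintegralZ _ i1) F2 (eq_cintegral mu rayT_r) cintegral0 mulr0.
have mF := cintegrable_measurable iF.
have m0 : measurable_fun setT (fun r : R => 0 < r) by exact: measurable_fun_ltr.
have m0' : measurable_fun setT (fun r : R => 0 < - r) by exact: measurable_fun_ltr.
have cut (p : R -> bool) (f : R -> R[i]) : measurable_fun setT p -> cintegrable mu f ->
    cintegrable mu (fun r => if p r then f r else 0).
  move=> mp jf; apply: (cintegrable_le _ jf).
    by apply: cmeasurable_if => //; exact: cintegrable_measurable jf.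
  by move=> r; case: ifP => _; rewrite ?cmod0 ?cmod_ge0.
have iP := cut _ _ m0 iF; have iN := cut _ _ m0' iF.
have E1 : cintegral mu rayF = cintegral mu (fun r => if 0 < r then rayF r else 0) +
    cintegral mu (fun r => if 0 < - r then rayF r else 0).
  rewrite -(cintegralD iP iN); apply: ae_cintegral_neq0 => //.
    exact: cintegrable_measurable (cintegrableD iP iN).
  move=> r; rewrite oppr_gt0; case: ltgtP => // _ _; by rewrite ?addr0 ?add0r.
have iN' := cut _ _ m0 rayFN_integrable.
rewrite E1 -(cintegral_opp iN) -[RHS]Z.
have -> : cintegral mu (fun x : R => if 0 < - - x then rayF (- x) else 0) =
    cintegral mu (fun r => if 0 < r then rayF (- r) else 0).
  by apply: eq_cintegral => r; rewrite opprK.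
rewrite -(cintegralD iP iN').
by apply: eq_cintegral => r; case: ifP => _; rewrite ?addr0.
Qed.

End RayRotation.

Section Causality.
Context {R : realType}.
Local Notation mu := (@lebesgue_measure R).
Local Notation leb2 := (@leb2 R).

Definition polyexpw (j : nat) (z w : R[i]) : R[i] := w ^+ j * cexp (z * w).

(* j = 0, z = i x omega covers x >= 0, and z = x with j < n covers x < 0. *)
Lemma polyexpw_vanish (j : nat) (z : R[i]) (M c : R) : c <= 0 ->
  (forall w, lower_sector w -> cmod (polyexpw j z w) <= M /\ cmod (polyexpw j.-1 z w) <= M) ->
  let f := fun tau => cis (c * tau) * (1 + 'i%C * tau%:C) ^- 3 * polyexpw j z (rho tau) in
  cintegrable mu f /\ cintegral mu f = 0.
Proof.
(* The derivative of [polyexpw j z]; for [j = 0] the truncated predecessor is multiplied by 0. *)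
move=> c0 bM /=; pose G' w := j%:R * polyexpw j.-1 z w + z * polyexpw j z w.
pose M' := M + j%:R * M + cmod z * M.
have M0 : 0 <= M.
  have s0 : lower_sector (0 : R[i]).
    by exists 0, 0; split; rewrite ?mul0r// lexx andbT; have := pi_gt0 R; lra.
  by have [+ _] := bM _ s0; exact/le_trans/cmod_ge0.
have jM : 0 <= j%:R * M by rewrite mulr_ge0.
have zM : 0 <= cmod z * M by rewrite mulr_ge0 ?cmod_ge0.
have Gbnd w : lower_sector w -> cmod (polyexpw j z w) <= M' /\ cmod (G' w) <= M'.
  move=> /bM[h1 h2]; split; first by rewrite /M'; lra.
  rewrite /G' (le_trans (cmodD_le _ _))// (cmodM j%:R) (cmodM z) cmod_nat.
  have k1 : j%:R * cmod (polyexpw j.-1 z w) <= j%:R * M by rewrite ler_wpM2l.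
  have k2 : cmod z * cmod (polyexpw j z w) <= cmod z * M by rewrite ler_wpM2l ?cmod_ge0.
  by rewrite /M'; lra.
have Gder (w : R -> R[i]) (t : R) a : is_cderive w t a ->
    is_cderive (fun t => polyexpw j z (w t)) t (G' (w t) * a).
  move=> dw; have d := is_cderiveM (is_cderiveX j dw) (is_cderive_cexp (is_cderiveZ z dw)).
  by apply: (is_cderive_eq d); rewrite /G' /polyexpw /=; ring.
have Pdif k (w : R -> R[i]) (t : R) : cdiff w t -> cdiff (fun t => polyexpw k z (w t)) t.
  move=> dw; apply: cdiffM; first exact: cdiffX.
  by apply: cdiff_cexp; apply: cdiffM => //; exact: cdiff_cst.
have G'dif (w : R -> R[i]) (t : R) : cdiff w t -> cdiff (fun t => G' (w t)) t.
  by move=> dw; apply: cdiffD; apply: cdiffM; [exact: cdiff_cst|exact: Pdif|exact: cdiff_cst|exact: Pdif].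
have Pmeas k d (T : measurableType d) (w : T -> R[i]) : cmeasurable w ->
    cmeasurable (fun t => polyexpw k z (w t)).
  move=> mw; apply: cmeasurableM; first exact: cmeasurableX.
  by apply: cmeasurable_cexp; apply: cmeasurableM => //; exact: cmeasurable_cst.
have Gmeas d (T : measurableType d) (w : T -> R[i]) : cmeasurable w ->
    cmeasurable (fun t => polyexpw j z (w t)) /\ cmeasurable (fun t => G' (w t)).
  move=> mw; split; first exact: Pmeas.
  by apply: cmeasurableD; apply: cmeasurableM; [exact: cmeasurable_cst|exact: Pmeas|exact: cmeasurable_cst|exact: Pmeas].
split; first exact: (rayF_integrable c Gbnd Gmeas).
exact: (ray_rotation Gbnd Gder G'dif Gmeas c0).
Qed.

(** For [w] in the sector, [omega w] has argument between [pi / 3] and [2 pi / 3], hence nonnegative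
    imaginary part. *)
Lemma polyexpw_le_right (x : R) w : 0 <= x -> lower_sector w -> cmod (polyexpw 0 ('i%C * x%:C * omega) w) <= 1.
Proof.
move=> x0 [s [psi [s0 /andP[h1 h2] ->]]].
rewrite /polyexpw expr0 mul1r cmod_cexp -[leRHS](@expR0 R) ler_expR.
have -> : complex.Re ('i%C * x%:C * omega * (s%:C * cis psi)) = - (x * s * sin (2 * pi / 3 + psi)).
  rewrite (_ : omega = cis (2 * pi / 3)); last by rewrite /omega cexp_i.
  by rewrite sinD !cpartE /=; ring.
rewrite oppr_le0 mulr_ge0 ?mulr_ge0// sin_ge0_pi//; apply/andP.
by have := pi_gt0 R; split; lra.
Qed.

Lemma cos_sector (psi : R) : - (pi / 3) <= psi <= 0 -> 2^-1 <= cos psi.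
Proof.
move=> /andP[h1 h2]; have p0 := pi_gt0 R; rewrite -cos_pi3 -[psi]opprK cosN.
have [e|e] := ltP (- psi) (pi / 3); last by rewrite (_ : - psi = pi / 3)//; lra.
by rewrite ltW// ltr_cos// in_itv/=; apply/andP; split; lra.
Qed.

(** In the sector [Re w] is at least [|w| / 2], so the exponential beats the power. The bound
    depends on [x], which stays fixed. *)
Lemma polyexpw_le_left (j : nat) (x : R) : x < 0 -> exists M, forall w, lower_sector w ->
  cmod (polyexpw j x%:C w) <= M.
Proof.
move=> x0; exists ((j`! + j.+2`!)%:R * (2 / `|x|) ^+ j) => w [s [psi [s0 h ->]]].
have xn : 0 < `|x| by rewrite normr_gt0 lt_eqF.
have c1 := cos_sector h.
rewrite /polyexpw cmodM cmodX cmod_cexp cmodM cmodR cmod_cis mulr1 ger0_norm//.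
have y0 : 0 <= `|x| / 2 * s by rewrite mulr_ge0// ltW// divr_gt0.
have le1 : expR (complex.Re (x%:C * (s%:C * cis psi))) <= expR (- (`|x| / 2 * s)).
  rewrite ler_expR !cpartE /= !mul0r !subr0 ltr0_norm//.
  have : x * s <= 0 by rewrite mulr_le0_ge0// ltW.
  by nra.
have le2 := pow_expRN_le j y0.
have le3 : (`|x| / 2 * s) ^+ j * expR (- (`|x| / 2 * s)) <= (j`! + j.+2`!)%:R.
  by apply: (le_trans le2); rewrite ler_pdivrMr ?ltr_pwDl ?sqr_ge0// ler_peMr// lerDl sqr_ge0.
have -> : s ^+ j = (2 / `|x|) ^+ j * (`|x| / 2 * s) ^+ j.
  by rewrite -exprMn; congr (_ ^+ _); field; rewrite gt_eqF.
rewrite -[leLHS]mulrA [leLHS]mulrC -[leLHS]mulrA [X in _ * X <= _]mulrC -/(_ ^+ j) [leLHS]mulrA; apply: le_trans (_ : (`|x| / 2 * s) ^+ j * expR (- (`|x| / 2 * s)) * (2 / `|x|) ^+ j <= _).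
  rewrite [leRHS]mulrAC; apply: ler_wpM2l le1.
  by apply: mulr_ge0; [exact: exprn_ge0|exact: exprn_ge0 (divr_ge0 _ _)].
by rewrite ler_wpM2r ?exprn_ge0 ?divr_ge0.
Qed.

Section Vanish.
Variables (m n : nat).
Hypothesis hmn : (m + 4 <= n)%N.
Local Notation CK := (@CK R m n).

(** Off [tau = 0] the trace symbol is a single [polyexpw] of [rho tau] when [x >= 0] and a finite
    combination of them when [x < 0]. *)
Lemma trace_symb_vanish (x c : R) : c <= 0 ->
  cintegral mu (fun tau => cis (c * tau) * (1 + 'i%C * tau%:C) ^- 3 * trace_symb m n x tau) = 0.
Proof.
move=> c0; have mE : cmeasurable (fun tau => cis (c * tau) * (1 + 'i%C * tau%:C) ^- 3 * trace_symb m n x tau).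
  apply: cmeasurableM; last exact: cmeasurable_trace_symb.
  apply: cmeasurableM; first by apply: cmeasurable_cis; exact: measurable_funM.
  apply: cmeasurableV; apply: cmeasurableX; apply: cmeasurableD; first exact: cmeasurable_cst.
  by apply: cmeasurableM; [exact: cmeasurable_cst|exact: cmeasurable_real].
have [x0|x0] := leP 0 x.
  have [i1 e1] := @polyexpw_vanish 0 ('i%C * x%:C * omega) 1 c c0
    (fun w hw => conj (polyexpw_le_right x0 hw) (polyexpw_le_right x0 hw)).
  rewrite -[RHS]e1; apply: ae_cintegral_neq0 => //; first exact: cintegrable_measurable i1.
  move=> t t0; rewrite (trace_symb_ge0 hmn x0 t0); congr (_ * _).
  by rewrite /polyexpw expr0 mul1r.
have [p hp] := @K_profile R m n hmn.
have H j : cintegrable mu (fun tau => cis (c * tau) * (1 + 'i%C * tau%:C) ^- 3 * polyexpw j x%:C (rho tau)) /\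
    cintegral mu (fun tau => cis (c * tau) * (1 + 'i%C * tau%:C) ^- 3 * polyexpw j x%:C (rho tau)) = 0.
  have [M1 b1] := polyexpw_le_left j x0; have [M2 b2] := polyexpw_le_left j.-1 x0.
  apply: (@polyexpw_vanish j x%:C (Num.max M1 M2)) => // w hw.
  by split; rewrite le_max ?b1 ?b2 ?orbT.
pose F j (tau : R) := p j * x%:C ^+ j *
  (cis (c * tau) * (1 + 'i%C * tau%:C) ^- 3 * polyexpw j x%:C (rho tau)).
have iF j : cintegrable mu (F j) by apply: cintegrableZ; exact: (H j).1.
have e0 : cintegral mu (fun tau => \sum_(j < n) F j tau) = 0.
  rewrite (@cintegral_sum _ n F iF) big1// => j _.
  by rewrite /F (cintegralZ _ (H j).1) (H j).2 mulr0.
rewrite -[RHS]e0; apply: ae_cintegral_neq0 => //.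
  exact: cintegrable_measurable (@cintegrable_sum _ n F iF).
move=> t t0; rewrite /trace_symb hp// [X in _ * X]mulrA twopi_invK mul1r /profile one_sided_lt0//.
rewrite mulr_sumr; apply: eq_bigr => j _; rewrite /F /polyexpw (mulrC x%:C (rho t)).
set A := cis _ * _; set E := cexp _; ring.
Qed.

Lemma csupp_eq0 (h : R -> R[i]) (A : set R) x : csupp h `<=` A -> ~ A x -> h x = 0.
Proof.
move=> hA Ax; apply: contrapT => /eqP hx; apply: Ax; apply: hA.
exact: (@subset_closure _ [set p | h p != 0]).
Qed.

Lemma deriv1_eq0 (h : R -> R[i]) (O : set R) k (s : R) : csmooth h -> open O ->
  (forall x, O x -> h x = 0) -> O s -> deriv1 h k s = 0.
Proof.
move=> sh oO hO; elim: k s => [|k ih] s s0; first exact: hO.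
have [d1 d2] := @deriv1_is_cderive _ h k s sh.
have N : \forall t \near s, deriv1 h k t = 0.
  by apply: filterS (open_nbhs_nbhs (conj oO s0)) => t; exact: ih.
have u (f : R -> R) (a : R) : (\forall t \near s, f t = 0) -> is_derive s (1 : R) f a -> a = 0.
  move=> fe df; have d0 : is_derive s (1 : R) f 0.
    have e0 : \near s, (fun=> 0 : R) s = f s by apply: filterS fe => t ->.
    exact: (near_eq_is_derive e0 (is_derive_cst _ _ _)).
  by rewrite -(@derive_val _ _ _ _ _ _ _ df) (@derive_val _ _ _ _ _ _ _ d0).
by apply: complexP; [apply: u d1|apply: u d2]; near=> t;
  rewrite (_ : deriv1 h k t = 0)//; near: t.
Unshelve. all: by end_near. Qed.

Lemma bforce_causal (h : R -> R[i]) (x t : R) : C0c_infty h -> t <= 0 -> bforce m n h (x, t) = 0.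
Proof.
move=> [csh cph hs] t0; have sh := schwartz_of_compact csh cph.
(* The function [(1 + d_t)^3 h], expanded by the binomial formula. *)
pose h3 s := \sum_(k < 4) 'C(3, k)%:R * deriv1 h k s.
have id k : cintegrable mu (fun s => 'C(3, k)%:R * deriv1 h k s).
  have [M hM] := schwartz_bound k sh; apply: cintegrableZ.
  exact: le_inv1sq_integrable (ccontinuous_measurable (deriv1_ccontinuous k csh)) hM.
have i3 : cintegrable mu h3 by exact: (@cintegrable_sum _ 4 (fun k s => 'C(3, k)%:R * deriv1 h k s)).
have F3 (tau : R) : fourier1 h3 tau = (1 + 'i%C * tau%:C) ^+ 3 * fourier1 h tau.
  pose f k s := cis (- (s * tau)) * ('C(3, k)%:R * deriv1 h k s).
  have fi k : cintegrable mu (f k) by exact: (cintegrable_fourier tau (id k)).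
  rewrite fourier1E; transitivity (cintegral mu (fun s => \sum_(k < 4) f k s)).
    by apply: eq_cintegral => s; rewrite mulr_sumr.
  rewrite (@cintegral_sum _ 4 f fi) exprDn mulr_suml; apply: eq_bigr => k _.
  rewrite expr1n mul1r -mulr_natl -mulrA -(schwartz_fourier_deriv k tau sh) fourier1E.
  have ik : cintegrable mu (fun s => cis (- (s * tau)) * deriv1 h k s).
    apply: cintegrable_fourier.
    have [M hM] := schwartz_bound k sh.
    exact: le_inv1sq_integrable (ccontinuous_measurable (deriv1_ccontinuous k csh)) hM.
  by rewrite -(cintegralZ _ ik); apply: eq_cintegral => s; rewrite mulrCA.
have h30 s : s < 0 -> h3 s = 0.
  move=> s0; rewrite /h3 big1// => k _.
  have hO (y : R) : [set z : R | z < 0] y -> h y = 0.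
    by move=> y0; apply: csupp_eq0 hs _ => /=; apply/negP; rewrite -ltNge.
  by rewrite (deriv1_eq0 k csh (@open_lt _ _) hO s0) mulr0.
have n0 (tau : R) : 1 + 'i%C * tau%:C != 0 by rewrite -cmod_eq0 cmod_1Di gt_eqF// jap_gt0.
pose F (p : R * R) := cis (- (p.1 * p.2)) * h3 p.1 *
  (cis (t * p.2) * (1 + 'i%C * p.2%:C) ^- 3 * trace_symb m n x p.2).
have m2 : cmeasurable (fun tau : R => (1 + 'i%C * tau%:C) ^- 3 : R[i]).
  apply: cmeasurableV; apply: cmeasurableX; apply: cmeasurableD; first exact: cmeasurable_cst.
  by apply: cmeasurableM; [exact: cmeasurable_cst|exact: cmeasurable_real].
have m3 : cmeasurable (fun tau => cis (t * tau) * (1 + 'i%C * tau%:C) ^- 3 * trace_symb m n x tau).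
  apply: cmeasurableM; last exact: cmeasurable_trace_symb.
  by apply: cmeasurableM => //; apply: cmeasurable_cis; exact: measurable_funM.
have mF : cmeasurable F.
  apply: cmeasurableM; last by apply: (cmeasurable_comp m3); exact: measurable_snd.
  apply: cmeasurableM.
    apply: cmeasurable_cis; apply: measurable_funN; apply: measurable_funM; [exact: measurable_fst|exact: measurable_snd].
  by apply: (cmeasurable_comp (cintegrable_measurable i3)); exact: measurable_fst.
have iF : cintegrable leb2 F.
  apply: (@leb2_le_cintegrable _ _ (fun s => cmod (h3 s)) (fun tau => CK * (1 + (1 * tau) ^+ 2)^-1)) => //.
  - exact: cintegrable_cmod.
  - rewrite /comp; under eq_fun do rewrite EFinM.
    by apply: integrableZl => //; exact: inv1sq_integrable.
  - move=> s tau; rewrite /F /= cmodM (cmodM _ (h3 s)) cmod_cis mul1r ler_wpM2l ?cmod_ge0//.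
    rewrite mul1r (cmodM _ (trace_symb m n x tau)) (cmodM (cis _)) cmod_cis mul1r mulrC.
    rewrite cmodV cmodX cmod_1Di -japE; apply: ler_pM; rewrite ?cmod_ge0 ?invr_ge0 ?exprn_ge0 ?jap_ge0//.
      exact: cmod_trace_symb.
    by rewrite lef_pV2 ?posrE ?exprn_gt0 ?jap_gt0// ler_weXn2l// jap_ge1.
rewrite (bforce_traceE hmn x t sh); rewrite (_ : ifourier1 _ t = 0) ?mulr0//.
transitivity (cintegral mu (fun tau => cintegral mu (fun s => F (s, tau)))).
  apply: eq_cintegral => tau.
  pose B := cis (t * tau) * (1 + 'i%C * tau%:C) ^- 3 * trace_symb m n x tau.
  have -> : cintegral mu (fun s => F (s, tau)) = B * fourier1 h3 tau.
    rewrite fourier1E -(cintegralZ _ (cintegrable_fourier tau i3)).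
    by apply: eq_cintegral => s; rewrite mulrC.
  rewrite F3 /B; have q := n0 tau.
  move: (1 + _) (cis _) (fourier1 _ _) (trace_symb _ _ _ _) q => a b d e q.
  field; by rewrite q.
rewrite -(leb2_fubini iF) -[RHS](cintegral0 mu); apply: eq_cintegral => s.
have [s0|s0] := ltP s 0.
  rewrite -[RHS](cintegral0 mu); apply: eq_cintegral => tau.
  by rewrite /F /= h30// mulr0 mul0r.
(* The parameter [c] of the vanishing integral is [t - s], nonpositive because [t <= 0 <= s]. *)
have ts : t - s <= 0 by lra.
have V := trace_symb_vanish x ts.
have iV : cintegrable mu (fun tau => cis ((t - s) * tau) * (1 + 'i%C * tau%:C) ^- 3 * trace_symb m n x tau).
  apply: (@le_inv1sq_integrable _ _ CK).
    apply: cmeasurableM; last exact: cmeasurable_trace_symb.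
    by apply: cmeasurableM => //; apply: cmeasurable_cis; exact: measurable_funM.
  move=> tau; rewrite (cmodM _ (trace_symb m n x tau)) (cmodM (cis _)) cmod_cis mul1r mulrC.
  rewrite cmodV cmodX cmod_1Di -japE; apply: ler_pM; rewrite ?cmod_ge0 ?invr_ge0 ?exprn_ge0 ?jap_ge0//.
    exact: cmod_trace_symb.
  by rewrite lef_pV2 ?posrE ?exprn_gt0 ?jap_gt0// ler_weXn2l// jap_ge1.
rewrite -[RHS](mulr0 (h3 s)) -V -(cintegralZ _ iV); apply: eq_cintegral => tau.
rewrite /F /= mulrBl cisD; move: (h3 s) => a.
move: (cis (t * tau)) (cis (- (s * tau))) (_ ^- 3) (trace_symb _ _ _ _) => b d e f.
by ring.
Qed.

End Vanish.
End Causality.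

(** * Bourgain norms *)

Section LogWeight.
Context {R : realType}.
Local Notation mu := (@lebesgue_measure R).

Definition wsym (e r : R) : R := r `^ e + r `^ (- e).

Lemma wsym_gt0 e r : 0 < r -> 0 < wsym e r.
Proof. by move=> r0; rewrite addr_gt0 ?powR_gt0. Qed.

Lemma measurable_wsym e : measurable_fun setT (wsym e).
Proof. by apply: measurable_funD; exact: measurable_powR. Qed.

Lemma powR_expR (a x : R) : 0 < x -> x `^ a = expR (a * ln x).
Proof. by move=> x0; rewrite /powR gt_eqF. Qed.

Lemma exprn_expR (k : nat) (x : R) : 0 < x -> x ^+ k = expR (k%:R * ln x).
Proof. by move=> x0; rewrite -powR_mulrn ?ltW// powR_expR. Qed.

(** Going from [r] up to at most [k r], the increasing power gains at most [k^e] and the decreasing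
    one does not grow. *)
Lemma wsym_mono e k r t : 1 <= k -> 0 <= e -> 0 < r -> 0 < t -> r <= t -> t <= k * r ->
  wsym e t <= k `^ e * wsym e r.
Proof.
move=> k1 e0 r0 t0 rt tk; have k0 : 0 < k by exact: lt_le_trans k1.
have ke : 1 <= k `^ e by rewrite -(powRr0 k) ler_powR.
rewrite /wsym mulrDr lerD//.
  rewrite -powRM; [|exact: ltW|exact: ltW].
  by apply: ge0_ler_powR => //; rewrite nnegrE ltW// mulr_gt0.
apply: (@le_trans _ _ (r `^ (- e))).
  by rewrite !powRN lef_pV2 ?posrE ?powR_gt0//; apply: ge0_ler_powR => //; rewrite nnegrE ltW.
by rewrite ler_peMl ?powR_ge0.
Qed.

(** This is [exp(arsinh x)]. Its logarithmic derivative is exactly [1 / <x>], and it is comparable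
    to [<x>] for [x >= 0], so replacing [<x>] by it inside the weight yields an elementary
    primitive. *)
Definition uplus (x : R) : R := x + jap x.

Lemma uplus_gt0 x : 0 < uplus x.
Proof.
rewrite /uplus -ltrBlDl sub0r; apply: (le_lt_trans (ler_norm _)); rewrite normrN.
by rewrite -sqrtr_sqr ltr_sqrt ?ltrDr// ltr_pwDl// sqr_ge0.
Qed.

Lemma is_derive_uplus (x : R) : is_derive x (1 : R) uplus (uplus x / jap x).
Proof.
have q0 : 0 < 1 + x ^+ 2 by rewrite ltr_pwDl// sqr_ge0.
have d1 : is_derive x (1 : R) (fun x => 1 + x ^+ 2) (2 * x).
  have := is_deriveD (is_derive_cst (1 : R) x (1 : R)) (is_deriveM (is_derive_id x (1 : R)) (is_derive_id x (1 : R))).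
  rewrite (_ : cst 1 + id * id = fun x : R => 1 + x ^+ 2); last by apply/funext => y.
  by move=> h; apply: (is_derive_eq h); rewrite /GRing.scale /=; ring.
have d2 := @is_derive1_comp R Num.sqrt (fun x => 1 + x ^+ 2) x _ _ (is_derive1_sqrt q0) d1.
have d3 := is_deriveD (is_derive_id x (1 : R)) d2.
apply: (is_derive_eq d3); rewrite -/(jap x) /uplus.
by have j0 := jap_gt0 x; field; rewrite gt_eqF.
Qed.

(** With [v = (uplus x / L)^e] the kernel equals [v' / (e (1 + v^2))], whence the arctangent in
    [logprim]. *)
Definition logkern (e L x : R) : R := (jap x * wsym e (uplus x / L))^-1.
Definition logprim (e L x : R) : R := e^-1 * atan ((uplus x / L) `^ e).

Lemma is_derive_scaled_uplus (L a x : R) : 0 < L ->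
  is_derive x (1 : R) (fun x => (uplus x / L) `^ a) (a * (uplus x / L) `^ a / jap x).
Proof.
move=> L0; have u0 := uplus_gt0 x; have v0 : 0 < uplus x / L by rewrite divr_gt0.
have d1 : is_derive x (1 : R) (fun x => uplus x / L) (uplus x / jap x / L).
  have := is_deriveZ L^-1 (is_derive_uplus x).
  rewrite (_ : L^-1 \*: uplus = fun x => uplus x / L); last by apply/funext => y; rewrite /= mulrC.
  by move=> h; apply: (is_derive_eq h); rewrite /GRing.scale /= mulrC.
apply: (is_derive_eq (@is_derive1_comp R (fun y => y `^ a) (fun x => uplus x / L) x _ _ (is_derive1_powR a v0) d1)).
rewrite powRD; last by rewrite (gt_eqF v0) implybT.
by rewrite powRN powRr1 ?(ltW v0)//; field; rewrite !gt_eqF// jap_gt0.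
Qed.

Lemma is_derive_logprim (e L x : R) : 0 < e -> 0 < L ->
  is_derive x (1 : R) (logprim e L) (logkern e L x).
Proof.
move=> e0 L0; have v0 : 0 < uplus x / L by rewrite divr_gt0// uplus_gt0.
have d1 := is_derive_scaled_uplus e x L0.
have d2 := is_deriveZ e^-1 (is_derive1_comp (is_derive1_atan _) d1).
apply: (is_derive_eq d2); rewrite /logkern /wsym /GRing.scale /= powRN.
have p0 : 0 < (uplus x / L) `^ e by exact: powR_gt0.
move: ((uplus x / L) `^ e) p0 => p p0; have j0 := jap_gt0 x.
by field; rewrite ?gt_eqF// ?addr_gt0 ?mulr_gt0 ?ltr_pwDr ?ltr_pwDl ?sqr_ge0 ?exprn_gt0// mulr_gt0.
Qed.

Lemma logkern_continuous e L : 0 < L -> continuous (logkern e L).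
Proof.
move=> L0 x; have v0 : 0 < uplus x / L by rewrite divr_gt0// uplus_gt0.
have c a : {for x, continuous (fun x => (uplus x / L) `^ a)}.
  exact: (is_derive_continuous (fun x => is_derive_scaled_uplus a x L0)).
apply: cvgV; first by rewrite gt_eqF// mulr_gt0 ?jap_gt0 ?wsym_gt0.
apply: cvgM; last by apply: cvgD; exact: c.
apply: (@continuous_comp _ _ _ (fun x : R => 1 + x ^+ 2) Num.sqrt).
  by apply: cvgD; [exact: cvg_cst|exact: exprn_continuous].
exact: sqrt_continuous.
Qed.

Lemma logkern_ge0 e L x : 0 < L -> 0 <= logkern e L x.
Proof. by move=> L0; rewrite invr_ge0 mulr_ge0 ?jap_ge0// ltW// wsym_gt0// divr_gt0// uplus_gt0. Qed.

Lemma logprim_le e L x : 0 < e -> `|logprim e L x| <= e^-1 * (pi / 2).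
Proof.
move=> e0; have ei : 0 <= e^-1 by rewrite invr_ge0 ltW.
by rewrite normrM (ger0_norm ei) ler_wpM2l// norm_atan_le.
Qed.

(** For [x >= 0], [uplus x] lies between [<x>] and [2 <x>], and [wsym_mono] with [k = 2] applies.
    Negative [x] are covered by the reflected kernel. *)
Lemma wsym_jap_le e L (x : R) : 0 < e -> 0 < L ->
  (jap x * wsym e (jap x / L))^-1 <= 2 `^ e * (logkern e L x + logkern e L (- x)).
Proof.
move=> e0 L0; wlog x0 : x / 0 <= x => [H|].
  have [/H//|/ltW] := leP 0 x; rewrite -oppr_ge0 => /H.
  by rewrite japN opprK (addrC (logkern e L (- x))).
apply: (@le_trans _ _ (2 `^ e * logkern e L x)); last first.
  by rewrite ler_wpM2l ?powR_ge0// lerDl logkern_ge0.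
have J := jap_gt0 x; have xJ := norm_le_jap x; rewrite ger0_norm// in xJ.
have a0 : 0 < jap x / L by rewrite divr_gt0.
have b0 : 0 < uplus x / L by rewrite divr_gt0// uplus_gt0.
have wa := wsym_gt0 e a0; have wb := wsym_gt0 e b0.
have p2 : 0 < 2 `^ e :> R by exact: powR_gt0.
rewrite /logkern ler_pdivlMr ?mulr_gt0// mulrC ler_pdivrMr ?mulr_gt0// mulrCA.
apply: ler_wpM2l; first exact: ltW.
apply: wsym_mono => //; [by rewrite ler1n|exact: ltW| |].
  by apply: ler_wpM2r; [rewrite invr_ge0 ltW|rewrite /uplus lerDr].
by rewrite mulrA ler_wpM2r ?invr_ge0 ?(ltW L0)// /uplus; lra.
Qed.

(** The factor [2^e] is from [wsym_jap_le], one 2 from [ge0_FTC_bound], the other from the two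
    reflected primitives, each at most [e^-1 pi / 2]. *)
Definition Clog (e : R) : R := 2 `^ e * (2 * (2 * (e^-1 * (pi / 2)))).

Lemma Clog_ge0 e : 0 < e -> 0 <= Clog e.
Proof.
by move=> e0; rewrite mulr_ge0 ?powR_ge0// !mulr_ge0// ?invr_ge0 ?(ltW e0)// pi_ge0.
Qed.

(* The weight 1/<x> has infinite logarithmic mass; the factor wsym makes it finite uniformly in the scale L. *)
Lemma wsym_integral (e L a : R) : 0 < e -> 0 < L ->
  (\int[mu]_x ((jap (x - a) * wsym e (jap (x - a) / L))^-1)%:E <= (Clog e)%:E)%E.
Proof.
move=> e0 L0.
pose f x := logkern e L (x - a) + logkern e L (- (x - a)).
pose F x := logprim e L (x - a) - logprim e L (- (x - a)).
have ds (x : R) : is_derive x (1 : R) (fun x => x - a) 1.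
  apply: (is_derive_eq (is_deriveB (is_derive_id x (1 : R)) (is_derive_cst a x (1 : R)))).
  by rewrite subr0.
have dF x : is_derive x (1 : R) F (f x).
  have d1 := @is_derive1_comp R (logprim e L) (fun x => x - a) x _ _ (is_derive_logprim (x - a) e0 L0) (ds x).
  have d2 := @is_derive1_comp R (logprim e L) (fun x => - (x - a)) x _ _ (is_derive_logprim (- (x - a)) e0 L0) (is_deriveN (ds x)).
  apply: (is_derive_eq (is_deriveB d1 d2)).
  by rewrite /f mulr1 mulrN1 opprK.
have cs : continuous (fun x : R => x - a) by exact: is_derive_continuous ds.
have cf : continuous f.
  move=> x; apply: cvgD.
    exact: (continuous_comp (cs x) (@logkern_continuous e L L0 (x - a))).
  apply: (@continuous_comp _ _ _ (fun x => - (x - a)) (logkern e L)); last exact: logkern_continuous.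
  by apply: cvgN; exact: cs.
have f0 x : 0 <= f x by rewrite addr_ge0 ?logkern_ge0.
have FM x : `|F x| <= 2 * (e^-1 * (pi / 2)).
  by rewrite (le_trans (ler_normB _ _))// mulrDl mul1r lerD// logprim_le.
have I := ge0_FTC_bound cf f0 dF FM.
have mf := continuous_measurable_fun cf.
have mj : measurable_fun setT (fun x : R => jap (x - a)).
  by apply: (measurableT_comp measurable_jap); exact: continuous_measurable_fun.
apply: (@le_trans _ _ (\int[mu]_x (2 `^ e * f x)%:E)%E).
  apply: ge0_le_integral_EFin.
  - apply: measurable_fun_inv; apply: measurable_funM => //.
    by apply: (measurableT_comp (measurable_wsym e)); exact: measurable_funM.
  - exact: measurable_funM.
  - by move=> x; rewrite invr_ge0 mulr_ge0 ?jap_ge0// ltW// wsym_gt0// divr_gt0// jap_gt0.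
  - by move=> x; exact: wsym_jap_le.
rewrite ge0_integralZ_EFin ?powR_ge0// /Clog EFinM lee_wpmul2l// lee_fin powR_ge0//.
Qed.

Lemma ge0_integral_opp (f : R -> R) : measurable_fun setT f -> (forall x, 0 <= f x) ->
  (\int[mu]_x (f (- x))%:E = \int[mu]_x (f x)%:E)%E.
Proof.
move=> mf f0.
pose g (x : measurableTypeR R) : measurableTypeR R := - x.
have mg : measurable_fun setT g by exact: oppr_measurable.
have mfE : measurable_fun setT (EFin \o f) by exact/measurable_EFinP.
have mfg : measurable_fun setT ((EFin \o f) \o g) by exact: measurableT_comp.
have e : ((EFin \o f) \o g) \o g = EFin \o f by apply/funext => x /=; rewrite /g opprK.
have P := @ge0_integral_pushforward _ _ _ _ _ g mg mu setT _ measurableT mfg.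
rewrite e preimage_setT in P; rewrite -[RHS]P; last by move=> x _; rewrite lee_fin.
by apply: eq_measure_integral => //= A mA _; exact/esym/lebesgue_measureN.
Qed.

(** By reflection this is twice the integral of [x^(-1/3)] over []0, 1]], whose primitive is
    [(3/2) x^(2/3)]. *)
Lemma crt_inv_integral :
  (\int[mu]_x (if (`|x| < 1)%R then (crt x)^-1 else 0)%:E <= 3%:E)%E.
Proof.
pose g (x : R) := x `^ (- 3^-1).
pose G (x : R) := 3 / 2 * x `^ (2 / 3).
pose f (x : R) := if 0 < x then (if x <= 1 then g x else 0) else 0.
have mf : measurable_fun setT f.
  apply: measurable_fun_ifT => //; first exact: measurable_fun_ltr.
  by apply: measurable_fun_ifT => //; [exact: measurable_fun_ler|exact: measurable_powR].
have f0 x : 0 <= f x by rewrite /f; case: ifP => // _; case: ifP => // _; exact: powR_ge0.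
have dG (x : R) : 0 < x -> is_derive x (1 : R) G (g x).
  move=> x0; apply: (is_derive_eq (is_deriveZ (3 / 2) (is_derive1_powR (2 / 3) x0))).
  rewrite /GRing.scale /= mulrA /g (_ : 3 / 2 * (2 / 3) = 1); last by field.
  by rewrite mul1r; congr (_ `^ _); field.
have cg (x : R) : 0 < x -> {for x, continuous g}.
  move=> x0; have [d _] := is_derive1_powR (- 3^-1) x0.
  by apply: differentiable_continuous; apply/derivable1_diffP.
have If : (\int[mu]_x (f x)%:E <= (3 / 2)%:E)%E.
  pose I (n : nat) : set R := [set` `[n.+2%:R^-1, 1]].
  have ni n : 0 < n.+2%:R^-1 :> R by rewrite invr_gt0.
  have ni1 n : n.+2%:R^-1 < 1 :> R by rewrite invf_lt1// ltr1n.
  have IT : \bigcup_n I n = [set` `]0, 1]].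
    apply/seteqP; split => x.
      move=> [n _]; rewrite /I /= !in_itv /= => /andP[h1 ->].
      by rewrite (lt_le_trans (ni n) h1).
    rewrite /= in_itv /= => /andP[x0 x1].
    have [N _ /(_ N (leqnn _)) /= h] := near_natr_ge x^-1.
    exists N => //; rewrite /I /= in_itv /= x1 andbT -[leRHS]invrK lef_pV2 ?posrE ?invr_gt0//.
    by rewrite (le_trans h)// ler_nat; lia.
  have h := @ge0_nondecreasing_set_cvg_integral _ (measurableTypeR R) _ I (EFin \o g) mu.
  have {}h : (\int[mu]_(x in I n) (g x)%:E)%E @[n --> \oo] --> (\int[mu]_(x in `]0%R, 1%R]) (g x)%:E)%E.
    rewrite IT in h; apply: h.
    - move=> k n kn; apply/subsetPset => x; rewrite /I /= !in_itv /= => /andP[h1 ->].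
      by rewrite andbT (le_trans _ h1)// lef_pV2 ?posrE// ler_nat.
    - by move=> n; exact: measurable_itv.
    - by move=> n; apply/measurable_EFinP; apply: measurable_funTS; exact: measurable_powR.
    - by move=> n x _; rewrite lee_fin powR_ge0.
  have -> : (\int[mu]_x (f x)%:E = \int[mu]_(x in `]0%R, 1%R]) (g x)%:E)%E.
    rewrite [RHS]integral_mkcond; apply: eq_integral => x _.
    rewrite patchE; case: ifPn.
      by rewrite inE /= in_itv /= => /andP[x0 x1]; rewrite /f x0 x1.
    rewrite notin_setE /= in_itv /= => /negP; rewrite /f.
    by case: (0 < x) => //=; case: (x <= 1).
  apply: (cvge_to_le h); apply: nearW => n.
  have pos x : x \in `[n.+2%:R^-1, (1:R)] -> 0 < x.
    by rewrite in_itv /= => /andP[h1 _]; exact: lt_le_trans h1.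
  rewrite /I (@continuous_FTC2 _ g G)//.
  - rewrite -EFinB lee_fin /G powR1 mulr1.
    have := powR_ge0 (n.+2%:R^-1) (2 / 3 : R); lra.
  - apply: continuous_in_subspaceT => x; rewrite inE => /pos; exact: cg.
  - split.
    + by move=> x; rewrite in_itv /= => /andP[h1 _]; have [] := dG x (lt_trans (ni n) h1).
    + apply: cvg_at_right_filter; have [d _] := dG _ (ni n).
      by apply: differentiable_continuous; apply/derivable1_diffP.
    + apply: cvg_at_left_filter; have [d _] := dG _ (@ltr01 R).
      by apply: differentiable_continuous; apply/derivable1_diffP.
  - by move=> x; rewrite in_itv /= => /andP[h1 _]; rewrite derive1E; have [_ ->] := dG x (lt_trans (ni n) h1).
have mf' : measurable_fun setT (fun x : R => f (- x)) by exact: (measurableT_comp mf (@oppr_measurable R setT)).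
apply: (@le_trans _ _ (\int[mu]_x (f x + f (- x))%:E)%E).
  apply: ge0_le_integral_EFin.
  - apply: measurable_fun_ifT => //; first by apply: measurable_fun_ltr => //; exact: normr_measurable.
    by apply: measurable_fun_inv; exact: measurable_crt.
  - exact: measurable_funD.
  - by move=> x; case: ifP => // _; rewrite invr_ge0 crt_ge0.
  - move=> x; case: ifPn => [x1|_]; last by rewrite addr_ge0.
    have [->|x0] := eqVneq x 0; first by rewrite crt0 invr0 addr_ge0.
    rewrite /crt -powRN.
    have [xn|xp] := ltP x 0.
      apply: ler_wpDl => //; rewrite /f oppr_gt0 xn.
      move: x1; rewrite ltr0_norm// => /ltW ->; exact: lexx.
    apply: ler_wpDr => //; have xp' : 0 < x by rewrite lt_neqAle eq_sym x0.
    by rewrite /f xp'; move: x1; rewrite gtr0_norm// => /ltW ->; exact: lexx.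
under eq_integral do rewrite EFinD.
rewrite ge0_integralD//; try (by move=> x _; rewrite lee_fin); try exact/measurable_EFinP.
rewrite (ge0_integral_opp mf f0) (_ : 3%:E = (3 / 2)%:E + (3 / 2)%:E)%E; first exact: leeD.
by rewrite -EFinD; congr EFin; field.
Qed.

End LogWeight.

(** * Weighted square integrals of the symbol *)

Section WeightBound.
Context {R : realType}.
Local Notation mu := (@lebesgue_measure R).
Local Notation leb2 := (@leb2 R).

(* B wsym(B/A) is dominated by its value at the larger scale S. *)
Lemma wsym_scale (e A B S : R) : 0 <= e -> e <= 1 -> 0 < A -> 0 < B -> A <= S -> B <= S ->
  B * wsym e (B / A) <= 2 * (S * (S / A) `^ e).
Proof.
move=> e0 e1 A0 B0 AS BS; have S0 : 0 < S by exact: lt_le_trans AS.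
have SA : 1 <= S / A by rewrite ler_pdivlMr// mul1r.
have r0 : 0 < B / A by rewrite divr_gt0.
have rS : B / A <= S / A by rewrite ler_wpM2r// invr_ge0 ltW.
rewrite /wsym mulrDr mulrDl !mul1r; apply: lerD.
  apply: ler_pM => //; rewrite ?powR_ge0 ?(ltW B0)//.
  by apply: ge0_ler_powR => //; rewrite nnegrE ltW// divr_gt0.
have -> : B * (B / A) `^ (- e) = A * (B / A) `^ (1 - e).
  rewrite (powRD (r := 1)); last by rewrite (gt_eqF r0) implybT.
  by rewrite powRr1 ?(ltW r0)// mulrA; congr (_ * _); field; rewrite gt_eqF.
have e1' : 0 <= 1 - e by rewrite subr_ge0.
apply: (@le_trans _ _ (A * (S / A) `^ (1 - e))).
  by rewrite ler_wpM2l ?(ltW A0)//; apply: ge0_ler_powR => //; rewrite nnegrE ltW// divr_gt0.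
apply: (@le_trans _ _ (A * (S / A) `^ 1)).
  by rewrite ler_wpM2l ?(ltW A0)// ler_powR// lerBlDr lerDl.
rewrite powRr1 ?(le_trans ler01 SA)// mulrCA mulfV ?gt_eqF// mulr1.
rewrite ler_peMr ?(ltW S0)// -(powRr0 (S / A)) ler_powR//.
Qed.

(* Both sides are homogeneous of degree 2s + 2 in Y; in p, q <= 1 the exponents on the left are the larger ones. *)
Lemma scale_bound (m n : nat) (s e p q Y : R) : (m <= n)%N -> 0 < e ->
  4 * e <= 2 * s + 2 * m%:R + 1 -> e <= 2 * (n%:R - m%:R) - 2 * s - 2 ->
  0 < p -> p <= 1 -> 0 < q -> q <= 1 -> 0 < Y ->
  (p * Y) `^ (2 * s) * (Y ^+ 3 * p `^ (- (3 * e))) * (p ^+ m * q ^+ (n - m) / Y) ^+ 2 *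
    ((p * Y) * wsym e (p / q)) <= 2 * (q * Y) `^ (2 * s + 2).
Proof.
move=> mn e0 h1 h2 p0 p1 q0 q1 Y0.
have lp : ln p <= 0 by rewrite -ln1 ler_ln ?posrE.
have lq : ln q <= 0 by rewrite -ln1 ler_ln ?posrE.
have pY : 0 < p * Y by rewrite mulr_gt0.
have lpY : ln (p * Y) = ln p + ln Y by rewrite lnM ?posrE.
have lqY : ln (q * Y) = ln q + ln Y by rewrite lnM ?posrE.
have lpq : ln (p / q) = ln p - ln q by rewrite ln_div ?posrE.
have nm : (n - m)%:R = n%:R - m%:R :> R by rewrite natrB.
(* Everything is a product of powers, so the logarithm turns the claim into linear inequalities in
   [ln p], [ln q] and [ln Y]. The exponent [a] is left free to treat both terms of [wsym] at
   once. *)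
have E a : (p * Y) `^ (2 * s) * (Y ^+ 3 * p `^ (- (3 * e))) * (p ^+ m * q ^+ (n - m) / Y) ^+ 2 *
    ((p * Y) * (p / q) `^ a) = expR (2 * s * (ln p + ln Y) + (3 * ln Y - 3 * e * ln p) +
    (2 * (m%:R * ln p + (n%:R - m%:R) * ln q - ln Y)) + (ln p + ln Y + a * (ln p - ln q))).
  have -> : p ^+ m * q ^+ (n - m) / Y = expR (m%:R * ln p + (n%:R - m%:R) * ln q - ln Y).
    by rewrite !expRD expRN lnK ?posrE// -nm -!exprn_expR.
  rewrite [(p * Y) `^ _]powR_expR// lpY [(p / q) `^ _]powR_expR ?divr_gt0// lpq [p `^ _]powR_expR//.
  have eP : p * Y = expR (ln p + ln Y) by rewrite -lpY lnK.
  rewrite [Y ^+ 3]exprn_expR// -[expR _ ^+ 2]expRM_natl eP.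
  by rewrite -!expRD; congr expR; ring.
rewrite [wsym _ _]/wsym mulrDr mulrDr !E [_ `^ (2 * s + 2)]powR_expR ?mulr_gt0// lqY [leRHS]mulrDl !mul1r.
(* These four products are the only nonlinear facts needed: they express that [p] and [q] are at
   most 1 and that the exponents leave room. *)
have k1 : 0 <= (2 * s + 2 * m%:R + 1 - 4 * e) * - ln p by rewrite mulr_ge0 ?oppr_ge0 ?subr_ge0.
have k2 : 0 <= (2 * (n%:R - m%:R) - 2 * s - 2 - e) * - ln q by rewrite mulr_ge0 ?oppr_ge0 ?subr_ge0.
have k3 : 0 <= e * - ln p by rewrite mulr_ge0 ?oppr_ge0 ?(ltW e0).
have k4 : 0 <= e * - ln q by rewrite mulr_ge0 ?oppr_ge0 ?(ltW e0).
by apply: lerD; rewrite ler_expR; lra.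
Qed.

Variables (m n : nat) (s : R).
Hypothesis hmn : (m + 4 <= n)%N.
Hypothesis s1 : -1 <= s.
Hypothesis hm : - s - 2^-1 < m%:R.
Hypothesis hn : m%:R + s + 2 < n%:R.
Local Notation CK := (@CK R m n).
Local Notation K := (@symb_K R m n).

(* Small enough for [eps_m] and [eps_n], the exponent conditions of [scale_bound]. *)
Definition eps : R := Num.min ((2 * s + 2 * m%:R + 1) / 4) 2^-1.

Lemma eps_gt0 : 0 < eps.
Proof. by rewrite lt_min; apply/andP; split; [rewrite divr_gt0//|]; move: hm; lra. Qed.
Lemma eps_le1 : eps <= 1.
Proof. by rewrite ge_min; apply/orP; right; lra. Qed.
Lemma eps_m : 4 * eps <= 2 * s + 2 * m%:R + 1.
Proof.
have : eps <= (2 * s + 2 * m%:R + 1) / 4 by rewrite ge_min lexx.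
lra.
Qed.
Lemma eps_n : eps <= 2 * (n%:R - m%:R) - 2 * s - 2.
Proof.
have : eps <= 2^-1 by rewrite ge_min lexx orbT.
move: hn; lra.
Qed.

Definition bmod (k : R * R) : R := jap (k.2 - k.1 ^+ 3).
Definition logb (k : R * R) : R := wsym eps (bmod k / jap k.1 ^+ 3).
(** The weight against [|K|^2] in the integral that defines [J]. *)
Definition Wt (k : R * R) : R := jap k.1 `^ (2 * s) * (bmod k * logb k).

Lemma bmod_gt0 k : 0 < bmod k. Proof. exact: jap_gt0. Qed.
Lemma logb_gt0 k : 0 < logb k.
Proof. by rewrite wsym_gt0// divr_gt0 ?exprn_gt0 ?jap_gt0. Qed.
Lemma Wt_gt0 k : 0 < Wt k.
Proof. by rewrite mulr_gt0 ?powR_gt0 ?jap_gt0// mulr_gt0 ?bmod_gt0 ?logb_gt0. Qed.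

Lemma measurable_bmod : measurable_fun setT bmod.
Proof.
apply: (measurableT_comp measurable_jap); apply: measurable_funB; first exact: measurable_snd.
by apply: measurable_funX; exact: measurable_fst.
Qed.
Lemma measurable_jap1 : measurable_fun setT (fun k : R * R => jap k.1).
Proof. exact: (measurableT_comp measurable_jap measurable_fst). Qed.
Lemma measurable_logb : measurable_fun setT logb.
Proof.
apply: (measurableT_comp (measurable_wsym eps)); apply: measurable_funM; first exact: measurable_bmod.
by apply: measurable_fun_inv; apply: measurable_funX; exact: measurable_jap1.
Qed.
Lemma measurable_Wt : measurable_fun setT Wt.
Proof.
apply: measurable_funM; first exact: (measurableT_comp (measurable_powR _) measurable_jap1).
by apply: measurable_funM; [exact: measurable_bmod|exact: measurable_logb].
Qed.

Lemma bmod_le (xi tau : R) : bmod (xi, tau) <= 1 + crt tau ^+ 3 + `|xi| ^+ 3.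
Proof.
rewrite /bmod (le_trans (jap_le1D _))// crtX3 -addrA lerD2l -normrX.
by rewrite (le_trans (ler_normB _ _)).
Qed.

(** With [T = crt tau], [X = <xi>] and [Y = T + X], the modulation is at most [Y^3] and [|K|] is of
    order [p^m q^(n-m) / Y], so [scale_bound] applies. The factor [X wsym(X / T)] is kept in the
    denominator because [wsym_integral] integrates its inverse uniformly in [T]. *)
Lemma high_bound (xi tau : R) : 1 <= crt tau ->
  Wt (xi, tau) * cmod (K xi tau) ^+ 2 <=
  4 * (CK * 2 ^+ n.+1) ^+ 2 * crt tau `^ (2 * s + 2) * (jap xi * wsym eps (jap xi / crt tau))^-1.
Proof.
set T := crt tau => T1; set X := jap xi; have X1 : 1 <= X := jap_ge1 xi.
have T0 : 0 < T by exact: lt_le_trans T1.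
have X0 : 0 < X := jap_gt0 xi; pose Y := T + X; have Y0 : 0 < Y by rewrite addr_gt0.
pose p := X / Y; pose q := T / Y.
have p0 : 0 < p by rewrite divr_gt0.
have q0 : 0 < q by rewrite divr_gt0.
have p1 : p <= 1 by rewrite ler_pdivrMr// mul1r /Y; lra.
have q1 : q <= 1 by rewrite ler_pdivrMr// mul1r /Y; lra.
have pY : p * Y = X by rewrite mulfVK// gt_eqF.
have qY : q * Y = T by rewrite mulfVK// gt_eqF.
have xX := norm_le_jap xi; rewrite -/X in xX.
have Xx := jap_le1D xi; rewrite -/X in Xx.
have pq : p / q = X / T by rewrite /p /q; field; rewrite !gt_eqF.
have mn : (m <= n)%N by rewrite (leq_trans _ hmn)// leq_addr.
have BY : bmod (xi, tau) <= Y ^+ 3.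
  rewrite (le_trans (bmod_le _ _))// -/T.
  have x3 : `|xi| ^+ 3 <= X ^+ 3 by rewrite lerXn2r ?nnegrE ?(ltW X0).
  (* The mixed terms of [(T + X)^3] absorb the constant 1 of [bmod_le]; this is where [T >= 1]
     enters. *)
  have tx : 1 <= T * X by rewrite -[1]mulr1 ler_pM.
  have : Y ^+ 3 = T ^+ 3 + X ^+ 3 + 3 * (T * X) * Y by rewrite /Y; ring.
  have : 1 <= (T * X) * Y by rewrite -[1]mulr1 ler_pM// /Y; lra.
  nra.
have X3Y : X ^+ 3 <= Y ^+ 3 by rewrite lerXn2r ?nnegrE ?ltW// /Y ltrDr.
have w1 := wsym_scale (ltW eps_gt0) eps_le1 (exprn_gt0 3 X0) (bmod_gt0 (xi, tau)) X3Y BY.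
have e3 : (Y ^+ 3 / X ^+ 3) `^ eps = p `^ (- (3 * eps)).
  have -> : Y ^+ 3 / X ^+ 3 = p ^- 3 by rewrite /p; field; rewrite !gt_eqF.
  by rewrite -powR_mulrn ?(ltW p0)// -powRN -powRrM mulNr.
rewrite e3 in w1.
have k1 : cmod (K xi tau) <= CK * 2 ^+ n.+1 * (p ^+ m * q ^+ (n - m) / Y).
  apply: (le_trans (cmod_K_le hmn xi tau)); rewrite -[leRHS]mulrA; apply: ler_wpM2l; first exact: CK_ge0.
  rewrite -/T.
  have yy : Y / 2 <= `|xi| + T by rewrite /Y; lra.
  have y2 : 0 < Y / 2 by rewrite divr_gt0.
  apply: (@le_trans _ _ (X ^+ m * T ^+ (n - m) / (Y / 2) ^+ n.+1)).
    apply: ler_pM; rewrite ?mulr_ge0 ?exprn_ge0 ?invr_ge0 ?exprn_ge0 ?addr_ge0 ?(ltW T0)//.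
      by apply: ler_wpM2r; [exact: exprn_ge0 (ltW T0)|rewrite lerXn2r ?nnegrE ?(ltW X0)].
    by rewrite lef_pV2 ?posrE ?exprn_gt0 ?(lt_le_trans y2)// lerXn2r ?nnegrE ?(ltW y2)// (le_trans _ yy)// ltW.
  have -> : (Y / 2) ^+ n.+1 = Y ^+ m * Y ^+ (n - m) * Y * 2 ^- n.+1.
    by rewrite exprMn exprVn -exprD subnKC// exprSr.
  rewrite /p /q !exprMn !exprVn le_eqVlt; apply/orP; left; apply/eqP.
  have a := expf_neq0 m (lt0r_neq0 Y0); have b := expf_neq0 (n - m) (lt0r_neq0 Y0).
  have c : 2 ^+ n.+1 != 0 :> R by rewrite expf_neq0.
  field; rewrite ?a ?b ?c ?(lt0r_neq0 Y0)//.
have wY : 0 < wsym eps (X / T) by rewrite wsym_gt0// divr_gt0.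
rewrite ler_pdivlMr ?mulr_gt0//.
have sb := scale_bound mn eps_gt0 eps_m eps_n p0 p1 q0 q1 Y0; rewrite pY qY pq in sb.
have Kq : cmod (K xi tau) ^+ 2 <= (CK * 2 ^+ n.+1) ^+ 2 * (p ^+ m * q ^+ (n - m) / Y) ^+ 2.
  rewrite -exprMn lerXn2r ?nnegrE ?cmod_ge0//.
  by rewrite (le_trans (cmod_ge0 _) k1).
have D0 : 0 <= (CK * 2 ^+ n.+1) ^+ 2 by rewrite sqr_ge0.
move: ((CK * 2 ^+ n.+1) ^+ 2) D0 Kq => D D0 Kq.
move: ((p ^+ m * q ^+ (n - m) / Y) ^+ 2) Kq sb => Q Kq sb.
rewrite /Wt /logb -/X /=.
apply: (@le_trans _ _ (X `^ (2 * s) * (2 * (Y ^+ 3 * p `^ (- (3 * eps)))) * (D * Q) * (X * wsym eps (X / T)))).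
  apply: ler_wpM2r; first by rewrite mulr_ge0 ?ltW.
  apply: ler_pM => //; rewrite ?sqr_ge0//.
    by rewrite mulr_ge0 ?powR_ge0// mulr_ge0// ltW ?bmod_gt0// logb_gt0.
  by apply: ler_wpM2l => //; exact: powR_ge0.
have := ler_wpM2l (mulr_ge0 (ler0n R 2) D0) sb.
move=> h; apply: le_trans (le_trans h _); rewrite le_eqVlt; apply/orP; left; apply/eqP; ring.
Qed.

(** For [crt tau <= 1] the modulation is at most [3 <xi>^3], so modulation and logarithmic weight
    together cost a multiple of [<xi>^3]. The decay of [K] pays for [<xi>^(2 s + 3)] and still
    leaves the inverse square of [|xi| + T]. *)
Lemma low_bound (xi tau : R) : 0 < crt tau -> crt tau <= 1 ->
  Wt (xi, tau) * cmod (K xi tau) ^+ 2 <=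
  18 * CK ^+ 2 * 2 `^ (2 * s + 3) * (crt tau)^-1 * ckern tau xi.
Proof.
set T := crt tau => T0 T1; set X := jap xi; have X1 : 1 <= X := jap_ge1 xi.
have X0 : 0 < X := jap_gt0 xi; pose y := `|xi| + T; have y0 : 0 < y by rewrite ltr_pwDr.
have xX := norm_le_jap xi; rewrite -/X in xX.
have Xx := jap_le1D xi; rewrite -/X in Xx.
have mn : (m <= n)%N by rewrite (leq_trans _ hmn)// leq_addr.
have S3 : bmod (xi, tau) <= 3 * X ^+ 3.
  apply: (le_trans (bmod_le _ _)); rewrite -/T.
  have x3 : `|xi| ^+ 3 <= X ^+ 3 by rewrite lerXn2r ?nnegrE ?(ltW X0).
  have t3 : T ^+ 3 <= 1 by rewrite exprn_ile1// ltW.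
  have : 1 <= X ^+ 3 by rewrite exprn_ege1.
  lra.
have X33 : X ^+ 3 <= 3 * X ^+ 3 by rewrite ler_peMl ?exprn_ge0 ?(ltW X0)// ler1n.
have w1 := wsym_scale (ltW eps_gt0) eps_le1 (exprn_gt0 3 X0) (bmod_gt0 (xi, tau)) X33 S3.
(* 18 is [2 * 3 * 3]: the 2 of [wsym_scale], the scale [3 X^3], and [3^eps <= 3]. *)
have w2 : bmod (xi, tau) * logb (xi, tau) <= 18 * X ^+ 3.
  apply: (le_trans w1); rewrite mulfK ?gt_eqF ?exprn_gt0//.
  have : 3 `^ eps <= 3 :> R by rewrite -[leRHS]powRr1// ler_powR ?eps_le1// ler1n.
  have X3 : 0 < X ^+ 3 by exact: exprn_gt0.
  nra.
(* For [|xi| >= 1] the [2 (n - m)] powers of [y] dominate [X^(2 s + 3)], since [n > m + s + 2]; for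
   [|xi| < 1] the bracket [X] is at most 2. *)
have key : X `^ (2 * s + 3) * (`|xi| ^+ m * T ^+ (n - m)) ^+ 2 <= 2 `^ (2 * s + 3) * (y ^+ n) ^+ 2.
  have s3 : 0 <= 2 * s + 3 by move: s1; lra.
  have xm : `|xi| ^+ m <= y ^+ m by rewrite lerXn2r ?nnegrE ?(ltW y0)// lerDl ltW.
  have [x1|x1] := leP 1 `|xi|.
    have y1 : 1 <= y by rewrite (le_trans x1)// lerDl ltW.
    have a1 : X `^ (2 * s + 3) <= 2 `^ (2 * s + 3) * (y ^+ (n - m)) ^+ 2.
      apply: (@le_trans _ _ ((2 * y) `^ (2 * s + 3))).
        apply: ge0_ler_powR => //; rewrite ?nnegrE ?(ltW X0)//; first by rewrite mulr_ge0 ?ltW.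
        by rewrite /y; move: T0; lra.
      rewrite powRM ?(ltW y0)// ler_wpM2l ?powR_ge0// -exprM -powR_mulrn ?(ltW y0)//.
      apply: ler_powR => //; rewrite natrM natrB//; move: hn; lra.
    have t1 : T ^+ (n - m) <= 1 by rewrite exprn_ile1// ltW.
    rewrite -{2}(subnKC mn) exprD exprMn (exprMn _ (y ^+ m)) mulrCA [leRHS]mulrCA.
    apply: ler_pM; rewrite ?sqr_ge0//.
    - by rewrite mulr_ge0 ?powR_ge0 ?sqr_ge0.
    - by rewrite lerXn2r ?nnegrE ?exprn_ge0 ?(ltW y0).
    - apply: le_trans a1; rewrite ler_piMr ?powR_ge0// exprn_ile1// exprn_ge0// ltW//.
  apply: ler_pM; rewrite ?powR_ge0 ?sqr_ge0//.
    apply: ge0_ler_powR => //; rewrite ?nnegrE ?(ltW X0)//; lra.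
  have tm : T ^+ (n - m) <= y ^+ (n - m) by rewrite lerXn2r ?nnegrE ?(ltW y0) ?(ltW T0)// lerDr.
  rewrite -{2}(subnKC mn) exprD lerXn2r ?nnegrE ?mulr_ge0 ?exprn_ge0 ?(ltW y0) ?(ltW T0)//.
  by apply: ler_pM; rewrite ?exprn_ge0 ?(ltW T0).
have ck : (y ^+ 2)^-1 <= T^-1 * ckern tau xi.
  rewrite /ckern -/T mulrA -invfM -expr2 -invfM lef_pV2 ?posrE ?exprn_gt0//; last first.
    by rewrite mulr_gt0 ?exprn_gt0// ltr_pwDl ?sqr_ge0.
  rewrite mulrDr mulr1 exprMn exprVn mulrA mulfV ?gt_eqF ?exprn_gt0// mul1r /y.
  rewrite -[xi ^+ 2]real_normK ?num_real//.
  have : 0 <= `|xi| * T by rewrite mulr_ge0 ?normr_ge0 ?(ltW T0).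
  by rewrite sqrrD; nra.
have kK : cmod (K xi tau) ^+ 2 <= CK ^+ 2 * ((`|xi| ^+ m * T ^+ (n - m)) ^+ 2 / (y ^+ n.+1) ^+ 2).
  rewrite -exprVn -exprMn -[leRHS]exprMn lerXn2r ?nnegrE ?cmod_ge0//.
    by rewrite (le_trans (cmod_ge0 _) (cmod_K_le hmn xi tau)).
  exact: (cmod_K_le hmn xi tau).
have C0 : 0 <= CK ^+ 2 by exact: sqr_ge0.
move: (CK ^+ 2) C0 kK => D D0 kK.
have y1n : y ^+ n.+1 = y ^+ n * y by rewrite exprSr.
rewrite y1n (exprMn 2 (y ^+ n)) in kK.
have yn0 : 0 < (y ^+ n) ^+ 2 by rewrite !exprn_gt0.
move: ((y ^+ n) ^+ 2) ((`|xi| ^+ m * T ^+ (n - m)) ^+ 2) (sqr_ge0 (`|xi| ^+ m * T ^+ (n - m))) yn0 key kK => Z Q Q0 Z0 key kK.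
have split3 : X `^ (2 * s + 3) = X `^ (2 * s) * X ^+ 3.
  by rewrite powRD ?(gt_eqF X0) ?implybT// powR_mulrn// ltW.
have -> : 18 * D * 2 `^ (2 * s + 3) * T^-1 * ckern tau xi = 18 * D * 2 `^ (2 * s + 3) * (T^-1 * ckern tau xi) by ring.
apply: (@le_trans _ _ (18 * D * 2 `^ (2 * s + 3) * (y ^+ 2)^-1)); last first.
  by apply: ler_wpM2l ck; rewrite !mulr_ge0 ?powR_ge0.
rewrite /Wt /= -/X.
apply: (@le_trans _ _ (X `^ (2 * s) * (18 * X ^+ 3) * (D * (Q / (Z * y ^+ 2))))).
  apply: ler_pM => //; rewrite ?sqr_ge0//.
    by rewrite mulr_ge0 ?powR_ge0// mulr_ge0 ?ltW ?bmod_gt0 ?logb_gt0.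
  by rewrite ler_wpM2l ?powR_ge0.
have -> : X `^ (2 * s) * (18 * X ^+ 3) * (D * (Q / (Z * y ^+ 2))) =
    18 * D * (X `^ (2 * s + 3) * Q / Z) * (y ^+ 2)^-1.
  by rewrite split3; field; rewrite !gt_eqF.
rewrite ler_wpM2r ?invr_ge0 ?sqr_ge0// ler_wpM2l ?mulr_ge0// ler_pdivrMr//.
Qed.

Definition Cslice : R := Num.max (18 * CK ^+ 2 * 2 `^ (2 * s + 3) * pi)
  (4 * (CK * 2 ^+ n.+1) ^+ 2 * Clog eps).

Definition slice_bound (tau : R) : R :=
  if `|tau| < 1 then (crt tau)^-1 else crt tau `^ (2 * s + 2).

(** [low_bound] integrates to a multiple of [pi] through [ckern], and [high_bound] to a multiple of
    [Clog eps] through [wsym_integral] at scale [crt tau]. At [tau = 0] the symbol is 0 by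
    convention. *)
Lemma weight_slice (tau : R) :
  (\int[mu]_xi (Wt (xi, tau) * cmod (K xi tau) ^+ 2)%:E <= (Cslice * slice_bound tau)%:E)%E.
Proof.
have mI : measurable_fun setT (fun xi => Wt (xi, tau) * cmod (K xi tau) ^+ 2).
  apply: measurable_funM; first exact: (measurableT_comp measurable_Wt (measurable_pair2 tau)).
  by apply: measurable_funX; apply: measurable_cmod; exact: cmeasurable_K1.
have I0 xi : 0 <= Wt (xi, tau) * cmod (K xi tau) ^+ 2 by rewrite mulr_ge0 ?sqr_ge0// ltW// Wt_gt0.
have c1 : 0 <= 18 * CK ^+ 2 * 2 `^ (2 * s + 3) :> R.
  by apply: mulr_ge0; [apply: mulr_ge0 => //; exact: sqr_ge0|exact: powR_ge0].
have c2 : 0 <= 4 * (CK * 2 ^+ n.+1) ^+ 2 by rewrite mulr_ge0 ?sqr_ge0.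
rewrite /slice_bound; have [->|t0] := eqVneq tau 0.
  rewrite normr0 ltr01 crt0 invr0 mulr0 (_ : (fun xi => _) = fun=> 0%E) ?integral0//.
  by apply/funext => xi; rewrite symb_K0 cmod0 expr0n mulr0.
have T0 := crt_gt0 t0; have T3 := crtX3 tau.
case: ifPn => [t1|]; last rewrite -leNgt => t1.
  have T1 : crt tau <= 1.
    by rewrite leNgt; apply/negP => T1; have := @exprn_egt1 R 3 _ T1; rewrite T3 /=; lra.
  apply: (@le_trans _ _ (\int[mu]_xi (18 * CK ^+ 2 * 2 `^ (2 * s + 3) * (crt tau)^-1 * ckern tau xi)%:E)%E).
    apply: ge0_le_integral_EFin => //; last by move=> xi; exact: low_bound.
    by apply: measurable_funM => //; exact: measurable_ckern.
  have c1' : 0 <= 18 * CK ^+ 2 * 2 `^ (2 * s + 3) * (crt tau)^-1 by rewrite mulr_ge0// invr_ge0 ltW.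
  rewrite (@ge0_integralZ_EFin _ _ _ mu _ _ c1' (measurable_ckern tau) (ckern_ge0 tau)).
  apply: (@le_trans _ _ ((18 * CK ^+ 2 * 2 `^ (2 * s + 3) * (crt tau)^-1)%:E * pi%:E)%E).
    by rewrite lee_wpmul2l ?lee_fin// ckern_integral.
  rewrite -EFinM lee_fin mulrAC ler_wpM2r ?invr_ge0 ?(ltW T0)// /Cslice.
  by rewrite le_max lexx.
have T1 : 1 <= crt tau.
  rewrite leNgt; apply/negP => T1.
  have : crt tau ^+ 3 < 1 by rewrite exprn_ilt1// ltW.
  by rewrite T3; lra.
set D := 4 * _ in c2; pose g (xi : R) := (jap xi * wsym eps (jap xi / crt tau))^-1.
have g0 xi : 0 <= g xi by rewrite invr_ge0 mulr_ge0 ?jap_ge0// ltW// wsym_gt0// divr_gt0// jap_gt0.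
have mg : measurable_fun setT g.
  apply: measurable_fun_inv; apply: measurable_funM; first exact: measurable_jap.
  apply: (measurableT_comp (measurable_wsym eps)); apply: measurable_funM => //; exact: measurable_jap.
have c2' : 0 <= D * crt tau `^ (2 * s + 2) by rewrite mulr_ge0 ?powR_ge0.
apply: (@le_trans _ _ (\int[mu]_xi (D * crt tau `^ (2 * s + 2) * g xi)%:E)%E).
  apply: ge0_le_integral_EFin => //; last by move=> xi; exact: high_bound.
  exact: measurable_funM.
rewrite (@ge0_integralZ_EFin _ _ _ mu _ _ c2' mg g0).
apply: (@le_trans _ _ ((D * crt tau `^ (2 * s + 2))%:E * (Clog eps)%:E)%E).
  apply: lee_wpmul2l; first by rewrite lee_fin.
  have e0 (x : R) : (jap (x - 0) * wsym eps (jap (x - 0) / crt tau))^-1 = g x by rewrite subr0.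
  have E : (\int[mu]_x ((jap (x - 0) * wsym eps (jap (x - 0) / crt tau))^-1)%:E = \int[mu]_x (g x)%:E)%E.
    by apply: eq_integral => x _; rewrite e0.
  by rewrite -E; exact: wsym_integral eps_gt0 T0.
rewrite -EFinM lee_fin mulrAC ler_wpM2r ?powR_ge0// /Cslice.
by rewrite le_max lexx orbT.
Qed.

Lemma Cslice_ge0 : 0 <= Cslice.
Proof.
rewrite le_max; apply/orP; left; apply: mulr_ge0; last exact: pi_ge0.
by apply: mulr_ge0; [apply: mulr_ge0 => //; exact: sqr_ge0|exact: powR_ge0].
Qed.

Lemma measurable_slice_bound : measurable_fun setT slice_bound.
Proof.
apply: measurable_fun_ifT; first by apply: measurable_fun_ltr => //; exact: normr_measurable.
  by apply: measurable_fun_inv; exact: measurable_crt.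
exact: (measurableT_comp (measurable_powR _) measurable_crt).
Qed.

Lemma slice_bound_ge0 tau : 0 <= slice_bound tau.
Proof. by rewrite /slice_bound; case: ifP; rewrite ?powR_ge0 ?invr_ge0 ?crt_ge0. Qed.

(** Left general in [g], because it is applied to the transform of [h] and also to that of its
    derivative. *)
Definition Mquad (g : R -> R[i]) : \bar R :=
  (\int[leb2]_k (Wt k * cmod (g k.2 * K k.1 k.2) ^+ 2)%:E)%E.

(** The 3 is the bound of [crt_inv_integral] on low frequencies. On high ones [(2 s + 2) / 3] is
    twice the Sobolev exponent, and [s >= -1] allows replacing [|tau|] by [<tau>]. *)
Lemma Mquad_le (g : R -> R[i]) (A : R) : cmeasurable g -> (forall tau, cmod (g tau) <= A) ->
  (Mquad g <= Cslice%:E * ((A ^+ 2 * 3)%:E + Hsq ((s + 1) / 3) g))%E.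
Proof.
move=> mg gA; have C0 := Cslice_ge0.
have mcg : measurable_fun setT (fun tau => cmod (g tau)) by exact: measurable_cmod.
have mf : measurable_fun setT (fun k : R * R => Wt k * cmod (g k.2 * K k.1 k.2) ^+ 2).
  apply: measurable_funM; first exact: measurable_Wt.
  apply: measurable_funX; apply: measurable_cmod; apply: cmeasurableM; last exact: cmeasurable_K2.
  exact: (cmeasurable_comp mg measurable_snd).
have f0 (k : R * R) : 0 <= Wt k * cmod (g k.2 * K k.1 k.2) ^+ 2 by rewrite mulr_ge0 ?sqr_ge0// ltW// Wt_gt0.
rewrite /Mquad leb2_tonelli2//=.
have mb := measurable_slice_bound.
apply: (@le_trans _ _ (\int[mu]_tau (Cslice * (cmod (g tau) ^+ 2 * slice_bound tau))%:E)%E).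
  apply: ge0_le_integral => //.
  - by move=> tau _; apply: integral_ge0 => xi _; rewrite lee_fin (f0 (xi, tau)).
  - apply: (@measurable_fun_fubini_tonelli_G _ _ _ _ _ mu (fun k : R * R => (Wt k * cmod (g k.2 * K k.1 k.2) ^+ 2)%:E)).
      exact/measurable_EFinP.
    by move=> k; rewrite lee_fin.
  - apply/measurable_EFinP; apply: measurable_funM => //; apply: measurable_funM => //.
    exact: measurable_funX.
  - move=> tau _.
    have -> : (\int[mu]_x (Wt (x, tau) * cmod (g tau * K x tau) ^+ 2)%:E =
        \int[mu]_x (cmod (g tau) ^+ 2 * (Wt (x, tau) * cmod (K x tau) ^+ 2))%:E)%E.
      by apply: eq_integral => x _; rewrite (cmodM (g tau)) exprMn mulrCA.
    rewrite ge0_integralZ_EFin ?sqr_ge0//; first last.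
    + by move=> x; rewrite mulr_ge0 ?sqr_ge0// ltW// Wt_gt0.
    + apply: measurable_funM; first exact: (measurableT_comp measurable_Wt (measurable_pair2 tau)).
      by apply: measurable_funX; apply: measurable_cmod; exact: cmeasurable_K1.
    rewrite mulrCA [leRHS]EFinM; apply: lee_wpmul2l; first by rewrite lee_fin sqr_ge0.
    exact: weight_slice.
rewrite ge0_integralZ_EFin//; first last.
- by move=> tau; rewrite mulr_ge0 ?sqr_ge0 ?slice_bound_ge0.
- by apply: measurable_funM => //; exact: measurable_funX.
rewrite lee_wpmul2l ?lee_fin//.
pose lo (tau : R) : R := if `|tau| < 1 then (crt tau)^-1 else 0.
have mlo : measurable_fun setT lo.
  apply: measurable_fun_ifT => //; first by apply: measurable_fun_ltr => //; exact: normr_measurable.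
  by apply: measurable_fun_inv; exact: measurable_crt.
have lo0 x : 0 <= lo x by rewrite /lo; case: ifP => // _; rewrite invr_ge0 crt_ge0.
have mh : measurable_fun setT (fun tau => (jap tau `^ ((s + 1) / 3) * cmod (g tau)) ^+ 2).
  by apply: measurable_funX; apply: measurable_funM => //; exact: measurable_jap_powR.
have mlo' : measurable_fun setT (fun tau => A ^+ 2 * lo tau) by exact: measurable_funM.
apply: (@le_trans _ _ (\int[mu]_tau (A ^+ 2 * lo tau + (jap tau `^ ((s + 1) / 3) * cmod (g tau)) ^+ 2)%:E)%E).
  apply: ge0_le_integral_EFin.
  - by apply: measurable_funM => //; exact: measurable_funX.
  - exact: measurable_funD.
  - by move=> tau; rewrite mulr_ge0 ?sqr_ge0 ?slice_bound_ge0.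
  - move=> tau; rewrite /slice_bound /lo; case: ifPn => [t1|].
      rewrite ler_wpDr ?sqr_ge0// ler_wpM2r ?invr_ge0 ?crt_ge0// lerXn2r ?nnegrE ?cmod_ge0//.
      exact: le_trans (cmod_ge0 _) (gA tau).
    rewrite -leNgt => t1; rewrite mulr0 add0r exprMn mulrC ler_wpM2r ?sqr_ge0//.
    rewrite /crt -powRrM -[leRHS]powR_mulrn ?powR_ge0// -powRrM.
    have -> : 3^-1 * (2 * s + 2) = (s + 1) / 3 * 2 by field.
    apply: ge0_ler_powR; rewrite ?nnegrE ?jap_ge0 ?norm_le_jap//.
    by move: s1; lra.
under eq_integral do rewrite EFinD.
rewrite ge0_integralD//; first last.
- exact/measurable_EFinP.
- by move=> x _; rewrite lee_fin sqr_ge0.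
- exact/measurable_EFinP.
- by move=> x _; rewrite lee_fin mulr_ge0 ?sqr_ge0.
apply: leeD => //; rewrite ge0_integralZ_EFin ?sqr_ge0// [leRHS]EFinM.
by apply: lee_wpmul2l; [rewrite lee_fin sqr_ge0|exact: crt_inv_integral].
Qed.

End WeightBound.

(** * Weighted Cauchy-Schwarz for series of extended reals *)

Section SeriesCS.
Context {R : realType}.
Local Open Scope ereal_scope.

Lemma poweR_half_sqr (x : \bar R) : 0 <= x -> (x `^ 2^-1) `^ 2 = x.
Proof. by move=> x0; rewrite -poweRrM mulVf// poweRe1. Qed.

Lemma poweR_sqr_half (x : \bar R) : 0 <= x -> (x `^ 2) `^ 2^-1 = x.
Proof. by move=> x0; rewrite -poweRrM mulfV// poweRe1. Qed.

Lemma lee_sqr (x y : \bar R) : 0 <= x -> x <= y -> x `^ 2 <= y `^ 2.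
Proof.
move=> x0 xy; apply: gt0_ler_poweR => //; rewrite in_itv /= leey andbT//.
exact: le_trans xy.
Qed.

Lemma lee_sqrt (x y : \bar R) : 0 <= x -> x <= y -> x `^ 2^-1 <= y `^ 2^-1.
Proof.
move=> x0 xy; apply: gt0_ler_poweR => //; rewrite in_itv /= leey andbT//.
exact: le_trans xy.
Qed.

Lemma sum_cauchy_schwarz (r v : nat -> R) (L : nat) : (forall l, 0 <= r l)%R -> (forall l, 0 < v l)%R ->
  ((\sum_(0 <= l < L) r l) ^+ 2 <= (\sum_(0 <= l < L) v l) * \sum_(0 <= l < L) (v l)^-1 * r l ^+ 2)%R.
Proof.
move=> r0 v0; elim: L => [|L ih]; first by rewrite !big_geq// expr0n mulr0.
rewrite !big_nat_recr//=; move: ih.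
have P0 : (0 <= \sum_(0 <= l < L) r l)%R by apply: sumr_ge0.
have V0 : (0 <= \sum_(0 <= l < L) v l)%R by apply: sumr_ge0 => l _; exact: ltW.
have S0 : (0 <= \sum_(0 <= l < L) (v l)^-1 * r l ^+ 2)%R.
  by apply: sumr_ge0 => l _; rewrite mulr_ge0 ?sqr_ge0// invr_ge0 ltW.
move: (\sum_(0 <= l < L) r l)%R (\sum_(0 <= l < L) v l)%R (\sum_(0 <= l < L) (v l)^-1 * r l ^+ 2)%R P0 V0 S0.
move=> P V S P0 V0 S0 ih; have w0 := v0 L; have a0 := r0 L.
move: (v L) (r L) w0 a0 => w a w0 a0.
have e : ((V + w) * (S + w^-1 * a ^+ 2) = V * S + (V * a ^+ 2 * w^-1 + w * S) + a ^+ 2)%R.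
  by field; rewrite gt_eqF.
rewrite e; have wi : (0 < w^-1)%R by rewrite invr_gt0.
(* AM-GM: (2Pa)^2 <= 4 V S a^2 = 4 (V a^2 / w) (w S) *)
suff : (2 * (P * a) <= V * a ^+ 2 * w^-1 + w * S)%R.
  by rewrite sqrrD -mulr_natl; move: ih; lra.
have X0 : (0 <= V * a ^+ 2 * w^-1)%R.
  by apply: mulr_ge0; [apply: mulr_ge0 => //; exact: sqr_ge0|exact: ltW].
have Y0 : (0 <= w * S)%R by rewrite mulr_ge0// ltW.
have XY : (V * a ^+ 2 * w^-1 * (w * S) = V * S * a ^+ 2)%R by field; rewrite gt_eqF.
move: (V * a ^+ 2 * w^-1)%R (w * S)%R X0 Y0 XY => X Y X0 Y0 XY.
rewrite -ler_sqr ?nnegrE ?addr_ge0 ?mulr_ge0//.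
have : ((P * a) ^+ 2 <= X * Y)%R by rewrite XY exprMn ler_wpM2r ?sqr_ge0.
have : (0 <= (X - Y) ^+ 2)%R by rewrite sqr_ge0.
by rewrite exprMn; nra.
Qed.

(** An infinite term makes the right-hand side infinite; otherwise the finite inequality passes to
    the limit. *)
Lemma series_cauchy_schwarz (N : nat -> \bar R) (v : nat -> R) (V : R) :
  (forall l, 0 <= N l) -> (forall l, 0 < v l)%R -> (forall L, \sum_(0 <= l < L) v l <= V)%R ->
  (\sum_(0 <= l <oo) N l) `^ 2 <= V%:E * \sum_(0 <= l <oo) ((v l)^-1)%:E * N l `^ 2.
Proof.
move=> N0 v0 vV.
have V0 : (0 < V)%R by apply: lt_le_trans (vV 1%N); rewrite big_nat1.
have t0 l : 0 <= ((v l)^-1)%:E * N l `^ 2 by rewrite mule_ge0 ?poweR_ge0// lee_fin invr_ge0 ltW.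
have S0 : 0 <= \sum_(0 <= l <oo) ((v l)^-1)%:E * N l `^ 2 by apply: nneseries_ge0.
have [fin|/existsNP[l Nl]] := pselect (forall l, N l \is a fin_num); last first.
  have Ny : N l = +oo.
    by apply/eqP; rewrite -leye_eq leNgt; apply/negP => h; apply: Nl; rewrite ge0_fin_numE.
  rewrite (_ : \sum_(0 <= l <oo) ((v l)^-1)%:E * N l `^ 2 = +oo); first by rewrite gt0_muley ?leey// lte_fin.
  apply: (@nneseries_pinfty _ _ xpredT l) => //.
  by rewrite Ny poweRyr// gt0_muley// lte_fin invr_gt0.
set Z := V%:E * _; have Z0 : 0 <= Z by rewrite mule_ge0// lee_fin ltW.
rewrite -[leRHS]poweR_half_sqr//; apply: lee_sqr; first exact: nneseries_ge0.
apply: lime_le; first exact: is_cvg_nneseries.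
apply: nearW => L; rewrite -[leLHS]poweR_sqr_half ?sume_ge0//; apply: lee_sqrt; first exact: poweR_ge0.
have NE l : N l = (fine (N l))%:E by rewrite fineK.
have r0 l : (0 <= fine (N l))%R by apply: fine_ge0.
have -> : \sum_(0 <= l < L) N l = (\sum_(0 <= l < L) fine (N l))%:E.
  by rewrite -sumEFin; apply: eq_bigr => l _.
rewrite poweR_EFin powR_mulrn ?sumr_ge0//.
apply: (@le_trans _ _ ((\sum_(0 <= l < L) v l) * \sum_(0 <= l < L) (v l)^-1 * fine (N l) ^+ 2)%R%:E).
  by rewrite lee_fin; exact: sum_cauchy_schwarz.
apply: (@le_trans _ _ (V * \sum_(0 <= l < L) (v l)^-1 * fine (N l) ^+ 2)%R%:E).
  rewrite lee_fin ler_wpM2r ?vV//; apply: sumr_ge0 => l _.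
  by rewrite mulr_ge0 ?sqr_ge0// invr_ge0 ltW.
rewrite EFinM /Z; apply: lee_wpmul2l; first by rewrite lee_fin ltW.
rewrite -sumEFin; apply: le_trans (nneseries_lim_ge L _); last by move=> *; exact: t0.
by apply: lee_sum => l _; rewrite EFinM {2}NE poweR_EFin powR_mulrn.
Qed.

Lemma lee_sqrD (P a : \bar R) : 0 <= P -> 0 <= a -> P `^ 2 + a `^ 2 <= (P + a) `^ 2.
Proof.
move=> P0 a0.
have [Pf|] := boolP (P \is a fin_num); last first.
  by rewrite ge0_fin_numE// -leNgt leye_eq => /eqP ->; rewrite addye ?poweRyr ?leey//; rewrite gt_eqF// (lt_le_trans _ a0)// ltNyr.
have [af|] := boolP (a \is a fin_num); last first.
  by rewrite ge0_fin_numE// -leNgt leye_eq => /eqP ->; rewrite addey ?poweRyr ?leey//; rewrite gt_eqF// (lt_le_trans _ P0)// ltNyr.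
case: P P0 Pf => // p p0 _; case: a a0 af => // q q0 _; rewrite !lee_fin in p0 q0.
rewrite [leRHS](_ : _ = ((p + q) `^ 2)%:E)// !poweR_EFin [leLHS](_ : _ = (p `^ 2 + q `^ 2)%:E)// lee_fin.
rewrite !powR_mulrn ?addr_ge0// sqrrD.
have : (0 <= p * q)%R by rewrite mulr_ge0.
lra.
Qed.

Lemma series_sqr_le (N : nat -> \bar R) : (forall l, 0 <= N l) ->
  \sum_(0 <= l <oo) N l `^ 2 <= (\sum_(0 <= l <oo) N l) `^ 2.
Proof.
move=> N0; set S := \sum_(0 <= l <oo) N l; have S0 : 0 <= S by exact: nneseries_ge0.
apply: lime_le; first by apply: is_cvg_nneseries => *; exact: poweR_ge0.
apply: nearW => L; apply: (@le_trans _ _ ((\sum_(0 <= l < L) N l) `^ 2)); last first.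
  by apply: lee_sqr; [exact: sume_ge0|exact: nneseries_lim_ge].
elim: L => [|L ih]; first by rewrite !big_geq ?poweR_ge0.
rewrite !big_nat_recr//=; apply: (le_trans (leeD ih (le_refl _))).
have P0 : 0 <= \sum_(0 <= l < L) N l by exact: sume_ge0.
exact: lee_sqrD P0 (N0 L).
Qed.

(** The exponent is the distance of [l] to [p], so the sum consists of at most two geometric tails,
    and the bound is uniform in the centre [p]. *)
Lemma geometric_dist_sum (q : R) (p L : nat) : (0 < q)%R -> (q < 1)%R ->
  (\sum_(0 <= l < L) q ^+ (maxn l p - minn l p) <= 2 / (1 - q))%R.
Proof.
move=> q0 q1; have g0 : (0 < 1 - q)%R by rewrite subr_gt0.
have geo K : (\sum_(0 <= i < K) q ^+ i <= (1 - q)^-1)%R.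
  rewrite -[leRHS]mul1r ler_pdivlMr// mulrC.
  have -> : ((1 - q) * \sum_(0 <= i < K) q ^+ i = 1 - q ^+ K)%R.
    elim: K => [|K ih]; first by rewrite big_geq// expr0 mulr0 subrr.
    by rewrite big_nat_recr//= mulrDr ih exprS; ring.
  by rewrite lerBlDr lerDl exprn_ge0// ltW.
(* A sharper form that survives induction on the centre: shifting both indices preserves their
   distance. *)
suff H : forall p L, (\sum_(0 <= l < L) q ^+ (maxn l p - minn l p) <=
    (1 - q)^-1 + \sum_(0 <= i < p) q ^+ i.+1)%R.
  apply: (le_trans (H p L)); rewrite mulrDl !mul1r lerD2l (le_trans _ (geo p.+1))//.
  by rewrite [leRHS]big_nat_recl// lerDr expr0.
elim=> [|p' ih] L'.
  rewrite [X in (_ <= _ + X)%R]big_geq// addr0; apply: (le_trans _ (geo L')); rewrite le_eqVlt; apply/orP; left.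
  by apply/eqP; apply: eq_bigr => l _; rewrite maxn0 minn0 subn0.
case: L' => [|L'].
  by rewrite big_geq// addr_ge0 ?invr_ge0 ?(ltW g0)// sumr_ge0// => i _; rewrite exprn_ge0// ltW.
rewrite big_nat_recl// max0n min0n subn0 [X in (_ <= _ + X)%R]big_nat_recr//=.
rewrite [leLHS]addrC addrA lerD2r; apply: (le_trans _ (ih L')).
rewrite le_eqVlt; apply/orP; left; apply/eqP; apply: eq_bigr => l _.
by rewrite maxnSS minnSS subSS.
Qed.

End SeriesCS.

(** * Dyadic decomposition of the frequency plane *)

Section Blocks.
Context {R : realType}.
Local Notation mu := (@lebesgue_measure R).
Local Notation leb2 := (@leb2 R).

Definition dyad (j : nat) : set R := [set x | 2 ^+ j <= x < 2 ^+ j.+1].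

Lemma dyad_trivIset : trivIset setT dyad.
Proof.
apply: ltn_trivIset => j i ij; rewrite -subset0 => x [/andP[_ h1] /andP[h2 _]].
suff : 2 ^+ i.+1 <= 2 ^+ j :> R by move=> h; have := lt_le_trans h1 (le_trans h h2); rewrite ltxx.
by rewrite ler_weXn2l// ler1n.
Qed.

Lemma dyad_cover (x : R) : 1 <= x -> exists j, dyad j x.
Proof.
move=> x1; have x0 : 0 <= x by exact: le_trans x1.
have /andP[h1 h2] := truncn_itv x0.
have t0 : (0 < Num.truncn x)%N by case: (Num.truncn x) h2 => // h2; lra.
exists (trunc_log 2 (Num.truncn x)); apply/andP; split.
  by rewrite -natrX (le_trans _ h1)// ler_nat trunc_logP.
by rewrite -natrX (lt_le_trans h2)// ler_nat trunc_log_ltn.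
Qed.

Lemma measurable_dyad j : measurable (dyad j).
Proof.
have -> : dyad j = [set` `[2 ^+ j, 2 ^+ j.+1[ ] by apply/seteqP; split => x; rewrite /= in_itv.
exact: measurable_itv.
Qed.

Lemma AblockE j : Ablock j = (fun k : R * R => jap k.1) @^-1` dyad j. Proof. by []. Qed.
Lemma BblockE l : Bblock l = (@bmod R) @^-1` dyad l. Proof. by []. Qed.

Lemma measurable_Ablock j : measurable (@Ablock R j).
Proof.
rewrite AblockE -[X in measurable X]setTI.
exact: (measurable_jap1 measurableT (measurable_dyad j)).
Qed.

Lemma measurable_Bblock l : measurable (@Bblock R l).
Proof.
rewrite BblockE -[X in measurable X]setTI.
exact: (measurable_bmod measurableT (measurable_dyad l)).
Qed.

Lemma trivIset_preimage_dyad (f : R * R -> R) : trivIset setT (fun j => f @^-1` dyad j).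
Proof.
apply/trivIsetP => i j _ _ ij; rewrite -preimage_setI.
by move/trivIsetP: dyad_trivIset => /(_ i j I I ij) ->; rewrite preimage_set0.
Qed.

Lemma bigcup_preimage_dyad (f : R * R -> R) : (forall k, 1 <= f k) -> \bigcup_j (f @^-1` dyad j) = setT.
Proof. by move=> f1; apply/seteqP; split => // k _; have [j h] := dyad_cover (f1 k); exists j. Qed.

(** Both dyadic families partition the plane, because the two brackets are at least 1. *)
Lemma block_integral (f : R * R -> \bar R) : measurable_fun setT f -> (forall k, (0 <= f k)%E) ->
  (\int[leb2]_k f k = \sum_(0 <= j <oo) \sum_(0 <= l <oo) \int[leb2]_(k in Ablock j `&` Bblock l) f k)%E.
Proof.
move=> mf f0.
have cA : \bigcup_j Ablock j = [set: R * R].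
  by apply: bigcup_preimage_dyad => k; exact: jap_ge1.
have cB : \bigcup_l Bblock l = [set: R * R].
  by apply: (@bigcup_preimage_dyad (@bmod R)) => k; exact: jap_ge1.
rewrite -{1}cA ge0_integral_bigcup//; first last.
- exact: (@trivIset_preimage_dyad (fun k => jap k.1)).
- by rewrite cA.
- exact: measurable_Ablock.
apply: eq_eseriesr => j _.
have -> : Ablock j = \bigcup_l (Ablock j `&` @Bblock R l) by rewrite -setI_bigcupr cB setIT.
have mAB l : measurable (Ablock j `&` @Bblock R l).
  by apply: measurableI; [exact: measurable_Ablock|exact: measurable_Bblock].
rewrite ge0_integral_bigcup//.
- by apply: eq_eseriesr => l _; rewrite -setI_bigcupr cB setIT.
- exact: measurable_funTS.
- by apply: trivIset_setIl; exact: (@trivIset_preimage_dyad (@bmod R)).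
Qed.

End Blocks.

Section BourgainNorms.
Context {R : realType}.
Local Notation mu := (@lebesgue_measure R).
Local Notation leb2 := (@leb2 R).
Local Notation crestr := (@Defs.crestr R).
Implicit Types U : R * R -> R[i].

(** The square of [bweight s 2^-1], written without square roots. *)
Definition wsq (s : R) U (k : R * R) : R := jap k.1 `^ (2 * s) * bmod k * cmod (U k) ^+ 2.

Lemma wsq_ge0 s U k : 0 <= wsq s U k.
Proof. by rewrite mulr_ge0 ?sqr_ge0// mulr_ge0 ?powR_ge0// ltW// bmod_gt0. Qed.

Lemma measurable_wsq s U : cmeasurable U -> measurable_fun setT (wsq s U).
Proof.
move=> mU; apply: measurable_funM; last by apply: measurable_funX; exact: measurable_cmod.
apply: measurable_funM; last exact: measurable_bmod.
exact: (measurableT_comp (measurable_powR _) measurable_jap1).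
Qed.

Lemma Lnorm_block s U (S : set (R * R)) :
  ('N[leb2]_2%:E[bweight s 2^-1 U \_ S] `^ 2 = \int[leb2]_(k in S) (wsq s U k)%:E)%E.
Proof.
pose f (k : R * R) := if k \in S then jap k.1 `^ s * jap (k.2 - k.1 ^+ 3) `^ 2^-1 * cmod (U k) else 0.
have -> : bweight s 2^-1 U \_ S = EFin \o f.
  by apply/funext => k; rewrite patchE /f /=; case: ifP.
rewrite Lnorm2_sqr [RHS]integral_mkcond; apply: eq_integral => k _.
rewrite patchE /f; case: ifP => _; last by rewrite expr0n.
congr EFin; rewrite !exprMn /wsq /bmod; congr (_ * _ * _).
  by rewrite -powR_mulrn ?powR_ge0// -powRrM mulrC.
by rewrite -[LHS]powR_mulrn ?powR_ge0// -powRrM mulVf// powRr1// jap_ge0.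
Qed.

Lemma Lnorm_block_ge0 s U (S : set (R * R)) : (0 <= 'N[leb2]_2%:E[bweight s 2^-1 U \_ S])%E.
Proof. exact: Lnorm_ge0. Qed.

Lemma Xsb1_hat_sqr s U : (Xsb1_hat s 2^-1 U `^ 2 =
  \sum_(0 <= j <oo) (\sum_(0 <= l <oo) 'N[leb2]_2%:E[bweight s 2^-1 U \_ (Ablock j `&` Bblock l)]) `^ 2)%E.
Proof. by rewrite /Xsb1_hat poweR_half_sqr//; apply: nneseries_ge0 => *; exact: poweR_ge0. Qed.

Lemma Xsb1_hat_ge0 s U : (0 <= Xsb1_hat s 2^-1 U)%E.
Proof. exact: poweR_ge0. Qed.

Lemma Xsb_hat_sqr s U : (Xsb_hat s 2^-1 U `^ 2 = \int[leb2]_k (wsq s U k)%:E)%E.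
Proof. by rewrite -(Lnorm_block s U setT) patch_setT. Qed.

Lemma Xsb_hat_ge0 s U : (0 <= Xsb_hat s 2^-1 U)%E.
Proof. exact: Lnorm_ge0. Qed.

Lemma measurable_block j l : measurable (Ablock j `&` @Bblock R l).
Proof. by apply: measurableI; [exact: measurable_Ablock|exact: measurable_Bblock]. Qed.

(** In the modulation index, a sum of nonnegative terms dominates the square root of the sum of
    their squares. *)
Lemma Xsb_hat_le s U : cmeasurable U -> (Xsb_hat s 2^-1 U <= Xsb1_hat s 2^-1 U)%E.
Proof.
move=> mU; rewrite -[leLHS]poweR_sqr_half ?Xsb_hat_ge0// -[leRHS]poweR_sqr_half ?Xsb1_hat_ge0//.
apply: lee_sqrt; first exact: poweR_ge0.
rewrite Xsb_hat_sqr Xsb1_hat_sqr block_integral.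
- apply: lee_nneseries => [j _ _|j _].
    by apply: nneseries_ge0 => l _ _; apply: integral_ge0 => k _; rewrite lee_fin wsq_ge0.
  apply: le_trans (series_sqr_le (fun l => Lnorm_block_ge0 s U _)).
  by apply: lee_nneseries => [l _ _|l _]; rewrite ?Lnorm_block//;
    apply: integral_ge0 => k _; rewrite lee_fin wsq_ge0.
- by apply/measurable_EFinP; exact: measurable_wsq.
- by move=> k; rewrite lee_fin wsq_ge0.
Qed.

Lemma crestr_wsq s (A : set (R * R)) U k : wsq s (crestr A U) k <= wsq s U k.
Proof.
rewrite /wsq /crestr; case: ifP => // _; rewrite cmod0 expr0n mulr0; exact: wsq_ge0.
Qed.

Lemma measurable_Dset : measurable (@Dset R).
Proof.
have m1 : measurable_fun setT (fun k : R * R => k.1) by exact: measurable_fst.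
have m2 : measurable_fun setT (fun k : R * R => k.2) by exact: measurable_snd.
have n1 : measurable_fun setT (fun k : R * R => `|k.1|) by exact: measurableT_comp.
have n2 : measurable_fun setT (fun k : R * R => `|k.2|) by exact: measurableT_comp.
have -> : @Dset R = (fun k : R * R => [&& k.1 != 0, `|k.1| <= 1 & `|k.1| ^- 3 <= `|k.2|]) @^-1` [set true].
  apply/seteqP; split => k /=; first by move=> [-> -> ->].
  by move=> /and3P[].
rewrite -[X in measurable X]setTI.
have mb : measurable_fun setT (fun k : R * R => [&& k.1 != 0, `|k.1| <= 1 & `|k.1| ^- 3 <= `|k.2|]).
  apply: measurable_and.
    by apply: measurable_neg; apply: measurable_fun_eqr => //.
  apply: measurable_and; apply: measurable_fun_ler => //.
  by apply: measurable_fun_inv; exact: measurable_funX.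
exact: (mb measurableT).
Qed.

Lemma cmeasurable_crestr (A : set (R * R)) U : measurable A -> cmeasurable U -> cmeasurable (crestr A U).
Proof.
move=> mA mU; apply: cmeasurable_if => //.
apply: (measurable_fun_bool true); rewrite setTI.
rewrite (_ : _ @^-1` _ = A)//; apply/seteqP; split => k /=; first exact: set_mem.
exact: mem_set.
Qed.

Lemma Xsb1_hat_crestr s (A : set (R * R)) U : measurable A -> cmeasurable U ->
  (Xsb1_hat s 2^-1 (crestr A U) <= Xsb1_hat s 2^-1 U)%E.
Proof.
move=> mA mU; have mV := cmeasurable_crestr mA mU.
apply: lee_sqrt; first by apply: nneseries_ge0 => *; exact: poweR_ge0.
apply: lee_nneseries => [j _ _|j _]; first exact: poweR_ge0.
apply: lee_sqr; first by apply: nneseries_ge0 => *; exact: Lnorm_block_ge0.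
apply: lee_nneseries => [l _ _|l _]; first exact: Lnorm_block_ge0.
rewrite -[leLHS]poweR_sqr_half ?Lnorm_block_ge0// -[leRHS]poweR_sqr_half ?Lnorm_block_ge0//.
apply: lee_sqrt; first exact: poweR_ge0.
rewrite !Lnorm_block; have mS := measurable_block j l; apply: ge0_le_integral => //.
- by move=> k _; rewrite lee_fin wsq_ge0.
- by apply: measurable_funTS; apply/measurable_EFinP; exact: measurable_wsq.
- by apply: measurable_funTS; apply/measurable_EFinP; exact: measurable_wsq.
- by move=> k _; rewrite lee_fin crestr_wsq.
Qed.

Lemma Xsb_hat_crestr s (A : set (R * R)) U : measurable A -> cmeasurable U ->
  (Xsb_hat s 2^-1 (crestr A U) <= Xsb1_hat s 2^-1 U)%E.
Proof.
move=> mA mU; apply: le_trans (Xsb1_hat_crestr s mA mU).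
by apply: Xsb_hat_le; exact: cmeasurable_crestr.
Qed.

(** Both pieces are restrictions of one transform, so each is at most the full norm; the comparison
    is made representative by representative, before taking the infimum. *)
Lemma X_norm_le (u : R * R -> R[i]) : (X_norm u <= 2%:E * Xsb1_norm (- (3 / 4)) 2^-1 u)%E.
Proof.
rewrite -lee_pdivrMl//; apply: le_ereal_inf_tmp => _ [U uU <-].
rewrite lee_pdivrMl//; have [_ [mU _] _] := uU.
have mD := measurable_Dset; have mDc := measurableC mD.
have mX := mule_natl (Xsb1_hat (- (3 / 4)) 2^-1 U) 2.
apply: (@le_trans _ _ (Xsb1_hat (- (3 / 4)) 2^-1 (crestr (~` Dset) U) +
                  Xsb_hat (- (3 / 4)) 2^-1 (crestr Dset U))%E).
  by apply: ereal_inf_lbound; exists U.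
rewrite [leRHS]mX [leRHS]mule2n; apply: leeD; first exact: Xsb1_hat_crestr.
exact: Xsb_hat_crestr.
Qed.

Section Estimates.
Variables (m n : nat) (s : R).
Hypothesis hmn : (m + 4 <= n)%N.
Hypothesis s1 : -1 <= s.
Hypothesis hm : - s - 2^-1 < m%:R.
Hypothesis hn : m%:R + s + 2 < n%:R.
Local Notation K := (@symb_K R m n).
Local Notation eps := (@eps R m s).

(** The ratio of the geometric series in the modulation index. *)
Definition qeps : R := 2 `^ (- eps).

Lemma qeps_gt0 : 0 < qeps. Proof. exact: powR_gt0. Qed.
Lemma qeps_lt1 : qeps < 1.
Proof.
rewrite /qeps powRN invf_lt1 ?powR_gt0// -[ltLHS]expR0 powR_expR// ltr_expR mulr_gt0 ?eps_gt0//.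
by rewrite ln_gt0// ltr1n.
Qed.

Lemma qepsX_inv d : (qeps ^+ d)^-1 = (2 ^+ d) `^ eps.
Proof. by rewrite /qeps powRN exprVn invrK -powR_mulrn ?powR_ge0// -powRrM mulrC powRrM powR_mulrn. Qed.

Lemma dyad_exp_high (j l : nat) : (3 * j <= l)%N -> (l - 3 * j + j.+1 * 3 = 3 + l)%N.
Proof. by lia. Qed.

Lemma dyad_exp_low (j l : nat) : (l < 3 * j)%N -> (3 * j - l + l.+1 = (j * 3).+1)%N.
Proof. by lia. Qed.

(** On the block, the quotient of the modulation by [<xi>^3] is [2^(l - 3 j)] up to a factor 8, or 2
    for the inverse. The term of [wsym] with the matching sign then dominates; the constant stays 8
    because [eps <= 1]. *)
Lemma dyad_weight_le j l (k : R * R) : (Ablock j `&` Bblock l) k ->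
  (qeps ^+ (maxn l (3 * j) - minn l (3 * j)))^-1 <= 8 * logb m s k.
Proof.
move=> [/andP[a1 a2] /andP[b1 b2]]; rewrite qepsX_inv /logb -/(bmod k) in b1 b2 *.
set A := jap k.1 in a1 a2 *; set B := bmod k in b1 b2 *.
have A0 : 0 < A := jap_gt0 _; have B0 : 0 < B := bmod_gt0 k.
have e0 := eps_gt0 hm; have e1 := eps_le1 m s.
have A3 : 0 < A ^+ 3 by exact: exprn_gt0.
have r0 : 0 < B / A ^+ 3 by rewrite divr_gt0.
have c (x : R) : 1 <= x -> x `^ eps <= x.
  by move=> x1; rewrite -[leRHS]powRr1 ?(le_trans _ x1)// ler_powR.
have pe : 0 <= (B / A ^+ 3) `^ eps by exact: powR_ge0.
have pn : 0 <= (B / A ^+ 3) `^ (- eps) by exact: powR_ge0.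
have p2 i : 0 < 2 ^+ i :> R by exact: exprn_gt0.
have mono (x y : R) : 0 < x -> x <= y -> x `^ eps <= y `^ eps.
  move=> x0 xy; apply: ge0_ler_powR; rewrite ?nnegrE ?(ltW e0) ?(ltW x0)//.
  exact: le_trans (ltW x0) xy.
have [jl|lj] := leqP (3 * j)%N l.
  have h : 2 ^+ (l - 3 * j) <= 8 * (B / A ^+ 3).
    rewrite mulrA ler_pdivlMr//; apply: (@le_trans _ _ (2 ^+ (l - 3 * j) * (2 ^+ j.+1) ^+ 3)).
      by rewrite ler_wpM2l ?(ltW (p2 _))// lerXn2r ?nnegrE ?(ltW A0) ?(ltW (p2 _)) ?(ltW a2).
    rewrite -exprM -exprD (dyad_exp_high jl).
    by rewrite exprD -[8](_ : 2 ^+ 3 = 8) ?ler_wpM2l//; rewrite -natrX.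
  apply: (le_trans (mono _ _ (p2 _) h)); rewrite powRM ?(ltW r0)// /wsym mulrDr.
  apply: ler_wpDr; first by rewrite mulr_ge0.
  by apply: ler_wpM2r => //; apply: c; rewrite ler1n.
have h : 2 ^+ (3 * j - l) <= 2 * (B / A ^+ 3)^-1.
  rewrite invf_div mulrA ler_pdivlMr//.
  apply: (@le_trans _ _ (2 ^+ (3 * j - l) * 2 ^+ l.+1)); first by rewrite ler_wpM2l ?ltW.
  rewrite -exprD (dyad_exp_low lj).
  by rewrite exprS exprM ler_wpM2l// lerXn2r ?nnegrE ?(ltW A0) ?(ltW (p2 _)).
apply: (le_trans (mono _ _ (p2 _) h)); rewrite powRM ?invr_ge0 ?(ltW r0)// /wsym mulrDr.
rewrite -(powR_inv1 (ltW r0)) -powRrM mulN1r.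
apply: ler_wpDl; first by rewrite mulr_ge0.
apply: ler_wpM2r => //; apply: (le_trans (c 2 _)); lra.
Qed.

Definition Cblk : R := 2 / (1 - qeps) * 8.

Lemma Cblk_ge0 : 0 <= Cblk.
Proof. by rewrite mulr_ge0// divr_ge0// subr_ge0 ltW// qeps_lt1. Qed.

Lemma Xsb1_hat_le U : cmeasurable U ->
  (Xsb1_hat s 2^-1 U `^ 2 <= Cblk%:E * \int[leb2]_k (Wt m s k * cmod (U k) ^+ 2)%:E)%E.
Proof.
move=> mU; rewrite Xsb1_hat_sqr.
have V0 : 0 <= 2 / (1 - qeps) by rewrite divr_ge0// subr_ge0 ltW// qeps_lt1.
have f0 k : 0 <= Wt m s k * cmod (U k) ^+ 2 by rewrite mulr_ge0 ?sqr_ge0// ltW// Wt_gt0.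
have mf : measurable_fun setT (fun k => Wt m s k * cmod (U k) ^+ 2).
  apply: measurable_funM; first exact: measurable_Wt.
  by apply: measurable_funX; exact: measurable_cmod.
rewrite block_integral; [|exact/measurable_EFinP|by move=> k; rewrite lee_fin].
have I0 j l : (0 <= \int[leb2]_(k in Ablock j `&` Bblock l) (Wt m s k * cmod (U k) ^+ 2)%:E)%E.
  by apply: integral_ge0 => k _; rewrite lee_fin.
have S0 j : (0 <= \sum_(0 <= l <oo) \int[leb2]_(k in Ablock j `&` Bblock l) (Wt m s k * cmod (U k) ^+ 2)%:E)%E.
  by apply: nneseries_ge0 => l _ _.
rewrite -nneseriesZl//; apply: lee_nneseries => [j _ _|j _]; first exact: poweR_ge0.
(* [v l] is [2^(- eps |l - 3 j|)], comparable to the inverse of the weight at [2^l / 2^(3 j)], with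
   sums bounded uniformly in [j]. *)
pose v l := qeps ^+ (maxn l (3 * j) - minn l (3 * j)).
have v0 l : 0 < v l by rewrite exprn_gt0// qeps_gt0.
have cs := @series_cauchy_schwarz _ (fun l => 'N[leb2]_2%:E[bweight s 2^-1 U \_ (Ablock j `&` Bblock l)]%E) v
  (2 / (1 - qeps)) (fun l => Lnorm_block_ge0 s U _) v0
  (fun L => geometric_dist_sum (3 * j) L qeps_gt0 qeps_lt1).
apply: (le_trans cs); rewrite /Cblk [X in (_ <= X * _)%E]EFinM -[leRHS]muleA.
apply: lee_wpmul2l; first by rewrite lee_fin.
rewrite -nneseriesZl//; apply: lee_nneseries => [l _ _|l _].
  by rewrite mule_ge0 ?poweR_ge0// lee_fin invr_ge0 ltW.
rewrite Lnorm_block; have mS := measurable_block j l.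
have mw : measurable_fun (Ablock j `&` Bblock l) (fun k => (wsq s U k)%:E).
  by apply: measurable_funTS; apply/measurable_EFinP; exact: measurable_wsq.
have mW : measurable_fun (Ablock j `&` Bblock l) (fun k => (Wt m s k * cmod (U k) ^+ 2)%:E).
  by apply: measurable_funTS; exact/measurable_EFinP.
rewrite -ge0_integralZl//; last by rewrite lee_fin invr_ge0 ltW.
  rewrite -ge0_integralZl//.
    apply: ge0_le_integral => //.
    - by move=> k _; rewrite mule_ge0 ?lee_fin ?wsq_ge0// invr_ge0 ltW.
    - exact: measurable_funeM.
    - exact: measurable_funeM.
    - move=> k Sk; rewrite -!EFinM lee_fin; have := dyad_weight_le Sk; rewrite -/(v l) => vk.
      rewrite /wsq /Wt; have D0 : 0 <= jap k.1 `^ (2 * s) * bmod k * cmod (U k) ^+ 2 := wsq_ge0 s U k.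
      have := ler_wpM2r D0 vk; move/le_trans; apply.
      by rewrite le_eqVlt; apply/orP; left; apply/eqP; ring.
  by move=> k _; rewrite lee_fin.
by move=> k _; rewrite lee_fin wsq_ge0.
Qed.

End Estimates.
End BourgainNorms.

(** * Estimates of the forcing term by the Sobolev norm of the datum *)

Section ForcingEstimates.
Context {R : realType}.
Local Notation mu := (@lebesgue_measure R).
Local Notation leb2 := (@leb2 R).
Variables (m n : nat) (s : R).
Hypothesis hmn : (m + 4 <= n)%N.
Hypothesis s1 : -1 <= s.
Hypothesis hm : - s - 2^-1 < m%:R.
Hypothesis hn : m%:R + s + 2 < n%:R.
Local Notation K := (@symb_K R m n).
Local Notation eps := (@eps R m s).
Local Notation sg := ((s + 1) / 3).
Implicit Types h : R -> R[i].

(* Cauchy-Schwarz in tau with weight <tau - xi^3> wsym, whose inverse has bounded integral. *)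
Lemma Hsq_slice_le (g V : R -> R[i]) (D : R) : cmeasurable g -> cmeasurable V -> 0 <= D ->
  (forall xi, xi != 0 -> ((cmod (V xi))%:E <= D%:E * \int[mu]_tau (cmod (g tau * K xi tau))%:E)%E) ->
  (Hsq s V <= (D ^+ 2 * Clog eps)%:E * Mquad m n s g)%E.
Proof.
move=> mg mV D0 VD; have e0 := eps_gt0 hm; have cl := Clog_ge0 e0.
have mU : cmeasurable (fun k : R * R => g k.2 * K k.1 k.2).
  apply: cmeasurableM; last exact: cmeasurable_K2.
  exact: (cmeasurable_comp mg measurable_snd).
have mf : measurable_fun setT (fun k : R * R => Wt m s k * cmod (g k.2 * K k.1 k.2) ^+ 2).
  apply: measurable_funM; first exact: measurable_Wt.
  by apply: measurable_funX; exact: measurable_cmod.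
have f0 (k : R * R) : 0 <= Wt m s k * cmod (g k.2 * K k.1 k.2) ^+ 2 by rewrite mulr_ge0 ?sqr_ge0// ltW// Wt_gt0.
have mI : measurable_fun setT (fun xi : R => \int[mu]_tau (Wt m s (xi, tau) * cmod (g tau * K xi tau) ^+ 2)%:E)%E.
  apply: (@measurable_fun_fubini_tonelli_F _ _ _ _ _ mu (fun k : R * R => (Wt m s k * cmod (g k.2 * K k.1 k.2) ^+ 2)%:E)).
    exact/measurable_EFinP.
  by move=> k; rewrite lee_fin.
have I0 xi : (0 <= \int[mu]_tau (Wt m s (xi, tau) * cmod (g tau * K xi tau) ^+ 2)%:E)%E.
  by apply: integral_ge0 => tau _; rewrite lee_fin (f0 (xi, tau)).
have c0 : 0 <= D ^+ 2 * Clog eps by rewrite mulr_ge0 ?sqr_ge0.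
rewrite /Mquad leb2_tonelli1//= -ge0_integralZl//.
apply: ae_ge0_le_integral => //.
- by move=> x _; rewrite lee_fin sqr_ge0.
- apply/measurable_EFinP; apply: measurable_funX; apply: measurable_funM; first exact: measurable_jap_powR.
  exact: measurable_cmod.
- by move=> x _; rewrite mule_ge0// lee_fin.
- exact: measurable_funeM.
exists [set 0]; split => //; first exact: lebesgue_measure_set1.
move=> xi /= nx; apply: contrapT => /eqP x0; apply: nx => _.
pose b tau := bmod (xi, tau) * logb m s (xi, tau).
have b0 tau : 0 < b tau by rewrite mulr_gt0 ?bmod_gt0 ?logb_gt0.
have mb : measurable_fun setT b.
  have mp : measurable_fun setT (pair xi : R -> R * R) by exact: measurable_pair1.
  apply: measurable_funM; first exact: (measurableT_comp measurable_bmod mp).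
  exact: (measurableT_comp (@measurable_logb _ m s) mp).
have mu1 : measurable_fun setT (fun tau => cmod (g tau * K xi tau)).
  by apply: measurable_cmod; exact: (cmeasurable_pair1 xi mU).
have mr : measurable_fun setT (fun tau => b tau `^ 2^-1) by exact: (measurableT_comp (measurable_powR _) mb).
have sq tau : (b tau `^ 2^-1) ^+ 2 = b tau.
  by rewrite -[LHS]powR_mulrn ?powR_ge0// -powRrM mulVf// powRr1// ltW.
have cs := @cauchy_schwarz _ _ _ mu (fun tau => (b tau `^ 2^-1)^-1)
  (fun tau => b tau `^ 2^-1 * cmod (g tau * K xi tau)).
have {}cs : ((\int[mu]_tau (cmod (g tau * K xi tau))%:E) `^ 2 <=
    (Clog eps)%:E * \int[mu]_tau (b tau * cmod (g tau * K xi tau) ^+ 2)%:E)%E.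
  have E1 : (\int[mu]_tau ((b tau `^ 2^-1)^-1 * (b tau `^ 2^-1 * cmod (g tau * K xi tau)))%:E =
      \int[mu]_tau (cmod (g tau * K xi tau))%:E)%E.
    by apply: eq_integral => tau _; rewrite mulKf// gt_eqF// powR_gt0.
  have E2 : (\int[mu]_tau ((b tau `^ 2^-1 * cmod (g tau * K xi tau)) ^+ 2)%:E =
      \int[mu]_tau (b tau * cmod (g tau * K xi tau) ^+ 2)%:E)%E.
    by apply: eq_integral => tau _; rewrite exprMn sq.
  (* The inverse weight is integrated by [wsym_integral], centred at [xi^3] and at scale
     [<xi>^3]. *)
  have E3 : (\int[mu]_tau (((b tau `^ 2^-1)^-1) ^+ 2)%:E <= (Clog eps)%:E)%E.
    have J3 : 0 < jap xi ^+ 3 by rewrite exprn_gt0 ?jap_gt0.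
    have E : (\int[mu]_tau (((b tau `^ 2^-1)^-1) ^+ 2)%:E =
       \int[mu]_tau ((jap (tau - xi ^+ 3) * wsym eps (jap (tau - xi ^+ 3) / jap xi ^+ 3))^-1)%:E)%E.
      by apply: eq_integral => tau _; rewrite exprVn sq.
    by rewrite E; exact: wsym_integral.
  rewrite E1 E2 in cs; apply: le_trans (cs _ _ _ _) _ => //.
  - exact: measurable_fun_inv.
  - exact: measurable_funM.
  - by move=> tau; rewrite invr_ge0 powR_ge0.
  - by move=> tau; rewrite mulr_ge0 ?powR_ge0 ?cmod_ge0.
  - apply: lee_wpmul2r => //; apply: integral_ge0 => tau _.
    by rewrite lee_fin mulr_ge0 ?sqr_ge0// ltW.
have jx : 0 <= jap xi `^ (2 * s) by exact: powR_ge0.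
have -> : (\int[mu]_tau (Wt m s (xi, tau) * cmod (g tau * K xi tau) ^+ 2)%:E =
    (jap xi `^ (2 * s))%:E * \int[mu]_tau (b tau * cmod (g tau * K xi tau) ^+ 2)%:E)%E.
  rewrite -ge0_integralZ_EFin//.
  - by apply: eq_integral => tau _; rewrite (mulrA (jap xi `^ (2 * s))).
  - by apply: measurable_funM => //; exact: measurable_funX.
  - by move=> tau; rewrite mulr_ge0 ?sqr_ge0// ltW.
have i0 : (0 <= \int[mu]_tau (cmod (g tau * K xi tau))%:E)%E.
  by apply: integral_ge0 => tau _; rewrite lee_fin cmod_ge0.
have v0 : (0 <= (cmod (V xi))%:E)%E by rewrite lee_fin cmod_ge0.
have := lee_sqr v0 (VD xi x0).
rewrite poweRM ?lee_fin// !poweR_EFin !powR_mulrn ?cmod_ge0// => V2.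
have j2 : (jap xi `^ s) ^+ 2 = jap xi `^ (2 * s).
  by rewrite -[LHS]powR_mulrn ?powR_ge0// -powRrM mulrC.
rewrite exprMn j2 EFinM muleCA; apply: lee_wpmul2l; first by rewrite lee_fin.
apply: (le_trans V2); rewrite [X in (_ <= X * _)%E]EFinM -[leRHS]muleA; apply: lee_wpmul2l; first by rewrite lee_fin sqr_ge0.
exact: cs.
Qed.

(** Cauchy-Schwarz on [[0, 2]] and Plancherel; [s >= -1] makes the Sobolev exponent nonnegative. The
    4 is the square of the factor 2 in the complex integral bound, and the length 2 of the interval
    is absorbed by the [2 pi] of Plancherel. *)
Lemma fourier_sup_le h (tau : R) : schwartz h -> (forall x, ~ (0 <= x <= 2) -> h x = 0) ->
  ((cmod (fourier1 h tau) ^+ 2)%:E <= 4%:E * Hsq sg (fourier1 h))%E.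
Proof.
move=> sh h02; have ih := schwartz_integrable sh; have mh := cintegrable_measurable ih.
have mch : measurable_fun setT (fun x => cmod (h x)) by exact: measurable_cmod.
have iH := schwartz_fourier_integrable sh; have mH := cintegrable_measurable iH.
pose chi (x : R) : R := if 0 <= x <= 2 then 1 else 0.
have chi0 x : 0 <= chi x by rewrite /chi; case: ifP.
have mchi : measurable_fun setT chi.
  apply: measurable_fun_ifT => //; apply: measurable_and; exact: measurable_fun_ler.
have chi2 : (\int[mu]_x (chi x ^+ 2)%:E = 2%:E)%E.
  transitivity (\int[mu]_(x in `[0%R, 2%R]) (1%R)%:E)%E.
    rewrite [RHS]integral_mkcond; apply: eq_integral => x _; rewrite patchE /chi.
    rewrite mem_setE in_itv /=; case: ifP => _; [by rewrite expr1n|by rewrite expr0n].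
  rewrite integral_cst//= mul1e lebesgue_measure_itv/= lte_fin ltr0n/= sube0//.
have l1 : ((cmod (fourier1 h tau))%:E <= 2%:E * \int[mu]_x (chi x * cmod (h x))%:E)%E.
  rewrite fourier1E; have iF := cintegrable_fourier tau ih.
  apply: (le_trans (@cmod_cintegral_le _ _ _ mu _ (cintegrable_measurable iF))).
  apply: lee_wpmul2l; first by rewrite lee_fin.
  rewrite le_eqVlt; apply/orP; left; apply/eqP; apply: eq_integral => x _.
  rewrite cmodM cmod_cis mul1r /chi; case: ifPn => [_|/negP/h02 ->]; first by rewrite mul1r.
  by rewrite cmod0 mulr0.
have cs := @cauchy_schwarz _ _ _ mu chi (fun x => cmod (h x)) mchi mch chi0 (fun x => cmod_ge0 _).
rewrite chi2 in cs.
have i0 : (0 <= \int[mu]_x (chi x * cmod (h x))%:E)%E.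
  by apply: integral_ge0 => x _; rewrite lee_fin mulr_ge0 ?cmod_ge0.
have v0 : (0 <= (cmod (fourier1 h tau))%:E)%E by rewrite lee_fin cmod_ge0.
have := lee_sqr v0 l1.
rewrite poweRM// poweR_EFin powR_mulrn ?cmod_ge0// => /le_trans; apply.
have P := plancherel_schwartz sh.
have Hs : (\int[mu]_xi (cmod (fourier1 h xi) ^+ 2)%:E <= Hsq sg (fourier1 h))%E.
  have mcH : measurable_fun setT (fun x => cmod (fourier1 h x)) by exact: measurable_cmod.
  apply: ge0_le_integral_EFin.
  - exact: measurable_funX.
  - by apply: measurable_funX; apply: measurable_funM => //; exact: measurable_jap_powR.
  - by move=> x; exact: sqr_ge0.
  - move=> x; rewrite exprMn ler_peMl ?sqr_ge0// exprn_ege1//.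
    rewrite -[leLHS](powRr0 (jap x)) ler_powR ?jap_ge1//; move: s1; lra.
have pp : (2 : R) <= 2 * pi by have := pi_ge2 R; lra.
have J0 : (0 <= \int[mu]_x (cmod (h x) ^+ 2)%:E)%E by apply: integral_ge0 => x _; rewrite lee_fin sqr_ge0.
rewrite poweR_EFin (_ : 2 `^ 2 = 4 :> R); last by rewrite powR_mulrn// -natrX.
apply: lee_wpmul2l; first by rewrite lee_fin.
apply: (le_trans cs); apply: le_trans Hs; rewrite P.
by apply: lee_wpmul2r => //; rewrite lee_fin.
Qed.

(** 13 is [4 * 3 + 1]: the sup bound 4 times the low-frequency integral 3, plus the Sobolev term. *)
Definition Cquad : R := Cslice m n s * 13.

Lemma Cquad_ge0 : 0 <= Cquad.
Proof. by rewrite /Cquad; move: (Cslice_ge0 m n s) => ?; rewrite mulr_ge0. Qed.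

Lemma Hsq_schwartz_fin h : schwartz h -> (Hsq sg (fourier1 h) < +oo)%E.
Proof.
move=> sh; rewrite -Hhat_sqr -(Hnorm_schwartz _ sh); apply: poweR_lty.
exact: Hnorm_schwartz_fin.
Qed.

Lemma Mquad_fourier_le h : schwartz h -> (forall x, ~ (0 <= x <= 2) -> h x = 0) ->
  (Mquad m n s (fourier1 h) <= Cquad%:E * Hsq sg (fourier1 h))%E.
Proof.
move=> sh h02; have C0 := Cslice_ge0 m n s.
have mH := cintegrable_measurable (schwartz_fourier_integrable sh).
have fin := Hsq_schwartz_fin sh.
have H0 : (0 <= Hsq sg (fourier1 h))%E by apply: integral_ge0 => x _; rewrite lee_fin sqr_ge0.
have HE : Hsq sg (fourier1 h) = (fine (Hsq sg (fourier1 h)))%:E by rewrite fineK// ge0_fin_numE.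
pose A := Num.sqrt (4 * fine (Hsq sg (fourier1 h))).
have f0 : 0 <= fine (Hsq sg (fourier1 h)) by exact: fine_ge0.
have A2 : A ^+ 2 = 4 * fine (Hsq sg (fourier1 h)) by rewrite sqr_sqrtr// mulr_ge0.
have bd tau : cmod (fourier1 h tau) <= A.
  rewrite -ler_sqr ?nnegrE ?cmod_ge0 ?sqrtr_ge0// A2 -lee_fin [leRHS]EFinM -HE.
  exact: fourier_sup_le.
apply: (le_trans (Mquad_le hmn s1 hm hn mH bd)).
rewrite /Cquad [X in (_ <= X * _)%E]EFinM -[leRHS]muleA; apply: lee_wpmul2l; first by rewrite lee_fin.
rewrite A2 HE -EFinD -EFinM lee_fin; lra.
Qed.

Definition CXsb : R := Num.sqrt (Cblk m s * Cquad).

Lemma CXsb_sqr : CXsb ^+ 2 = Cblk m s * Cquad.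
Proof. by rewrite sqr_sqrtr// mulr_ge0 ?Cblk_ge0 ?Cquad_ge0. Qed.

Lemma Xsb1_norm_le h : schwartz h -> (forall x, ~ (0 <= x <= 2) -> h x = 0) ->
  (Xsb1_norm s 2^-1 (bforce m n h) <= CXsb%:E * Hnorm sg h)%E.
Proof.
move=> sh h02; rewrite (Hnorm_schwartz _ sh).
apply: (@le_trans _ _ (Xsb1_hat s 2^-1 (fsymb m n h))).
  by apply: ereal_inf_lbound; exists (fsymb m n h) => //; exact: bforce_fourier2.
apply: Lnorm2_le_sqr; rewrite ?sqrtr_ge0 ?Xsb1_hat_ge0 ?Lnorm_ge0//.
rewrite CXsb_sqr Hhat_sqr.
apply: (le_trans (Xsb1_hat_le hmn s1 hm hn (cmeasurable_fsymb m n sh))).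
rewrite [X in (_ <= X * _)%E]EFinM -[leRHS]muleA; apply: lee_wpmul2l; first by rewrite lee_fin Cblk_ge0.
exact: Mquad_fourier_le.
Qed.

Definition CHsb : R := Num.sqrt (Clog eps * Cquad).

(** Common to the bound at a fixed time, where the Schwartz function is the datum, and to time
    differences, where it is its derivative. *)
Lemma Hsb_le h (u U : R -> R[i]) (D : R) : schwartz h -> (forall x, ~ (0 <= x <= 2) -> h x = 0) ->
  is_fourier1 u U -> 0 <= D ->
  (forall xi, xi != 0 -> ((cmod (U xi))%:E <= D%:E * \int[mu]_tau (cmod (fourier1 h tau * K xi tau))%:E)%E) ->
  (Hnorm s u <= (D * CHsb)%:E * Hnorm sg h)%E.
Proof.
move=> sh h02 uU D0 UD; rewrite (Hnorm_schwartz _ sh).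
have mH := cintegrable_measurable (schwartz_fourier_integrable sh).
have [_ [mU _] _] := uU; have e0 := eps_gt0 hm; have cl := Clog_ge0 e0.
apply: (le_trans (Hnorm_le s uU)).
apply: Lnorm2_le_sqr; rewrite ?mulr_ge0 ?sqrtr_ge0 ?Lnorm_ge0//.
rewrite !Hhat_sqr exprMn [CHsb ^+ 2](sqr_sqrtr (mulr_ge0 cl Cquad_ge0)) (mulrA (D ^+ 2)).
apply: (le_trans (Hsq_slice_le mH mU D0 UD)).
rewrite [X in (_ <= X * _)%E]EFinM -[leRHS]muleA; apply: lee_wpmul2l; first by rewrite lee_fin mulr_ge0 ?sqr_ge0.
exact: Mquad_fourier_le.
Qed.

Lemma Hnorm_space_le h (t : R) : schwartz h -> (forall x, ~ (0 <= x <= 2) -> h x = 0) ->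
  (Hnorm s (fun x => bforce m n h (x, t)) <= (2 * CHsb)%:E * Hnorm sg h)%E.
Proof.
move=> sh h02; apply: (Hsb_le sh h02 (bforce_space_fourier hmn t sh)) => // xi x0.
have iF := cintegrable_ifourier t (fsymb_slice_integrable hmn sh x0).
rewrite /space_symb cmodM cmodR ger0_norm; last by rewrite invr_ge0 mulr_ge0// pi_ge0.
rewrite EFinM; have p1 : (2 * pi)^-1 <= 1 :> R by rewrite invf_le1 ?mulr_gt0 ?pi_gt0//; have := pi_ge2 R; lra.
apply: (@le_trans _ _ (1%:E * (cmod (cintegral mu (fun tau => cis (t * tau) * fsymb m n h (xi, tau))))%:E)%E).
  by apply: lee_wpmul2r; rewrite lee_fin ?cmod_ge0.
rewrite mul1e; apply: (le_trans (@cmod_cintegral_le _ _ _ mu _ (cintegrable_measurable iF))).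
apply: lee_wpmul2l; first by rewrite lee_fin.
by rewrite le_eqVlt; apply/orP; left; apply/eqP; apply: eq_integral => tau _;
  rewrite (cmodM (cis _)) cmod_cis mul1r.
Qed.

(* The factor tau gained from exp(i t tau) - exp(i t0 tau) is absorbed by h'. *)
Lemma Hnorm_spaceB_le h (t t0 : R) : schwartz h -> (forall x, ~ (0 <= x <= 2) -> deriv1 h 1 x = 0) ->
  (Hnorm s (fun x => (bforce m n h (x, t) - bforce m n h (x, t0))%R) <=
    (4 * `|t - t0| * CHsb)%:E * Hnorm sg (deriv1 h 1))%E.
Proof.
move=> sh h02; have sh' : schwartz (deriv1 h 1) by exact: schwartz_deriv.
apply: (Hsb_le sh' h02 (bforce_spaceB_fourier hmn t t0 sh)) => [|xi x0]; first by rewrite mulr_ge0.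
have iF r := cintegrable_ifourier r (fsymb_slice_integrable hmn sh x0).
rewrite /space_symb -mulrBr -(cintegralB (iF t) (iF t0)).
rewrite cmodM cmodR ger0_norm; last by rewrite invr_ge0 mulr_ge0// pi_ge0.
rewrite EFinM; have p1 : (2 * pi)^-1 <= 1 :> R by rewrite invf_le1 ?mulr_gt0 ?pi_gt0//; have := pi_ge2 R; lra.
set I := cintegral mu _.
apply: (@le_trans _ _ (1%:E * (cmod I)%:E)%E).
  by apply: lee_wpmul2r; rewrite lee_fin ?cmod_ge0.
rewrite mul1e; apply: (le_trans (@cmod_cintegral_le _ _ _ mu _ (cintegrable_measurable (cintegrableB (iF t) (iF t0))))).
have -> : (4 * `|t - t0|)%:E = (2%:E * (2 * `|t - t0|)%:E)%E :> \bar R by rewrite -EFinM; congr EFin; ring.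
rewrite -muleA; apply: lee_wpmul2l; first by rewrite lee_fin.
have mK : cmeasurable (fun tau => fourier1 (deriv1 h 1) tau * K xi tau).
  apply: cmeasurableM; last exact: (cmeasurable_pair1 xi (@cmeasurable_K2 R m n)).
  exact: cintegrable_measurable (schwartz_fourier_integrable sh').
have d0 : 0 <= 2 * `|t - t0| by rewrite mulr_ge0.
rewrite -ge0_integralZ_EFin//; first last.
- by move=> tau; exact: cmod_ge0.
- exact: measurable_cmod.
apply: ge0_le_integral_EFin.
- by apply: measurable_cmod; exact: cintegrable_measurable (cintegrableB (iF t) (iF t0)).
- by apply: measurable_funM => //; exact: measurable_cmod.
- by move=> tau; exact: cmod_ge0.
move=> tau; rewrite -mulrBl (cmodM _ (fsymb m n h (xi, tau))) /fsymb /=.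
rewrite (schwartz_fourier_deriv 1 tau sh) expr1.
rewrite (cmodM _ (K xi tau)) (cmodM _ (K xi tau)) (cmodM _ (fourier1 h tau)) (cmodM 'i%C) cmodi cmodR mul1r.
rewrite !mulrA ler_wpM2r ?cmod_ge0// ler_wpM2r ?cmod_ge0//.
by rewrite (le_trans (cis_lip _ _))// -mulrBl normrM mulrA.
Qed.

End ForcingEstimates.

Section Assembly.
Context {R : realType}.
Local Notation leb2 := (@leb2 R).
Variables (m n : nat).
Hypothesis hmn : (m + 4 <= n)%N.

Lemma C0c_schwartz (h : R -> R[i]) : C0c_infty h -> schwartz h.
Proof. by move=> [sh ch _]; exact: schwartz_of_compact. Qed.

Lemma supp02 (h : R -> R[i]) : csupp h `<=` `[0, 2] -> forall x, ~ (0 <= x <= 2) -> h x = 0.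
Proof. by move=> hs x x02; apply: csupp_eq0 hs _; rewrite /= in_itv. Qed.

Lemma supp02_deriv (h : R -> R[i]) : csmooth h -> csupp h `<=` `[0, 2] ->
  forall x, ~ (0 <= x <= 2) -> deriv1 h 1 x = 0.
Proof.
move=> sh hs x x02; apply: (@deriv1_eq0 R h (~` `[0, 2])) => //.
- by rewrite openC; exact: itv_closed.
- by move=> y y02; apply: csupp_eq0 hs y02.
Qed.

Lemma airy_dist_halfplane (h : R -> R[i]) : C0c_infty h ->
  (exists F : R * R -> R[i],
     [/\ ccontinuous F, airy_dist setT (bforce m n h) F & forall x t : R, 0 < x -> F (x, t) = 0]) /\
  airy_dist [set p | 0 < p.1] (bforce m n h) (fun=> 0).
Proof.
move=> /C0c_schwartz sh; have iA := airy_symb_integrable hmn sh.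
have D := airy_dist_bforce hmn sh.
have V (x t : R) : 0 < x -> ((2 * pi) ^- 2)%:C * ifourier2 (airy_symb m n h) (x, t) = 0.
  by move=> x0; rewrite (airy_vanish hmn t sh x0) mulr0.
split.
  exists (fun p => ((2 * pi) ^- 2)%:C * ifourier2 (airy_symb m n h) p); split => //.
  by apply: ccontinuousZ; exact: ccontinuous_ifourier2.
(* At each point either [phi] is 0, or the point lies in the support of [phi], hence in [x > 0],
   where the continuous right-hand side vanishes. *)
move=> phi cphi kphi sphi; rewrite (D phi cphi kphi (@subsetT _ _)); apply: eq_cintegral => -[x t].
rewrite mul0r; have [->|pn] := eqVneq (phi (x, t)) 0; first by rewrite mulr0.
rewrite V ?mul0r//; have := sphi (x, t); apply.
exact: (@subset_closure _ [set p | phi p != 0]).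
Qed.

(** Membership follows from a Lipschitz bound in time, with constant proportional to the Sobolev
    norm of the derivative of [h]. *)
Lemma CHs_estimate (s : R) : -1 <= s -> - s - 2^-1 < m%:R -> m%:R + s + 2 < n%:R ->
  exists C : R, forall h : R -> R[i], C0c_infty h -> csupp h `<=` `[0, 2] ->
    in_CHs s (bforce m n h) /\
    (CHs_norm s (bforce m n h) <= C%:E * Hnorm ((s + 1) / 3) h)%E.
Proof.
move=> s1 hm hn; exists (2 * CHsb m n s) => h ch hs; have sh := C0c_schwartz ch.
have [csh _ _] := ch; have h2 := supp02 hs; have h2' := supp02_deriv csh hs.
have le t := Hnorm_space_le hmn s1 hm hn t sh h2.
have sh' : schwartz (deriv1 h 1) by exact: schwartz_deriv.
have fin := Hnorm_schwartz_fin ((s + 1) / 3) sh; have fin' := Hnorm_schwartz_fin ((s + 1) / 3) sh'.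
split; last by apply: ub_ereal_sup => _ [t _ <-]; exact: le.
split => [t|t0].
  apply: (le_lt_trans (le t)); rewrite -(fineK (x := Hnorm _ h)) -?EFinM ?ltry//.
  by rewrite ge0_fin_numE// Hnorm_ge0.
set A := Hnorm ((s + 1) / 3) (deriv1 h 1) in fin'.
have Af : A \is a fin_num by rewrite ge0_fin_numE// Hnorm_ge0.
apply: (@squeeze_cvge _ _ _ _ (fun=> 0%E) _ (fun t => (4 * `|t - t0| * CHsb m n s * fine A)%:E)).
- apply: nearW => t; rewrite Hnorm_ge0/= EFinM fineK//; exact: Hnorm_spaceB_le.
- exact: cvg_cst.
apply: cvg_EFin; first exact: nearW.
have L : 4 * `|t - t0| * CHsb m n s * fine A @[t --> t0] --> 4 * 0 * CHsb m n s * fine A.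
  apply: cvgM; last exact: cvg_cst.
  apply: cvgM; last exact: cvg_cst.
  apply: cvgM; first exact: cvg_cst.
  by apply/norm_cvg0P; apply/subr_cvg0; exact: cvg_id.
by rewrite mulr0 !mul0r in L; exact: L.
Qed.

End Assembly.
Theorem proposition4p5 (R : realType) (m n : nat) (hmn : (m + 4 <= n)%N) :
  (* (a) *)
  [/\ forall h : R -> R[i], C0c_infty h -> ccontinuous (bforce m n h),
      forall alpha : R, exists C : R, forall h : R -> R[i], C0c_infty h ->
        [/\ (ereal_sup [set Hnorm alpha (fun t => bforce m n h (x, t)) | x in setT]
              <= C%:E * Hnorm alpha h)%E,
            forall x : R, (Hnorm alpha (fun t => bforce m n h (x, t)) < +oo)%E &
            forall x0 : R,
              Hnorm alpha (fun t => bforce m n h (x, t) - bforce m n h (x0, t))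
                @[x --> x0] --> 0%E] &
      forall h : R -> R[i], C0c_infty h ->
        forall t : R, bforce m n h (0, t) = h t] /\
  (* (b) *)
  (forall h : R -> R[i], C0c_infty h ->
     (forall x t : R, t <= 0 -> bforce m n h (x, t) = 0) /\
     (forall x : R, bforce m n h (x, 0) = 0)) /\
  (* (c) *)
  (forall h : R -> R[i], C0c_infty h ->
     (exists F : R * R -> R[i],
        [/\ ccontinuous F,
            airy_dist setT (bforce m n h) F &
            forall x t : R, 0 < x -> F (x, t) = 0]) /\
     airy_dist [set p | 0 < p.1] (bforce m n h) (fun=> 0)) /\
  (* (d) *)
  (forall h : R -> R[i], C0c_infty h -> forall x : R, 0 < x ->
     (forall t : R, bforce m n h (x, t) =
        ((2 * pi)^-1)%:C *
        cintegral lebesgue_measure (fun tau =>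
          cexp ('i%C * (t * tau)%:C) * fourier1 h tau *
          cexp ('i%C * x%:C * omega * rho tau))) /\
     (forall tau : R, tau != 0 ->
        cmod (cexp ('i%C * x%:C * omega * rho tau)) =
        expR (- (Num.sqrt 3 / 2) * `|tau| `^ 3^-1 * x))) /\
  (* (e) *)
  (forall s : R, -1 <= s -> - s - 2^-1 < m%:R -> m%:R + s + 2 < n%:R ->
     (exists C : R, forall h : R -> R[i], C0c_infty h -> csupp h `<=` `[0, 2] ->
        (Xsb1_norm s 2^-1 (bforce m n h) <= C%:E * Hnorm ((s + 1) / 3) h)%E) /\
     (exists C : R, forall h : R -> R[i], C0c_infty h -> csupp h `<=` `[0, 2] ->
        in_CHs s (bforce m n h) /\
        (CHs_norm s (bforce m n h) <= C%:E * Hnorm ((s + 1) / 3) h)%E)) /\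
  (* the case s = -3/4, m = 1, n = 5 *)
  ([/\ - (- (3 / 4)) - 2^-1 < 1%:R :> R & 1%:R + - (3 / 4) + 2 < 5%:R :> R] /\
   exists C : R, forall h : R -> R[i], C0c_infty h -> csupp h `<=` `[0, 2] ->
     (X_norm (bforce 1 5 h) <=
        2%:E * Xsb1_norm (- (3 / 4)) 2^-1 (bforce 1 5 h))%E /\
     (2%:E * Xsb1_norm (- (3 / 4)) 2^-1 (bforce 1 5 h) <=
        C%:E * Hnorm 12^-1 h)%E).

Proof.
split.
  split=> [h ch|alpha|h ch t]; first exact: (bforce_ccontinuous hmn (C0c_schwartz ch)).
    exists (CK m n) => h ch; have sh := C0c_schwartz ch.
    have le x := Hnorm_trace_le hmn x alpha sh; have fin := Hnorm_schwartz_fin alpha sh.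
    split.
    - by apply: ub_ereal_sup => _ [x _ <-]; exact: le.
    - move=> x; apply: (le_lt_trans (le x)).
      by rewrite -(fineK (x := Hnorm _ h)) -?EFinM ?ltry// ge0_fin_numE// Hnorm_ge0.
    - by move=> x0; exact: Hnorm_trace_cvg.
  exact: (bforce_x0 hmn t (C0c_schwartz ch)).
split; first by move=> h ch; split => [x t|x]; [exact: bforce_causal|exact: bforce_causal (lexx 0)].
split; first exact: airy_dist_halfplane.
split.
  move=> h ch x x0; split => [t|tau _]; last exact: cmod_ray_symb.
  exact: (bforce_explicit hmn t (C0c_schwartz ch) (ltW x0)).
split.
  move=> s s1 hm hn; split; last exact: CHs_estimate.
  exists (CXsb m n s) => h ch hs.
  exact: (Xsb1_norm_le hmn s1 hm hn (C0c_schwartz ch) (supp02 hs)).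
have e1 : - (- (3 / 4)) - 2^-1 < 1%:R :> R by lra.
have e2 : 1%:R + - (3 / 4) + 2 < 5%:R :> R by lra.
split => //; exists (2 * CXsb 1 5 (- (3 / 4))) => h ch hs; split; first exact: X_norm_le.
have s1 : -1 <= - (3 / 4) :> R by lra.
have := Xsb1_norm_le (isT : (1 + 4 <= 5)%N) s1 e1 e2 (C0c_schwartz ch) (supp02 hs).
have -> : (- (3 / 4) + 1) / 3 = 12^-1 :> R by field.
by move=> le; rewrite EFinM -muleA; apply: lee_wpmul2l => //; rewrite lee_fin.
Qed.
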